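(* The functors $G: \mathbf{MrgBiCat}_\otimes \to \mathbf{BiCat}$ and $\int: \mathbf{BiCat} \to \mathbf{MrgBiCat}_\otimes$ (described in the context) are two sides of an equivalence of large categories.
   Context: Bicategories. $\mathbf{BiCat}$ is the category of bicategories (horizontal composite of $a:x\to y$ and $b:y\to z$ written $a\otimes b$, horizontal units $1_x$, associators $\alpha_{a,b,c}:(a\otimes b)\otimes c\to a\otimes(b\otimes c)$, unitors $\lambda_a:1_x\otimes a\to a$, $\rho_a:a\otimes 1_y\to a$) and functors, i.e. pseudofunctors with structural isomorphisms $f_{a,b}:f(a)\otimes f(b)\to f(a\otimes b)$, $f_x:1_{f(x)}\to f(1_x)$. Merge-bicategories. A regular 2-polygraph $X$ consists of 0-cells, 1-cells $a: x \to y$, and, for all $n,m\ge 1$, 2-cells $p:(a_1,\ldots,a_n)\to(b_1,\ldots,b_m)$ between non-empty composable sequences of 1-cells with the same initial source and the same final target. Greek capitals denote possibly empty composable sequences; commas denote concatenation. A merge-bicategory is a regular 2-polygraph with operations: given $t:(\Gamma)\to(\Delta_1,\Lambda,\Delta_2)$ and $s:(\Gamma_1,\Lambda,\Gamma_2)\to(\Delta)$ with $\Lambda$ non-empty, occupying outputs $j_1,\ldots,j_2$ of $t$ and inputs $i_1,\ldots,i_2$ of $s$, such that ($\Gamma_1$ or $\Delta_1$ is empty) and ($\Gamma_2$ or $\Delta_2$ is empty), a 2-cell $\mathrm{mrg}_{[j_1,j_2]}^{[i_1,i_2]}(t,s):(\Gamma_1,\Gamma,\Gamma_2)\to(\Delta_1,\Delta,\Delta_2)$;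 whenever the same pasting diagram of three 2-cells (with the same identifications of output with input 1-cells) can be evaluated by two successive merges in two different orders, the results are equal. No units are part of the structure. Morphisms preserve boundaries and merges. Write $\mathrm{cut}_{j,i}=\mathrm{mrg}_{[j,j]}^{[i,i]}$. A unit on a non-empty sequence $\Gamma$ is a 2-cell $\mathrm{id}_\Gamma:(\Gamma)\to(\Gamma)$ such that merging any 2-cell with it along $\Gamma$, on either side, returns that 2-cell. $X$ is unital if every non-empty composable sequence has a unit. $t:(\Gamma)\to(\Delta_1,a,\Delta_2)$, with $a$ its $j$-th output, is universal at $\partial_j^+$ if for all $\Gamma_1,\Gamma_2$ and non-empty $\Delta$ with ($\Gamma_1$ or $\Delta_1$ empty) and ($\Gamma_2$ or $\Delta_2$ empty), every $s:(\Gamma_1,\Gamma,\Gamma_2)\to(\Delta_1,\Delta,\Delta_2)$ is the merge along $a$ of $t$ and a unique $r:(\Gamma_1,a,\Gamma_2)\to(\Delta)$; universality at $\partial_i^-$ is the dual notion (reversing 2-cells). A tensor of $a,b$ is a 2-cell $t_{a,b}:(a,b)\to(a\otimes b)$ universal at $\partial_1^+$. A tensor unit on $x$ is $1_x:x\to x$ such that for all $a:x\to y$ there is $l_a:(1_x,a)\to(a)$ universal at $\partial_1^+$ and $\partial_2^-$, and for all $b:z\to x$ there is $r_b:(b,1_x)\to(b)$ universal at $\partial_1^+$ and $\partial_1^-$. A 1-cell $e:x\to x'$ is tensor universal if for each $a:x\to y$ there is a 2-cell $(e,u)\to(a)$, and for each $a':x'\to y$ a 2-cell $(e,a')\to(v)$,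 both universal at $\partial_1^+$ and $\partial_2^-$; and for each $b':z\to x'$ there is a 2-cell $(u',e)\to(b')$, and for each $b:z\to x$ a 2-cell $(b,e)\to(v')$, both universal at $\partial_1^+$ and $\partial_1^-$ (for some $u,v,u',v'$). Pars, par units, par universal 1-cells are the duals, obtained by reversing the direction of all 2-cells. $X$ is representable if it is unital, every 0-cell has a tensor unit and a par unit, and every composable pair of 1-cells has a tensor and a par. A morphism is strong if it maps units on 1-cells to units, tensor (par) universal 1-cells to tensor (par) universal 1-cells, tensors to tensors and pars to pars. $\mathbf{MrgBiCat}_\otimes$ is the category of representable merge-bicategories and strong morphisms. The functor $G$. For each representable $X$ choose tensors $t_{a,b}$, tensor units $1_x$, and witnesses $\{l_a,r_a\}$ that are coherent: $\mathrm{cut}_{1,2}(p,l_b)=\mathrm{cut}_{1,1}(l_a,p)$ for $p:(a,\Gamma)\to(b,\Delta)$; $\mathrm{cut}_{m,1}(p',r_b)=\mathrm{cut}_{1,n}(r_a,p')$ for $p':(\Gamma',a)\to(\Delta',b)$ with $n$ inputs, $m$ outputs; $\mathrm{cut}_{1,j}(r_a,q)=\mathrm{cut}_{1,j+1}(l_b,q)$ for $q$ with $j$-th and $(j+1)$-st inputs $a,b$; $l_{1_x}=r_{1_x}$ (such choices exist). $GX$ is the bicategory with the 0-cells and 1-cells of $X$, 2-cells those of $X$ with one input and one output, vertical composition $\mathrm{cut}_{1,1}$, the chosen horizontal composites and units of 1-cells, and $p\otimes q$ (for $p:(a)\to(c)$, $q:(b)\to(d)$), $\alpha,\lambda,\rho$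 the unique 2-cells with $\mathrm{cut}_{1,1}(t_{a,b},p\otimes q)=\mathrm{cut}_{1,2}(q,\mathrm{cut}_{1,1}(p,t_{c,d}))$, $\mathrm{cut}_{1,1}(\mathrm{cut}_{1,1}(t_{a,b},t_{a\otimes b,c}),\alpha_{a,b,c})=\mathrm{cut}_{1,2}(t_{b,c},t_{a,b\otimes c})$, $\mathrm{cut}_{1,1}(t_{1_x,a},\lambda_a)=l_a$, $\mathrm{cut}_{1,1}(t_{a,1_y},\rho_a)=r_a$. For strong $f$, $Gf$ is the restriction of $f$ with $f_{a,b}$, $f_x$ the unique 2-cells with $\mathrm{cut}_{1,1}(t_{f(a),f(b)},f_{a,b})=f(t_{a,b})$ and $\mathrm{cut}_{1,1}(f_x,f(l_{1_x}))=l_{f(1_x)}$. The functor $\int$. $\int B$ has the 0-cells and 1-cells of $B$; its 2-cells $(a_1,\ldots,a_n)\to(b_1,\ldots,b_m)$ are the 2-cells $(\ldots(a_1\otimes a_2)\ldots)\otimes a_n\to(\ldots(b_1\otimes b_2)\ldots)\otimes b_m$ of $B$; merges are induced by composition in $B$ using the unique coherence 2-cells built from associators, inverses and vertical units to re-bracket as needed. $\int f$ equals $f$ on 0- and 1-cells, and sends the 2-cell given by $p$ to the one given by $f(p)$ precomposed and postcomposed with the unique coherence 2-cells (built from the $f_{a,b}$, associators, their inverses and vertical units) between $f$ of a left-bracketed composite and the left-bracketed composite of the images. *)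

(* Defs.v *)
From Stdlib Require Import List Permutation Arith Lia.
From Stdlib Require Import ProofIrrelevance FunctionalExtensionality
  ClassicalEpsilon Eqdep.
Import ListNotations.

Set Implicit Arguments.

Definition the (A : Type) (P : A -> Prop) (H : exists! x, P x) : A :=
  proj1_sig (constructive_definite_description P H).

Lemma theP A (P : A -> Prop) (H : exists! x, P x) : P (the P H).
Proof. unfold the. apply proj2_sig. Qed.

Record category := Category {
  Obj : Type;
  Hom : Obj -> Obj -> Type;
  idm : forall x, Hom x x;
  cmp : forall x y z, Hom x y -> Hom y z -> Hom x z;
  cmp_idl : forall x y (f : Hom x y), cmp (idm x) f = f;
  cmp_idr : forall x y (f : Hom x y), cmp f (idm y) = f;
  cmp_assoc : forall x y z w (f : Hom x y) (g : Hom y z) (h : Hom z w),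
    cmp (cmp f g) h = cmp f (cmp g h) }.

Arguments Hom {c} x y.
Arguments idm {c} x : rename.
Arguments cmp {c x y z} f g.

Record functor (C D : category) := Functor {
  fob : Obj C -> Obj D;
  fmap : forall x y : Obj C, Hom x y -> Hom (fob x) (fob y);
  fmap_id : forall x : Obj C, fmap x x (idm x) = idm (fob x);
  fmap_cmp : forall (x y z : Obj C) (f : Hom x y) (g : Hom y z),
    fmap x z (cmp f g) = cmp (fmap x y f) (fmap y z g) }.

Arguments fmap {C D} f {x y} _ : rename.

Definition id_functor (C : category) : functor C C :=
  @Functor C C (fun x => x) (fun x y f => f)
    (fun x => eq_refl) (fun x y z f g => eq_refl).

Definition comp_functor (C D E : category) (F : functor C D) (K : functor D E) :
  functor C E.
Proof.
  refine (@Functor C E (fun x => fob K (fob F x))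
            (fun x y f => fmap K (fmap F f)) _ _).
  - intros x. rewrite fmap_id. apply fmap_id.
  - intros x y z f g. rewrite fmap_cmp. apply fmap_cmp.
Defined.

Definition isomorphism (C : category) (x y : Obj C) (f : Hom x y) : Prop :=
  exists g : Hom y x, cmp f g = idm x /\ cmp g f = idm y.

Arguments isomorphism {C x y} f.

Definition naturally_isomorphic (C D : category) (F K : functor C D) : Prop :=
  exists eta : forall x : Obj C, Hom (fob F x) (fob K x),
    (forall x, isomorphism (eta x)) /\
    (forall (x y : Obj C) (f : Hom x y),
        cmp (fmap F f) (eta y) = cmp (eta x) (fmap K f)).

Definition equivalence_pair (C D : category)
    (F : functor C D) (K : functor D C) : Prop :=
  naturally_isomorphic (comp_functor F K) (id_functor C) /\
  naturally_isomorphic (comp_functor K F) (id_functor D).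

Record bicat_data := BicatData {
  bob : Type;
  bhom : bob -> bob -> Type;
  bcell : forall x y, bhom x y -> bhom x y -> Type;
  vid : forall x y (a : bhom x y), bcell a a;
  vcomp : forall x y (a b c : bhom x y), bcell a b -> bcell b c -> bcell a c;
  hunit : forall x, bhom x x;
  hcomp1 : forall x y z, bhom x y -> bhom y z -> bhom x z;
  hcomp2 : forall x y z (a c : bhom x y) (b d : bhom y z),
    bcell a c -> bcell b d -> bcell (hcomp1 a b) (hcomp1 c d);
  asc : forall x y z w (a : bhom x y) (b : bhom y z) (c : bhom z w),
    bcell (hcomp1 (hcomp1 a b) c) (hcomp1 a (hcomp1 b c));
  lun : forall x y (a : bhom x y), bcell (hcomp1 (hunit x) a) a;
  run : forall x y (a : bhom x y), bcell (hcomp1 a (hunit y)) a }.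

Arguments bhom {B} x y : rename.
Arguments bcell {B x y} a b : rename.
Arguments vid {B x y} a : rename.
Arguments vcomp {B x y a b c} p q : rename.
Arguments hunit {B} x : rename.
Arguments hcomp1 {B x y z} a b : rename.
Arguments hcomp2 {B x y z a c b d} p q : rename.
Arguments asc {B x y z w} a b c : rename.
Arguments lun {B x y} a : rename.
Arguments run {B x y} a : rename.

Declare Scope bicat_scope.
Delimit Scope bicat_scope with bicat.
Local Open Scope bicat_scope.
Notation "a ⊗ b" := (hcomp1 a b) (at level 40, left associativity) : bicat_scope.
Notation "p ⊠ q" := (hcomp2 p q) (at level 40, left associativity) : bicat_scope.
Notation "p ⊙ q" := (vcomp p q) (at level 45, left associativity) : bicat_scope.

Definition invertible (B : bicat_data) (x y : bob B) (a b : bhom x y)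
    (p : bcell a b) : Prop :=
  exists q : bcell b a, p ⊙ q = vid a /\ q ⊙ p = vid b.

Arguments invertible {B x y a b} p.

Record is_bicat (B : bicat_data) : Prop := IsBicat {
  vidl : forall (x y : bob B) (a b : bhom x y) (p : bcell a b), vid a ⊙ p = p;
  vidr : forall (x y : bob B) (a b : bhom x y) (p : bcell a b), p ⊙ vid b = p;
  vassoc : forall (x y : bob B) (a b c d : bhom x y)
      (p : bcell a b) (q : bcell b c) (r : bcell c d),
    p ⊙ q ⊙ r = p ⊙ (q ⊙ r);
  hvid : forall (x y z : bob B) (a : bhom x y) (b : bhom y z),
    vid a ⊠ vid b = vid (a ⊗ b);
  interchange : forall (x y z : bob B) (a b c : bhom x y) (a' b' c' : bhom y z)
      (p : bcell a b) (q : bcell b c) (p' : bcell a' b') (q' : bcell b' c'),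
    (p ⊙ q) ⊠ (p' ⊙ q') = (p ⊠ p') ⊙ (q ⊠ q');
  asc_inv : forall (x y z w : bob B) (a : bhom x y) (b : bhom y z) (c : bhom z w),
    invertible (asc a b c);
  lun_inv : forall (x y : bob B) (a : bhom x y), invertible (lun a);
  run_inv : forall (x y : bob B) (a : bhom x y), invertible (run a);
  asc_nat : forall (x y z w : bob B) (a a' : bhom x y) (b b' : bhom y z)
      (c c' : bhom z w) (p : bcell a a') (q : bcell b b') (r : bcell c c'),
    ((p ⊠ q) ⊠ r) ⊙ asc a' b' c' = asc a b c ⊙ (p ⊠ (q ⊠ r));
  lun_nat : forall (x y : bob B) (a b : bhom x y) (p : bcell a b),
    (vid (hunit x) ⊠ p) ⊙ lun b = lun a ⊙ p;
  run_nat : forall (x y : bob B) (a b : bhom x y) (p : bcell a b),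
    (p ⊠ vid (hunit y)) ⊙ run b = run a ⊙ p;
  pentagon : forall (x y z w v : bob B) (a : bhom x y) (b : bhom y z)
      (c : bhom z w) (d : bhom w v),
    (asc a b c ⊠ vid d) ⊙ asc a (b ⊗ c) d ⊙ (vid a ⊠ asc b c d)
    = asc (a ⊗ b) c d ⊙ asc a b (c ⊗ d);
  triangle : forall (x y z : bob B) (a : bhom x y) (b : bhom y z),
    asc a (hunit y) b ⊙ (vid a ⊠ lun b) = run a ⊠ vid b }.

Record bicat := Bicat { bdata :> bicat_data; bicatP : is_bicat bdata }.

Record psf_data (B C : bicat_data) := PsfData {
  f0 : bob B -> bob C;
  f1 : forall x y, bhom x y -> bhom (f0 x) (f0 y);
  f2 : forall x y (a b : bhom x y), bcell a b -> bcell (f1 x y a) (f1 x y b);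
  ften : forall x y z (a : bhom x y) (b : bhom y z),
    bcell (f1 x y a ⊗ f1 y z b) (f1 x z (a ⊗ b));
  funit : forall x, bcell (hunit (f0 x)) (f1 x x (hunit x)) }.

Arguments f1 {B C} f {x y} _ : rename.
Arguments f2 {B C} f {x y a b} _ : rename.
Arguments ften {B C} f {x y z} a b : rename.

Arguments f0 {B C} f x : rename.
Arguments funit {B C} f x : rename.

Record is_psf (B C : bicat_data) (f : psf_data B C) : Prop := IsPsf {
  f2_vid : forall (x y : bob B) (a : bhom x y), f2 f (vid a) = vid (f1 f a);
  f2_vcomp : forall (x y : bob B) (a b c : bhom x y) (p : bcell a b) (q : bcell b c),
    f2 f (p ⊙ q) = f2 f p ⊙ f2 f q;
  ften_inv : forall (x y z : bob B) (a : bhom x y) (b : bhom y z),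
    invertible (ften f a b);
  funit_inv : forall x : bob B, invertible (funit f x);
  ften_nat : forall (x y z : bob B) (a c : bhom x y) (b d : bhom y z)
      (p : bcell a c) (q : bcell b d),
    (f2 f p ⊠ f2 f q) ⊙ ften f c d = ften f a b ⊙ f2 f (p ⊠ q);
  ften_asc : forall (x y z w : bob B) (a : bhom x y) (b : bhom y z) (c : bhom z w),
    (ften f a b ⊠ vid (f1 f c)) ⊙ ften f (a ⊗ b) c ⊙ f2 f (asc a b c)
    = asc (f1 f a) (f1 f b) (f1 f c)
        ⊙ (vid (f1 f a) ⊠ ften f b c) ⊙ ften f a (b ⊗ c);
  funit_lun : forall (x y : bob B) (a : bhom x y),
    (funit f x ⊠ vid (f1 f a)) ⊙ ften f (hunit x) a ⊙ f2 f (lun a)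
    = lun (f1 f a);
  funit_run : forall (x y : bob B) (a : bhom x y),
    (vid (f1 f a) ⊠ funit f y) ⊙ ften f a (hunit y) ⊙ f2 f (run a)
    = run (f1 f a) }.

Record psf (B C : bicat) := Psf { pdata :> psf_data B C; psfP : is_psf pdata }.

Lemma psf_eq (B C : bicat) (f g : psf B C) : pdata f = pdata g -> f = g.
Proof.
  destruct f as [f Hf], g as [g Hg]; simpl; intros ->.
  f_equal; apply proof_irrelevance.
Qed.

Definition psf_id_data (B : bicat_data) : psf_data B B :=
  @PsfData B B (fun x => x) (fun x y a => a) (fun x y a b p => p)
    (fun x y z a b => vid (a ⊗ b)) (fun x => vid (hunit x)).

Definition psf_comp_data (B C D : bicat_data)
    (f : psf_data B C) (g : psf_data C D) : psf_data B D :=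
  @PsfData B D (fun x => f0 g (f0 f x)) (fun x y a => f1 g (f1 f a))
    (fun x y a b p => f2 g (f2 f p))
    (fun x y z a b => ften g (f1 f a) (f1 f b) ⊙ f2 g (ften f a b))
    (fun x => funit g (f0 f x) ⊙ f2 g (funit f x)).

Lemma invertible_vid (B : bicat_data) (HB : is_bicat B) (x y : bob B)
  (a : bhom x y) : invertible (vid a).
Proof. exists (vid a); split; apply vidl; auto. Qed.

Lemma invertible_vcomp (B : bicat_data) (HB : is_bicat B) (x y : bob B)
  (a b c : bhom x y) (p : bcell a b) (q : bcell b c) :
  invertible p -> invertible q -> invertible (p ⊙ q).
Proof.
  intros [p' [H1 H2]] [q' [H3 H4]]. exists (q' ⊙ p'); split.
  - rewrite (vassoc HB), <- (vassoc HB _ _ _ _ _ _ q), H3, (vidl HB); auto.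
  - rewrite (vassoc HB), <- (vassoc HB _ _ _ _ _ _ p'), H2, (vidl HB); auto.
Qed.

Lemma invertible_f2 (B C : bicat_data) (f : psf_data B C) (Hf : is_psf f)
  (x y : bob B) (a b : bhom x y) (p : bcell a b) :
  invertible p -> invertible (f2 f p).
Proof.
  intros [q [H1 H2]]. exists (f2 f q); split;
    rewrite <- (f2_vcomp Hf), ?H1, ?H2; apply (f2_vid Hf).
Qed.

Lemma psf_id_is (B : bicat) : is_psf (psf_id_data B).
Proof.
  destruct B as [B HB]; simpl.
  constructor; simpl; intros; auto;
    try (apply invertible_vid; auto).
  - now rewrite (vidl HB), (vidr HB).
  - now rewrite !(hvid HB), !(vidl HB), !(vidr HB).
  - now rewrite !(hvid HB), !(vidl HB).
  - now rewrite !(hvid HB), !(vidl HB).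
Qed.

Lemma psf_comp_is (B C D : bicat) (f : psf B C) (g : psf C D) :
  is_psf (psf_comp_data f g).
Proof.
  destruct B as [B HB], C as [C HC], D as [D HD], f as [f Hf], g as [g Hg]; simpl in *.
  constructor; simpl; intros.
  - now rewrite (f2_vid Hf), (f2_vid Hg).
  - now rewrite (f2_vcomp Hf), (f2_vcomp Hg).
  - apply invertible_vcomp; auto. apply (ften_inv Hg).
    apply invertible_f2; auto. apply (ften_inv Hf).
  - apply invertible_vcomp; auto. apply (funit_inv Hg).
    apply invertible_f2; auto. apply (funit_inv Hf).
  - rewrite <- (vassoc HD), (ften_nat Hg), !(vassoc HD), <- !(f2_vcomp Hg).
    now rewrite (ften_nat Hf).
  - transitivity ((ften g (f1 f a) (f1 f b) ⊠ vid (f1 g (f1 f c)))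
      ⊙ ften g (f1 f a ⊗ f1 f b) (f1 f c)
      ⊙ f2 g ((ften f a b ⊠ vid (f1 f c)) ⊙ ften f (a ⊗ b) c ⊙ f2 f (asc a b c))).
    + rewrite <- (vidl HD _ _ _ _ (vid (f1 g (f1 f c)))) at 1.
      rewrite (interchange HD), <- (f2_vid Hg), !(f2_vcomp Hg), !(vassoc HD).
      f_equal. rewrite <- !(vassoc HD). do 2 f_equal. apply (ften_nat Hg).
    + rewrite (ften_asc Hf), !(f2_vcomp Hg), <- !(vassoc HD), (ften_asc Hg).
      rewrite !(vassoc HD). f_equal.
      rewrite <- (vidl HD _ _ _ _ (vid (f1 g (f1 f a)))) at 2.
      rewrite (interchange HD), !(vassoc HD). f_equal.
      rewrite <- (f2_vid Hg), <- !(vassoc HD). f_equal. symmetry; apply (ften_nat Hg).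
  - rewrite <- (vidl HD _ _ _ _ (vid (f1 g (f1 f a)))).
    rewrite (interchange HD). rewrite <- (f2_vid Hg) at 2.
    rewrite !(vassoc HD), <- (vassoc HD _ _ _ _ _ _ (f2 g _ ⊠ _)), (ften_nat Hg), !(vassoc HD),
      <- !(f2_vcomp Hg), <- !(vassoc HC), (funit_lun Hf), <- !(vassoc HD).
    apply (funit_lun Hg).
  - rewrite <- (vidl HD _ _ _ _ (vid (f1 g (f1 f a)))).
    rewrite (interchange HD). rewrite <- (f2_vid Hg) at 2.
    rewrite !(vassoc HD), <- (vassoc HD _ _ _ _ _ _ (f2 g _ ⊠ _)), (ften_nat Hg), !(vassoc HD),
      <- !(f2_vcomp Hg), <- !(vassoc HC), (funit_run Hf), <- !(vassoc HD).
    apply (funit_run Hg).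
Qed.

Definition psf_id (B : bicat) : psf B B := Psf B B (psf_id_is B).
Definition psf_comp (B C D : bicat) (f : psf B C) (g : psf C D) : psf B D :=
  Psf B D (psf_comp_is f g).

Lemma psf_data_eq (B C : bicat_data) g0 g1 g2 t t' u u' :
  (forall x y z (a : bhom x y) (b : bhom y z), t x y z a b = t' x y z a b) ->
  (forall x, u x = u' x) ->
  @PsfData B C g0 g1 g2 t u = @PsfData B C g0 g1 g2 t' u'.
Proof.
  intros H1 H2. assert (t = t') as ->.
  { do 5 (apply functional_extensionality_dep; intro). apply H1. }
  f_equal. apply functional_extensionality_dep; intro; apply H2.
Qed.

Definition BiCat : category.
Proof.
  refine (@Category bicat psf psf_id psf_comp _ _ _).
  - intros B C [[g0 g1 g2 t u] Hf]. apply psf_eq; simpl. apply psf_data_eq; intros; simpl.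
    + rewrite (f2_vid Hf). apply (vidr (bicatP C)).
    + rewrite (f2_vid Hf). apply (vidr (bicatP C)).
  - intros B C [[g0 g1 g2 t u] Hf]. apply psf_eq; simpl. apply psf_data_eq; intros; simpl;
    apply (vidl (bicatP C)).
  - intros B C D E f g h. apply psf_eq; simpl. apply psf_data_eq; intros; simpl;
    rewrite (f2_vcomp (psfP h)); symmetry; apply (vassoc (bicatP E)).
Defined.

Fixpoint chain (C0 C1 : Type) (src tgt : C1 -> C0)
    (x : C0) (Γ : list C1) (y : C0) : Prop :=
  match Γ with
  | [] => x = y
  | a :: Γ' => src a = x /\ chain src tgt (tgt a) Γ' y
  end.

Record polygraph := Polygraph {
  cell0 : Type;
  cell1 : Type;
  cell2 : Type;
  src : cell1 -> cell0;
  tgt : cell1 -> cell0;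
  inp : cell2 -> list cell1;
  out : cell2 -> list cell1;
  inp_nonempty : forall p, inp p <> [];
  out_nonempty : forall p, out p <> [];
  parallel : forall p, exists x y,
    chain src tgt x (inp p) y /\ chain src tgt x (out p) y }.

Arguments src {X} a : rename.
Arguments tgt {X} a : rename.
Arguments inp {X} p : rename.
Arguments out {X} p : rename.

(** The sequence [Λ] is at once a segment of the outputs of [t] and of the
    inputs of [s]; its position in each is given by its complement. *)
Record mergeable (X : polygraph) (t s : cell2 X)
    (Δ1 Λ Δ2 Γ1 Γ2 : list (cell1 X)) : Prop := Mergeable {
  mrg_out : out t = Δ1 ++ Λ ++ Δ2;
  mrg_inp : inp s = Γ1 ++ Λ ++ Γ2;
  mrg_nonempty : Λ <> [];
  mrg_left : Γ1 = [] \/ Δ1 = [];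
  mrg_right : Γ2 = [] \/ Δ2 = [] }.

Record merge_data := MergeData {
  poly :> polygraph;
  mrg : forall (t s : cell2 poly) (Δ1 Λ Δ2 Γ1 Γ2 : list (cell1 poly)),
    mergeable poly t s Δ1 Λ Δ2 Γ1 Γ2 -> cell2 poly }.

Arguments mrg {X t s Δ1 Λ Δ2 Γ1 Γ2} h : rename.

(** [pasting P L I O g r] says that [r] is obtained by successive merges of the
    2-cells [P i], for [i] in [L].  The port [(i, k)] stands for the input or
    output of [P i] at position [k] (from 0); [I] and [O] list the ports on
    the boundary of the diagram, and [g] the pairs of an output and an input
    port that have been identified. *)
Definition port : Type := nat * nat.

Inductive pasting (X : merge_data) (P : nat -> cell2 X) :
  list nat -> list port -> list port -> list (port * port) -> cell2 X -> Prop :=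
| pasting_leaf : forall i,
    pasting X P [i] (map (pair i) (seq 0 (length (inp (P i)))))
      (map (pair i) (seq 0 (length (out (P i))))) [] (P i)
| pasting_mrg : forall (L L' : list nat) (I D1 M D2 C1 N C2 O : list port)
    (g g' : list (port * port)) (t s : cell2 X)
    (Δ1 Λ Δ2 Γ1 Γ2 : list (cell1 X)) (h : mergeable X t s Δ1 Λ Δ2 Γ1 Γ2),
    pasting X P L I (D1 ++ M ++ D2) g t ->
    pasting X P L' (C1 ++ N ++ C2) O g' s ->
    length D1 = length Δ1 -> length M = length Λ ->
    length C1 = length Γ1 -> length N = length Λ ->
    pasting X P (L ++ L') (C1 ++ I ++ C2) (D1 ++ O ++ D2)
      (combine M N ++ g ++ g') (mrg h).

Record is_merge_bicat (X : merge_data) : Prop := IsMergeBicat {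
  inp_mrg : forall (t s : cell2 X) (Δ1 Λ Δ2 Γ1 Γ2 : list (cell1 X))
      (h : mergeable X t s Δ1 Λ Δ2 Γ1 Γ2),
    inp (mrg h) = Γ1 ++ inp t ++ Γ2;
  out_mrg : forall (t s : cell2 X) (Δ1 Λ Δ2 Γ1 Γ2 : list (cell1 X))
      (h : mergeable X t s Δ1 Λ Δ2 Γ1 Γ2),
    out (mrg h) = Δ1 ++ out s ++ Δ2;
  mrg_pasting : forall (P : nat -> cell2 X) (L L' : list nat) (I O : list port)
      (g g' : list (port * port)) (r r' : cell2 X),
    Permutation L [0; 1; 2] -> Permutation L' [0; 1; 2] ->
    (forall e, In e g <-> In e g') ->
    pasting X P L I O g r -> pasting X P L' I O g' r' -> r = r' }.

Record merge_bicat := MergeBicat {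
  mdata :> merge_data;
  mergeP : is_merge_bicat mdata }.

(** [is_cut X j i t s r] says that [r] is the merge of the [j]-th output of [t]
    with the [i]-th input of [s], counting from 1. *)
Definition is_cut (X : merge_data) (j i : nat) (t s r : cell2 X) : Prop :=
  exists (Δ1 : list (cell1 X)) (a : cell1 X) (Δ2 Γ1 Γ2 : list (cell1 X))
    (h : mergeable X t s Δ1 [a] Δ2 Γ1 Γ2),
    j = S (length Δ1) /\ i = S (length Γ1) /\ mrg h = r.

Definition co_poly (X : polygraph) : polygraph.
Proof.
  refine (@Polygraph (cell0 X) (cell1 X) (cell2 X) (@src X) (@tgt X)
            (@out X) (@inp X) (out_nonempty X) (inp_nonempty X) _).
  intros p. destruct (parallel X p) as (x & y & H1 & H2). exists x, y; auto.
Defined.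

Lemma co_mergeable (X : polygraph) (t s : cell2 X) (Δ1 Λ Δ2 Γ1 Γ2 : list (cell1 X)) :
  mergeable (co_poly X) t s Δ1 Λ Δ2 Γ1 Γ2 -> mergeable X s t Γ1 Λ Γ2 Δ1 Δ2.
Proof. intros [? ? ? ? ?]; constructor; simpl in *; tauto. Qed.

Definition co (X : merge_data) : merge_data :=
  @MergeData (co_poly X)
    (fun t s Δ1 Λ Δ2 Γ1 Γ2 h => @mrg X s t Γ1 Λ Γ2 Δ1 Δ2 (co_mergeable h)).

Definition is_unit (X : merge_data) (Γ : list (cell1 X)) (e : cell2 X) : Prop :=
  inp e = Γ /\ out e = Γ /\
  (forall (t : cell2 X) (Δ1 Δ2 : list (cell1 X))
     (h : mergeable X t e Δ1 Γ Δ2 [] []), mrg h = t) /\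
  (forall (s : cell2 X) (Γ1 Γ2 : list (cell1 X))
     (h : mergeable X e s [] Γ [] Γ1 Γ2), mrg h = s).

Definition unital (X : merge_data) : Prop :=
  forall (Γ : list (cell1 X)) (x y : cell0 X),
    Γ <> [] -> chain src tgt x Γ y -> exists e, is_unit X Γ e.

Definition universal_out (X : merge_data) (t : cell2 X) (j : nat) : Prop :=
  exists (Δ1 : list (cell1 X)) (a : cell1 X) (Δ2 : list (cell1 X)),
    out t = Δ1 ++ a :: Δ2 /\ j = S (length Δ1) /\
    forall (Γ1 Γ2 Δ : list (cell1 X)) (s : cell2 X),
      Δ <> [] -> Γ1 = [] \/ Δ1 = [] -> Γ2 = [] \/ Δ2 = [] ->
      inp s = Γ1 ++ inp t ++ Γ2 -> out s = Δ1 ++ Δ ++ Δ2 ->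
      exists! r : cell2 X,
        inp r = Γ1 ++ a :: Γ2 /\ out r = Δ /\
        is_cut X j (S (length Γ1)) t r s.

Definition universal_in (X : merge_data) (t : cell2 X) (i : nat) : Prop :=
  universal_out (co X) t i.

Definition is_tensor (X : merge_data) (a b c : cell1 X) (t : cell2 X) : Prop :=
  inp t = [a; b] /\ out t = [c] /\ universal_out X t 1.

Definition left_witness (X : merge_data) (e a b : cell1 X) (t : cell2 X) : Prop :=
  inp t = [e; a] /\ out t = [b] /\ universal_out X t 1 /\ universal_in X t 2.

Definition right_witness (X : merge_data) (e a b : cell1 X) (t : cell2 X) : Prop :=
  inp t = [a; e] /\ out t = [b] /\ universal_out X t 1 /\ universal_in X t 1.

Definition is_tensor_unit (X : merge_data) (x : cell0 X) (e : cell1 X) : Prop :=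
  src e = x /\ tgt e = x /\
  (forall a : cell1 X, src a = x -> exists l, left_witness X e a a l) /\
  (forall b : cell1 X, tgt b = x -> exists r, right_witness X e b b r).

Definition tensor_universal (X : merge_data) (e : cell1 X) : Prop :=
  (forall a : cell1 X, src a = src e -> exists u t, left_witness X e u a t) /\
  (forall a' : cell1 X, src a' = tgt e -> exists v t, left_witness X e a' v t) /\
  (forall b' : cell1 X, tgt b' = tgt e -> exists u' t, right_witness X e u' b' t) /\
  (forall b : cell1 X, tgt b = src e -> exists v' t, right_witness X e b v' t).

Definition is_par (X : merge_data) (a b c : cell1 X) (t : cell2 X) : Prop :=
  is_tensor (co X) a b c t.
Definition is_par_unit (X : merge_data) (x : cell0 X) (e : cell1 X) : Prop :=
  is_tensor_unit (co X) x e.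
Definition par_universal (X : merge_data) (e : cell1 X) : Prop :=
  tensor_universal (co X) e.

Record representable (X : merge_data) : Prop := Representable {
  rep_unital : unital X;
  rep_tensor_unit : forall x : cell0 X, exists e, is_tensor_unit X x e;
  rep_par_unit : forall x : cell0 X, exists e, is_par_unit X x e;
  rep_tensor : forall a b : cell1 X, tgt a = src b -> exists c t, is_tensor X a b c t;
  rep_par : forall a b : cell1 X, tgt a = src b -> exists c t, is_par X a b c t }.

Record rep_merge_bicat := RepMergeBicat {
  rbicat :> merge_bicat;
  repP : representable rbicat }.

Record merge_map (X Y : polygraph) := MergeMap {
  m0 : cell0 X -> cell0 Y;
  m1 : cell1 X -> cell1 Y;
  m2 : cell2 X -> cell2 Y }.

Arguments m0 {X Y} f x : rename.
Arguments m1 {X Y} f a : rename.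
Arguments m2 {X Y} f p : rename.

Record is_morphism (X Y : merge_data) (f : merge_map X Y) : Prop := IsMorphism {
  m_src : forall a : cell1 X, src (m1 f a) = m0 f (src a);
  m_tgt : forall a : cell1 X, tgt (m1 f a) = m0 f (tgt a);
  m_inp : forall p : cell2 X, inp (m2 f p) = map (m1 f) (inp p);
  m_out : forall p : cell2 X, out (m2 f p) = map (m1 f) (out p);
  m_mrg : forall (t s : cell2 X) (Δ1 Λ Δ2 Γ1 Γ2 : list (cell1 X))
      (h : mergeable X t s Δ1 Λ Δ2 Γ1 Γ2)
      (h' : mergeable Y (m2 f t) (m2 f s) (map (m1 f) Δ1) (map (m1 f) Λ)
              (map (m1 f) Δ2) (map (m1 f) Γ1) (map (m1 f) Γ2)),
    m2 f (mrg h) = mrg h' }.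

Record is_strong (X Y : merge_data) (f : merge_map X Y) : Prop := IsStrong {
  strong_unit : forall (a : cell1 X) (e : cell2 X),
    is_unit X [a] e -> is_unit Y [m1 f a] (m2 f e);
  strong_tensor_universal : forall e : cell1 X,
    tensor_universal X e -> tensor_universal Y (m1 f e);
  strong_par_universal : forall e : cell1 X,
    par_universal X e -> par_universal Y (m1 f e);
  strong_tensor : forall (a b c : cell1 X) (t : cell2 X),
    is_tensor X a b c t -> is_tensor Y (m1 f a) (m1 f b) (m1 f c) (m2 f t);
  strong_par : forall (a b c : cell1 X) (t : cell2 X),
    is_par X a b c t -> is_par Y (m1 f a) (m1 f b) (m1 f c) (m2 f t) }.

Record strong_morphism (X Y : merge_data) := StrongMorphism {
  smap :> merge_map X Y;
  smap_morphism : is_morphism X Y smap;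
  smap_strong : is_strong X Y smap }.

Lemma strong_morphism_eq (X Y : merge_data) (f g : strong_morphism X Y) :
  smap f = smap g -> f = g.
Proof.
  destruct f as [f Hf Hf'], g as [g Hg Hg']; simpl; intros ->.
  f_equal; apply proof_irrelevance.
Qed.

Definition merge_map_id (X : polygraph) : merge_map X X :=
  @MergeMap X X (fun x => x) (fun a => a) (fun p => p).

Definition merge_map_comp (X Y Z : polygraph) (f : merge_map X Y)
    (g : merge_map Y Z) : merge_map X Z :=
  @MergeMap X Z (fun x => m0 g (m0 f x)) (fun a => m1 g (m1 f a))
    (fun p => m2 g (m2 f p)).

Lemma mrg_irrelevance (X : merge_data) (t s : cell2 X)
  (Δ1 Λ Δ2 Γ1 Γ2 Δ1' Λ' Δ2' Γ1' Γ2' : list (cell1 X))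
  (h : mergeable X t s Δ1 Λ Δ2 Γ1 Γ2) (h' : mergeable X t s Δ1' Λ' Δ2' Γ1' Γ2') :
  Δ1 = Δ1' -> Λ = Λ' -> Δ2 = Δ2' -> Γ1 = Γ1' -> Γ2 = Γ2' -> mrg h = mrg h'.
Proof. intros; subst. f_equal. apply proof_irrelevance. Qed.

Lemma mergeable_map (X Y : merge_data) (f : merge_map X Y) (Hf : is_morphism X Y f)
  (t s : cell2 X) (Δ1 Λ Δ2 Γ1 Γ2 : list (cell1 X)) :
  mergeable X t s Δ1 Λ Δ2 Γ1 Γ2 ->
  mergeable Y (m2 f t) (m2 f s) (map (m1 f) Δ1) (map (m1 f) Λ)
    (map (m1 f) Δ2) (map (m1 f) Γ1) (map (m1 f) Γ2).
Proof.
  intros [H1 H2 H3 H4 H5]. constructor.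
  - rewrite (m_out Hf), H1, !map_app; auto.
  - rewrite (m_inp Hf), H2, !map_app; auto.
  - destruct Λ; simpl; congruence.
  - destruct H4; subst; simpl; auto.
  - destruct H5; subst; simpl; auto.
Qed.

Definition strong_id (X : merge_data) : strong_morphism X X.
Proof.
  refine (@StrongMorphism X X (merge_map_id X) _ _).
  - constructor; intros; simpl; rewrite ?map_id; auto.
    apply mrg_irrelevance; symmetry; apply map_id.
  - constructor; auto.
Defined.

Definition strong_comp (X Y Z : merge_data) (f : strong_morphism X Y)
  (g : strong_morphism Y Z) : strong_morphism X Z.
Proof.
  refine (@StrongMorphism X Z (merge_map_comp f g) _ _);
    destruct f as [f Hf Sf], g as [g Hg Sg]; simpl.
  - constructor; intros; simpl.
    + now rewrite (m_src Hg), (m_src Hf).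
    + now rewrite (m_tgt Hg), (m_tgt Hf).
    + rewrite (m_inp Hg), (m_inp Hf). apply map_map.
    + rewrite (m_out Hg), (m_out Hf). apply map_map.
    + rewrite (m_mrg Hf h (mergeable_map Hf h)),
        (m_mrg Hg _ (mergeable_map Hg (mergeable_map Hf h))).
      apply mrg_irrelevance; apply map_map.
  - destruct Sf, Sg. constructor; simpl; auto.
Defined.

Definition MrgBiCat : category.
Proof.
  refine (@Category rep_merge_bicat (fun X Y => strong_morphism X Y)
    (fun X => strong_id X) (fun X Y Z f g => strong_comp f g) _ _ _).
  - intros X Y f. apply strong_morphism_eq. now destruct f as [[]].
  - intros X Y f. apply strong_morphism_eq. now destruct f as [[]].
  - intros X Y Z W f g h. now apply strong_morphism_eq.
Defined.

Lemma is_cut_fun (X : merge_data) j i (t s r r' : cell2 X) :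
  is_cut X j i t s r -> is_cut X j i t s r' -> r = r'.
Proof.
  intros (Δ1 & a & Δ2 & Γ1 & Γ2 & h & H1 & H2 & <-)
         (Δ1' & a' & Δ2' & Γ1' & Γ2' & h' & H1' & H2' & <-).
  pose proof h as [E1 E2 _ _ _]; pose proof h' as [E1' E2' _ _ _].
  rewrite E1 in E1'. rewrite E2 in E2'.
  assert (Δ1 = Δ1') as <-.
  { apply (f_equal (firstn (length Δ1))) in E1'.
    replace (length Δ1) with (length Δ1') in E1' at 2 by lia.
    rewrite !firstn_app, !firstn_all, !Nat.sub_diag in E1'.
    simpl in E1'; rewrite !app_nil_r in E1'; auto. }
  assert (Γ1 = Γ1') as <-.
  { apply (f_equal (firstn (length Γ1))) in E2'.
    replace (length Γ1) with (length Γ1') in E2' at 2 by lia.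
    rewrite !firstn_app, !firstn_all, !Nat.sub_diag in E2'.
    simpl in E2'; rewrite !app_nil_r in E2'; auto. }
  apply app_inv_head in E1', E2'. simpl in *.
  injection E1' as -> ->. injection E2' as ->.
  apply mrg_irrelevance; auto.
Qed.

Lemma cut_intro (X : merge_bicat) (t s : cell2 X) Δ1 a Δ2 Γ1 Γ2 :
  out t = Δ1 ++ a :: Δ2 -> inp s = Γ1 ++ a :: Γ2 ->
  Γ1 = [] \/ Δ1 = [] -> Γ2 = [] \/ Δ2 = [] ->
  exists r, is_cut X (S (length Δ1)) (S (length Γ1)) t s r /\
    inp r = Γ1 ++ inp t ++ Γ2 /\ out r = Δ1 ++ out s ++ Δ2.
Proof.
  intros H1 H2 H3 H4.
  assert (h : mergeable X t s Δ1 [a] Δ2 Γ1 Γ2) by (constructor; auto; discriminate).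
  exists (mrg h). split; [|split].
  - exists Δ1, a, Δ2, Γ1, Γ2, h; auto.
  - apply (inp_mrg (mergeP X)).
  - apply (out_mrg (mergeP X)).
Qed.

Arguments cut_intro X t s Δ1 a Δ2 Γ1 Γ2 : clear implicits.

Lemma cut_assoc (X : merge_bicat) (t s u p q w : cell2 X) a b i k :
  out t = [a] -> out s = [b] ->
  is_cut X 1 i t s p -> is_cut X 1 k p u w -> is_cut X 1 k s u q ->
  is_cut X 1 (k + i - 1) t q w.
Proof.
  intros Ht Hs Hp Hw Hq.
  destruct Hp as (Δ1 & a' & Δ2 & Γ1 & Γ2 & h & H1 & -> & <-).
  destruct Hw as (Δ1' & b' & Δ2' & Φ1 & Φ2 & h' & H1' & -> & <-).
  destruct Hq as (Δ1'' & b'' & Δ2'' & Φ1' & Φ2' & h'' & H1'' & Hk & <-).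
  destruct Δ1, Δ1', Δ1''; try discriminate. clear H1 H1' H1''.
  pose proof h as [E1 E2 _ _ _]; pose proof h' as [E1' E2' _ _ _];
  pose proof h'' as [E1'' E2'' _ _ _].
  simpl in *.
  rewrite Ht in E1; injection E1 as <- <-.
  rewrite Hs in E1''; injection E1'' as <- <-.
  rewrite (out_mrg (mergeP X)) in E1'. rewrite Hs in E1'. injection E1' as <- <-.
  rewrite E2' in E2''.
  assert (Φ1' = Φ1 /\ Φ2' = Φ2) as [-> ->].
  { apply (f_equal (firstn (length Φ1))) in E2'' as E.
    replace (length Φ1) with (length Φ1') in E at 2 by lia.
    rewrite !firstn_app, !firstn_all, !Nat.sub_diag in E.
    simpl in E; rewrite !app_nil_r in E. subst.
    apply app_inv_head in E2''. injection E2''; auto. }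
  assert (h4 : mergeable X t (mrg h'') [] [a] [] (Φ1 ++ Γ1) (Γ2 ++ Φ2)).
  { constructor; auto; try discriminate.
    rewrite (inp_mrg (mergeP X)), E2. now rewrite <- !app_assoc. }
  exists [], a, [], (Φ1 ++ Γ1), (Γ2 ++ Φ2), h4. rewrite length_app.
  repeat split; [lia|].
  set (P := fun n => match n with 0 => t | 1 => s | _ => u end).
  set (Lf := fun i l => map (pair i) l : list port).
  assert (S2 : forall (l : list (cell1 X)) l1 x l2, l = l1 ++ x :: l2 ->
    seq 0 (length l) = seq 0 (length l1) ++ [length l1] ++
      seq (S (length l1)) (length l2)).
  { intros l l1 x l2 ->. rewrite length_app, seq_app; reflexivity. }
  pose proof (pasting_leaf X P 0) as L0. pose proof (pasting_leaf X P 1) as L1.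
  pose proof (pasting_leaf X P 2) as L2.
  unfold P in L0, L1, L2; fold P in L0, L1, L2.
  rewrite Ht in L0. rewrite Hs, (S2 _ _ _ _ E2), !map_app in L1.
  rewrite (S2 _ _ _ _ E2'), !map_app in L2. simpl in L0, L1.
  assert (R1 := @pasting_mrg X P _ _ _ [] [(0,0)] [] _ [(1, length Γ1)] _ _ _ _
      _ _ _ _ _ _ _ h L0 L1 eq_refl eq_refl ltac:(now rewrite length_map, length_seq)
      eq_refl).
  assert (R2 := @pasting_mrg X P _ _ _ [] [(1,0)] [] _ [(2, length Φ1)] _ _ _ _
      _ _ _ _ _ _ _ h' R1 L2 eq_refl eq_refl ltac:(now rewrite length_map, length_seq)
      eq_refl).
  assert (R3 := @pasting_mrg X P _ _ _ [] [(1,0)] [] _ [(2, length Φ1)] _ _ _ _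
      _ _ _ _ _ _ _ h'' L1 L2 eq_refl eq_refl ltac:(now rewrite length_map, length_seq)
      eq_refl).
  simpl in R3. rewrite <- !app_assoc in R3.
  rewrite (app_assoc (A := port)) in R3; simpl app in R3.
  assert (R4 := @pasting_mrg X P _ _ _ [] [(0,0)] [] _ [(1, length Γ1)] _ _ _ _
      _ _ _ _ _ _ _ h4 L0 R3 eq_refl eq_refl
      ltac:(now rewrite !length_app, !length_map, !length_seq) eq_refl).
  simpl in R2, R4. rewrite <- ?app_assoc in R4. rewrite <- ?app_assoc in R2.
  simpl in R2, R4.
  refine (mrg_pasting (mergeP X) _ _ _ R4 R2);
    [ apply Permutation_refl | apply Permutation_refl | ].
  simpl; intros; tauto.
Qed.

Arguments cut_assoc {X t s u p q w a b i k} _ _ _ _ _.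

Lemma cut_unit_r (X : merge_bicat) (t e : cell2 X) a :
  is_unit X [a] e -> out t = [a] -> is_cut X 1 1 t e t.
Proof.
  intros (H1 & H2 & H3 & H4) Ht.
  assert (h : mergeable X t e [] [a] [] [] []) by (constructor; auto; discriminate).
  exists [], a, [], [], [], h; repeat split; apply H3.
Qed.

Arguments cut_unit_r {X t e a} _ _.

Lemma src_first (X : polygraph) (p : cell2 X) a Γ b Δ :
  inp p = a :: Γ -> out p = b :: Δ -> src a = src b.
Proof.
  intros H1 H2. destruct (parallel X p) as (x & y & H3 & H4).
  rewrite H1 in H3; rewrite H2 in H4; simpl in *. intuition congruence.
Qed.

Lemma chain_last (X : polygraph) Γ a x y :
  chain src tgt x (Γ ++ [a]) y -> @tgt X a = y.
Proof.
  revert x; induction Γ; simpl; intros x H; [tauto|]. eapply IHΓ, H.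
Qed.

Lemma tgt_last (X : polygraph) (p : cell2 X) a Γ b Δ :
  inp p = Γ ++ [a] -> out p = Δ ++ [b] -> tgt a = tgt b.
Proof.
  intros H1 H2. destruct (parallel X p) as (x & y & H3 & H4).
  rewrite H1 in H3; rewrite H2 in H4.
  apply chain_last in H3, H4; congruence.
Qed.

Record coherent_choice (X : merge_data) := CoherentChoice {
  ten : forall a b : cell1 X, tgt a = src b -> cell1 X;
  tcell : forall (a b : cell1 X) (h : tgt a = src b), cell2 X;
  tcellP : forall (a b : cell1 X) (h : tgt a = src b),
    is_tensor X a b (ten a b h) (tcell a b h);
  one : cell0 X -> cell1 X;
  oneP : forall x : cell0 X, is_tensor_unit X x (one x);
  lwit : cell1 X -> cell2 X;
  lwitP : forall a : cell1 X, left_witness X (one (src a)) a a (lwit a);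
  rwit : cell1 X -> cell2 X;
  rwitP : forall a : cell1 X, right_witness X (one (tgt a)) a a (rwit a);
  lwit_coh : forall (p : cell2 X) (a b : cell1 X) (Γ Δ : list (cell1 X)),
    inp p = a :: Γ -> out p = b :: Δ ->
    exists r, is_cut X 1 2 p (lwit b) r /\ is_cut X 1 1 (lwit a) p r;
  rwit_coh : forall (p : cell2 X) (a b : cell1 X) (Γ Δ : list (cell1 X)),
    inp p = Γ ++ [a] -> out p = Δ ++ [b] ->
    exists r, is_cut X (length (out p)) 1 p (rwit b) r /\
      is_cut X 1 (length (inp p)) (rwit a) p r;
  mid_coh : forall (q : cell2 X) (a b : cell1 X) (Γ1 Γ2 : list (cell1 X)) (j : nat),
    inp q = Γ1 ++ a :: b :: Γ2 -> j = S (length Γ1) ->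
    exists r, is_cut X 1 j (rwit a) q r /\ is_cut X 1 (S j) (lwit b) q r;
  one_coh : forall x : cell0 X, lwit (one x) = rwit (one x) }.

Arguments ten {X} c a b h.
Arguments tcell {X} c a b h.
Arguments one {X} c x.
Arguments lwit {X} c a.
Arguments rwit {X} c a.

Definition Ghom (X : polygraph) (x y : cell0 X) : Type :=
  {a : cell1 X | src a = x /\ tgt a = y}.

Definition Gcell (X : polygraph) (x y : cell0 X) (a b : Ghom X x y) : Type :=
  {p : cell2 X | inp p = [proj1_sig a] /\ out p = [proj1_sig b]}.

Arguments Gcell {X x y} a b.

Definition Gthe (X : polygraph) (x y : cell0 X) (a b : Ghom X x y)
    (P : cell2 X -> Prop)
    (H : exists! r, inp r = [proj1_sig a] /\ out r = [proj1_sig b] /\ P r) :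
  Gcell a b :=
  exist _ (the _ H)
    (conj (proj1 (theP _ H)) (proj1 (proj2 (theP _ H)))).

Arguments Gthe {X x y} a b P H.

Lemma cut_along (X : merge_bicat) (t : cell2 X) a :
  out t = [a] -> universal_out X t 1 ->
  forall Γ1 Γ2 b s, inp s = Γ1 ++ inp t ++ Γ2 -> out s = [b] ->
  exists! r, inp r = Γ1 ++ a :: Γ2 /\ out r = [b] /\ is_cut X 1 (S (length Γ1)) t r s.
Proof.
  intros Ht (Δ1 & a' & Δ2 & H1 & H2 & H3) Γ1 Γ2 b s H4 H5.
  destruct Δ1; [|discriminate]. rewrite Ht in H1. injection H1 as <- <-.
  apply H3; auto; discriminate.
Qed.

Arguments cut_along X {t a} _ _ Γ1 Γ2 b s _ _.

Lemma unit_unique (X : merge_bicat) a (e e' : cell2 X) :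
  is_unit X [a] e -> is_unit X [a] e' -> e = e'.
Proof.
  intros (H1 & H2 & H3 & H4) (H1' & H2' & H3' & H4').
  assert (h : mergeable X e e' [] [a] [] [] []) by (constructor; auto; discriminate).
  transitivity (mrg h); [symmetry; apply H3' | apply H4].
Qed.

Lemma Gvid_ex (X : rep_merge_bicat) (a : cell1 X) :
  exists! e : cell2 X, inp e = [a] /\ out e = [a] /\ is_unit X [a] e.
Proof.
  destruct (rep_unital (repP X) (Γ := [a]) (src a) (tgt a)) as [e He];
    [discriminate | simpl; auto |].
  exists e. split.
  - split; [|split]; auto; apply He.
  - intros e' (_ & _ & H). eapply unit_unique; eauto.
Qed.

Lemma Gvcomp_ex (X : merge_bicat) (p q : cell2 X) a b c :
  inp p = [a] -> out p = [b] -> inp q = [b] -> out q = [c] ->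
  exists! r, inp r = [a] /\ out r = [c] /\ is_cut X 1 1 p q r.
Proof.
  intros H1 H2 H3 H4.
  destruct (cut_intro X p q [] b [] [] []) as (r & Hr & H5 & H6); auto.
  rewrite H1 in H5; rewrite H4 in H6; simpl in *.
  exists r. split; auto. intros r' (_ & _ & H'). eapply is_cut_fun; eauto.
Qed.

Section G.
Variable X : rep_merge_bicat.
Variable c : coherent_choice X.

Definition Gvid (x y : cell0 X) (a : Ghom X x y) : Gcell a a :=
  Gthe a a (is_unit X [proj1_sig a]) (Gvid_ex X (proj1_sig a)).

Definition Gvcomp (x y : cell0 X) (a b d : Ghom X x y)
    (p : Gcell a b) (q : Gcell b d) : Gcell a d :=
  Gthe a d (is_cut X 1 1 (proj1_sig p) (proj1_sig q))
    (Gvcomp_ex X _ _ (proj1 (proj2_sig p)) (proj2 (proj2_sig p))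
       (proj1 (proj2_sig q)) (proj2 (proj2_sig q))).

Definition Gone (x : cell0 X) : Ghom X x x :=
  exist _ (one c x) (conj (proj1 (oneP c x)) (proj1 (proj2 (oneP c x)))).

Lemma Gcomposable (x y z : cell0 X) (a : Ghom X x y) (b : Ghom X y z) :
  tgt (proj1_sig a) = src (proj1_sig b).
Proof. destruct a as [a [? ?]], b as [b [? ?]]; simpl; congruence. Qed.

Lemma Gten_bd (x y z : cell0 X) (a : Ghom X x y) (b : Ghom X y z) :
  src (ten c _ _ (Gcomposable a b)) = x /\ tgt (ten c _ _ (Gcomposable a b)) = z.
Proof.
  destruct (tcellP c _ _ (Gcomposable a b)) as (H1 & H2 & _).
  destruct a as [a [Ha1 Ha2]], b as [b [Hb1 Hb2]]; simpl in *.
  split.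
  - transitivity (src a); auto. symmetry. exact (src_first _ _ H1 H2).
  - transitivity (tgt b); auto. symmetry. exact (tgt_last _ _ _ [a] _ [] H1 H2).
Qed.

Definition Gten (x y z : cell0 X) (a : Ghom X x y) (b : Ghom X y z) : Ghom X x z :=
  exist _ (ten c _ _ (Gcomposable a b)) (Gten_bd a b).

Definition Gtcell (x y z : cell0 X) (a : Ghom X x y) (b : Ghom X y z) : cell2 X :=
  tcell c _ _ (Gcomposable a b).

Lemma Gtcell_inp x y z (a : Ghom X x y) (b : Ghom X y z) :
  inp (Gtcell a b) = [proj1_sig a; proj1_sig b].
Proof. apply (tcellP c). Qed.

Lemma Gtcell_out x y z (a : Ghom X x y) (b : Ghom X y z) :
  out (Gtcell a b) = [proj1_sig (Gten a b)].
Proof. apply (tcellP c). Qed.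

Lemma Gtcell_univ x y z (a : Ghom X x y) (b : Ghom X y z) :
  universal_out X (Gtcell a b) 1.
Proof. apply (tcellP c). Qed.

(** [r] satisfies [cut_{1,1}(t_{a,b}, r) = cut_{1,2}(q, cut_{1,1}(p, t_{a',b'}))]. *)
Definition Ghcomp_eqn (x y z : cell0 X) (a a' : Ghom X x y) (b b' : Ghom X y z)
    (p q r : cell2 X) : Prop :=
  exists u v, is_cut X 1 1 p (Gtcell a' b') u /\ is_cut X 1 2 q u v /\
    is_cut X 1 1 (Gtcell a b) r v.

Lemma Ghcomp_ex (x y z : cell0 X) (a a' : Ghom X x y) (b b' : Ghom X y z)
  (p : Gcell a a') (q : Gcell b b') :
  exists! r, inp r = [proj1_sig (Gten a b)] /\ out r = [proj1_sig (Gten a' b')] /\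
    Ghcomp_eqn a a' b b' (proj1_sig p) (proj1_sig q) r.
Proof.
  destruct p as [p [Hp Hp']], q as [q [Hq Hq']]; simpl.
  destruct (cut_intro X p (Gtcell a' b') [] (proj1_sig a') [] [] [proj1_sig b'])
    as (u & Hu & Hu1 & Hu2); auto using Gtcell_inp.
  rewrite Hp in Hu1; rewrite Gtcell_out in Hu2; simpl in *.
  destruct (cut_intro X q u [] (proj1_sig b') [] [proj1_sig a] [])
    as (v & Hv & Hv1 & Hv2); auto.
  rewrite Hq in Hv1; rewrite Hu2 in Hv2; simpl in *.
  destruct (cut_along X (Gtcell_out a b) (Gtcell_univ a b) [] [] (proj1_sig (Gten a' b')) v)
    as (r & (Hr1 & Hr2 & Hr3) & Hr4); auto.
  { rewrite Gtcell_inp; auto. }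
  exists r. split.
  - repeat split; auto. exists u, v; auto.
  - intros r' (H1 & H2 & u' & v' & H3 & H4 & H5). apply Hr4.
    rewrite (is_cut_fun H3 Hu) in H4. rewrite (is_cut_fun H4 Hv) in H5. auto.
Qed.

Definition Ghcomp (x y z : cell0 X) (a a' : Ghom X x y) (b b' : Ghom X y z)
    (p : Gcell a a') (q : Gcell b b') : Gcell (Gten a b) (Gten a' b') :=
  Gthe (Gten a b) (Gten a' b')
    (Ghcomp_eqn a a' b b' (proj1_sig p) (proj1_sig q)) (Ghcomp_ex p q).

(** [r] satisfies [cut_{1,1}(cut_{1,1}(t_{a,b}, t_{ab,d}), r) = cut_{1,2}(t_{b,d}, t_{a,bd})]. *)
Definition Gasc_eqn (x y z w : cell0 X) (a : Ghom X x y) (b : Ghom X y z)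
    (d : Ghom X z w) (r : cell2 X) : Prop :=
  exists u v, is_cut X 1 1 (Gtcell a b) (Gtcell (Gten a b) d) u /\
    is_cut X 1 2 (Gtcell b d) (Gtcell a (Gten b d)) v /\ is_cut X 1 1 u r v.

Lemma Gasc_ex (x y z w : cell0 X) (a : Ghom X x y) (b : Ghom X y z) (d : Ghom X z w) :
  exists! r, inp r = [proj1_sig (Gten (Gten a b) d)] /\
    out r = [proj1_sig (Gten a (Gten b d))] /\ Gasc_eqn a b d r.
Proof.
  destruct (cut_intro X (Gtcell a b) (Gtcell (Gten a b) d) [] (proj1_sig (Gten a b)) [] [] [proj1_sig d])
    as (u & Hu & Hu1 & Hu2); auto using Gtcell_inp, Gtcell_out.
  rewrite Gtcell_inp in Hu1. rewrite Gtcell_out in Hu2. simpl app in *.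
  destruct (cut_intro X (Gtcell b d) (Gtcell a (Gten b d)) [] (proj1_sig (Gten b d)) [] [proj1_sig a] [])
    as (v & Hv & Hv1 & Hv2); auto using Gtcell_inp, Gtcell_out.
  rewrite Gtcell_inp in Hv1. rewrite Gtcell_out in Hv2. simpl app in *.
  destruct (cut_along X (Gtcell_out a b) (Gtcell_univ a b) [] [proj1_sig d] (proj1_sig (Gten a (Gten b d))) v)
    as (s & (Hs1 & Hs2 & Hs3) & Hs4); auto.
  { rewrite Gtcell_inp; auto. }
  simpl app in *; simpl length in *.
  destruct (cut_along X (Gtcell_out (Gten a b) d) (Gtcell_univ (Gten a b) d) [] [] (proj1_sig (Gten a (Gten b d))) s)
    as (r & (Hr1 & Hr2 & Hr3) & Hr4); auto.
  { rewrite Gtcell_inp; auto. }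
  simpl app in *; simpl length in *.
  assert (K : forall r' s', inp r' = [proj1_sig (Gten (Gten a b) d)] ->
     is_cut X 1 1 (Gtcell (Gten a b) d) r' s' ->
     exists w', is_cut X 1 1 u r' w' /\ is_cut X 1 1 (Gtcell a b) s' w').
  { intros r' s' H1 H2.
    destruct (cut_intro X u r' [] (proj1_sig (Gten (Gten a b) d)) [] [] [])
      as (w' & Hw & _ & _); auto.
    exists w'; split; auto.
    exact (cut_assoc (Gtcell_out a b) (Gtcell_out (Gten a b) d) Hu Hw H2). }
  exists r. split.
  - repeat split; auto. exists u, v. repeat split; auto.
    destruct (K r s) as (w' & H1 & H2); auto.
    now rewrite (is_cut_fun Hs3 H2).
  - intros r' (H1 & H2 & u' & v' & H3 & H4 & H5). apply Hr4. repeat split; auto.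
    rewrite (is_cut_fun H3 Hu), (is_cut_fun H4 Hv) in H5.
    destruct (cut_intro X (Gtcell (Gten a b) d) r' [] (proj1_sig (Gten (Gten a b) d))
                [] [] []) as (s' & H6 & H7 & H8); auto using Gtcell_out.
    rewrite Gtcell_inp in H7. rewrite H2 in H8. simpl app in *; simpl length in *.
    destruct (K r' s') as (w' & H9 & H10); auto.
    rewrite (is_cut_fun H9 H5) in H10.
    rewrite (Hs4 s'); auto.
Qed.

Definition Gasc (x y z w : cell0 X) (a : Ghom X x y) (b : Ghom X y z)
    (d : Ghom X z w) : Gcell (Gten (Gten a b) d) (Gten a (Gten b d)) :=
  Gthe (Gten (Gten a b) d) (Gten a (Gten b d)) (Gasc_eqn a b d) (Gasc_ex a b d).

Lemma Glun_ex (x y : cell0 X) (a : Ghom X x y) :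
  exists! r, inp r = [proj1_sig (Gten (Gone x) a)] /\ out r = [proj1_sig a] /\
    is_cut X 1 1 (Gtcell (Gone x) a) r (lwit c (proj1_sig a)).
Proof.
  destruct (lwitP c (proj1_sig a)) as (H1 & H2 & _).
  apply (cut_along X (Gtcell_out (Gone x) a) (Gtcell_univ (Gone x) a) [] []); auto.
  rewrite Gtcell_inp, H1. destruct a as [a [Ha1 Ha2]]; simpl. now rewrite Ha1.
Qed.

Lemma Grun_ex (x y : cell0 X) (a : Ghom X x y) :
  exists! r, inp r = [proj1_sig (Gten a (Gone y))] /\ out r = [proj1_sig a] /\
    is_cut X 1 1 (Gtcell a (Gone y)) r (rwit c (proj1_sig a)).
Proof.
  destruct (rwitP c (proj1_sig a)) as (H1 & H2 & _).
  apply (cut_along X (Gtcell_out a (Gone y)) (Gtcell_univ a (Gone y)) [] []); auto.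
  rewrite Gtcell_inp, H1. destruct a as [a [Ha1 Ha2]]; simpl. now rewrite Ha2.
Qed.

Definition Glun (x y : cell0 X) (a : Ghom X x y) : Gcell (Gten (Gone x) a) a :=
  Gthe (Gten (Gone x) a) a _ (Glun_ex a).

Definition Grun (x y : cell0 X) (a : Ghom X x y) : Gcell (Gten a (Gone y)) a :=
  Gthe (Gten a (Gone y)) a _ (Grun_ex a).

Definition G_data : bicat_data :=
  @BicatData (cell0 X) (@Ghom X) (@Gcell X) Gvid Gvcomp Gone Gten Ghcomp
    Gasc Glun Grun.

End G.

Arguments Gone {X} c x.
Arguments Gten {X} c {x y z} a b.
Arguments Gtcell {X} c {x y z} a b.

Section Gmap.
Variables X Y : rep_merge_bicat.
Variable cX : coherent_choice X.
Variable cY : coherent_choice Y.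
Variable f : strong_morphism X Y.

Lemma Gmap1_bd (x y : cell0 X) (a : Ghom X x y) :
  src (m1 f (proj1_sig a)) = m0 f x /\ tgt (m1 f (proj1_sig a)) = m0 f y.
Proof.
  destruct a as [a [Ha1 Ha2]]; simpl.
  now rewrite (m_src (smap_morphism f)), (m_tgt (smap_morphism f)), Ha1, Ha2.
Qed.

Definition Gmap1 (x y : cell0 X) (a : Ghom X x y) : Ghom Y (m0 f x) (m0 f y) :=
  exist _ (m1 f (proj1_sig a)) (Gmap1_bd a).

Lemma Gmap2_bd (x y : cell0 X) (a b : Ghom X x y) (p : Gcell a b) :
  inp (m2 f (proj1_sig p)) = [m1 f (proj1_sig a)] /\
  out (m2 f (proj1_sig p)) = [m1 f (proj1_sig b)].
Proof.
  destruct p as [p [H1 H2]]; simpl.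
  now rewrite (m_inp (smap_morphism f)), (m_out (smap_morphism f)), H1, H2.
Qed.

Definition Gmap2 (x y : cell0 X) (a b : Ghom X x y) (p : Gcell a b) :
  Gcell (Gmap1 a) (Gmap1 b) :=
  exist _ (m2 f (proj1_sig p)) (Gmap2_bd p).

Lemma Gmap_ten_ex (x y z : cell0 X) (a : Ghom X x y) (b : Ghom X y z) :
  exists! r, inp r = [proj1_sig (Gten cY (Gmap1 a) (Gmap1 b))] /\
    out r = [proj1_sig (Gmap1 (Gten cX a b))] /\
    is_cut Y 1 1 (Gtcell cY (Gmap1 a) (Gmap1 b)) r (m2 f (Gtcell cX a b)).
Proof.
  apply (cut_along Y (Gtcell_out _ cY _ _) (Gtcell_univ _ cY _ _) [] []).
  - now rewrite Gtcell_inp, (m_inp (smap_morphism f)), Gtcell_inp.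
  - now rewrite (m_out (smap_morphism f)), Gtcell_out.
Qed.

Definition Gmap_ten (x y z : cell0 X) (a : Ghom X x y) (b : Ghom X y z) :
  Gcell (Gten cY (Gmap1 a) (Gmap1 b)) (Gmap1 (Gten cX a b)) :=
  Gthe _ _ _ (Gmap_ten_ex a b).

Lemma one_tensor_universal (x : cell0 X) : tensor_universal X (one cX x).
Proof.
  destruct (oneP cX x) as (H1 & H2 & H3 & H4).
  repeat split; intros a Ha; rewrite ?H1, ?H2 in Ha; exists a; auto.
Qed.

(** A 2-cell [(e, e) -> (e)] universal at its output is also universal at its
    first input when [e] is tensor universal. *)
Lemma tensor_universal_square (e : cell1 Y) (m : cell2 Y) :
  src e = tgt e -> tensor_universal Y e -> is_tensor Y e e e m ->
  forall d s, inp s = [d; e] -> out s = [e] ->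
  exists! q, inp q = [d] /\ out q = [e] /\ is_cut Y 1 1 q m s.
Proof.
  intros He (_ & _ & _ & TU) (Hm1 & Hm2 & Hm3) d s Hs1 Hs2.
  destruct (TU e (eq_sym He)) as (v & t & Ht1 & Ht2 & Ht3 & Ht4).
  destruct (rep_unital (repP Y) (Γ := [e]) (src e) (tgt e)) as [i Hi];
    [discriminate | simpl; auto |].
  destruct (rep_unital (repP Y) (Γ := [v]) (src v) (tgt v)) as [j Hj];
    [discriminate | simpl; auto |].
  destruct (cut_along Y Ht2 Ht3 [] [] e m) as (r & (Hr1 & Hr2 & Hr3) & Hr4); auto.
  { rewrite Ht1, Hm1; auto. }
  destruct (cut_along Y Hm2 Hm3 [] [] v t) as (r' & (Hr1' & Hr2' & Hr3') & Hr4'); auto.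
  { rewrite Ht1, Hm1; auto. }
  destruct (cut_along Y Ht2 Ht3 [] [] v t) as (k & _ & Hk); auto.
  { rewrite Ht1; auto. }
  destruct (cut_along Y Hm2 Hm3 [] [] e m) as (k' & _ & Hk'); auto.
  { rewrite Hm1; auto. }
  simpl app in *; simpl length in *.
  assert (RR : is_cut Y 1 1 r r' j).
  { destruct (cut_intro Y r r' [] e [] [] []) as (w & Hw & Hw1 & Hw2); auto.
    rewrite Hr1 in Hw1; rewrite Hr2' in Hw2; simpl in *.
    replace j with w; auto.
    transitivity k; [symmetry|]; apply Hk; repeat split; auto; try apply Hj.
    - exact (cut_assoc Ht2 Hr2 Hr3 Hr3' Hw).
    - eapply cut_unit_r; eauto. }
  assert (RR' : is_cut Y 1 1 r' r i).
  { destruct (cut_intro Y r' r [] v [] [] []) as (w & Hw & Hw1 & Hw2); auto.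
    rewrite Hr1' in Hw1; rewrite Hr2 in Hw2; simpl in *.
    replace i with w; auto.
    transitivity k'; [symmetry|]; apply Hk'; repeat split; auto; try apply Hi.
    - exact (cut_assoc Hm2 Hr2' Hr3' Hr3 Hw).
    - eapply cut_unit_r; eauto. }
  destruct (cut_intro Y s r' [] e [] [] []) as (s' & Hs' & Hs1' & Hs2'); auto.
  rewrite Hs1 in Hs1'; rewrite Hr2' in Hs2'; simpl in *.
  destruct Ht4 as (Γ1 & e' & Γ2 & H1 & H2 & H3). simpl in H1.
  destruct Γ1; [|discriminate]. rewrite Ht1 in H1. injection H1 as <- <-.
  destruct (H3 [] [] [d] s') as (q & (Hq1 & Hq2 & Hq3) & Hq4); auto; try discriminate.
  { simpl. rewrite Ht2; auto. }
  simpl in Hq1, Hq2.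
  assert (CO : forall p w, is_cut Y 1 1 p t w -> is_cut (co Y) 1 1 t p w).
  { intros p w (D1 & b & D2 & C1 & C2 & h & E1 & E2 & E3).
    assert (h' : mergeable (co_poly Y) t p C1 [b] C2 D1 D2).
    { pose proof h as []; constructor; simpl in *; tauto. }
    exists C1, b, C2, D1, D2, h'. repeat split; auto.
    simpl. rewrite <- E3. apply mrg_irrelevance; auto. }
  assert (OC : forall p w, is_cut (co Y) 1 1 t p w -> is_cut Y 1 1 p t w).
  { intros p w (D1 & b & D2 & C1 & C2 & h & E1 & E2 & E3).
    exists C1, b, C2, D1, D2, (co_mergeable h). auto. }
  assert (INV : forall w w', out w = [e] -> out w' = [e] ->
     is_cut Y 1 1 w r' s' -> is_cut Y 1 1 w' r' s' -> w = w').
  { intros w w' O1 O2 C1 C2.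
    assert (Z : forall u, out u = [e] -> is_cut Y 1 1 u r' s' -> is_cut Y 1 1 s' r u).
    { intros u O C.
      destruct (cut_intro Y s' r [] v [] [] []) as (z & Hz & _ & _); auto.
      pose proof (cut_assoc O Hr2' C Hz RR') as Z1. simpl in Z1.
      now rewrite (is_cut_fun (cut_unit_r Hi O) Z1). }
    exact (is_cut_fun (Z w O1 C1) (Z w' O2 C2)). }
  exists q. split.
  - repeat split; auto.
    destruct (cut_intro Y q m [] e [] [] [e]) as (w & Hw & Hw1 & Hw2); auto.
    rewrite Hm2 in Hw2; simpl in Hw2; simpl length in *.
    replace s with w; auto. apply INV; auto.
    destruct (cut_intro Y w r' [] e [] [] []) as (z & Hz & _ & _); auto.
    simpl length in *.
    pose proof (cut_assoc Hq1 Hm2 Hw Hz Hr3') as Z1. simpl in Z1.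
    now rewrite (is_cut_fun (OC _ _ Hq3) Z1).
  - intros q' (Hq1' & Hq2' & Hq3'). apply Hq4. repeat split; auto.
    apply CO. exact (cut_assoc Hq2' Hm2 Hq3' Hs' Hr3').
Qed.

Lemma Gmap_unit_ex (x : cell0 X) :
  exists! r, inp r = [proj1_sig (Gone cY (m0 f x))] /\
    out r = [proj1_sig (Gmap1 (Gone cX x))] /\
    is_cut Y 1 1 r (m2 f (lwit cX (one cX x))) (lwit cY (m1 f (one cX x))).
Proof.
  destruct (oneP cX x) as (H1 & H2 & _).
  destruct (lwitP cX (one cX x)) as (L1 & L2 & L3 & _). rewrite H1 in L1.
  destruct (lwitP cY (m1 f (one cX x))) as (K1 & K2 & _).
  simpl. eapply tensor_universal_square; eauto.
  - now rewrite (m_src (smap_morphism f)), (m_tgt (smap_morphism f)), H1, H2.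
  - apply (strong_tensor_universal (smap_strong f)), one_tensor_universal.
  - apply (strong_tensor (smap_strong f)). repeat split; auto.
  - rewrite K1, (m_src (smap_morphism f)), H1; auto.
Qed.

Definition Gmap_unit (x : cell0 X) : Gcell (Gone cY (m0 f x)) (Gmap1 (Gone cX x)) :=
  Gthe _ _ _ (Gmap_unit_ex x).

Definition G_map : psf_data (G_data X cX) (G_data Y cY) :=
  @PsfData (G_data X cX) (G_data Y cY) (m0 f) Gmap1 Gmap2 Gmap_ten Gmap_unit.

End Gmap.

Definition coherent_choices : Type := forall X : rep_merge_bicat, coherent_choice X.

(** Functoriality is a property of the data above, which do not depend on it;
    [G_functor] packages the data with a proof of this property. *)
Record G_functorial (c : coherent_choices) : Prop := GFunctorial {
  G_bicat : forall X : rep_merge_bicat, is_bicat (G_data X (c X));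
  G_psf : forall (X Y : rep_merge_bicat) (f : strong_morphism X Y),
    is_psf (G_map X Y (c X) (c Y) f);
  G_map_id : forall X : rep_merge_bicat,
    G_map X X (c X) (c X) (strong_id X) = psf_id_data (G_data X (c X));
  G_map_comp : forall (X Y Z : rep_merge_bicat) (f : strong_morphism X Y)
      (g : strong_morphism Y Z),
    G_map X Z (c X) (c Z) (strong_comp f g)
    = psf_comp_data (G_map X Y (c X) (c Y) f) (G_map Y Z (c Y) (c Z) g) }.

Definition G_ob (c : coherent_choices) (H : G_functorial c)
    (X : rep_merge_bicat) : bicat :=
  @Bicat (G_data X (c X)) (G_bicat H X).

Definition G_mor (c : coherent_choices) (H : G_functorial c)
    (X Y : rep_merge_bicat) (f : strong_morphism X Y) : psf (G_ob H X) (G_ob H Y) :=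
  @Psf (G_ob H X) (G_ob H Y) (G_map X Y (c X) (c Y) f) (G_psf H X Y f).

Definition G_functor (c : coherent_choices) (H : G_functorial c) : functor MrgBiCat BiCat.
Proof.
  refine (@Functor MrgBiCat BiCat (G_ob H) (G_mor H) _ _).
  - intros X. apply psf_eq, (G_map_id H).
  - intros X Y Z f g. apply psf_eq, (G_map_comp H).
Defined.

Lemma inverse_ex (B : bicat) (x y : bob B) (a b : bhom x y) (p : bcell a b) :
  invertible p -> exists! q : bcell b a, p ⊙ q = vid a /\ q ⊙ p = vid b.
Proof.
  intros [q [H1 H2]]. exists q. split; auto. intros q' [H3 H4].
  rewrite <- (vidr (bicatP B) _ _ _ _ q), <- H3, <- (vassoc (bicatP B)), H2.
  apply (vidl (bicatP B)).
Qed.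

Definition inverse (B : bicat) (x y : bob B) (a b : bhom x y) (p : bcell a b)
    (H : invertible p) : bcell b a :=
  the _ (inverse_ex B H).

Arguments inverse {B x y a b} p H.

Inductive nepath (B : bicat_data) (x : bob B) : bob B -> Type :=
| psingle : forall y, bhom x y -> nepath B x y
| psnoc : forall y z, nepath B x y -> bhom y z -> nepath B x z.

Arguments psingle {B x y} a : rename.
Arguments psnoc {B x y z} N a : rename.

Inductive path (B : bicat_data) (x : bob B) : bob B -> Type :=
| pempty : path B x x
| pfull : forall y, nepath B x y -> path B x y.

Arguments pempty {B x}.
Arguments pfull {B x y} N : rename.

Fixpoint ncat (B : bicat_data) (x y z : bob B) (M : nepath B x y)
    (N : nepath B y z) : nepath B x z :=
  match N in nepath _ _ z' return nepath B x z' with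
  | psingle a => psnoc M a
  | psnoc N' a => psnoc (ncat M N') a
  end.

Definition catl (B : bicat_data) (x y z : bob B) (Γ : path B x y) :
    nepath B y z -> nepath B x z :=
  match Γ in path _ _ y' return nepath B y' z -> nepath B x z with
  | pempty => fun N => N
  | pfull M => fun N => ncat M N
  end.

Definition catr (B : bicat_data) (x y z : bob B) (N : nepath B x y)
    (Γ : path B y z) : nepath B x z :=
  match Γ in path _ _ z' return nepath B x z' with
  | pempty => N
  | pfull M => ncat N M
  end.

Fixpoint lcomp (B : bicat_data) (x y : bob B) (N : nepath B x y) : bhom x y :=
  match N in nepath _ _ y' return bhom x y' with
  | psingle a => a
  | psnoc N' a => lcomp N' ⊗ a
  end.

Section Coherence.
Variable B : bicat.

Definition asci (x y z w : bob B) (a : bhom x y) (b : bhom y z) (c : bhom z w) :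
  bcell (a ⊗ (b ⊗ c)) (a ⊗ b ⊗ c) :=
  inverse (asc a b c) (asc_inv (bicatP B) _ _ _ _ a b c).

Arguments asci {x y z w} a b c.

Fixpoint split (x y z : bob B) (M : nepath B x y) (N : nepath B y z) :
    bcell (lcomp (ncat M N)) (lcomp M ⊗ lcomp N) :=
  match N as N0 in nepath _ _ z'
    return bcell (lcomp (ncat M N0)) (lcomp M ⊗ lcomp N0) with
  | psingle a => vid (lcomp M ⊗ a)
  | psnoc N' a => (split M N' ⊠ vid a) ⊙ asc (lcomp M) (lcomp N') a
  end.

Fixpoint join (x y z : bob B) (M : nepath B x y) (N : nepath B y z) :
    bcell (lcomp M ⊗ lcomp N) (lcomp (ncat M N)) :=
  match N as N0 in nepath _ _ z'
    return bcell (lcomp M ⊗ lcomp N0) (lcomp (ncat M N0)) with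
  | psingle a => vid (lcomp M ⊗ a)
  | psnoc N' a => asci (lcomp M) (lcomp N') a ⊙ (join M N' ⊠ vid a)
  end.

Definition whisker_l (x y z : bob B) (Γ : path B x y) :
    forall N N' : nepath B y z, bcell (lcomp N) (lcomp N') ->
    bcell (lcomp (catl Γ N)) (lcomp (catl Γ N')) :=
  match Γ in path _ _ y' return
    forall N N' : nepath B y' z, bcell (lcomp N) (lcomp N') ->
    bcell (lcomp (catl Γ N)) (lcomp (catl Γ N')) with
  | pempty => fun N N' p => p
  | pfull M => fun N N' p => split M N ⊙ (vid (lcomp M) ⊠ p) ⊙ join M N'
  end.

Definition whisker_r (x y z : bob B) (N N' : nepath B x y)
    (p : bcell (lcomp N) (lcomp N')) (Γ : path B y z) :
    bcell (lcomp (catr N Γ)) (lcomp (catr N' Γ)) :=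
  match Γ in path _ _ z' return
    bcell (lcomp (catr N Γ)) (lcomp (catr N' Γ)) with
  | pempty => p
  | pfull M => split N M ⊙ (p ⊠ vid (lcomp M)) ⊙ join N' M
  end.

Definition vcast (x y : bob B) (N N' : nepath B x y) (E : N = N') :
    bcell (lcomp N) (lcomp N') :=
  match E in _ = N0 return bcell (lcomp N) (lcomp N0) with
  | eq_refl => vid (lcomp N)
  end.

End Coherence.

Record arrow (B : bicat_data) := Arrow {
  asrc : bob B;
  atgt : bob B;
  ahom : bhom asrc atgt }.

Arguments Arrow {B asrc atgt} ahom.

Fixpoint plist (B : bicat_data) (x y : bob B) (N : nepath B x y) : list (arrow B) :=
  match N with
  | psingle a => [Arrow a]
  | psnoc N' a => plist N' ++ [Arrow a]
  end.

Definition clist (B : bicat_data) (x y : bob B) (Γ : path B x y) : list (arrow B) :=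
  match Γ with
  | pempty => []
  | pfull N => plist N
  end.

Record icell (B : bicat_data) := ICell {
  isrc : bob B;
  itgt : bob B;
  iinp : nepath B isrc itgt;
  iout : nepath B isrc itgt;
  ibody : bcell (lcomp iinp) (lcomp iout) }.

Arguments ICell {B isrc itgt} iinp iout ibody.

Lemma plist_nonempty (B : bicat_data) (x y : bob B) (N : nepath B x y) :
  plist N <> [].
Proof. destruct N; simpl; [discriminate|]. now intros H%app_eq_nil. Qed.

Lemma chain_app (C0 C1 : Type) (s t : C1 -> C0) Γ Δ x z :
  chain s t x (Γ ++ Δ) z <-> exists y, chain s t x Γ y /\ chain s t y Δ z.
Proof.
  revert x; induction Γ; simpl; intros x.
  - split; [intros; exists x; auto | intros (y & -> & H); auto].
  - rewrite IHΓ. firstorder.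
Qed.

Lemma plist_chain (B : bicat_data) (x y : bob B) (N : nepath B x y) :
  chain (@asrc B) (@atgt B) x (plist N) y.
Proof.
  induction N; simpl; auto. apply chain_app. exists y; simpl; auto.
Qed.

Definition int_poly (B : bicat_data) : polygraph.
Proof.
  refine (@Polygraph (bob B) (arrow B) (icell B) (@asrc B) (@atgt B)
            (fun p => plist (iinp p)) (fun p => plist (iout p)) _ _ _).
  - intros p. apply plist_nonempty.
  - intros p. apply plist_nonempty.
  - intros p. exists (isrc p), (itgt p). split; apply plist_chain.
Defined.

Lemma plist_inj_aux (B : bicat_data) (x y y' : bob B)
  (N : nepath B x y) (N' : nepath B x y') :
  plist N = plist N' -> existT (nepath B x) y N = existT (nepath B x) y' N'.
Proof.
  revert y' N'; induction N as [y a | y z N IH a]; intros y' [w b | v w N' b]; simpl; intros H.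
  - injection H as E1 E2. subst w. apply inj_pair2 in E2.
    apply inj_pair2 in E2. now subst.
  - destruct (plist N') eqn:E; [now apply plist_nonempty in E|].
    apply (f_equal (@length _)) in H. simpl in H. rewrite length_app in H. simpl in H; lia.
  - destruct (plist N) eqn:E; [now apply plist_nonempty in E|].
    apply (f_equal (@length _)) in H. simpl in H. rewrite length_app in H. simpl in H; lia.
  - apply app_inj_tail in H as [H1 H2]. apply IH in H1.
    injection H1 as E1 E2. subst v. apply inj_pair2 in E2. subst N'.
    injection H2 as E1 E2. subst w. apply inj_pair2 in E2. apply inj_pair2 in E2. now subst.
Qed.

Lemma plist_inj (B : bicat_data) (x y : bob B) (N N' : nepath B x y) :
  plist N = plist N' -> N = N'.
Proof. intros H. apply plist_inj_aux, inj_pair2 in H. auto. Qed.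

Lemma clist_surj (B : bicat_data) (Γ : list (arrow B)) (x y : bob B) :
  chain (@asrc B) (@atgt B) x Γ y -> exists P : path B x y, clist P = Γ.
Proof.
  revert y; induction Γ as [|a Γ IH] using rev_ind; intros y H.
  - simpl in H. subst y. now exists pempty.
  - apply chain_app in H as (z & H1 & H2). simpl in H2. destruct H2 as [<- <-].
    destruct a as [u v a]; simpl in *.
    destruct (IH _ H1) as [P HP]; subst Γ; clear IH H1.
    revert v a; destruct P as [|z N]; intros v a.
    + now exists (pfull (psingle a)).
    + now exists (pfull (psnoc N a)).
Qed.

Lemma plist_ncat (B : bicat_data) (x y z : bob B) (M : nepath B x y) (N : nepath B y z) :
  plist (ncat M N) = plist M ++ plist N.
Proof. induction N; simpl; auto. now rewrite IHN, app_assoc. Qed.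

Lemma plist_catl (B : bicat_data) (x y z : bob B) (Γ : path B x y) (N : nepath B y z) :
  plist (catl Γ N) = clist Γ ++ plist N.
Proof. destruct Γ; simpl; auto using plist_ncat. Qed.

Lemma plist_catr (B : bicat_data) (x y z : bob B) (N : nepath B x y) (Γ : path B y z) :
  plist (catr N Γ) = plist N ++ clist Γ.
Proof. destruct Γ; simpl; rewrite ?app_nil_r; auto using plist_ncat. Qed.

(** Typed versions of the sequences surrounding the segment along which [t] and
    [s] are merged.  Since [Γ1] or [Δ1] is empty, and likewise on the right,
    [Γ1, out t, Γ2] and [Δ1, inp s, Δ2] are one and the same sequence.  There is
    at most one frame, so that [int_mrg] below involves no arbitrary choice. *)
Record frame (B : bicat_data) (t s : icell B)
    (Δ1 Δ2 Γ1 Γ2 : list (arrow B)) : Type := Frame {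
  fsrc : bob B;
  ftgt : bob B;
  fin1 : path B fsrc (isrc t);
  fin2 : path B (itgt t) ftgt;
  fout1 : path B fsrc (isrc s);
  fout2 : path B (itgt s) ftgt;
  fin1E : clist fin1 = Γ1;
  fin2E : clist fin2 = Γ2;
  fout1E : clist fout1 = Δ1;
  fout2E : clist fout2 = Δ2;
  fmid : catl fin1 (catr (iout t) fin2) = catl fout1 (catr (iinp s) fout2) }.

Lemma chain_inj (B : bicat_data) (Λ : list (arrow B)) x y x' y' :
  Λ <> [] -> chain (@asrc B) (@atgt B) x Λ y -> chain (@asrc B) (@atgt B) x' Λ y' ->
  x = x' /\ y = y'.
Proof.
  destruct Λ as [|a Λ]; [congruence|]. intros _ [H1 H2] [H3 H4].
  split; [congruence|]. clear H1 H3. revert a H2 H4.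
  induction Λ; simpl; intros b H2 H4; [congruence|].
  eapply IHΛ; [apply H2 | apply H4].
Qed.

Lemma frame_ex (B : bicat_data) (t s : icell B) (Δ1 Λ Δ2 Γ1 Γ2 : list (arrow B)) :
  mergeable (int_poly B) t s Δ1 Λ Δ2 Γ1 Γ2 -> inhabited (frame t s Δ1 Δ2 Γ1 Γ2).
Proof.
  intros [H1 H2 H3 H4 H5]; simpl in *.
  pose proof (plist_chain (iout t)) as T. rewrite H1 in T.
  apply chain_app in T as (u & T1 & T). apply chain_app in T as (v & T2 & T3).
  pose proof (plist_chain (iinp s)) as S. rewrite H2 in S.
  apply chain_app in S as (u' & S1 & S). apply chain_app in S as (v' & S2 & S3).
  destruct (chain_inj _ _ _ _ H3 T2 S2) as [<- <-].
  assert (exists z (P : path B z (isrc t)) (Q : path B z (isrc s)),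
             clist P = Γ1 /\ clist Q = Δ1) as (z & P & Q & HP & HQ).
  { destruct H4; subst; simpl in *.
    - rewrite <- S1 in T1. exists (isrc t), pempty.
      destruct (clist_surj _ _ _ T1) as [Q HQ]. exists Q; auto.
    - rewrite <- T1 in S1. exists (isrc s).
      destruct (clist_surj _ _ _ S1) as [P HP]. exists P, pempty; auto. }
  assert (exists w (P : path B (itgt t) w) (Q : path B (itgt s) w),
             clist P = Γ2 /\ clist Q = Δ2) as (w & P' & Q' & HP' & HQ').
  { destruct H5; subst; simpl in *.
    - rewrite S3 in T3. exists (itgt t), pempty.
      destruct (clist_surj _ _ _ T3) as [R HR]. exists R; auto.
    - rewrite T3 in S3. exists (itgt s).
      destruct (clist_surj _ _ _ S3) as [R HR]. exists R, pempty; auto. }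
  constructor. refine (@Frame B t s Δ1 Δ2 Γ1 Γ2 z w P P' Q Q' HP HP' HQ HQ' _).
  apply plist_inj. rewrite !plist_catl, !plist_catr, HP, HP', HQ, HQ', H1, H2.
  rewrite <- !app_assoc.
  destruct H4 as [-> | ->], H5 as [-> | ->]; simpl; rewrite ?app_nil_r; auto.
Qed.

Definition int_mrg (B : bicat) (t s : icell B) (Δ1 Λ Δ2 Γ1 Γ2 : list (arrow B))
    (h : mergeable (int_poly B) t s Δ1 Λ Δ2 Γ1 Γ2) : icell B :=
  let F := epsilon (frame_ex h) (fun _ => True) in
  ICell (catl (fin1 F) (catr (iinp t) (fin2 F)))
    (catl (fout1 F) (catr (iout s) (fout2 F)))
    (whisker_l B (fin1 F) (catr (iinp t) (fin2 F)) (catr (iout t) (fin2 F))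
        (whisker_r B (iinp t) (iout t) (ibody t) (fin2 F))
     ⊙ vcast B (fmid F)
     ⊙ whisker_l B (fout1 F) (catr (iinp s) (fout2 F)) (catr (iout s) (fout2 F))
        (whisker_r B (iinp s) (iout s) (ibody s) (fout2 F))).

Definition int_data (B : bicat) : merge_data :=
  @MergeData (int_poly B) (@int_mrg B).

Section IntMap.
Variables B C : bicat.
Variable f : psf B C.

Fixpoint nmap (x y : bob B) (N : nepath B x y) : nepath C (f0 f x) (f0 f y) :=
  match N in nepath _ _ y' return nepath C (f0 f x) (f0 f y') with
  | psingle a => psingle (f1 f a)
  | psnoc N' a => psnoc (nmap N') (f1 f a)
  end.

Fixpoint fjoin (x y : bob B) (N : nepath B x y) :
    bcell (lcomp (nmap N)) (f1 f (lcomp N)) :=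
  match N as N0 in nepath _ _ y'
    return bcell (lcomp (nmap N0)) (f1 f (lcomp N0)) with
  | psingle a => vid (f1 f a)
  | psnoc N' a => (fjoin N' ⊠ vid (f1 f a)) ⊙ ften f (lcomp N') a
  end.

Fixpoint fsplit (x y : bob B) (N : nepath B x y) :
    bcell (f1 f (lcomp N)) (lcomp (nmap N)) :=
  match N as N0 in nepath _ _ y'
    return bcell (f1 f (lcomp N0)) (lcomp (nmap N0)) with
  | psingle a => vid (f1 f a)
  | psnoc N' a =>
      inverse (ften f (lcomp N') a) (ften_inv (psfP f) _ _ _ (lcomp N') a)
        ⊙ (fsplit N' ⊠ vid (f1 f a))
  end.

Definition int_map : merge_map (int_data B) (int_data C) :=
  @MergeMap (int_data B) (int_data C) (f0 f)
    (fun a => Arrow (f1 f (ahom a)))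
    (fun p => ICell (nmap (iinp p)) (nmap (iout p))
                (fjoin (iinp p) ⊙ f2 f (ibody p) ⊙ fsplit (iout p))).

End IntMap.

Arguments int_map {B C} f.

Record int_functorial : Prop := IntFunctorial {
  int_merge_bicat : forall B : bicat, is_merge_bicat (int_data B);
  int_representable : forall B : bicat, representable (int_data B);
  int_morphism : forall (B C : bicat) (f : psf B C),
    is_morphism (int_data B) (int_data C) (int_map f);
  int_strong : forall (B C : bicat) (f : psf B C),
    is_strong (int_data B) (int_data C) (int_map f);
  int_map_id : forall B : bicat,
    int_map (psf_id B) = merge_map_id (int_data B);
  int_map_comp : forall (B C D : bicat) (f : psf B C) (g : psf C D),
    int_map (psf_comp f g) = merge_map_comp (int_map f) (int_map g) }.

Definition int_ob (H : int_functorial) (B : bicat) : rep_merge_bicat :=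
  @RepMergeBicat (@MergeBicat (int_data B) (int_merge_bicat H B))
    (int_representable H B).

Definition int_mor (H : int_functorial) (B C : bicat) (f : psf B C) :
    strong_morphism (int_ob H B) (int_ob H C) :=
  @StrongMorphism (int_ob H B) (int_ob H C) (int_map f)
    (int_morphism H f) (int_strong H f).

Definition int_functor (H : int_functorial) : functor BiCat MrgBiCat.
Proof.
  refine (@Functor BiCat MrgBiCat (int_ob H) (int_mor H) _ _).
  - intros B. apply strong_morphism_eq, (int_map_id H).
  - intros B C D f g. apply strong_morphism_eq, (int_map_comp H).
Defined.

(* Main.v *)
From Stdlib Require Import List Permutation Lia.
From Stdlib Require Import ProofIrrelevance FunctionalExtensionality
  ClassicalEpsilon Eqdep.
Import ListNotations.
Require Import Defs.

Set Implicit Arguments.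

(** The theorem is true because a merge-bicategory hides a strict 2-category.  If [X] is
    unital, whiskering a cell is merging it with a unit, and the sequences of 1-cells,
    with 2-cells composed along whole boundaries, form a strict 2-category from which
    all merges are recovered ([unital_calculus]).  Conversely any such structure, called
    a calculus below, has merges that satisfy the pasting axiom
    ([calculus_merge_bicat]): a pasting diagram becomes a sequence of cells acting on
    disjoint or successive segments of a word, and two orders of evaluation differ by
    instances of the exchange law.  The sequences of 1-cells in a bicategory [B] form a
    calculus as well ([int_calculus]); the coherence that is needed reduces, by
    induction on sequences, to the pentagon ([split_assoc]).

    In a calculus the universal properties become simple.  A cell with one output is
    universal there exactly when it is invertible, and a tensor unit is a cancellable
    idempotent ([unitlike]), a notion that does not see the direction of 2-cells.  So
    representability means that units in this sense exist and that each composable pair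
    is isomorphic to a single 1-cell ([rich]); tensor and par structures determine each
    other.  Cancelling the unit also yields coherent unitors
    ([rich_coherent_choice]), and it makes strong morphisms the same as maps of
    calculi that preserve units ([calculus_map_strong], [strong_calculus_map]).

    A bicategory is presented by a calculus when its 2-cells are the cells with one
    input and one output and its operations are computed from chosen invertible cells
    [(a, b) -> (a ⊗ b)].  The bicategory axioms then follow from the exchange law
    ([presented_bicat]), and maps of calculi induce pseudofunctors
    ([presented_psf]).  Now [GX] is presented by the calculus of [X]
    ([G_presentation]), and [B] by the calculus of [∫ B] ([int_presentation]).  This
    proves that [G] is a functor; that [∫] is one is a computation with the constraint
    cells of pseudofunctors ([int_is_functorial]).

    For the equivalence, conjugation with iterated tensors sends the sequences of a
    presented bicategory to those of the calculus ([real_calculus_map]).  For [GX] it is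
    bijective, as 1-cells are the same and conjugation with invertible cells is
    bijective; this gives an isomorphism [∫ G X -> X], natural because strong morphisms
    preserve tensors ([counit_iso], [counit_natural]).  In the other direction [B] and
    [G ∫ B] are presented by the same calculus, and differ only in the choice of tensors;
    the comparisons of these tensors form an isomorphism of bicategories
    ([unit_psf_l], [unit_psf_r]).  It is natural because a pseudofunctor between
    presented bicategories is determined by its effect on cells and tensors: its unit
    cells follow from the rest ([psf_unit_unique]). *)

(** * The sequence calculus *)

Definition composable (X : polygraph) (Γ : list (cell1 X)) : Prop :=
  Γ <> [] /\ exists x y, chain src tgt x Γ y.

Definition neutral (X : polygraph) (sq : cell2 X -> cell2 X -> cell2 X)
    (Γ : list (cell1 X)) (e : cell2 X) : Prop :=
  inp e = Γ /\ out e = Γ /\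
  (forall p, inp p = Γ -> sq e p = p) /\ (forall p, out p = Γ -> sq p e = p).

(** A strict 2-category structure on sequences of 1-cells: [sq] composes along a
    whole boundary, [wh] whiskers on both sides.  It is the common language for a
    unital merge-bicategory and for the sequences in a bicategory.  The operations
    are total, with meaningless values outside the hypotheses of the laws; the last
    law says that the merges are those of the 2-category. *)
Record calculus (X : merge_data) := Calculus {
  sq : cell2 X -> cell2 X -> cell2 X;
  wh : list (cell1 X) -> cell2 X -> list (cell1 X) -> cell2 X;
  sq_inp : forall p q, out p = inp q -> inp (sq p q) = inp p;
  sq_out : forall p q, out p = inp q -> out (sq p q) = out q;
  wh_inp : forall A p B, composable X (A ++ inp p ++ B) ->
    inp (wh A p B) = A ++ inp p ++ B;
  wh_out : forall A p B, composable X (A ++ inp p ++ B) ->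
    out (wh A p B) = A ++ out p ++ B;
  sq_assoc : forall p q r, out p = inp q -> out q = inp r ->
    sq (sq p q) r = sq p (sq q r);
  wh_nil : forall p, wh [] p [] = p;
  wh_wh : forall A B p C D, composable X ((A ++ B) ++ inp p ++ C ++ D) ->
    wh A (wh B p C) D = wh (A ++ B) p (C ++ D);
  wh_sq : forall A p q B, out p = inp q -> composable X (A ++ inp p ++ B) ->
    wh A (sq p q) B = sq (wh A p B) (wh A q B);
  wh_exch : forall p q, composable X (inp p ++ inp q) ->
    sq (wh [] p (inp q)) (wh (out p) q []) = sq (wh (inp p) q []) (wh [] p (out q));
  neutral_ex : forall Γ, composable X Γ -> exists e, neutral X sq Γ e;
  wh_neutral : forall A Γ e B, neutral X sq Γ e -> composable X (A ++ Γ ++ B) ->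
    neutral X sq (A ++ Γ ++ B) (wh A e B);
  mrg_sq : forall t s Δ1 Λ Δ2 Γ1 Γ2 (h : mergeable X t s Δ1 Λ Δ2 Γ1 Γ2),
    mrg h = sq (wh Γ1 t Γ2) (wh Δ1 s Δ2) }.

Arguments sq {X} K p q : rename.
Arguments wh {X} K A p B : rename.

Lemma chain_det (X : polygraph) (Γ : list (cell1 X)) x y x' y' : Γ <> [] ->
  chain src tgt x Γ y -> chain src tgt x' Γ y' -> x = x' /\ y = y'.
Proof.
  destruct Γ as [|a Γ]; [easy|]. intros _ [<- H] [<- H']. split; auto.
  revert a H H'. induction Γ; simpl; intros; [congruence|]. destruct H, H'; eauto.
Qed.

Arguments chain_det {X} Γ {x y x' y'} _ _ _.

Lemma chain_parallel (X : polygraph) A (p : cell2 X) B x y :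
  chain src tgt x (A ++ inp p ++ B) y <-> chain src tgt x (A ++ out p ++ B) y.
Proof.
  destruct (parallel X p) as (u & v & H1 & H2).
  pose proof (inp_nonempty X p) as N1. pose proof (out_nonempty X p) as N2.
  assert (E : forall Γ Δ, Γ <> [] -> chain src tgt u Γ v -> chain src tgt u Δ v ->
    chain src tgt x (A ++ Γ ++ B) y -> chain src tgt x (A ++ Δ ++ B) y).
  { intros Γ Δ N G D H. apply chain_app in H as (z & Ha & H).
    apply chain_app in H as (w & Hg & Hb).
    destruct (chain_det _ N Hg G) as [-> ->].
    apply chain_app. exists u; split; auto. apply chain_app. exists v; auto. }
  split; apply E; auto.
Qed.

Lemma composable_glue (X : polygraph) (A B C : list (cell1 X)) : B <> [] ->
  composable X (A ++ B) -> composable X (B ++ C) -> composable X (A ++ B ++ C).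
Proof.
  intros N (_ & x & y & H) (_ & x' & y' & H'). split.
  { intros E. apply app_eq_nil in E as [_ E]. now apply app_eq_nil in E as [E _]. }
  apply chain_app in H as (z & Ha & Hb). apply chain_app in H' as (w & Hb' & Hc).
  destruct (chain_det _ N Hb Hb') as [-> ->].
  exists x, y'. apply chain_app. exists x'. split; auto. apply chain_app. eauto.
Qed.

Lemma composable_one (X : polygraph) (a : cell1 X) : composable X [a].
Proof. split; [discriminate|]. exists (src a), (tgt a). simpl. auto. Qed.

Lemma composable_cons (X : polygraph) (a b : cell1 X) Γ :
  composable X (a :: b :: Γ) <-> tgt a = src b /\ composable X (b :: Γ).
Proof.
  split.
  - intros (_ & x & y & H). simpl in H. destruct H as (_ & E & H). split; auto.
    split; [discriminate|]. exists (src b), y. simpl; auto.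
  - intros (E & _ & x & y & H). split; [discriminate|]. exists (src a), y.
    simpl in *. intuition congruence.
Qed.

Lemma composable_two (X : polygraph) (a b : cell1 X) :
  composable X [a; b] <-> tgt a = src b.
Proof.
  rewrite composable_cons. split; [tauto|]. split; auto. apply composable_one.
Qed.

Lemma composable_parallel (X : polygraph) A (p : cell2 X) B :
  composable X (A ++ inp p ++ B) <-> composable X (A ++ out p ++ B).
Proof.
  pose proof (inp_nonempty X p) as N1. pose proof (out_nonempty X p) as N2.
  split; intros (H & x & y & H'); (split; [|exists x, y; now apply chain_parallel]).
  - intros E. apply app_eq_nil in E as [_ E]. now apply app_eq_nil in E as [E _].
  - intros E. apply app_eq_nil in E as [_ E]. now apply app_eq_nil in E as [E _].
Qed.

Lemma composable_inp (X : polygraph) (p : cell2 X) : composable X (inp p).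
Proof.
  split; [apply inp_nonempty|]. destruct (parallel X p) as (u & v & H1 & H2). eauto.
Qed.

Lemma composable_out (X : polygraph) (p : cell2 X) : composable X (out p).
Proof.
  split; [apply out_nonempty|]. destruct (parallel X p) as (u & v & H1 & H2). eauto.
Qed.

Lemma composable_mid (X : polygraph) (A Γ B : list (cell1 X)) :
  Γ <> [] -> composable X (A ++ Γ ++ B) -> composable X Γ.
Proof.
  intros N (_ & x & y & H). apply chain_app in H as (z & Ha & H).
  apply chain_app in H as (w & Hg & Hb). split; eauto.
Qed.

Arguments composable_glue {X} A {B} C _ _ _.
Arguments composable_one {X} a.
Arguments chain_parallel {X} A p B x y.
Arguments composable_parallel {X} A p B.
Arguments composable_inp {X} p.
Arguments composable_out {X} p.
Arguments composable_mid {X} A {Γ} B _ _.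

(** ** Merges of three cells *)

Section Three.
Variable X : merge_bicat.

Lemma leaf_ports (P : nat -> cell2 X) i A B C A' B' C' :
  inp (P i) = A ++ B ++ C -> out (P i) = A' ++ B' ++ C' ->
  exists a b c a' b' c',
    (length a = length A /\ length b = length B /\ length c = length C) /\
    (length a' = length A' /\ length b' = length B' /\ length c' = length C') /\
    pasting X P [i] (a ++ b ++ c) (a' ++ b' ++ c') [] (P i).
Proof.
  intros H1 H2. pose proof (pasting_leaf X P i) as H. rewrite H1, H2 in H.
  rewrite !length_app, !seq_app, !map_app in H.
  do 6 eexists. split; [|split]; [..|exact H]; rewrite !length_map, !length_seq; auto.
Qed.

Lemma pasting_step (P : nat -> cell2 X) L L' I J D1 M D2 J' C1 N C2 O g g' t s
  Δ1 Λ Δ2 Γ1 Γ2 (h : mergeable X t s Δ1 Λ Δ2 Γ1 Γ2) :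
  pasting X P L I J g t -> pasting X P L' J' O g' s ->
  J = D1 ++ M ++ D2 -> J' = C1 ++ N ++ C2 ->
  (length D1 = length Δ1 /\ length M = length Λ) ->
  (length C1 = length Γ1 /\ length N = length Λ) ->
  pasting X P (L ++ L') (C1 ++ I ++ C2) (D1 ++ O ++ D2)
    (combine M N ++ g ++ g') (mrg h).
Proof. intros H1 H2 -> -> [] []. eapply pasting_mrg; eauto. Qed.

Lemma pasting_unique (P : nat -> cell2 X) L L' I O I' O' g g' r r' :
  pasting X P L I O g r -> pasting X P L' I' O' g' r' ->
  Permutation L [0; 1; 2] -> Permutation L' [0; 1; 2] ->
  I = I' -> O = O' -> (forall e, In e g <-> In e g') -> r = r'.
Proof. intros H1 H2 P1 P2 -> -> H. exact (mrg_pasting (mergeP X) P1 P2 H H1 H2). Qed.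

Let three (t s u : cell2 X) : nat -> cell2 X :=
  fun n => match n with 0 => t | 1 => s | _ => u end.

(* Names the ports of the cell [P i], cut up according to given decompositions of
   its input and of its output. *)
Ltac leaf P i H1 H2 := 
  let a := fresh "a" in let b := fresh "b" in let c := fresh "c" in
  let a' := fresh "o" in let b' := fresh "o" in let c' := fresh "o" in
  let E := fresh "E" in let E' := fresh "E" in let L := fresh "Leaf" in
  destruct (leaf_ports P i _ _ _ _ _ _ H1 H2)
    as (a & b & c & a' & b' & c' & E & E' & L);
  destruct E as (? & ? & ?), E' as (? & ? & ?).

Ltac zero := repeat match goal with
  | H : length ?l = length (@nil _) |- _ => apply length_zero_iff_nil in H; subst l
  end.

Ltac lens := rewrite ?length_app; simpl; rewrite ?length_app; simpl; lia.

Ltac lists := simpl; rewrite ?app_nil_r, <- ?app_assoc; reflexivity.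

Ltac step R h H1 H2 D1 M D2 C1 N C2 :=
  assert (R := pasting_step D1 M D2 C1 N C2 h H1 H2 ltac:(lists) ltac:(lists)
    ltac:(split; lens) ltac:(split; lens)); rewrite ?app_nil_r, <- ?app_assoc in R;
  simpl in R.

Lemma out_full t s Λ : out t = Λ -> inp s = Λ -> mergeable X t s [] Λ [] [] [].
Proof.
  intros H1 H2. constructor; auto; rewrite ?app_nil_r; auto.
  rewrite <- H1. apply out_nonempty.
Qed.

(** Three instances of the pasting axiom, for three cells each: cells in series
    ([mrg_nest]), two cells side by side above a third one ([mrg_side]), and a cell
    that follows a merge of the most general shape ([mrg_after]).  They are all that
    is needed to see a unital merge-bicategory as a strict 2-category. *)
Lemma mrg_nest t s u Γ1 Λ Γ2 Φ1 Σ Φ2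
  (h1 : mergeable X t s [] Λ [] Γ1 Γ2)
  (h2 : mergeable X (mrg h1) u [] Σ [] Φ1 Φ2)
  (h3 : mergeable X s u [] Σ [] Φ1 Φ2)
  (h4 : mergeable X t (mrg h3) [] Λ [] (Φ1 ++ Γ1) (Γ2 ++ Φ2)) :
  mrg h2 = mrg h4.
Proof.
  pose proof h1 as [O1 I1 _ _ _]. pose proof h3 as [O3 I3 _ _ _].
  assert (It : inp (three t s u 0) = [] ++ inp t ++ []) by (simpl; now rewrite app_nil_r).
  assert (Ou : out (three t s u 2) = [] ++ out u ++ []) by (simpl; now rewrite app_nil_r).
  leaf (three t s u) 0 It O1. leaf (three t s u) 1 I1 O3. leaf (three t s u) 2 I3 Ou. zero.
  step R1 h1 Leaf Leaf0 (@nil port) o0 (@nil port) a0 b0 c0.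
  step R2 h2 R1 Leaf1 (@nil port) o3 (@nil port) a1 b1 c1.
  step R3 h3 Leaf0 Leaf1 (@nil port) o3 (@nil port) a1 b1 c1.
  step R4 h4 Leaf R3 (@nil port) o0 (@nil port) (a1 ++ a0) b0 (c0 ++ c1).
  eapply pasting_unique; [exact R2 | exact R4 | ..]; simpl; auto.
  - intros e. rewrite ?app_nil_r, ?in_app_iff. tauto.
Qed.

Lemma mrg_side p q e A B C D E
  (h1 : mergeable X q e [] B [] (A ++ C) E)
  (h2 : mergeable X p (mrg h1) [] A [] [] D)
  (h3 : mergeable X p e [] A [] [] (C ++ B ++ E))
  (h4 : mergeable X q (mrg h3) [] B [] (inp p ++ C) E) :
  D = C ++ inp q ++ E -> mrg h2 = mrg h4.
Proof.
  intros ->.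
  pose proof h1 as [O1 I1 _ _ _]. pose proof h3 as [O3 I3 _ _ _].
  assert (Ip : inp (three p q e 0) = [] ++ inp p ++ []) by (simpl; now rewrite app_nil_r).
  assert (Iq : inp (three p q e 1) = [] ++ inp q ++ []) by (simpl; now rewrite app_nil_r).
  assert (Oe : out (three p q e 2) = [] ++ out e ++ []) by (simpl; now rewrite app_nil_r).
  simpl in I3.
  leaf (three p q e) 0 Ip O3. leaf (three p q e) 1 Iq O1. leaf (three p q e) 2 I1 Oe. zero.
  rewrite length_app in *.
  assert (exists a c, a1 = a ++ c /\ length a = length A /\ length c = length C)
    as (a & c & -> & La & Lc).
  { exists (firstn (length A) a1), (skipn (length A) a1).
    rewrite firstn_skipn, length_firstn, length_skipn. repeat split; lia. }
  step R1 h1 Leaf0 Leaf1 (@nil port) o3 (@nil port) (a ++ c) b1 c1.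
  step R2 h2 Leaf R1 (@nil port) o0 (@nil port) (@nil port) a (c ++ b0 ++ c1).
  step R3 h3 Leaf Leaf1 (@nil port) o0 (@nil port) (@nil port) a (c ++ b1 ++ c1).
  step R4 h4 Leaf0 R3 (@nil port) o3 (@nil port) (b ++ c) b1 c1.
  eapply pasting_unique; [exact R2 | exact R4 | ..]; simpl; auto.
  - apply perm_swap.
  - intros x. rewrite ?app_nil_r, ?in_app_iff. tauto.
Qed.

Lemma mrg_after t s e Δ1 Λ Δ2 Γ1 Γ2
  (h1 : mergeable X t s Δ1 Λ Δ2 Γ1 Γ2)
  (h2 : mergeable X (mrg h1) e [] (Δ1 ++ out s ++ Δ2) [] [] [])
  (h3 : mergeable X s e [] (out s) [] Δ1 Δ2)
  (h4 : mergeable X t (mrg h3) [] (out t) [] Γ1 Γ2) :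
  mrg h2 = mrg h4.
Proof.
  pose proof h1 as [O1 I1 _ N1 N2]. pose proof h3 as [O3 I3 _ _ _].
  assert (It : inp (three t s e 0) = [] ++ inp t ++ []) by (simpl; now rewrite app_nil_r).
  assert (Oe : out (three t s e 2) = [] ++ out e ++ []) by (simpl; now rewrite app_nil_r).
  leaf (three t s e) 0 It O1. leaf (three t s e) 1 I1 O3. leaf (three t s e) 2 I3 Oe. zero.
  assert (Lo : length (out t) = length Δ1 + (length Λ + length Δ2))
    by (rewrite O1, !length_app; lia).
  step R1 h1 Leaf Leaf0 o o0 o1 a0 b0 c0.
  step R2 h2 R1 Leaf1 (@nil port) (o ++ o3 ++ o1) (@nil port)
    (@nil port) (a1 ++ b1 ++ c1) (@nil port).
  step R3 h3 Leaf0 Leaf1 (@nil port) o3 (@nil port) a1 b1 c1.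
  assert (E : a1 ++ a0 ++ b0 ++ c0 ++ c1 = a0 ++ (a1 ++ b0 ++ c1) ++ c0).
  { destruct N1, N2; subst; zero; rewrite ?app_nil_r, <- ?app_assoc; simpl;
      rewrite ?app_nil_r; auto. }
  rewrite E in R3.
  step R4 h4 Leaf R3 (@nil port) (o ++ o0 ++ o1) (@nil port) a0 (a1 ++ b0 ++ c1) c0.
  eapply pasting_unique; [exact R2 | exact R4 | ..]; simpl; auto.
  - intros x.
    assert (EC : forall (l1 l2 l1' l2' : list port), length l1 = length l1' ->
      combine (l1 ++ l2) (l1' ++ l2') = combine l1 l1' ++ combine l2 l2').
    { induction l1; destruct l1'; simpl; intros; try discriminate; auto.
      f_equal; auto. }
    rewrite !EC by lia. rewrite !in_app_iff. tauto.
Qed.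

End Three.

(** ** The calculus of a unital merge-bicategory *)

Section UnitalCalculus.
Variable X : merge_bicat.
Hypothesis U : unital X.

Definition total_mrg (t s : cell2 X) Δ1 Λ Δ2 Γ1 Γ2 : cell2 X :=
  match excluded_middle_informative (mergeable X t s Δ1 Λ Δ2 Γ1 Γ2) with
  | left h => mrg h
  | right _ => t
  end.

Lemma total_mrgE t s Δ1 Λ Δ2 Γ1 Γ2 (h : mergeable X t s Δ1 Λ Δ2 Γ1 Γ2) :
  total_mrg t s Δ1 Λ Δ2 Γ1 Γ2 = mrg h.
Proof.
  unfold total_mrg. destruct excluded_middle_informative; [|easy].
  now apply mrg_irrelevance.
Qed.

(** Whole boundaries are composed by a merge.  Whiskering is the merge with the unit
    on the whiskered output: a merge adds 1-cells on both sides of a cell only if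
    they come from the second cell, and a unit adds nothing else. *)
Definition unital_sq (p q : cell2 X) : cell2 X := total_mrg p q [] (out p) [] [] [].

Definition unital_wh (A : list (cell1 X)) (p : cell2 X) (B : list (cell1 X)) : cell2 X :=
  match excluded_middle_informative (exists e, is_unit X (A ++ out p ++ B) e) with
  | left H => total_mrg p (proj1_sig (constructive_indefinite_description _ H))
                [] (out p) [] A B
  | right _ => p
  end.

Lemma is_unit_unique Γ (e e' : cell2 X) : is_unit X Γ e -> is_unit X Γ e' -> e = e'.
Proof.
  intros (H1 & H2 & H3 & H4) (H1' & H2' & H3' & H4').
  assert (h : mergeable X e e' [] Γ [] [] []).
  { constructor; rewrite ?app_nil_r; auto. rewrite <- H1. apply inp_nonempty. }
  transitivity (mrg h); [symmetry; apply H3' | apply H4].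
Qed.

Lemma unit_ex Γ : composable X Γ -> exists e, is_unit X Γ e.
Proof. intros (H & x & y & H'). eapply U; eauto. Qed.

Lemma unital_sqE p q : out p = inp q ->
  exists h : mergeable X p q [] (out p) [] [] [], unital_sq p q = mrg h.
Proof.
  intros H. assert (h : mergeable X p q [] (out p) [] [] []) by now apply out_full.
  exists h. apply total_mrgE.
Qed.

Lemma unital_whE A p B e : is_unit X (A ++ out p ++ B) e ->
  exists h : mergeable X p e [] (out p) [] A B, unital_wh A p B = mrg h.
Proof.
  intros H. assert (h : mergeable X p e [] (out p) [] A B).
  { destruct H as (H & _). constructor; auto; rewrite ?app_nil_r; auto.
    apply out_nonempty. }
  exists h. unfold unital_wh. destruct excluded_middle_informative as [H'|H']; [|exfalso; eauto].
  destruct constructive_indefinite_description as [e' He']; simpl.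
  assert (e' = e) as -> by (eapply is_unit_unique; eauto). apply total_mrgE.
Qed.

Lemma unital_sq_bd p q : out p = inp q -> inp (unital_sq p q) = inp p /\ out (unital_sq p q) = out q.
Proof.
  intros H. destruct (unital_sqE p q H) as [h ->].
  rewrite (inp_mrg (mergeP X)), (out_mrg (mergeP X)), !app_nil_r. auto.
Qed.

Lemma unital_wh_bd A p B : composable X (A ++ inp p ++ B) ->
  inp (unital_wh A p B) = A ++ inp p ++ B /\ out (unital_wh A p B) = A ++ out p ++ B.
Proof.
  intros H. apply composable_parallel in H. destruct (unit_ex H) as [e He].
  destruct (unital_whE _ _ _ He) as [h ->].
  rewrite (inp_mrg (mergeP X)), (out_mrg (mergeP X)), !app_nil_r. split; auto. apply He.
Qed.

(** Composing with a cell that extends a unit of the whole output: the unit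
    disappears. *)
Lemma mrg_through_unit p e q Λ A B (h : mergeable X p e [] Λ [] A B)
  (h' : mergeable X p q [] Λ [] A B) :
  is_unit X (inp q) e -> unital_sq (mrg h) q = mrg h'.
Proof.
  intros He. assert (E : out (mrg h) = inp q).
  { rewrite (out_mrg (mergeP X)), app_nil_r. apply He. }
  destruct (unital_sqE _ _ E) as [h2 ->].
  assert (Eo : out (mrg h) = out e) by now rewrite (out_mrg (mergeP X)), app_nil_r.
  assert (h3 : mergeable X e q [] (out (mrg h)) [] [] []).
  { apply out_full; auto. }
  assert (E3 : mrg h3 = q).
  { destruct He as (_ & _ & _ & He). assert (K : mergeable X e q [] (inp q) [] [] []).
    { apply out_full; auto. congruence. }
    transitivity (mrg K); [now apply mrg_irrelevance | apply (He q [] [] K)]. }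
  assert (h4 : mergeable X p (mrg h3) [] Λ [] ([] ++ A) (B ++ [])).
  { rewrite E3, app_nil_r. auto. }
  rewrite (mrg_nest X h h2 h3 h4). clear h2. revert h4. rewrite E3. intros h4.
  apply mrg_irrelevance; auto using app_nil_r.
Qed.

Lemma mergeable_inner p q : forall A B, inp q = A ++ out p ++ B ->
  mergeable X p q [] (out p) [] A B.
Proof.
  intros. constructor; auto; rewrite ?app_nil_r; auto. apply out_nonempty.
Qed.

(** Whiskering followed by a cell is a single merge, so that units are gone as soon as
    a whiskered cell is composed with another one. *)
Lemma unital_wh_sq A p B q (h : mergeable X p q [] (out p) [] A B) :
  unital_sq (unital_wh A p B) q = mrg h.
Proof.
  pose proof (composable_inp q) as C.
  assert (I : inp q = A ++ out p ++ B) by apply h.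
  destruct (unit_ex C) as [e He]. pose proof He as He'. rewrite I in He'.
  destruct (unital_whE _ _ _ He') as [h' ->]. now apply mrg_through_unit.
Qed.

Definition unital_calculus : calculus X.
Proof.
  refine (@Calculus X unital_sq unital_wh _ _ _ _ _ _ _ _ _ _ _ _).
  - intros. now apply unital_sq_bd.
  - intros. now apply unital_sq_bd.
  - intros. now apply unital_wh_bd.
  - intros. now apply unital_wh_bd.
  - intros p q r H1 H2.
    destruct (unital_sq_bd p q H1) as [I1 O1]. destruct (unital_sq_bd q r H2) as [I2 O2].
    assert (H3 : out (unital_sq p q) = inp r) by congruence.
    assert (H4 : out p = inp (unital_sq q r)) by congruence.
    destruct (unital_sqE _ _ H3) as [h3 ->]. destruct (unital_sqE _ _ H4) as [h4 ->].
    revert h3 h4. destruct (unital_sqE _ _ H1) as [h1 ->]. destruct (unital_sqE _ _ H2) as [h2 ->].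
    intros h3 h4.
    assert (E : out (mrg h1) = out q)
      by (rewrite (out_mrg (mergeP X)), app_nil_r; auto).
    revert h3. rewrite E. intros h3.
    apply (mrg_nest X h1 h3 h2 h4).
  - intros p. destruct (unit_ex (composable_out p)) as [e He].
    pose proof He as He'. rewrite <- (app_nil_r (out p)) in He'.
    destruct (unital_whE [] p [] He') as [h ->]. apply He.
  - intros A B p C D H.
    apply composable_parallel in H. destruct (unit_ex H) as [e He].
    destruct (unital_whE _ _ _ He) as [h ->].
    assert (H' : composable X (B ++ out p ++ C)).
    { apply (composable_mid A D).
      - intros E. apply app_eq_nil in E as [_ E]. apply app_eq_nil in E as [E _].
        now apply out_nonempty in E.
      - now rewrite <- !app_assoc in *. }
    assert (K : composable X (B ++ inp p ++ C)) by now apply composable_parallel.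
    destruct (unital_wh_bd _ _ _ K) as [I1 O1].
    assert (He' : is_unit X (A ++ out (unital_wh B p C) ++ D) e).
    { rewrite O1. now rewrite <- !app_assoc in *. }
    destruct (unital_whE _ _ _ He') as [h' ->].
    destruct (unit_ex H') as [e' Hu]. revert h'.
    destruct (unital_whE _ _ _ Hu) as [h'' ->]. intros h'.
    assert (Ee : out (mrg h'') = out e').
    { rewrite (out_mrg (mergeP X)), app_nil_r. auto. }
    revert h'. rewrite Ee. intros h'.
    assert (h3 : mergeable X e' e [] (out e') [] A D).
    { apply mergeable_inner. destruct He' as [-> _]. rewrite O1.
      destruct Hu as (_ & -> & _). auto. }
    assert (E3 : mrg h3 = e).
    { destruct Hu as (H1 & H2 & _ & Hu).
      assert (Z : mergeable X e' e [] (B ++ out p ++ C) [] A D) by congruence.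
      rewrite <- (Hu e A D Z). now apply mrg_irrelevance. }
    assert (h4 : mergeable X p (mrg h3) [] (out p) [] (A ++ B) (C ++ D))
      by now rewrite E3.
    rewrite (mrg_nest X h'' h' h3 h4). revert h4. rewrite E3. intros.
    now apply mrg_irrelevance.
  - intros A p q B H C.
    pose proof C as C'. apply composable_parallel in C'. rewrite H in C'.
    destruct (unital_wh_bd _ _ _ C) as [I1 O1]. destruct (unital_wh_bd _ _ _ C') as [I2 O2].
    destruct (unital_sq_bd _ _ H) as [I3 O3].
    pose proof C' as C''. apply composable_parallel in C''.
    destruct (unit_ex C'') as [e He].
    assert (h1 : mergeable X p (unital_wh A q B) [] (out p) [] A B).
    { apply mergeable_inner. congruence. }
    rewrite (unital_wh_sq h1).
    pose proof He as He'. rewrite <- O3 in He'.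
    destruct (unital_whE _ _ _ He') as [h2 ->].
    revert h1. destruct (unital_whE _ _ _ He) as [h3 ->]. intros h1.
    revert h2. destruct (unital_sqE _ _ H) as [h0 ->]. intros h2.
    assert (Eo : out (mrg h0) = out q)
      by (rewrite (out_mrg (mergeP X)), app_nil_r; auto).
    revert h2. rewrite Eo. intros h2.
    assert (h4 : mergeable X p (mrg h3) [] (out p) [] (A ++ []) ([] ++ B))
      by now rewrite app_nil_r.
    rewrite (mrg_nest X h0 h2 h3 h4). apply mrg_irrelevance; auto using app_nil_r.
  - intros p q C.
    assert (C1 : composable X (out p ++ inp q)).
    { apply (composable_parallel [] p). auto. }
    assert (C2 : composable X (out p ++ out q)).
    { pose proof (composable_parallel (out p) q []) as Z.
      rewrite !app_nil_r in Z. now apply Z. }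
    destruct (unit_ex C2) as [e He].
    pose proof He as He1. rewrite <- (app_nil_r (out p ++ out q)), <- app_assoc in He1.
    assert (K : composable X (inp p ++ out q)) by (apply (composable_parallel [] p); auto).
    assert (B1 := unital_wh_bd (out p) q []). assert (B2 := unital_wh_bd (inp p) q []).
    assert (B3 := unital_wh_bd [] p (out q)). simpl in B3. rewrite !app_nil_r in B1, B2.
    destruct (B1 C1) as [I1 O1]. destruct (B2 C) as [I2 O2]. destruct (B3 K) as [I3 O3].
    assert (h1 : mergeable X p (unital_wh (out p) q []) [] (out p) [] [] (inp q))
      by now apply mergeable_inner.
    rewrite (unital_wh_sq h1).
    assert (h2 : mergeable X q (unital_wh [] p (out q)) [] (out q) [] (inp p) []).
    { apply mergeable_inner. now rewrite I3, app_nil_r. }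
    rewrite (unital_wh_sq h2). revert h1 h2.
    destruct (unital_whE [] p (out q) He) as [h4 ->].
    destruct (unital_whE (out p) q [] He1) as [h3 ->]. intros h1 h2.
    assert (h3' : mergeable X q e [] (out q) [] (out p ++ []) []) by now rewrite app_nil_r.
    assert (h4' : mergeable X p e [] (out p) [] [] ([] ++ out q ++ []))
      by (simpl; now rewrite app_nil_r).
    assert (E3 : mrg h3 = mrg h3') by (apply mrg_irrelevance; auto using app_nil_r).
    assert (E4 : mrg h4 = mrg h4') by (apply mrg_irrelevance; simpl; auto using app_nil_r).
    revert h1 h2. rewrite E3, E4. intros h1 h2.
    assert (h2' : mergeable X q (mrg h4') [] (out q) [] (inp p ++ []) [])
      by now rewrite (app_nil_r (inp p)).
    rewrite (mrg_side X [] h3' h1 h4' h2') by (simpl; now rewrite app_nil_r).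
    apply mrg_irrelevance; auto using app_nil_r.
  - intros Γ C. destruct (unit_ex C) as [e (H1 & H2 & H3 & H4)]. exists e.
    repeat split; auto.
    + intros p Hp. destruct (unital_sqE e p) as [h ->]; [congruence|].
      assert (h' : mergeable X e p [] Γ [] [] []) by congruence.
      transitivity (mrg h'); [now apply mrg_irrelevance | apply (H4 p [] [] h')].
    + intros p Hp. destruct (unital_sqE p e) as [h ->]; [congruence|].
      assert (h' : mergeable X p e [] Γ [] [] []) by congruence.
      transitivity (mrg h'); [now apply mrg_irrelevance | apply (H3 p [] [] h')].
  - intros A Γ e B (H1 & H2 & H3 & H4) C.
    pose proof C as C'. rewrite <- H1 in C'. destruct (unital_wh_bd _ _ _ C') as [I1 O1].
    destruct (unit_ex C) as [u Hu]. pose proof Hu as Hu'. rewrite <- H2 in Hu'.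
    assert (Cg : composable X Γ).
    { rewrite <- H1. apply composable_inp. }
    assert (He : is_unit X Γ e).
    { destruct (unit_ex Cg) as [v Hv]. replace e with v; auto.
      rewrite <- (H3 v) by apply Hv.
      destruct (unital_sqE e v) as [h ->]; [destruct Hv; congruence|].
      assert (h' : mergeable X e v [] Γ [] [] []) by congruence.
      destruct Hv as (_ & _ & Hv & _). transitivity (mrg h'); [now apply mrg_irrelevance | apply (Hv e [] [] h')]. }
    destruct (unital_whE _ _ _ Hu') as [h E].
    assert (Eu : unital_wh A e B = u).
    { rewrite E. assert (h' : mergeable X e u [] Γ [] A B) by congruence.
      destruct He as (_ & _ & _ & He). rewrite <- (He u A B h'). now apply mrg_irrelevance. }
    rewrite Eu. destruct Hu as (U1 & U2 & U3 & U4).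
    repeat split; auto.
    + intros p Hp. destruct (unital_sqE u p) as [h1 ->]; [congruence|].
      assert (h' : mergeable X u p [] (A ++ Γ ++ B) [] [] []) by congruence.
      transitivity (mrg h'); [now apply mrg_irrelevance | apply (U4 p [] [] h')].
    + intros p Hp. destruct (unital_sqE p u) as [h1 ->]; [congruence|].
      assert (h' : mergeable X p u [] (A ++ Γ ++ B) [] [] []) by congruence.
      transitivity (mrg h'); [now apply mrg_irrelevance | apply (U3 p [] [] h')].
  - intros t s Δ1 Λ Δ2 Γ1 Γ2 h. pose proof h as [H1 H2 H3 H4 H5].
    assert (E : Γ1 ++ out t ++ Γ2 = Δ1 ++ inp s ++ Δ2).
    { rewrite H1, H2. destruct H4, H5; subst; simpl; rewrite ?app_nil_r, <- ?app_assoc; auto. }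
    assert (C : composable X (Δ1 ++ out s ++ Δ2)).
    { pose proof (composable_out (mrg h)) as Z.
      now rewrite (out_mrg (mergeP X)) in Z. }
    pose proof C as C'. apply composable_parallel in C'.
    destruct (unital_wh_bd _ _ _ C') as [I1 O1].
    assert (h1 : mergeable X t (unital_wh Δ1 s Δ2) [] (out t) [] Γ1 Γ2)
      by (apply mergeable_inner; congruence).
    rewrite (unital_wh_sq h1). destruct (unit_ex C) as [e He]. revert h1.
    destruct (unital_whE _ _ _ He) as [h3 ->]. intros h4.
    assert (h2 : mergeable X (mrg h) e [] (Δ1 ++ out s ++ Δ2) [] [] []).
    { apply out_full; [apply (out_mrg (mergeP X)) | apply He]. }
    rewrite <- (mrg_after X h h2 h3 h4). symmetry. apply He.
Defined.

End UnitalCalculus.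

(** * Partial operations *)

Definition pick (A : Type) (P : A -> Prop) : option A :=
  match excluded_middle_informative (exists x, P x) with
  | left h => Some (proj1_sig (constructive_indefinite_description _ h))
  | right _ => None
  end.

Lemma pick_some A (P : A -> Prop) x : (forall y, P y -> y = x) -> P x -> pick P = Some x.
Proof.
  intros H Hx. unfold pick. destruct excluded_middle_informative as [h|h].
  - f_equal. apply H. destruct constructive_indefinite_description; auto.
  - exfalso; eauto.
Qed.

Arguments pick_some {A P} x _ _.

Lemma pickP A (P : A -> Prop) x : pick P = Some x -> P x.
Proof.
  unfold pick. destruct excluded_middle_informative; [|discriminate].
  destruct constructive_indefinite_description; simpl. congruence.
Qed.

Section Partial.
Variable X : merge_data.
Variable K : calculus X.

(** [vc] and [W] are [sq] and [wh], undefined where the boundaries do not match.  The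
    gain is that the laws become unconditional equations, as both sides are defined
    under the same conditions; they can then be used for rewriting. *)
Definition vc (p q : option (cell2 X)) : option (cell2 X) :=
  match p, q with
  | Some p, Some q =>
      if excluded_middle_informative (out p = inp q) then Some (sq K p q) else None
  | _, _ => None
  end.

Definition W (A : list (cell1 X)) (p : option (cell2 X)) (B : list (cell1 X)) :
    option (cell2 X) :=
  match p with
  | Some p =>
      if excluded_middle_informative (composable X (A ++ inp p ++ B))
      then Some (wh K A p B) else None
  | None => None
  end.

Definition idc (Γ : list (cell1 X)) : option (cell2 X) := pick (neutral X (sq K) Γ).

(** Says nothing when [p] is undefined, so that the judgement is syntax-directed and
    can be derived without composability conditions. *)
Definition typ (p : option (cell2 X)) (Γ Δ : list (cell1 X)) : Prop :=
  forall p', p = Some p' -> inp p' = Γ /\ out p' = Δ.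

Lemma vc_Some p q : out p = inp q -> vc (Some p) (Some q) = Some (sq K p q).
Proof. intros. unfold vc. now destruct excluded_middle_informative. Qed.

Lemma W_Some A p B : composable X (A ++ inp p ++ B) -> W A (Some p) B = Some (wh K A p B).
Proof. intros. unfold W. now destruct excluded_middle_informative. Qed.

Lemma vc_inv p q r : vc p q = Some r ->
  exists p' q', p = Some p' /\ q = Some q' /\ out p' = inp q' /\ r = sq K p' q'.
Proof.
  destruct p as [p|], q as [q|]; simpl; try discriminate.
  destruct excluded_middle_informative; [|discriminate]. intros [= <-]. eauto 6.
Qed.

Lemma W_inv A p B r : W A p B = Some r ->
  exists p', p = Some p' /\ composable X (A ++ inp p' ++ B) /\ r = wh K A p' B.
Proof.
  destruct p as [p|]; simpl; try discriminate.
  destruct excluded_middle_informative; [|discriminate]. intros [= <-]. eauto.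
Qed.

Lemma typ_Some p : typ (Some p) (inp p) (out p).
Proof. intros p' [= <-]; auto. Qed.

Lemma typ_vc p q Γ Δ Δ' Θ : typ p Γ Δ -> typ q Δ' Θ -> typ (vc p q) Γ Θ.
Proof.
  intros H1 H2 r H. apply vc_inv in H as (p' & q' & -> & -> & E & ->).
  rewrite sq_inp, sq_out by auto. split; [apply H1 | apply H2]; auto.
Qed.

Lemma typ_W A p B Γ Δ : typ p Γ Δ -> typ (W A p B) (A ++ Γ ++ B) (A ++ Δ ++ B).
Proof.
  intros H r E. apply W_inv in E as (p' & -> & E & ->).
  rewrite wh_inp, wh_out by auto. destruct (H _ eq_refl) as [-> ->]; auto.
Qed.

Lemma typ_idc Γ : typ (idc Γ) Γ Γ.
Proof. intros e H. apply pickP in H. destruct H as (? & ? & _); auto. Qed.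

Lemma neutral_unique Γ e e' :
  neutral X (sq K) Γ e -> neutral X (sq K) Γ e' -> e = e'.
Proof.
  intros (H1 & H2 & H3 & H4) (H1' & H2' & H3' & H4').
  rewrite <- (H4' e) by auto. auto.
Qed.

Lemma idc_Some Γ e : neutral X (sq K) Γ e -> idc Γ = Some e.
Proof. intros H. apply pick_some; auto. intros. eapply neutral_unique; eauto. Qed.

Lemma idc_def Γ : composable X Γ -> exists e, idc Γ = Some e /\ neutral X (sq K) Γ e.
Proof. intros H. destruct (neutral_ex K H) as [e He]. eauto using idc_Some. Qed.

Lemma vc_assoc p q r : vc (vc p q) r = vc p (vc q r).
Proof.
  destruct p as [p|], q as [q|], r as [r|]; simpl; auto;
    repeat (destruct excluded_middle_informative; simpl; auto);
    repeat match goal with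
    | H : context [sq _ _ _] |- _ => first [rewrite sq_inp in H by auto | rewrite sq_out in H by auto]
    end; try congruence.
  f_equal. now apply sq_assoc.
Qed.

Lemma W_nil p : W [] p [] = p.
Proof.
  destruct p as [p|]; auto. rewrite W_Some; [now rewrite wh_nil|].
  simpl. rewrite app_nil_r. apply composable_inp.
Qed.

Lemma composable_sub (A B C D : list (cell1 X)) (p : cell2 X) :
  composable X ((A ++ B) ++ inp p ++ C ++ D) -> composable X (B ++ inp p ++ C).
Proof.
  intros H. apply (composable_mid A D).
  - intros E. apply app_eq_nil in E as [_ E]. apply app_eq_nil in E as [E _].
    now apply inp_nonempty in E.
  - now rewrite <- !app_assoc in *.
Qed.

Lemma W_W A B p C D : W A (W B p C) D = W (A ++ B) p (C ++ D).
Proof.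
  destruct p as [p|]; auto. unfold W at 2 3.
  destruct (excluded_middle_informative (composable X ((A ++ B) ++ inp p ++ C ++ D)))
    as [H|H].
  - pose proof (composable_sub _ _ _ _ _ H) as H'.
    destruct excluded_middle_informative; [|easy].
    rewrite W_Some; [now rewrite wh_wh|].
    rewrite wh_inp by auto. now rewrite <- !app_assoc in *.
  - destruct excluded_middle_informative; auto.
    unfold W. destruct excluded_middle_informative as [H'|]; auto.
    rewrite wh_inp in H' by auto. rewrite <- !app_assoc in *. contradiction.
Qed.

Lemma W_vc A p q B : W A (vc p q) B = vc (W A p B) (W A q B).
Proof.
  destruct p as [p|], q as [q|]; simpl; auto.
  2:{ destruct excluded_middle_informative; auto. }
  destruct (excluded_middle_informative (out p = inp q)) as [E|E].
  - assert (Z : composable X (A ++ inp p ++ B) <-> composable X (A ++ inp q ++ B))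
      by (rewrite <- E; apply composable_parallel).
    simpl. rewrite (sq_inp K) by auto.
    destruct (excluded_middle_informative (composable X (A ++ inp p ++ B))) as [H|H];
      destruct (excluded_middle_informative (composable X (A ++ inp q ++ B))) as [H'|H'];
      try tauto.
    rewrite vc_Some; [now rewrite wh_sq|]. rewrite wh_inp, wh_out by auto. congruence.
  - repeat destruct excluded_middle_informative; auto.
    simpl. destruct excluded_middle_informative as [E'|]; auto.
    rewrite wh_inp, wh_out in E' by auto.
    apply app_inv_head, app_inv_tail in E'. contradiction.
Qed.

Lemma vc_idl p Γ Δ : typ p Γ Δ -> vc (idc Γ) p = p.
Proof.
  destruct p as [p|].
  - intros H. destruct (H _ eq_refl) as [<- <-].
    destruct (idc_def (composable_inp p)) as (e & -> & H1 & H2 & H3 & _).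
    rewrite vc_Some by auto. now rewrite H3.
  - destruct (idc Γ); auto.
Qed.

Lemma vc_idr p Γ Δ : typ p Γ Δ -> vc p (idc Δ) = p.
Proof.
  destruct p as [p|]; auto.
  intros H. destruct (H _ eq_refl) as [<- <-].
  destruct (idc_def (composable_out p)) as (e & -> & H1 & H2 & _ & H3).
  rewrite vc_Some by auto. now rewrite H3.
Qed.

Lemma W_idc A Γ B : Γ <> [] -> W A (idc Γ) B = idc (A ++ Γ ++ B).
Proof.
  intros N. unfold W. destruct (idc Γ) as [e|] eqn:E.
  - apply pickP in E. pose proof E as (H1 & _).
    destruct excluded_middle_informative as [H|H].
    + rewrite H1 in H. symmetry. apply idc_Some. apply (wh_neutral K); auto.
    + destruct (idc (A ++ Γ ++ B)) as [e'|] eqn:E'; auto.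
      apply pickP in E' as (H' & _). rewrite H1 in H. destruct H. rewrite <- H'.
      apply composable_inp.
  - destruct (idc (A ++ Γ ++ B)) as [e'|] eqn:E'; auto.
    apply pickP in E' as (H' & _). pose proof (composable_inp e') as C.
    rewrite H' in C. apply composable_mid in C; auto.
    destruct (idc_def C) as (? & ? & _). congruence.
Qed.

Lemma exch_two (p q : cell2 X) :
  vc (W [] (Some p) (inp q)) (W (out p) (Some q) [])
  = vc (W (inp p) (Some q) []) (W [] (Some p) (out q)).
Proof.
  destruct (classic (composable X (inp p ++ inp q))) as [H|H].
  - assert (C1 : composable X (out p ++ inp q)) by (apply (composable_parallel [] p); auto).
    assert (C2 : composable X (inp p ++ out q)).
    { pose proof (composable_parallel (inp p) q []) as Z.
      rewrite !app_nil_r in Z. now apply Z. }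
    rewrite !W_Some by (simpl; rewrite ?app_nil_r; auto).
    rewrite !vc_Some; [now rewrite wh_exch|..];
      rewrite wh_inp, wh_out by (simpl; rewrite ?app_nil_r; auto);
      simpl; now rewrite ?app_nil_r.
  - unfold W. rewrite app_nil_r. simpl.
    repeat destruct excluded_middle_informative; simpl; auto; tauto.
Qed.

(** The exchange law in general position, obtained from [wh_exch] by whiskering. *)
Lemma exch A V B p q Γ Δ Γ' Δ' : typ p Γ Δ -> typ q Γ' Δ' ->
  vc (W A p (V ++ Γ' ++ B)) (W (A ++ Δ ++ V) q B)
  = vc (W (A ++ Γ ++ V) q B) (W A p (V ++ Δ' ++ B)).
Proof.
  intros Hp Hq. destruct p as [p|], q as [q|]; simpl; auto.
  2: destruct excluded_middle_informative; auto.
  2: destruct excluded_middle_informative; auto.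
  destruct (Hp _ eq_refl) as [<- <-], (Hq _ eq_refl) as [<- <-].
  assert (E : W A (W [] (Some p) V) (inp q ++ B) = W A (Some p) (V ++ inp q ++ B))
    by (rewrite W_W, app_nil_r; auto).
  assert (E' : W A (W [] (Some p) V) (out q ++ B) = W A (Some p) (V ++ out q ++ B))
    by (rewrite W_W, app_nil_r; auto).
  change (vc (W A (Some p) (V ++ inp q ++ B)) (W (A ++ out p ++ V) (Some q) B)
    = vc (W (A ++ inp p ++ V) (Some q) B) (W A (Some p) (V ++ out q ++ B))).
  rewrite <- E, <- E'.
  destruct (W [] (Some p) V) as [p'|] eqn:Ep.
  - destruct (typ_W [] V (@typ_Some p) Ep) as [I O]. simpl in I, O.
    rewrite <- I, <- O.
    assert (Z : forall C D, W A (W [] (Some p') C) D = W A (Some p') (C ++ D))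
      by (intros; rewrite W_W, app_nil_r; auto).
    assert (Z' : forall C, W A (W C (Some q) []) B = W (A ++ C) (Some q) B)
      by (intros; rewrite W_W; auto).
    rewrite <- !Z, <- !Z', <- !W_vc. now rewrite exch_two.
  - simpl. destruct excluded_middle_informative as [H|H]; auto.
Qed.

(** The conditions on the empty sequences in a merge say precisely that the two
    whiskered cells have a common boundary. *)
Lemma mrg_vc t s Δ1 Λ Δ2 Γ1 Γ2 (h : mergeable X t s Δ1 Λ Δ2 Γ1 Γ2) :
  Some (mrg h) = vc (W Γ1 (Some t) Γ2) (W Δ1 (Some s) Δ2).
Proof.
  rewrite (mrg_sq K). pose proof h as [H1 H2 H3 H4 H5].
  assert (E : Γ1 ++ out t ++ Γ2 = Δ1 ++ inp s ++ Δ2).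
  { rewrite H1, H2. destruct H4, H5; subst; simpl; rewrite ?app_nil_r, <- ?app_assoc; auto. }
  assert (C : composable X (Γ1 ++ out t ++ Γ2)).
  { destruct (parallel X t) as (x & y & _ & T). rewrite H1 in T.
    destruct (parallel X s) as (u & v & S & _). rewrite H2 in S.
    assert (N : Γ1 ++ out t ++ Γ2 <> []).
    { intros Z. apply app_eq_nil in Z as [_ Z]. apply app_eq_nil in Z as [Z _].
      now apply out_nonempty in Z. }
    split; auto. rewrite H1.
    apply chain_app in T as (t1 & Ta & T). apply chain_app in T as (t2 & Tb & Tc).
    apply chain_app in S as (s1 & Sa & S). apply chain_app in S as (s2 & Sb & Sc).
    destruct (chain_det _ H3 Sb Tb) as [-> ->].
    exists (if Γ1 then x else u), (if Γ2 then y else v).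
    apply chain_app. exists x. split.
    { destruct H4 as [-> | ->]; simpl in *; auto.
      destruct Γ1; simpl in *; auto. subst; auto. }
    rewrite <- app_assoc. apply chain_app. exists t1; split; auto.
    rewrite <- app_assoc. apply chain_app. exists t2; split; auto.
    apply chain_app. exists y; split; auto.
    destruct H5 as [-> | ->]; simpl in *; auto.
    destruct Γ2; simpl in *; subst; auto. }
  rewrite !W_Some; [rewrite vc_Some; auto |..].
  - rewrite wh_out, wh_inp; auto; try now apply composable_parallel.
    rewrite <- E. auto.
  - rewrite <- E. auto.
  - now apply composable_parallel.
Qed.

End Partial.

Arguments typ {X} p Γ Δ.
Arguments typ_Some {X} p _ _.
Arguments typ_vc {X} K {p q Γ Δ Δ' Θ} _ _ _ _.
Arguments typ_W {X} K A {p} B {Γ Δ} _ _ _.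
Arguments typ_idc {X} K Γ _ _.
Arguments vc_idl {X} K {p Γ Δ} _.
Arguments vc_idr {X} K {p Γ Δ} _.
Arguments exch {X} K A V B {p q Γ Δ Γ' Δ'} _ _.
Arguments vc : simpl never.
Arguments W : simpl never.

(** * Pasting diagrams as rewriting sequences *)

Lemma app_inv_length (T : Type) (a b a' b' : list T) :
  a ++ b = a' ++ b' -> length a = length a' -> a = a' /\ b = b'.
Proof.
  revert a'; induction a; destruct a'; simpl; intros; try discriminate; auto.
  injection H as -> H. injection H0 as H0. destruct (IHa a'); subst; auto.
Qed.

Section Rewriting.
Variable X : merge_data.
Variable K : calculus X.
Variable P : nat -> cell2 X.
Notation vc := (vc K).
Notation W := (W K).
Notation idc := (idc K).

Definition iports i : list port := map (pair i) (seq 0 (length (inp (P i)))).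
Definition oports i : list port := map (pair i) (seq 0 (length (out (P i)))).

Variable wire : Type.
Variable lab : wire -> cell1 X.
Variables νi νo : port -> wire.

Definition wi i := map νi (iports i).
Definition wo i := map νo (oports i).

Hypothesis lab_wi : forall i, map lab (wi i) = inp (P i).
Hypothesis lab_wo : forall i, map lab (wo i) = out (P i).

(** A cell acts on a word of wires by replacing its input wires with its output
    wires; the last argument is the composite of the steps.  Wires, rather than
    1-cells, make the place where a cell acts unambiguous. *)
Inductive ev : list wire -> list nat -> list wire -> option (cell2 X) -> Prop :=
| ev_nil : forall w, ev w [] w (idc (map lab w))
| ev_cons : forall U V i L w c, ev (U ++ wo i ++ V) L w c ->
    ev (U ++ wi i ++ V) (i :: L) w (vc (W (map lab U) (Some (P i)) (map lab V)) c).

Lemma step_typ U V i : typ (W (map lab U) (Some (P i)) (map lab V))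
  (map lab (U ++ wi i ++ V)) (map lab (U ++ wo i ++ V)).
Proof. rewrite !map_app, lab_wi, lab_wo. apply typ_W, typ_Some. Qed.

Lemma ev_typ w L w' c : ev w L w' c -> typ c (map lab w) (map lab w').
Proof.
  induction 1; [apply typ_idc|]. eapply typ_vc; [apply step_typ | eauto].
Qed.

Lemma ev_app w L w' c L' w'' c' :
  ev w L w' c -> ev w' L' w'' c' -> ev w (L ++ L') w'' (vc c c').
Proof.
  induction 1; intros H'; simpl.
  - rewrite (vc_idl K (ev_typ H')). auto.
  - rewrite vc_assoc. constructor. auto.
Qed.

Lemma wi_nonempty i : wi i <> [].
Proof.
  intros E. pose proof (lab_wi i) as H. rewrite E in H.
  symmetry in H. now apply inp_nonempty in H.
Qed.

Lemma wo_nonempty i : wo i <> [].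
Proof.
  intros E. pose proof (lab_wo i) as H. rewrite E in H.
  symmetry in H. now apply out_nonempty in H.
Qed.

Lemma ev_whisker A B w L w' c : w <> [] -> ev w L w' c ->
  ev (A ++ w ++ B) L (A ++ w' ++ B) (W (map lab A) c (map lab B)).
Proof.
  intros N H. revert N. induction H; intros N.
  - rewrite W_idc by (now destruct w). rewrite <- !map_app. constructor.
  - rewrite W_vc, W_W, <- !map_app.
    replace (A ++ (U ++ wi i ++ V) ++ B) with ((A ++ U) ++ wi i ++ V ++ B)
      by now rewrite <- !app_assoc.
    constructor.
    replace ((A ++ U) ++ wo i ++ V ++ B) with (A ++ (U ++ wo i ++ V) ++ B)
      by now rewrite <- !app_assoc.
    apply IHev. intros E. apply app_eq_nil in E as [_ E]. apply app_eq_nil in E as [E _].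
    now apply wo_nonempty in E.
Qed.

(** By [mrg_vc], a merge lets the cells of the first diagram act before those of the
    second one. *)
Lemma pasting_ev L I O g r : pasting X P L I O g r ->
  (forall o p, In (o, p) g -> νo o = νi p) ->
  ev (map νi I) L (map νo O) (Some r) /\
  map lab (map νi I) = inp r /\ map lab (map νo O) = out r.
Proof.
  induction 1 as [i | L L' I D1 M D2 C1 N C2 O g g' t s Δ1 Λ Δ2 Γ1 Γ2 h H1 IH1 H2 IH2
                   LD LM LC LN]; intros G.
  - split; [|split; [apply lab_wi | apply lab_wo]].
    change (ev (wi i) [i] (wo i) (Some (P i))).
    pose proof (@ev_cons [] [] i [] (wo i) (idc (map lab (wo i)))) as E.
    simpl in E. rewrite !app_nil_r in E.
    rewrite (W_nil K), lab_wo, (vc_idr K (typ_Some (P i))) in E. apply E.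
    rewrite <- lab_wo. constructor.
  - destruct IH1 as (E1 & I1 & O1). { intros. apply G. rewrite !in_app_iff; auto. }
    destruct IH2 as (E2 & I2 & O2). { intros. apply G. rewrite !in_app_iff; auto. }
    assert (EM : map νo M = map νi N).
    { assert (LMN : length M = length N) by congruence.
      assert (G' : forall o p, In (o, p) (combine M N) -> νo o = νi p)
        by (intros; apply G; rewrite !in_app_iff; auto).
      clear - LMN G'. revert N LMN G'. induction M; destruct N; simpl; intros; try discriminate; auto.
      f_equal; auto. }
    pose proof h as [Ho Hi _ N1 N2].
    rewrite Ho, !map_app in O1. rewrite Hi, !map_app in I2.
    assert (S3 : forall (a b c a' b' c' : list (cell1 X)),
      a ++ b ++ c = a' ++ b' ++ c' -> length a = length a' -> length b = length b' ->
      a = a' /\ b = b' /\ c = c').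
    { intros a b c a' b' c' E La Lb. apply app_inv_length in E as [-> E]; auto.
      apply app_inv_length in E as [-> E]; auto. }
    assert (O1' := O1). assert (I2' := I2).
    apply S3 in O1' as (D1' & D2' & D3'); rewrite ?length_map; auto.
    apply S3 in I2' as (C1' & C2' & C3'); rewrite ?length_map; auto.
    assert (Z1 : Γ1 = [] -> C1 = []) by (intros ->; now apply length_zero_iff_nil in LC).
    assert (Z2 : Γ2 = [] -> C2 = []).
    { intros ->. apply (f_equal (@length _)) in C3'. rewrite !length_map in C3'.
      now apply length_zero_iff_nil in C3'. }
    assert (Z3 : Δ1 = [] -> D1 = []) by (intros ->; now apply length_zero_iff_nil in LD).
    assert (Z4 : Δ2 = [] -> D2 = []).
    { intros ->. apply (f_equal (@length _)) in D3'. rewrite !length_map in D3'.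
      now apply length_zero_iff_nil in D3'. }
    assert (B := mrg_vc K h).
    split; [|split].
    + rewrite B, !map_app in *.
      apply (ev_whisker (map νi C1) (map νi C2)) in E1.
      2:{ intros E. apply map_eq_nil in E. subst. simpl in I1. symmetry in I1.
          now apply inp_nonempty in I1. }
      apply (ev_whisker (map νo D1) (map νo D2)) in E2.
      2:{ intros E. rewrite <- EM in E. apply app_eq_nil in E as [_ E].
          apply app_eq_nil in E as [E _]. apply map_eq_nil in E. subst.
          apply (mrg_nonempty h), length_zero_iff_nil. auto. }
      rewrite C1', C3' in E1. rewrite D1', D3' in E2.
      eapply ev_app; [exact E1|].
      match goal with |- ev ?w _ _ _ =>
        match type of E2 with ev ?w' _ _ _ => replace w with w'; auto end end.
      rewrite EM. destruct N1 as [n|n], N2 as [n'|n'];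
        try apply Z1 in n; try apply Z2 in n'; try apply Z3 in n; try apply Z4 in n';
        subst; simpl; rewrite ?app_nil_r, <- ?app_assoc; auto.
    + pose proof (mrg_vc K h) as B'. symmetry in B'.
      assert (T := typ_vc K (typ_W K Γ1 Γ2 (typ_Some t)) (typ_W K Δ1 Δ2 (typ_Some s)) _ B').
      destruct T as [-> _]. rewrite !map_app, I1, C1', C3'. auto.
    + pose proof (mrg_vc K h) as B'. symmetry in B'.
      assert (T := typ_vc K (typ_W K Γ1 Γ2 (typ_Some t)) (typ_W K Δ1 Δ2 (typ_Some s)) _ B').
      destruct T as [_ ->]. rewrite !map_app, O2, D1', D3'. auto.
Qed.

Lemma split_unique (U S V U' V' : list wire) : S <> [] -> NoDup (U ++ S ++ V) ->
  U ++ S ++ V = U' ++ S ++ V' -> U = U' /\ V = V'.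
Proof.
  intros N. destruct S as [|x S]; [easy|]. simpl. revert U'.
  induction U as [|u U IH]; intros [|u' U']; simpl; intros D E.
  - injection E as E. apply app_inv_head in E. auto.
  - injection E as -> E. inversion D as [|? ? D1 _]. destruct D1.
    rewrite E. apply in_app_iff. simpl. auto.
  - injection E as -> E. inversion D as [|? ? D1 _]. destruct D1.
    apply in_app_iff. simpl. auto.
  - injection E as -> E. inversion D. destruct (IH U'); subst; auto.
Qed.

Lemma split_disjoint (U S V U' T V' : list wire) : S <> [] -> T <> [] ->
  (forall x, In x S -> In x T -> False) -> U ++ S ++ V = U' ++ T ++ V' ->
  exists Z, (U = U' ++ T ++ Z /\ V' = Z ++ S ++ V) \/
            (U' = U ++ S ++ Z /\ V = Z ++ T ++ V').
Proof.
  intros NS NT D E. apply app_eq_app in E as [l [[-> E]|[-> E]]].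
  - apply app_eq_app in E as [m [[-> E]|[-> E]]].
    + destruct m; [|destruct S; [easy|]].
      * simpl in E. exists []. rewrite ?app_nil_r in *. auto.
      * injection E as -> E. exfalso. apply (D w); simpl; auto.
        apply in_app_iff; simpl; auto.
    + exists m. auto.
  - apply app_eq_app in E as [m [[-> E]|[-> E]]].
    + destruct m; [|destruct T; [easy|]].
      * simpl in E. exists []. rewrite ?app_nil_r in *. auto.
      * injection E as -> E. exfalso. apply (D w); simpl; auto.
        apply in_app_iff; simpl; auto.
    + exists m. auto.
Qed.

Lemma NoDup_step U V i (R : list wire) :
  NoDup ((U ++ wi i ++ V) ++ wo i ++ R) -> NoDup ((U ++ wo i ++ V) ++ R).
Proof.
  intros H. apply (Permutation_NoDup (l' := wi i ++ (U ++ wo i ++ V) ++ R)) in H.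
  - now apply NoDup_app_remove_l in H.
  - rewrite <- !app_assoc, (Permutation_app_swap_app U).
    do 2 apply Permutation_app_head. apply Permutation_app_swap_app.
Qed.

(** A cell whose inputs are all present in the word can be made to act first: no wire
    occurs twice, so that the preceding cells act on disjoint segments, and the
    exchange law applies. *)
Lemma ev_bubble i L1 L2 : forall w w' c U V, ev w (L1 ++ i :: L2) w' c ->
  w = U ++ wi i ++ V -> NoDup (w ++ flat_map wo (L1 ++ i :: L2)) ->
  NoDup (flat_map wi (L1 ++ i :: L2)) ->
  exists c', ev (U ++ wo i ++ V) (L1 ++ L2) w' c' /\
    c = vc (W (map lab U) (Some (P i)) (map lab V)) c'.
Proof.
  induction L1 as [|j L1 IH]; simpl; intros w w' c U V H E D D'.
  - inversion H; subst. destruct (@split_unique U0 (wi i) V0 U V) as [-> ->];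
      auto using wi_nonempty.
    { rewrite H1. now apply NoDup_app_remove_r in D. }
    eauto.
  - inversion H as [|U' V' ? ? ? c0 H' E1]; subst.
    destruct (@split_disjoint U (wi i) V U' (wi j) V') as [Z [[-> ->]|[-> ->]]];
      auto using wi_nonempty.
    { intros x Hi Hj. clear -Hi Hj D'. apply in_split in Hj as (l1 & l2 & Ej).
      rewrite Ej, <- app_assoc in D'. simpl in D'. apply NoDup_remove_2 in D'.
      apply D'. rewrite !in_app_iff. right; right. rewrite flat_map_app, in_app_iff.
      simpl. rewrite in_app_iff. auto. }
    + destruct (IH _ _ _ (U' ++ wo j ++ Z) V H') as (c' & Hc & ->).
      { now rewrite <- !app_assoc. }
    { apply NoDup_step. now rewrite E1. }
      { now apply NoDup_app_remove_l in D'. }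
      exists (vc (W (map lab U') (Some (P j)) (map lab (Z ++ wo i ++ V))) c').
      split.
      * replace ((U' ++ wi j ++ Z) ++ wo i ++ V) with (U' ++ wi j ++ Z ++ wo i ++ V)
          by now rewrite <- !app_assoc.
        constructor. now rewrite <- !app_assoc in *.
      * rewrite <- !vc_assoc. f_equal. rewrite !map_app, !lab_wi, !lab_wo.
        apply exch; apply typ_Some.
    + destruct (IH _ _ _ U (Z ++ wo j ++ V') H') as (c' & Hc & ->).
      { now rewrite <- !app_assoc. }
      { apply NoDup_step. now rewrite E1. }
      { now apply NoDup_app_remove_l in D'. }
      exists (vc (W (map lab (U ++ wo i ++ Z)) (Some (P j)) (map lab V')) c').
      split.
      * replace (U ++ wo i ++ Z ++ wi j ++ V') with ((U ++ wo i ++ Z) ++ wi j ++ V')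
          by now rewrite <- !app_assoc.
        constructor. now rewrite <- !app_assoc in *.
      * rewrite <- !vc_assoc. f_equal. rewrite !map_app, !lab_wi, !lab_wo.
        symmetry. apply exch; apply typ_Some.
Qed.

(** The first cell of one order is moved to the front of the other order. *)
Lemma ev_unique L : forall L' w w1 w2 c1 c2, ev w L w1 c1 -> ev w L' w2 c2 ->
  Permutation L L' -> NoDup (w ++ flat_map wo L) -> NoDup (flat_map wi L) -> c1 = c2.
Proof.
  induction L as [|i L IH]; intros L' w w1 w2 c1 c2 H1 H2 Q D D'.
  - apply Permutation_nil in Q. subst. inversion H1; inversion H2; subst; auto.
  - assert (Hi : In i L') by (eapply Permutation_in; eauto; simpl; auto).
    apply in_split in Hi as (A & B & ->).
    pose proof (Permutation_cons_app_inv _ _ Q) as Q'.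
    inversion H1 as [|U V ? ? ? c H E]; subst.
    destruct (@ev_bubble i A B _ _ _ U V H2 eq_refl) as (c' & H' & ->).
    + eapply Permutation_NoDup; [|exact D]. apply Permutation_app_head.
      now apply Permutation_flat_map.
    + eapply Permutation_NoDup; [|exact D']. now apply Permutation_flat_map.
    + f_equal. eapply IH; eauto.
      * simpl in D. now apply NoDup_step.
      * simpl in D'. now apply NoDup_app_remove_l in D'.
Qed.

End Rewriting.

Section CalculusMerge.
Variable X : merge_data.
Variable K : calculus X.

Lemma mrg_bd t s Δ1 Λ Δ2 Γ1 Γ2 (h : mergeable X t s Δ1 Λ Δ2 Γ1 Γ2) :
  inp (mrg h) = Γ1 ++ inp t ++ Γ2 /\ out (mrg h) = Δ1 ++ out s ++ Δ2.
Proof.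
  pose proof (mrg_vc K h) as B. symmetry in B.
  exact (typ_vc K (typ_W K Γ1 Γ2 (typ_Some t)) (typ_W K Δ1 Δ2 (typ_Some s)) _ B).
Qed.

Lemma combine_split (A B : Type) (M : list A) : forall N : list B,
  length M = length N ->
  map fst (combine M N) = M /\ map snd (combine M N) = N.
Proof.
  induction M; destruct N; simpl; intros E; try discriminate; auto.
  destruct (IHM N); auto. split; congruence.
Qed.

Lemma pasting_ports P L I O g r : pasting X P L I O g r ->
  Permutation (I ++ map snd g) (flat_map (iports X P) L) /\
  Permutation (O ++ map fst g) (flat_map (oports X P) L).
Proof.
  induction 1 as [i | L L' I D1 M D2 C1 N C2 O g g' t s Δ1 Λ Δ2 Γ1 Γ2 h H1 [IH1 IH1'] H2 [IH2 IH2']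
                   LD LM LC LN].
  - simpl. rewrite !app_nil_r. split; reflexivity.
  - destruct (combine_split M N) as [E1 E2]; [congruence|].
    rewrite !map_app, E1, E2, !flat_map_app, <- IH1, <- IH1', <- IH2, <- IH2'.
    assert (dec : forall x y : port, {x = y} + {x <> y}) by (repeat decide equality).
    split; apply (Permutation_count_occ dec); intros x; rewrite ?count_occ_app; lia.
Qed.

Lemma port_eq_dec (x y : port) : {x = y} + {x <> y}.
Proof. repeat decide equality. Qed.

(** [d] is a default value for positions that are out of range. *)
Definition ilab (P : nat -> cell2 X) d (p : port) := nth (snd p) (inp (P (fst p))) d.
Definition olab (P : nat -> cell2 X) d (p : port) := nth (snd p) (out (P (fst p))) d.

Lemma map_nth_seq (A : Type) (l : list A) d :
  map (fun k => nth k l d) (seq 0 (length l)) = l.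
Proof.
  induction l; simpl; auto. f_equal. rewrite <- seq_shift, map_map. exact IHl.
Qed.

Lemma ilab_iports P d i : map (ilab P d) (iports X P i) = inp (P i).
Proof. unfold iports. rewrite map_map. exact (map_nth_seq (inp (P i)) d). Qed.

Lemma olab_oports P d i : map (olab P d) (oports X P i) = out (P i).
Proof. unfold oports. rewrite map_map. exact (map_nth_seq (out (P i)) d). Qed.

Lemma pasting_labels P d L I O g r : pasting X P L I O g r ->
  map (ilab P d) I = inp r /\ map (olab P d) O = out r /\
  forall o p, In (o, p) g -> olab P d o = ilab P d p.
Proof.
  induction 1 as [i | L L' I D1 M D2 C1 N C2 O g g' t s Δ1 Λ Δ2 Γ1 Γ2 h H1 IH1 H2 IH2
                   LD LM LC LN].
  - split; [apply ilab_iports|]. split; [apply olab_oports|]. intros ? ? [].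
  - destruct IH1 as (I1 & O1 & G1), IH2 as (I2 & O2 & G2).
    pose proof h as [Ho Hi _ _ _]. destruct (mrg_bd h) as [-> ->].
    rewrite Ho, !map_app in O1. rewrite Hi, !map_app in I2.
    apply app_inv_length in O1 as [D1' O1]; [|now rewrite length_map].
    apply app_inv_length in O1 as [M' D2']; [|now rewrite length_map].
    apply app_inv_length in I2 as [C1' I2]; [|now rewrite length_map].
    apply app_inv_length in I2 as [N' C2']; [|now rewrite length_map].
    rewrite !map_app, I1, O2, D1', D2', C1', C2'. split; auto. split; auto.
    intros o p. rewrite !in_app_iff. intros [Hc|[Hg|Hg]]; auto.
    assert (E : map (olab P d) M = map (ilab P d) N) by congruence.
    clear - E Hc. revert N E Hc. induction M; destruct N; simpl; try easy.
    intros [= E1 E2] [[= <- <-]|Hc]; eauto.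
Qed.

Lemma NoDup_ports (n : nat -> nat) L : NoDup L ->
  NoDup (flat_map (fun i => map (pair i) (seq 0 (n i))) L).
Proof.
  induction 1 as [|i L Hi _ IH]; simpl; [constructor|].
  apply NoDup_app; auto.
  - apply FinFun.Injective_map_NoDup; [congruence | apply seq_NoDup].
  - intros p Hp Hq. apply in_map_iff in Hp as (k & <- & _).
    apply in_flat_map in Hq as (j & Hj & Hq). apply in_map_iff in Hq as (k' & E & _).
    injection E as -> _. contradiction.
Qed.

Lemma NoDup_map_In (A B : Type) (f : A -> B) l : NoDup (map f l) ->
  forall x y, In x l -> In y l -> f x = f y -> x = y.
Proof.
  induction l as [|a l IH]; simpl; [easy|]. intros D x y.
  inversion D as [|? ? N D']; subst.
  intros [<-|Hx] [<-|Hy] E; auto.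
  - destruct N. rewrite E. now apply in_map.
  - destruct N. rewrite <- E. now apply in_map.
Qed.

Lemma calculus_pasting P L L' I O g g' r r' : NoDup L -> Permutation L L' ->
  (forall e, In e g <-> In e g') ->
  pasting X P L I O g r -> pasting X P L' I O g' r' -> r = r'.
Proof.
  intros DL QL Hg H H'.
  destruct (inp r) as [|d l] eqn:Ed; [now apply inp_nonempty in Ed|]. clear l Ed.
  destruct (pasting_labels d H) as (LI & LO & LG).
  destruct (pasting_ports H) as [QI QO].
  assert (DI : NoDup (I ++ map snd g)).
  { eapply Permutation_NoDup; [symmetry; exact QI | now apply NoDup_ports]. }
  assert (DO : NoDup (O ++ map fst g)).
  { eapply Permutation_NoDup; [symmetry; exact QO | now apply NoDup_ports]. }
  (* A wire is named by the output port where it starts, or else by the input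
     port where it ends. *)
  set (νo := fun p : port => inr p : port + port).
  set (νi := fun p : port =>
    match find (fun e => if port_eq_dec (snd e) p then true else false) g with
    | Some e => inr (fst e)
    | None => inl p
    end : port + port).
  set (lab := fun w : port + port =>
    match w with inl p => ilab P d p | inr p => olab P d p end).
  assert (F : forall p, (exists o, In (o, p) g /\ νi p = inr o) \/
     (~ In p (map snd g) /\ νi p = inl p)).
  { intros p. unfold νi. destruct (find _ g) as [[o q]|] eqn:E.
    - apply find_some in E as [E1 E2]. simpl in E2.
      destruct port_eq_dec; [subst|discriminate]. eauto.
    - right. split; auto. intros Hp. apply in_map_iff in Hp as ([o q] & <- & Hp).
      apply (find_none _ _ E) in Hp. destruct port_eq_dec; simpl in *; congruence. }
  assert (Li : forall p, lab (νi p) = ilab P d p).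
  { intros p. destruct (F p) as [(o & Ho & ->)|[_ ->]]; simpl; auto. }
  assert (G : forall o p, In (o, p) g -> νo o = νi p).
  { intros o p Hp. destruct (F p) as [(o' & Ho & ->)|[N _]].
    - apply NoDup_app_remove_l in DI.
      assert ((o, p) = (o', p)) as [= ->]; auto.
      apply (NoDup_map_In snd g DI); auto.
    - destruct N. now apply (in_map snd) in Hp. }
  assert (Hwi : forall i, map lab (wi X P νi i) = inp (P i)).
  { intros i. unfold wi. rewrite map_map, <- (ilab_iports P d). apply map_ext, Li. }
  assert (Hwo : forall i, map lab (wo X P νo i) = out (P i)).
  { intros i. unfold wo. rewrite map_map, <- (olab_oports P d). now apply map_ext. }
  destruct (pasting_ev K lab νi νo Hwi Hwo H G) as [E1 _].
  destruct (pasting_ev K lab νi νo Hwi Hwo H') as [E2 _].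
  { intros. now apply G, Hg. }
  assert (Fl : forall (f : port -> port + port) (h : nat -> list port) M,
     flat_map (fun i => map f (h i)) M = map f (flat_map h M)).
  { induction M; simpl; auto. rewrite map_app. congruence. }
  assert (E : Some r = Some r'); [|congruence].
  refine (ev_unique Hwi Hwo E1 E2 QL _ _); unfold wi, wo; rewrite Fl.
  - apply NoDup_app.
    + rewrite (map_ext_in νi inl).
      * apply FinFun.Injective_map_NoDup; [now intros ? ? [=]|]. now apply NoDup_app_remove_r in DI.
      * intros p Hp. destruct (F p) as [(o & Ho & _)|[_ ->]]; auto.
        exfalso. apply (in_map snd) in Ho. apply in_split in Ho as (l1 & l2 & El).
        simpl in El. rewrite El, app_assoc in DI. apply NoDup_remove_2 in DI.
        apply DI. rewrite !in_app_iff. auto.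
    + apply FinFun.Injective_map_NoDup; [now intros ? ? [=]| now apply NoDup_ports].
    + intros w Hw Hw'. apply in_map_iff in Hw as (p & <- & Hp).
      apply in_map_iff in Hw' as (q & Eq & _).
      destruct (F p) as [(o & Ho & _)|[_ E]]; [|rewrite E in Eq; discriminate].
      apply (in_map snd) in Ho. apply in_split in Ho as (l1 & l2 & El).
      simpl in El. rewrite El, app_assoc in DI. apply NoDup_remove_2 in DI.
      apply DI. rewrite !in_app_iff. auto.
  - apply FinFun.Injective_map_NoDup; [|now apply NoDup_ports].
    intros p q E. destruct (F p) as [(o & Ho & Ep)|[_ Ep]], (F q) as [(o' & Ho' & Eq)|[_ Eq]];
      rewrite Ep, Eq in E; try discriminate.
    + injection E as ->. apply NoDup_app_remove_l in DO.
      pose proof (NoDup_map_In fst g DO _ _ Ho Ho' eq_refl). congruence.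
    + congruence.
Qed.

(** The axiom on pasting diagrams of a merge-bicategory holds in every calculus, for
    any number of cells: it is the exchange law. *)
Theorem calculus_merge_bicat : is_merge_bicat X.
Proof.
  constructor.
  - intros. apply mrg_bd.
  - intros. apply mrg_bd.
  - intros P L L' I O g g' r r' H1 H2. apply calculus_pasting.
    + eapply Permutation_NoDup; [symmetry; exact H1|].
      repeat constructor; simpl; intuition discriminate.
    + now rewrite H1, H2.
Qed.

Lemma neutral_unit Γ e : neutral X (sq K) Γ e -> is_unit X Γ e.
Proof.
  intros He. pose proof He as (H1 & H2 & H3 & H4).
  assert (Ee : neutral X (sq K) (inp e) e) by congruence.
  split; [|split; [|split]]; auto.
  - intros t Δ1 Δ2 h. assert (E : Some (mrg h) = Some t); [|congruence].
    rewrite (mrg_vc K h), (W_nil K).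
    rewrite <- (idc_Some K He), W_idc by (rewrite <- H1; apply inp_nonempty).
    rewrite <- (mrg_out h). apply (vc_idr K (typ_Some t)).
  - intros s Γ1 Γ2 h. assert (E : Some (mrg h) = Some s); [|congruence].
    rewrite (mrg_vc K h), (W_nil K).
    rewrite <- (idc_Some K He), W_idc by (rewrite <- H1; apply inp_nonempty).
    rewrite <- (mrg_inp h). apply (vc_idl K (typ_Some s)).
Qed.

Lemma calculus_unital : unital X.
Proof.
  intros Γ x y H H'. destruct (neutral_ex K (Γ := Γ)) as [e He].
  - split; eauto.
  - exists e. now apply neutral_unit.
Qed.

Lemma unit_neutral Γ e : is_unit X Γ e -> neutral X (sq K) Γ e.
Proof.
  intros (H1 & H2 & H3 & H4). assert (C := composable_inp e). rewrite H1 in C.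
  destruct (neutral_ex K C) as [e' He']. replace e with e'; auto.
  pose proof (neutral_unit He') as (H1' & H2' & H3' & H4').
  assert (h : mergeable X e' e [] Γ [] [] []).
  { constructor; rewrite ?app_nil_r; auto. apply C. }
  transitivity (mrg h); [symmetry; apply H3 | apply H4'].
Qed.

End CalculusMerge.

(** * Universality in terms of invertible cells *)

Section CoCalculus.
Variable X : merge_data.
Variable K : calculus X.

Lemma co_neutral Γ e :
  neutral X (sq K) Γ e <-> neutral (co X) (fun p q => sq K q p) Γ e.
Proof. unfold neutral; simpl; tauto. Qed.

Definition co_calculus : calculus (co X).
Proof.
  refine (@Calculus (co X) (fun p q => sq K q p) (wh K) _ _ _ _ _ _ _ _ _ _ _ _); simpl.
  - intros. apply sq_out; auto.
  - intros. apply sq_inp; auto.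
  - intros. apply wh_out. now apply composable_parallel.
  - intros. apply wh_inp. now apply composable_parallel.
  - intros. symmetry. apply sq_assoc; auto.
  - apply wh_nil.
  - intros. apply wh_wh. now apply composable_parallel.
  - intros A p q B H C. apply wh_sq; auto. apply composable_parallel. rewrite <- H.
    now apply composable_parallel.
  - intros p q H.
    assert (H' : composable X (inp p ++ inp q)).
    { apply (composable_parallel [] p). simpl.
      pose proof (composable_parallel (out p) q []) as Z.
      rewrite !app_nil_r in Z. now apply Z. }
    pose proof (exch_two K p q) as E.
    assert (C1 : composable X (out p ++ inp q)) by (apply (composable_parallel [] p); auto).
    assert (C2 : composable X (inp p ++ out q)).
    { pose proof (composable_parallel (inp p) q []) as Z.
      rewrite !app_nil_r in Z. now apply Z. }
    rewrite (wh_exch K p q); auto.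
  - intros Γ H. destruct (neutral_ex K H) as [e He]. exists e. now apply co_neutral.
  - intros A Γ e B H C. apply co_neutral. apply wh_neutral; auto. now apply co_neutral.
  - intros. apply mrg_sq.
Defined.

End CoCalculus.

Section Universal.
Variable X : merge_data.
Variable K : calculus X.
Notation vc := (vc K).
Notation W := (W K).
Notation idc := (idc K).

Definition has (p : option (cell2 X)) (Γ Δ : list (cell1 X)) : Prop :=
  exists p', p = Some p' /\ inp p' = Γ /\ out p' = Δ.

Lemma has_typ p Γ Δ : has p Γ Δ -> typ p Γ Δ.
Proof. intros (p' & -> & <- & <-). apply typ_Some. Qed.

Lemma has_Some p : has (Some p) (inp p) (out p).
Proof. exists p; auto. Qed.

Lemma has_vc p q Γ Δ Θ : has p Γ Δ -> has q Δ Θ -> has (vc p q) Γ Θ.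
Proof.
  intros (p' & -> & <- & E) (q' & -> & E' & <-). exists (sq K p' q').
  rewrite vc_Some, sq_inp, sq_out by congruence. auto.
Qed.

Lemma has_W A p B Γ Δ : has p Γ Δ -> composable X (A ++ Γ ++ B) ->
  has (W A p B) (A ++ Γ ++ B) (A ++ Δ ++ B).
Proof.
  intros (p' & -> & <- & <-) C. exists (wh K A p' B).
  rewrite W_Some, wh_inp, wh_out by auto. auto.
Qed.

Lemma has_idc Γ : composable X Γ -> has (idc Γ) Γ Γ.
Proof. intros H. destruct (idc_def K H) as (e & -> & H1 & H2 & _). exists e; auto. Qed.

Lemma has_inp p Γ Δ : has p Γ Δ -> composable X Γ.
Proof. intros (p' & -> & <- & <-). apply composable_inp. Qed.

Lemma has_out p Γ Δ : has p Γ Δ -> composable X Δ.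
Proof. intros (p' & -> & <- & <-). apply composable_out. Qed.

Lemma has_composable p Γ Δ A B : has p Γ Δ ->
  composable X (A ++ Γ ++ B) <-> composable X (A ++ Δ ++ B).
Proof. intros (p' & -> & <- & <-). apply composable_parallel. Qed.

(** Mutually inverse expressions; both may be undefined. *)
Definition isoc (p q : option (cell2 X)) (Γ Δ : list (cell1 X)) : Prop :=
  typ p Γ Δ /\ typ q Δ Γ /\ vc p q = idc Γ /\ vc q p = idc Δ.

Lemma isoc_sym p q Γ Δ : isoc p q Γ Δ -> isoc q p Δ Γ.
Proof. intros (H1 & H2 & H3 & H4). repeat split; auto; now apply H1 || apply H2. Qed.

Lemma isoc_W A B p q Γ Δ : Γ <> [] -> Δ <> [] -> isoc p q Γ Δ ->
  isoc (W A p B) (W A q B) (A ++ Γ ++ B) (A ++ Δ ++ B).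
Proof.
  intros N N' (H1 & H2 & H3 & H4). split; [|split; [|split]]; try now apply typ_W.
  - now rewrite <- W_vc, H3, W_idc.
  - now rewrite <- W_vc, H4, W_idc.
Qed.

Lemma isoc_cancel_l p q Γ Δ x Θ : isoc p q Γ Δ -> typ x Γ Θ -> vc p (vc q x) = x.
Proof.
  intros (H1 & H2 & H3 & H4) T. rewrite <- vc_assoc, H3. eapply vc_idl; eauto.
Qed.

Lemma isoc_cancel_r p q Γ Δ x Θ : isoc p q Γ Δ -> typ x Θ Γ -> vc (vc x p) q = x.
Proof.
  intros (H1 & H2 & H3 & H4) T. rewrite vc_assoc, H3. eapply vc_idr; eauto.
Qed.

Lemma isoc_vc p q p' q' Γ Δ Θ : isoc p q Γ Δ -> isoc p' q' Δ Θ ->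
  isoc (vc p p') (vc q' q) Γ Θ.
Proof.
  intros H H'. pose proof (isoc_sym H) as S. pose proof (isoc_sym H') as S'.
  destruct H as (H1 & H2 & H3 & H4), H' as (H1' & H2' & H3' & H4').
  split; [|split; [|split]]; try (eapply typ_vc; eauto).
  - rewrite vc_assoc, <- (vc_assoc K p'), H3', (vc_idl K H2); auto.
  - rewrite vc_assoc, <- (vc_assoc K q), H4, (vc_idl K H1'); auto.
Qed.

Lemma has_inverse p q Γ Δ : has p Γ Δ -> isoc p q Γ Δ -> has q Δ Γ.
Proof.
  intros H (H1 & H2 & H3 & H4). apply has_out in H.
  destruct (has_idc H) as (e & E & _). rewrite E in H4.
  apply vc_inv in H4 as (q' & p' & -> & -> & _). 
  destruct (H2 _ eq_refl). exists q'; auto.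
Qed.

Definition equi (Γ Δ : list (cell1 X)) : Prop :=
  exists p q, has p Γ Δ /\ isoc p q Γ Δ.

Lemma equi_sym Γ Δ : equi Γ Δ -> equi Δ Γ.
Proof.
  intros (p & q & H & I). exists q, p. split; [eapply has_inverse; eauto|].
  now apply isoc_sym.
Qed.

Lemma equi_trans Γ Δ Θ : equi Γ Δ -> equi Δ Θ -> equi Γ Θ.
Proof.
  intros (p & q & H & I) (p' & q' & H' & I'). exists (vc p p'), (vc q' q).
  split; [eapply has_vc; eauto | eapply isoc_vc; eauto].
Qed.

Lemma equi_W A B Γ Δ : equi Γ Δ -> composable X (A ++ Γ ++ B) ->
  equi (A ++ Γ ++ B) (A ++ Δ ++ B).
Proof.
  intros (p & q & H & I) C. exists (W A p B), (W A q B).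
  split; [now apply has_W|]. apply isoc_W; auto.
  - apply has_inp in H. apply H.
  - apply has_out in H. apply H.
Qed.

Definition isom (t : cell2 X) : Prop :=
  exists q, isoc (Some t) q (inp t) (out t).

Lemma isom_equi t : isom t -> equi (inp t) (out t).
Proof. intros [q H]. exists (Some t), q. split; auto. apply has_Some. Qed.

Lemma equi_isom Γ Δ : equi Γ Δ -> exists t, inp t = Γ /\ out t = Δ /\ isom t.
Proof.
  intros (p & q & (t & -> & <- & <-) & H). exists t. split; [|split]; auto. exists q; auto.
Qed.

Lemma cut_iff t s r Δ1 a Δ2 Γ1 Γ2 i j : out t = Δ1 ++ a :: Δ2 -> inp s = Γ1 ++ a :: Γ2 ->
  (Γ1 = [] \/ Δ1 = []) -> (Γ2 = [] \/ Δ2 = []) ->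
  j = S (length Δ1) -> i = S (length Γ1) ->
  (is_cut X j i t s r <-> Some r = vc (W Γ1 (Some t) Γ2) (W Δ1 (Some s) Δ2)).
Proof.
  intros H1 H2 H3 H4 -> ->.
  assert (h : mergeable X t s Δ1 [a] Δ2 Γ1 Γ2) by (constructor; auto; discriminate).
  rewrite <- (mrg_vc K h). split.
  - intros H. f_equal. eapply is_cut_fun; [exact H|]. exists Δ1, a, Δ2, Γ1, Γ2, h; auto.
  - intros [= ->]. exists Δ1, a, Δ2, Γ1, Γ2, h; auto.
Qed.

(** Factoring the unit of the input through [t] yields an inverse. *)
Lemma universal_isom t c : out t = [c] -> universal_out X t 1 -> isom t.
Proof.
  intros Hc (Δ1 & a & Δ2 & H1 & H2 & H3).
  destruct Δ1; [|discriminate]. rewrite Hc in H1. injection H1 as <- <-. clear H2.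
  assert (C : forall r s, inp r = [c] ->
    is_cut X 1 1 t r s <-> Some s = vc (Some t) (Some r)).
  { intros r s Hr. rewrite (@cut_iff t r s [] c [] [] []) by auto.
    now rewrite !W_nil. }
  destruct (has_idc (composable_inp t)) as (e & E & E1 & E2).
  destruct (H3 [] [] (inp t) e) as (r & (R1 & R2 & R3) & _); auto.
  { apply inp_nonempty. } { now rewrite app_nil_r. } { now rewrite app_nil_r. }
  simpl in R1. apply C in R3; auto.
  exists (Some r). split; [apply typ_Some|]. split; [rewrite Hc, <- R1, <- R2; apply typ_Some|].
  rewrite <- R3. split; auto.
  destruct (has_idc (composable_out t)) as (e' & E' & E1' & E2').
  assert (V : has (vc (Some r) (Some t)) (out t) (out t)).
  { apply has_vc with (Δ := inp t); [rewrite Hc, <- R1, <- R2; apply has_Some | apply has_Some]. }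
  destruct V as (v & V & V1 & V2).
  destruct (H3 [] [] [c] t) as (z & _ & Hz); auto; try discriminate.
  { simpl. now rewrite app_nil_r. }
  rewrite V, E'. f_equal. transitivity z; [symmetry|]; apply Hz; simpl.
  - rewrite V1, V2, C by congruence. split; auto. split; auto.
    rewrite <- V, <- vc_assoc, <- R3, <- E. symmetry. apply (vc_idl K (typ_Some t)).
  - rewrite E1', E2', C by congruence. split; auto. split; auto.
    rewrite <- E'. symmetry. apply (vc_idr K (typ_Some t)).
Qed.

Lemma isom_universal t c : out t = [c] -> isom t -> universal_out X t 1.
Proof.
  intros Hc [q Hq]. exists [], c, []. split; auto. split; auto.
  intros Γ1 Γ2 Δ s N _ _ Hi Ho. simpl in Ho. rewrite app_nil_r in Ho.
  assert (Is := isoc_W Γ1 Γ2 (inp_nonempty X t) (out_nonempty X t) Hq).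
  assert (Ht : has (Some s) (Γ1 ++ inp t ++ Γ2) Δ) by (rewrite <- Hi, <- Ho; apply has_Some).
  assert (Hr : has (vc (W Γ1 q Γ2) (Some s)) (Γ1 ++ c :: Γ2) Δ).
  { eapply has_vc; [|exact Ht]. change (c :: Γ2) with ([c] ++ Γ2). rewrite <- Hc.
    eapply has_inverse; [|exact Is]. apply has_W; [apply has_Some|].
    now apply has_inp in Ht. }
  destruct Hr as (r & Er & R1 & R2). exists r. split.
  - split; auto. split; auto. rewrite (@cut_iff t r s [] c [] Γ1 Γ2) by auto.
    rewrite (W_nil K), <- Er. symmetry. eapply isoc_cancel_l; [exact Is|].
    exact (has_typ Ht).
  - intros r' (R1' & R2' & R3'). rewrite (@cut_iff t r' s [] c [] Γ1 Γ2) in R3' by auto.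
    rewrite (W_nil K) in R3'. assert (E : Some r = Some r'); [|congruence].
    rewrite <- Er, R3'. eapply isoc_cancel_l; [apply isoc_sym; exact Is|].
    rewrite Hc. simpl. rewrite <- R1'. apply typ_Some.
Qed.

(** Whiskering between [A] and [B] is fully faithful. *)
Definition ff (A B : list (cell1 X)) : Prop :=
  (forall q Δ Δ', Δ <> [] -> Δ' <> [] -> has q (A ++ Δ ++ B) (A ++ Δ' ++ B) ->
     exists r, has r Δ Δ' /\ W A r B = q) /\
  (forall r r' Δ Δ', has r Δ Δ' -> has r' Δ Δ' -> composable X (A ++ Δ ++ B) ->
     W A r B = W A r' B -> r = r').

Lemma ff_isom A B r Δ Δ' : ff A B -> has r Δ Δ' -> composable X (A ++ Δ ++ B) ->
  (exists q, isoc (W A r B) q (A ++ Δ ++ B) (A ++ Δ' ++ B)) -> exists r', isoc r r' Δ Δ'.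
Proof.
  intros [F1 F2] H C [q I].
  assert (N : Δ <> []) by (apply has_inp in H; apply H).
  assert (N' : Δ' <> []) by (apply has_out in H; apply H).
  assert (C' : composable X (A ++ Δ' ++ B)) by (apply (has_composable A B H); auto).
  destruct (F1 q Δ' Δ) as (r' & H' & E); auto.
  { eapply has_inverse; [|exact I]. apply has_W; auto. }
  subst q. exists r'. destruct I as (I1 & I2 & I3 & I4).
  split; [exact (has_typ H)|]. split; [exact (has_typ H')|].
  pose proof (has_inp H) as Ci. pose proof (has_out H) as Co. split.
  - apply (F2 _ _ Δ Δ); auto using has_idc.
    { eapply has_vc; eauto. } { rewrite W_vc, I3, W_idc; auto. }
  - apply (F2 _ _ Δ' Δ'); auto using has_idc.
    { eapply has_vc; eauto. } { rewrite W_vc, I4, W_idc; auto. }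
Qed.

(** Functors that are naturally isomorphic, by [φ], are fully faithful together. *)
Lemma ff_natural A B A' B' (φ ψ : list (cell1 X) -> option (cell2 X)) :
  (forall Δ, Δ <> [] -> composable X (A' ++ Δ ++ B') -> composable X (A ++ Δ ++ B)) ->
  (forall Δ, Δ <> [] -> composable X (A ++ Δ ++ B) ->
     has (φ Δ) (A ++ Δ ++ B) (A' ++ Δ ++ B') /\
     isoc (φ Δ) (ψ Δ) (A ++ Δ ++ B) (A' ++ Δ ++ B')) ->
  (forall r Δ Δ', has r Δ Δ' -> composable X (A ++ Δ ++ B) ->
     vc (W A r B) (φ Δ') = vc (φ Δ) (W A' r B')) ->
  ff A B -> ff A' B'.
Proof.
  intros HC Hφ Nat [F1 F2].
  assert (HC' : forall Δ, Δ <> [] -> composable X (A ++ Δ ++ B) -> composable X (A' ++ Δ ++ B')).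
  { intros Δ N C. destruct (Hφ Δ N C) as [H _]. now apply has_out in H. }
  assert (E : forall r Δ Δ', has r Δ Δ' -> composable X (A ++ Δ ++ B) ->
     W A' r B' = vc (ψ Δ) (vc (W A r B) (φ Δ'))).
  { intros r Δ Δ' H C. rewrite (Nat _ _ _ H C).
    assert (N : Δ <> []) by (apply has_inp in H; apply H).
    destruct (Hφ Δ N C) as [_ I]. symmetry. eapply isoc_cancel_l; [apply isoc_sym; eauto|].
    apply typ_W. exact (has_typ H). }
  split.
  - intros q Δ Δ' N N' H.
    assert (C : composable X (A ++ Δ ++ B)) by (apply HC; auto; now apply has_inp in H).
    assert (C' : composable X (A ++ Δ' ++ B)) by (apply HC; auto; now apply has_out in H).
    destruct (Hφ _ N C) as [P1 I1]. destruct (Hφ _ N' C') as [P2 I2].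
    destruct (F1 (vc (φ Δ) (vc q (ψ Δ'))) Δ Δ') as (r & Hr & Er); auto.
    { eapply has_vc; eauto. eapply has_vc; eauto. eapply has_inverse; eauto. }
    exists r. split; auto. rewrite (E _ _ _ Hr C), Er, !vc_assoc.
    pose proof (isoc_sym I2) as (_ & _ & Z & _). rewrite Z.
    rewrite (vc_idr K (has_typ H)).
    eapply isoc_cancel_l; [apply isoc_sym; eauto|]. apply has_typ; eauto.
  - intros r r' Δ Δ' H H' C0 Eq.
    assert (N : Δ <> []) by (apply has_inp in H; apply H).
    assert (N' : Δ' <> []) by (apply has_out in H; apply H).
    assert (C : composable X (A ++ Δ ++ B)) by (apply HC; auto).
    assert (C' : composable X (A ++ Δ' ++ B)) by (apply (has_composable A B H); auto).
    apply (F2 _ _ Δ Δ'); auto.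
    destruct (Hφ _ N' C') as [P2 I2].
    rewrite <- (isoc_cancel_r I2 (typ_W K A B (has_typ H))).
    rewrite <- (isoc_cancel_r I2 (typ_W K A B (has_typ H'))).
    rewrite !(Nat _ _ _ H C), !(Nat _ _ _ H' C), Eq. auto.
Qed.

Lemma ff_equi_l A A' B : equi A A' -> ff A B -> ff A' B.
Proof.
  intros (p & q & H & I). pose proof (has_inp H) as [N _]. pose proof (has_out H) as [N' _].
  apply (@ff_natural A B A' B (fun Δ => W [] p (Δ ++ B)) (fun Δ => W [] q (Δ ++ B))).
  - intros Δ _ C. apply (has_composable [] (Δ ++ B) H). auto.
  - intros Δ _ C. split.
    + apply (@has_W [] p (Δ ++ B) A A'); auto.
    + apply (@isoc_W [] (Δ ++ B) p q A A'); auto.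
  - intros r Δ Δ' Hr C. symmetry.
    pose proof (exch K [] [] B (has_typ H) (has_typ Hr)) as Z.
    simpl in Z. rewrite !app_nil_r in Z. exact Z.
Qed.

Lemma ff_equi_r A B B' : equi B B' -> ff A B -> ff A B'.
Proof.
  intros (p & q & H & I). pose proof (has_inp H) as [N _]. pose proof (has_out H) as [N' _].
  assert (E : forall Δ Γ, A ++ Δ ++ Γ = (A ++ Δ) ++ Γ ++ [])
    by (intros; now rewrite app_nil_r, app_assoc).
  apply (@ff_natural A B A B' (fun Δ => W (A ++ Δ) p []) (fun Δ => W (A ++ Δ) q [])).
  - intros Δ _. rewrite !E. apply (has_composable _ _ H).
  - intros Δ _. rewrite !E. intros C. split.
    + now apply has_W.
    + now apply isoc_W.
  - intros r Δ Δ' Hr _. pose proof (exch K A [] [] (has_typ Hr) (has_typ H)) as Z.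
    simpl in Z. rewrite !app_nil_r in Z. exact Z.
Qed.

(** The two-out-of-six argument, for the functors that whisker a cell with a context. *)
Lemma ff_factor A B A' B' :
  (forall Δ, Δ <> [] -> composable X (A ++ Δ ++ B) -> composable X (A' ++ (A ++ Δ ++ B) ++ B')) ->
  (forall Δ, Δ <> [] -> composable X (A' ++ Δ ++ B') -> composable X (A ++ (A' ++ Δ ++ B') ++ B)) ->
  ff (A ++ A') (B' ++ B) -> ff (A' ++ A) (B ++ B') -> ff A B.
Proof.
  intros HC HC' [F1 F2] [G1 G2].
  assert (E : forall C D C' D' Δ : list (cell1 X), (C ++ C') ++ Δ ++ D' ++ D = C ++ (C' ++ Δ ++ D') ++ D)
    by (intros; now rewrite <- !app_assoc).
  split.
  - intros q Δ Δ' N N' H.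
    destruct (G1 (W A' q B') Δ Δ') as (r & Hr & Er); auto.
    { rewrite !E. apply has_W; auto. apply HC; auto. now apply has_inp in H. }
    exists r. split; auto. rewrite <- W_W in Er.
    pose proof (has_inp H) as C. pose proof (HC _ N C) as C1.
    assert (NN : forall D : list (cell1 X), D <> [] -> A ++ D ++ B <> []).
    { intros D ND Z. apply app_eq_nil in Z as [_ Z]. now apply app_eq_nil in Z as [Z _]. }
    apply (F2 _ _ (A ++ Δ ++ B) (A ++ Δ' ++ B)); auto.
    + now apply has_W.
    + rewrite E. apply HC'; auto.
    + rewrite <- !W_W. now rewrite Er.
  - intros r r' Δ Δ' H H' C Eq. apply (G2 _ _ Δ Δ'); auto.
    + rewrite E. apply HC; auto. apply has_inp in H; apply H.
    + rewrite <- !W_W. now rewrite Eq.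
Qed.

End Universal.

(** * Units and equivalences *)

Section Duality.
Variable X : merge_data.
Variable K : calculus X.

Lemma co_vc p q : vc (co_calculus K) p q = vc K q p.
Proof.
  destruct p as [p|], q as [q|]; try reflexivity. unfold vc; simpl.
  repeat destruct excluded_middle_informative; try reflexivity; simpl in *; congruence.
Qed.

Lemma co_W A p B : W (co_calculus K) A p B = W K A p B.
Proof.
  destruct p as [p|]; try reflexivity. unfold W; simpl.
  pose proof (composable_parallel (X := X) A p B) as E.
  repeat destruct excluded_middle_informative; try reflexivity;
    unfold composable in *; simpl in *; tauto.
Qed.

Lemma co_idc Γ : idc (co_calculus K) Γ = idc K Γ.
Proof.
  destruct (idc K Γ) as [e|] eqn:E.
  - exact (idc_Some (co_calculus K) (proj1 (co_neutral K Γ e) (pickP _ E))).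
  - destruct (idc (co_calculus K) Γ) as [e|] eqn:E'; auto.
    pose proof (idc_Some K (proj2 (co_neutral K Γ e) (pickP _ E'))). congruence.
Qed.

Lemma co_has p Γ Δ : has (co X) p Γ Δ <-> has X p Δ Γ.
Proof.
  split; intros (p' & H1 & H2 & H3); exists p'; auto.
Qed.

Lemma co_typ (p : option (cell2 X)) Γ Δ : typ (X := co X) p Γ Δ <-> typ (X := X) p Δ Γ.
Proof.
  split; intros H p' E; destruct (H p' E); auto.
Qed.

Lemma co_isoc p q Γ Δ : isoc (co_calculus K) p q Γ Δ <-> isoc K p q Δ Γ.
Proof.
  unfold isoc. rewrite !co_vc, !co_idc, !co_typ. tauto.
Qed.

Lemma co_isom t : isom (co_calculus K) t <-> isom K t.
Proof.
  split; intros [q H]; exists q; now apply co_isoc.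
Qed.

Lemma co_equi Γ Δ : equi (co_calculus K) Γ Δ <-> equi K Γ Δ.
Proof.
  split; intros (p & q & H & I); exists q, p.
  - apply co_has in H. apply co_isoc in I. split; [|now apply isoc_sym].
    eapply has_inverse; eauto.
  - split; [|now apply co_isoc, isoc_sym].
    apply co_has. eapply has_inverse; eauto.
Qed.

Lemma co_ff A B : ff (co_calculus K) A B <-> ff K A B.
Proof.
  split; intros [F1 F2]; split.
  - intros q Δ Δ' N N' H. destruct (F1 q Δ' Δ) as (r & Hr & E); auto; [now apply co_has|].
    exists r. rewrite co_W in E. split; auto. now apply co_has.
  - intros r r' Δ Δ' H H' C E. apply (F2 r r' Δ' Δ); [now apply co_has.. | |].
    + apply (has_composable (X := X) A B H) in C. exact C.
    + now rewrite !co_W.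
  - intros q Δ Δ' N N' H. destruct (F1 q Δ' Δ) as (r & Hr & E); auto; [now apply co_has|].
    exists r. rewrite co_W. split; auto. now apply co_has.
  - intros r r' Δ Δ' H H' C E. rewrite !co_W in E.
    apply co_has in H, H'. apply (F2 r r' Δ' Δ); auto.
    apply (has_composable (X := X) A B H). exact C.
Qed.

End Duality.

Section Units.
Variable X : merge_data.
Variable K : calculus X.
Notation vc := (vc K).
Notation W := (W K).
Notation idc := (idc K).
Notation has := (has X).

Lemma universal_in_2 t e a b : inp t = [e; a] -> out t = [b] ->
  (universal_in X t 2 <-> forall Γ2 Δ s, Δ <> [] -> inp s = e :: Δ -> out s = b :: Γ2 ->
     exists! r, out r = a :: Γ2 /\ inp r = Δ /\
       Some s = vc (W [e] (Some r) []) (W [] (Some t) Γ2)).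
Proof.
  intros Hi Ho.
  assert (C : forall r s Γ2, out r = a :: Γ2 ->
    is_cut (co X) 2 1 t r s <-> Some s = vc (W [e] (Some r) []) (W [] (Some t) Γ2)).
  { intros r s Γ2 Hr.
    pose proof (@cut_iff (co X) (co_calculus K) t r s [e] a [] [] Γ2 1 2) as Z.
    rewrite co_vc, !co_W in Z. apply Z; auto. }
  split.
  - intros (Δ1 & a' & Δ2 & H1 & H2 & H3) Γ2 Δ s N Hs Hs'. simpl in H1.
    destruct Δ1 as [|e' [|? ?]]; try discriminate. rewrite Hi in H1.
    injection H1 as <- <- <-. clear H2.
    destruct (H3 [] Γ2 Δ s) as (r & (R1 & R2 & R3) & R4); simpl; auto.
    { rewrite Ho. auto. } { rewrite app_nil_r. auto. }
    exists r. simpl in *. split.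
    + split; [|split]; auto. now apply (C _ _ _ R1).
    + intros r' (R1' & R2' & R3'). apply R4. split; [|split]; auto. now apply (C r' s Γ2).
  - intros H. exists [e], a, []. simpl. split; [|split]; auto.
    intros Γ1 Γ2 Δ s N [->|?] _ Hs Hs'; [|discriminate]. simpl in *.
    rewrite app_nil_r in Hs'. rewrite Ho in Hs.
    destruct (H Γ2 Δ s) as (r & (R1 & R2 & R3) & R4); auto.
    exists r. split.
    + split; [|split]; auto. now apply (C r s Γ2).
    + intros r' (R1' & R2' & R3'). apply R4. split; [|split]; auto. now apply (C r' s Γ2) in R3'.
Qed.

Lemma universal_in_1 t e a b : inp t = [a; e] -> out t = [b] ->
  (universal_in X t 1 <-> forall Γ1 Δ s, Δ <> [] -> inp s = Δ ++ [e] -> out s = Γ1 ++ [b] ->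
     exists! r, out r = Γ1 ++ [a] /\ inp r = Δ /\
       Some s = vc (W [] (Some r) [e]) (W Γ1 (Some t) [])).
Proof.
  intros Hi Ho.
  assert (C : forall r s Γ1, out r = Γ1 ++ [a] ->
    is_cut (co X) 1 (S (length Γ1)) t r s <-> Some s = vc (W [] (Some r) [e]) (W Γ1 (Some t) [])).
  { intros r s Γ1 Hr.
    pose proof (@cut_iff (co X) (co_calculus K) t r s [] a [e] Γ1 [] (S (length Γ1)) 1) as Z.
    rewrite co_vc, !co_W in Z. apply Z; auto. }
  split.
  - intros (Δ1 & a' & Δ2 & H1 & H2 & H3) Γ1 Δ s N Hs Hs'. simpl in H1.
    destruct Δ1 as [|e' [|? ?]]; try discriminate. rewrite Hi in H1.
    injection H1 as <- <-. clear H2.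
    destruct (H3 Γ1 [] Δ s) as (r & (R1 & R2 & R3) & R4); simpl; auto.
    { rewrite Ho. auto. }
    exists r. simpl in *. split.
    + split; [|split]; auto. now apply (C _ _ _ R1).
    + intros r' (R1' & R2' & R3'). apply R4. split; [|split]; auto. now apply (C r' s Γ1).
  - intros H. exists [], a, [e]. simpl. split; [|split]; auto.
    intros Γ1 Γ2 Δ s N _ [->|?] Hs Hs'; [|discriminate]. simpl in *.
    rewrite app_nil_r, Ho in Hs.
    destruct (H Γ1 Δ s) as (r & (R1 & R2 & R3) & R4); auto.
    exists r. split.
    + split; [|split]; auto. now apply (C r s Γ1).
    + intros r' (R1' & R2' & R3'). apply R4. split; [|split]; auto. now apply (C r' s Γ1) in R3'.
Qed.

(** For an invertible cell [t : (e, a) -> (b)], the cells to be factored through [t] at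
    its second input are the cells [(e, Δ) -> (e, a, Γ)], up to composition with [t];
    universality at that input says that they come from unique cells
    [(Δ) -> (a, Γ)] by whiskering with [e]. *)
Lemma left_witness_of_ff t e a b : inp t = [e; a] -> out t = [b] -> isom K t ->
  ff K [e] [] -> left_witness X e a b t.
Proof.
  intros Hi Ho It [F1 F2]. split; [|split; [|split]]; auto.
  { eapply isom_universal; eauto. }
  apply (universal_in_2 _ Hi Ho). intros Γ2 Δ s N Hs Hs'.
  destruct It as [q Iq].
  assert (Hq : has (Some s) (e :: Δ) (b :: Γ2)) by (rewrite <- Hs, <- Hs'; apply has_Some).
  assert (Is := isoc_W [] Γ2 (inp_nonempty X t) (out_nonempty X t) Iq).
  assert (Ht : has (W [] (Some t) Γ2) (e :: a :: Γ2) (b :: Γ2)).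
  { pose proof (@has_W X K [] (Some t) Γ2 (inp t) (out t)) as Z.
    rewrite Hi, Ho in Z. simpl in Z. apply Z.
    - rewrite <- Hi, <- Ho. apply has_Some.
    - apply has_out in Hq.
      pose proof (composable_parallel [] t Γ2) as Y. rewrite Hi, Ho in Y. now apply Y. }
  rewrite Hi, Ho in Is. simpl in Is.
  destruct (F1 (vc (Some s) (W [] q Γ2)) Δ (a :: Γ2)) as (r & (r' & -> & R1 & R2) & E); auto.
  { discriminate. }
  { simpl. rewrite !app_nil_r.
    eapply has_vc; [exact Hq|]. eapply has_inverse; eauto. }
  exists r'. split.
  - split; [|split]; auto. rewrite E. symmetry.
    eapply isoc_cancel_r; [apply isoc_sym; exact Is | exact (has_typ Hq)].
  - intros r (R1' & R2' & R3').
    assert (Z : Some r' = Some r); [|congruence].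
    assert (Hr : has (Some r) Δ (a :: Γ2)) by (rewrite <- R1', <- R2'; apply has_Some).
    assert (Hr' : has (Some r') Δ (a :: Γ2)) by (rewrite <- R1, <- R2; apply has_Some).
    apply (F2 _ _ Δ (a :: Γ2)); auto.
    { simpl. rewrite app_nil_r. now apply has_inp in Hq. }
    rewrite E, R3'. eapply isoc_cancel_r; [exact Is|].
    pose proof (typ_W K [e] [] (has_typ Hr)) as T. simpl in T. rewrite !app_nil_r in T.
    exact T.
Qed.

Lemma right_witness_of_ff t e a b : inp t = [a; e] -> out t = [b] -> isom K t ->
  ff K [] [e] -> right_witness X e a b t.
Proof.
  intros Hi Ho It [F1 F2]. split; [|split; [|split]]; auto.
  { eapply isom_universal; eauto. }
  apply (universal_in_1 _ Hi Ho). intros Γ1 Δ s N Hs Hs'.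
  destruct It as [q Iq].
  assert (Hq : has (Some s) ([] ++ Δ ++ [e]) (Γ1 ++ [b])).
  { simpl. rewrite <- Hs, <- Hs'. apply has_Some. }
  assert (Is := isoc_W Γ1 [] (inp_nonempty X t) (out_nonempty X t) Iq).
  assert (Ht : has (W Γ1 (Some t) []) (Γ1 ++ [a; e]) (Γ1 ++ [b])).
  { pose proof (@has_W X K Γ1 (Some t) [] (inp t) (out t)) as Z.
    rewrite Hi, Ho in Z. simpl in Z. apply Z.
    - rewrite <- Hi, <- Ho. apply has_Some.
    - apply has_out in Hq.
      pose proof (composable_parallel Γ1 t []) as Y. rewrite Hi, Ho in Y. now apply Y. }
  rewrite Hi, Ho in Is. simpl in Is.
  destruct (F1 (vc (Some s) (W Γ1 q [])) Δ (Γ1 ++ [a])) as (r & (r' & -> & R1 & R2) & E); auto.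
  { now destruct Γ1. }
  { simpl. rewrite <- app_assoc. eapply has_vc; [exact Hq|]. eapply has_inverse; eauto. }
  exists r'. split.
  - split; [|split]; auto. rewrite E. symmetry.
    eapply isoc_cancel_r; [apply isoc_sym; exact Is | exact (has_typ Hq)].
  - intros r (R1' & R2' & R3').
    assert (Z : Some r' = Some r); [|congruence].
    assert (Hr : has (Some r) Δ (Γ1 ++ [a])) by (rewrite <- R1', <- R2'; apply has_Some).
    assert (Hr' : has (Some r') Δ (Γ1 ++ [a])) by (rewrite <- R1, <- R2; apply has_Some).
    apply (F2 _ _ Δ (Γ1 ++ [a])); auto; [now apply has_inp in Hq|].
    rewrite E, R3'. eapply isoc_cancel_r; [exact Is|].
    pose proof (typ_W K [] [e] (has_typ Hr)) as T. rewrite <- app_assoc in T. exact T.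
Qed.

Lemma left_witness_equi t e a b : left_witness X e a b t -> equi K [e; a] [b].
Proof.
  intros (H1 & H2 & H3 & _). rewrite <- H1, <- H2. apply isom_equi.
  eapply universal_isom; eauto.
Qed.

Lemma right_witness_equi t e a b : right_witness X e a b t -> equi K [a; e] [b].
Proof.
  intros (H1 & H2 & H3 & _). rewrite <- H1, <- H2. apply isom_equi.
  eapply universal_isom; eauto.
Qed.

Lemma ff_of_left_witness e :
  (forall a, src a = tgt e -> exists v t, left_witness X e a v t) -> ff K [e] [].
Proof.
  intros HW.
  assert (Wit : forall a Γ, composable X (e :: a :: Γ) -> exists b t q,
    inp t = [e; a] /\ out t = [b] /\ has (W [] (Some t) Γ) (e :: a :: Γ) (b :: Γ) /\
    isoc K (W [] (Some t) Γ) q (e :: a :: Γ) (b :: Γ) /\ universal_in X t 2).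
  { intros a Γ C. pose proof C as C'. apply composable_cons in C' as [E _].
    destruct (HW a) as (b & t & T1 & T2 & T3 & T4); auto.
    destruct (universal_isom K T2 T3) as [q Iq]. exists b, t, (W [] q Γ).
    split; [|split; [|split; [|split]]]; auto.
    - pose proof (@has_W X K [] (Some t) Γ (inp t) (out t)) as Z.
      rewrite T1, T2 in Z. simpl in Z. apply Z; auto. rewrite <- T1, <- T2. apply has_Some.
    - pose proof (isoc_W [] Γ (inp_nonempty X t) (out_nonempty X t) Iq) as Z.
      now rewrite T1, T2 in Z. }
  split.
  - intros q Δ Δ' N N' H. simpl in H. rewrite !app_nil_r in H.
    destruct Δ' as [|a Γ]; [easy|].
    destruct (Wit a Γ) as (b & t & i & T1 & T2 & T3 & T4 & T5); [now apply has_out in H|].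
    destruct (has_vc K H T3) as (s & Es & S1 & S2).
    destruct (proj1 (universal_in_2 _ T1 T2) T5 Γ Δ s) as (r & (R1 & R2 & R3) & _); auto.
    exists (Some r). assert (Hr : has (Some r) Δ (a :: Γ)) by (rewrite <- R1, <- R2; apply has_Some).
    split; auto.
    pose proof (typ_W K [e] [] (has_typ Hr)) as T. simpl in T. rewrite !app_nil_r in T.
    rewrite <- (isoc_cancel_r T4 T), <- R3, <- Es.
    apply (isoc_cancel_r T4 (has_typ H)).
  - intros r r' Δ Δ' H H' C E. simpl in C. rewrite app_nil_r in C.
    destruct Δ' as [|a Γ]; [now apply has_out in H as [? _]|].
    pose proof (has_W K [e] [] H) as HWr. simpl in HWr. rewrite !app_nil_r in HWr.
    specialize (HWr C).
    destruct (Wit a Γ) as (b & t & i & T1 & T2 & T3 & T4 & T5); [now apply has_out in HWr|].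
    destruct (has_vc K HWr T3) as (s & Es & S1 & S2).
    assert (N : Δ <> []) by (apply has_inp in H; apply H).
    destruct (proj1 (universal_in_2 _ T1 T2) T5 Γ Δ s) as (z & _ & Z); auto.
    destruct H as (r0 & -> & R1 & R2), H' as (r0' & -> & R1' & R2').
    f_equal. transitivity z; [symmetry|]; apply Z; split; auto; split; auto.
    now rewrite <- E.
Qed.

Lemma ff_of_right_witness e :
  (forall a, tgt a = src e -> exists v t, right_witness X e a v t) -> ff K [] [e].
Proof.
  intros HW.
  assert (Wit : forall a Γ, composable X (Γ ++ [a; e]) -> exists b t q,
    inp t = [a; e] /\ out t = [b] /\ has (W Γ (Some t) []) (Γ ++ [a; e]) (Γ ++ [b]) /\
    isoc K (W Γ (Some t) []) q (Γ ++ [a; e]) (Γ ++ [b]) /\ universal_in X t 1).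
  { intros a Γ C. pose proof (composable_mid Γ (Γ := [a; e]) []) as C'. simpl in C'.
    apply C' in C as E; [|discriminate]. apply composable_two in E.
    destruct (HW a) as (b & t & T1 & T2 & T3 & T4); auto.
    destruct (universal_isom K T2 T3) as [q Iq]. exists b, t, (W Γ q []).
    split; [|split; [|split; [|split]]]; auto.
    - pose proof (@has_W X K Γ (Some t) [] (inp t) (out t)) as Z.
      rewrite T1, T2 in Z. simpl in Z. apply Z; auto. rewrite <- T1, <- T2. apply has_Some.
    - pose proof (isoc_W Γ [] (inp_nonempty X t) (out_nonempty X t) Iq) as Z.
      now rewrite T1, T2 in Z. }
  split.
  - intros q Δ Δ' N N' H. simpl in H.
    destruct (exists_last N') as (Γ & a & ->). rewrite <- app_assoc in H. simpl in H.
    destruct (Wit a Γ) as (b & t & i & T1 & T2 & T3 & T4 & T5); [now apply has_out in H|].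
    destruct (has_vc K H T3) as (s & Es & S1 & S2).
    destruct (proj1 (universal_in_1 _ T1 T2) T5 Γ Δ s) as (r & (R1 & R2 & R3) & _); auto.
    exists (Some r).
    assert (Hr : has (Some r) Δ (Γ ++ [a])) by (rewrite <- R1, <- R2; apply has_Some).
    split; auto. pose proof (typ_W K [] [e] (has_typ Hr)) as T. rewrite <- app_assoc in T.
    rewrite <- (isoc_cancel_r T4 T), <- R3, <- Es.
    apply (isoc_cancel_r T4 (has_typ H)).
  - intros r r' Δ Δ' H H' C E. simpl in C.
    destruct (@exists_last _ Δ') as (Γ & a & ->); [apply has_out in H; apply H|].
    pose proof (has_W K [] [e] H C) as HWr. rewrite <- app_assoc in HWr. simpl in HWr.
    destruct (Wit a Γ) as (b & t & i & T1 & T2 & T3 & T4 & T5); [now apply has_out in HWr|].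
    destruct (has_vc K HWr T3) as (s & Es & S1 & S2).
    assert (N : Δ <> []) by (apply has_inp in H; apply H).
    destruct (proj1 (universal_in_1 _ T1 T2) T5 Γ Δ s) as (z & _ & Z); auto.
    destruct H as (r0 & -> & R1 & R2), H' as (r0' & -> & R1' & R2').
    f_equal. transitivity z; [symmetry|]; apply Z; split; auto; split; auto.
    now rewrite <- E.
Qed.

(** A unit in the sense of Saavedra and Kock: a cancellable idempotent.  Unlike the
    definition of tensor units, it does not change when 2-cells are reversed, which
    is why tensor units and par units agree. *)
Definition unitlike (i : cell1 X) : Prop :=
  src i = tgt i /\ ff K [i] [] /\ ff K [] [i] /\ equi K [i; i] [i].

Lemma tensor_unit_unitlike x i : is_tensor_unit X x i -> unitlike i /\ src i = x.
Proof.
  intros (H1 & H2 & H3 & H4). split; auto. split; [congruence|]. split; [|split].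
  - apply ff_of_left_witness. intros a Ha. destruct (H3 a) as [l Hl]; [congruence|]. eauto.
  - apply ff_of_right_witness. intros a Ha. destruct (H4 a) as [l Hl]; [congruence|]. eauto.
  - destruct (H3 i) as [l Hl]; auto. eapply left_witness_equi; eauto.
Qed.

(** Kock's construction: the left unitor at [a] is determined by the idempotence
    [m] through [W [i] l = W m [a]], because [i] is cancellable. *)
Lemma unit_left i m a : unitlike i -> inp m = [i; i] -> out m = [i] -> isom K m ->
  src a = tgt i ->
  exists l, inp l = [i; a] /\ out l = [a] /\ isom K l /\
    W [i] (Some l) [] = W [] (Some m) [a].
Proof.
  intros (E & F & _ & _) Hi Ho [q Iq] Ha.
  assert (C2 : composable X [i; a]) by now apply composable_two.
  assert (C3 : composable X [i; i; a]) by now apply composable_cons.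
  assert (Hm : has (W [] (Some m) [a]) [i; i; a] [i; a]).
  { apply (has_W K [] [a] (Γ := [i; i]) (Δ := [i])); auto.
    rewrite <- Hi, <- Ho. apply has_Some. }
  destruct (proj1 F (W [] (Some m) [a]) [i; a] [a]) as (r & Hr & Er); try discriminate; auto.
  destruct (ff_isom F Hr) as [r' Ir]; auto.
  { exists (W [] q [a]). rewrite Er.
    pose proof (isoc_W [] [a] (inp_nonempty X m) (out_nonempty X m) Iq) as Z.
    now rewrite Hi, Ho in Z. }
  destruct Hr as (l & -> & L1 & L2). exists l. split; [|split; [|split]]; auto.
  exists r'. now rewrite L1, L2.
Qed.

Arguments unit_left {i m} a _ _ _ _ _.

Lemma unit_right i m a : unitlike i -> inp m = [i; i] -> out m = [i] -> isom K m ->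
  tgt a = src i ->
  exists r, inp r = [a; i] /\ out r = [a] /\ isom K r /\
    W [] (Some r) [i] = W [a] (Some m) [].
Proof.
  intros (E & _ & F & _) Hi Ho [q Iq] Ha.
  assert (C3 : composable X [a; i; i]).
  { apply composable_cons. split; auto. now apply composable_two. }
  assert (Hm : has (W [a] (Some m) []) [a; i; i] [a; i]).
  { apply (has_W K [a] [] (Γ := [i; i]) (Δ := [i])); auto.
    rewrite <- Hi, <- Ho. apply has_Some. }
  destruct (proj1 F (W [a] (Some m) []) [a; i] [a]) as (r & Hr & Er); try discriminate; auto.
  destruct (ff_isom F Hr) as [r' Ir]; auto.
  { exists (W [a] q []). rewrite Er.
    pose proof (isoc_W [a] [] (inp_nonempty X m) (out_nonempty X m) Iq) as Z.
    now rewrite Hi, Ho in Z. }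
  destruct Hr as (l & -> & L1 & L2). exists l. split; [|split; [|split]]; auto.
  exists r'. now rewrite L1, L2.
Qed.

Arguments unit_right {i m} a _ _ _ _ _.

Lemma unitlike_tensor_unit i : unitlike i -> is_tensor_unit X (src i) i.
Proof.
  intros U. pose proof U as (E & F & F' & H).
  destruct (equi_isom H) as (m & M1 & M2 & M3).
  split; [|split; [|split]]; auto.
  - intros a Ha. destruct (unit_left a U M1 M2 M3) as (l & L1 & L2 & L3 & _); [congruence|].
    exists l. now apply left_witness_of_ff.
  - intros b Hb. destruct (unit_right b U M1 M2 M3) as (l & L1 & L2 & L3 & _); [congruence|].
    exists l. now apply right_witness_of_ff.
Qed.

Lemma equi_context A B Γ Δ : equi K Γ Δ ->
  composable X (A ++ Γ ++ B) <-> composable X (A ++ Δ ++ B).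
Proof. intros (p & q & H & _). apply (has_composable A B H). Qed.

Lemma equi_composable Γ Δ : equi K Γ Δ -> composable X Γ.
Proof. intros (p & q & H & _). now apply has_inp in H. Qed.

Lemma unitlike_equi i j : equi K [i] [j] -> unitlike i -> unitlike j.
Proof.
  intros H (E & F & F' & I).
  assert (C : composable X [i; i]) by now apply composable_two.
  assert (H2 : equi K [i; i] [j; j]).
  { eapply equi_trans; [apply (equi_W [] [i] H); auto|].
    apply (equi_W [j] [] H). now apply (equi_context [] [i] H). }
  split; [|split; [|split]].
  - destruct H2 as (p & q & H2 & _). apply has_out, composable_two in H2. auto.
  - exact (ff_equi_l H F).
  - exact (ff_equi_r H F').
  - exact (equi_trans (equi_sym H2) (equi_trans I H)).
Qed.

Lemma unitlike_unique i j : unitlike i -> unitlike j -> src i = src j -> equi K [i] [j].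
Proof.
  intros U V E. pose proof (unitlike_tensor_unit U) as (_ & _ & L & _).
  pose proof (unitlike_tensor_unit V) as (_ & _ & _ & R).
  destruct (L j) as [l Hl]; auto. destruct (R i) as [r Hr]; [destruct U; congruence|].
  eapply equi_trans; [apply equi_sym; eapply right_witness_equi; eauto|].
  eapply left_witness_equi; eauto.
Qed.

(** A 1-cell that is invertible up to invertible 2-cells. *)
Definition eqv (e : cell1 X) : Prop :=
  exists u i j, unitlike i /\ unitlike j /\ src i = src e /\ src j = tgt e /\
    equi K [e; u] [i] /\ equi K [u; e] [j].

Lemma eqv_ff e : eqv e -> ff K [e] [] /\ ff K [] [e].
Proof.
  intros (u & i & j & Ui & Uj & _ & _ & Ei & Ej).
  pose proof (equi_composable Ei) as Ci. pose proof (equi_composable Ej) as Cj.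
  split.
  - apply (@ff_factor X K [e] [] [u] []); simpl.
    + intros Δ N C. rewrite ?app_nil_r in *. now apply (composable_glue [u] (B := [e]) Δ).
    + intros Δ N C. rewrite ?app_nil_r in *. now apply (composable_glue [e] (B := [u]) Δ).
    + eapply ff_equi_l; [apply equi_sym; exact Ei | apply Ui].
    + eapply ff_equi_l; [apply equi_sym; exact Ej | apply Uj].
  - apply (@ff_factor X K [] [e] [] [u]); simpl.
    + intros Δ N C. rewrite <- app_assoc. now apply (composable_glue Δ (B := [e]) [u]).
    + intros Δ N C. rewrite <- app_assoc. now apply (composable_glue Δ (B := [u]) [e]).
    + eapply ff_equi_r; [apply equi_sym; exact Ej | apply Uj].
    + eapply ff_equi_r; [apply equi_sym; exact Ei | apply Ui].
Qed.

(** Representability in terms of invertible cells.  The statement is self-dual: an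
    invertible cell is a tensor, and its inverse is a par. *)
Definition rich : Prop :=
  (forall x, exists i, unitlike i /\ src i = x) /\
  (forall a b, tgt a = src b -> exists c, equi K [a; b] [c]).

(** Dividing the units at both ends by a tensor universal 1-cell gives a right and a
    left inverse, which agree up to an invertible cell.  Since [eqv] does not refer to
    the direction of 2-cells, it also describes the par universal 1-cells. *)
Lemma tensor_universal_eqv e : rich -> tensor_universal X e <-> eqv e.
Proof.
  intros [R1 R2]. split.
  - intros (T1 & T2 & T3 & T4).
    destruct (R1 (src e)) as (i & Ui & Ei). destruct (R1 (tgt e)) as (j & Uj & Ej).
    destruct (T1 i) as (u & t & Ht); auto.
    destruct (T3 j) as (u' & t' & Ht'); [destruct Uj; congruence|].
    apply left_witness_equi in Ht. apply right_witness_equi in Ht'.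
    exists u, i, j. split; [|split; [|split; [|split; [|split]]]]; auto.
    eapply equi_trans; [|exact Ht'].
    pose proof (equi_composable Ht) as C. pose proof (equi_composable Ht') as C'.
    assert (E : equi K [u'] [u]).
    { pose proof (unitlike_tensor_unit Ui) as (_ & _ & _ & R).
      pose proof (unitlike_tensor_unit Uj) as (_ & _ & L & _).
      destruct (R u') as [r Hr]. { apply composable_two in C'. congruence. }
      destruct (L u) as [l Hl]. { apply composable_two in C. congruence. }
      eapply equi_trans; [apply equi_sym; eapply right_witness_equi; eauto|].
      assert (C3 : composable X [u'; e; u]) by now apply (composable_glue [u'] (B := [e]) [u]).
      eapply equi_trans; [apply (equi_W [u'] [] (equi_sym Ht))|].
      { apply right_witness_equi in Hr. apply (equi_composable Hr). }
      eapply equi_trans; [apply (equi_W [] [u] Ht'); exact C3|].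
      eapply left_witness_equi; eauto. }
    apply (equi_W [] [e] (equi_sym E)).
    now apply (equi_context [] [e] E).
  - intros Q. destruct (eqv_ff Q) as [Fl Fr].
    destruct Q as (u & i & j & Ui & Uj & Si & Sj & Ei & Ej).
    pose proof (equi_composable Ei) as C. pose proof (equi_composable Ej) as C'.
    pose proof (unitlike_tensor_unit Ui) as (_ & Ti & L & _).
    pose proof (unitlike_tensor_unit Uj) as (_ & Tj & _ & R).
    assert (Eu : src u = tgt e) by (apply composable_two in C; auto).
    assert (Eu' : tgt u = src e) by (apply composable_two in C'; auto).
    split; [|split; [|split]].
    + intros a Ha. destruct (R2 u a) as [w Hw]; [congruence|].
      destruct (L a) as [l Hl]; [congruence|]. apply left_witness_equi in Hl.
      assert (C3 : composable X [e; u; a]).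
      { apply (composable_glue [e] (B := [u]) [a]); auto; [discriminate|].
        apply (equi_composable Hw). }
      assert (Q : equi K [e; w] [a]).
      { eapply equi_trans; [apply equi_sym, (equi_W [e] [] Hw); auto|].
        eapply equi_trans; [apply (equi_W [] [a] Ei); auto | exact Hl]. }
      destruct (equi_isom Q) as (t & H1 & H2 & H3).
      exists w, t. now apply left_witness_of_ff.
    + intros a Ha. destruct (R2 e a) as [w Hw]; auto.
      destruct (equi_isom Hw) as (t & H1 & H2 & H3).
      exists w, t. now apply left_witness_of_ff.
    + intros a Ha. destruct (R2 a u) as [w Hw]; [congruence|].
      destruct (R a) as [l Hl]; [congruence|]. apply right_witness_equi in Hl.
      assert (C3 : composable X [a; u; e]).
      { apply (composable_glue [a] (B := [u]) [e]); auto; [discriminate|].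
        apply (equi_composable Hw). }
      assert (Q : equi K [w; e] [a]).
      { eapply equi_trans; [apply equi_sym, (equi_W [] [e] Hw); auto|].
        eapply equi_trans; [apply (equi_W [a] [] Ej); auto | exact Hl]. }
      destruct (equi_isom Q) as (t & H1 & H2 & H3).
      exists w, t. now apply right_witness_of_ff.
    + intros a Ha. destruct (R2 a e) as [w Hw]; auto.
      destruct (equi_isom Hw) as (t & H1 & H2 & H3).
      exists w, t. now apply right_witness_of_ff.
Qed.

Lemma tensor_iff a b c t : is_tensor X a b c t <-> inp t = [a; b] /\ out t = [c] /\ isom K t.
Proof.
  split; intros (H1 & H2 & H3); split; auto; split; auto.
  - eapply universal_isom; eauto.
  - eapply isom_universal; eauto.
Qed.

Lemma representable_rich : representable X -> rich.
Proof.
  intros R. split.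
  - intros x. destruct (rep_tensor_unit R x) as [i Hi].
    exists i. eapply tensor_unit_unitlike; eauto.
  - intros a b E. destruct (rep_tensor R _ _ E) as (c & t & H).
    apply tensor_iff in H as (H1 & H2 & H3). exists c. rewrite <- H1, <- H2.
    now apply isom_equi.
Qed.

End Units.

Lemma co_unitlike X (K : calculus X) i : unitlike (co_calculus K) i <-> unitlike K i.
Proof. unfold unitlike. rewrite !co_ff, !co_equi. reflexivity. Qed.

Lemma co_eqv X (K : calculus X) e : eqv (co_calculus K) e <-> eqv K e.
Proof.
  split; intros (u & i & j & H1 & H2 & H3 & H4 & H5 & H6); exists u, i, j;
    rewrite ?co_unitlike, ?co_equi in *; auto 6.
Qed.

Lemma co_rich X (K : calculus X) : rich K -> rich (co_calculus K).
Proof.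
  intros [R1 R2]. split.
  - intros x. destruct (R1 x) as (i & U & E). exists i. now rewrite co_unitlike.
  - intros a b E. destruct (R2 a b E) as [c H]. exists c. now apply co_equi.
Qed.

Lemma rich_representable X (K : calculus X) : rich K -> representable X.
Proof.
  intros R. pose proof (co_rich R) as [R1' R2']. destruct R as [R1 R2].
  constructor.
  - exact (calculus_unital K).
  - intros x. destruct (R1 x) as (i & U & <-). exists i. eapply unitlike_tensor_unit; eauto.
  - intros x. destruct (R1' x) as (i & U & <-). exists i.
    eapply (unitlike_tensor_unit (K := co_calculus K)); eauto.
  - intros a b E. destruct (R2 a b E) as [c H]. destruct (equi_isom H) as (t & H1 & H2 & H3).
    exists c, t. apply (tensor_iff K); auto.
  - intros a b E. destruct (R2' a b E) as [c H]. destruct (equi_isom H) as (t & H1 & H2 & H3).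
    exists c, t. apply (tensor_iff (co_calculus K)); auto.
Qed.

(** * Morphisms of calculi *)

Record calculus_map (X Y : merge_data) (KX : calculus X) (KY : calculus Y)
    (f : merge_map X Y) : Prop := CalculusMap {
  cm_src : forall a, src (m1 f a) = m0 f (src a);
  cm_tgt : forall a, tgt (m1 f a) = m0 f (tgt a);
  cm_inp : forall p, inp (m2 f p) = map (m1 f) (inp p);
  cm_out : forall p, out (m2 f p) = map (m1 f) (out p);
  cm_sq : forall p q, out p = inp q -> m2 f (sq KX p q) = sq KY (m2 f p) (m2 f q);
  cm_wh : forall A p B, composable X (A ++ inp p ++ B) ->
    m2 f (wh KX A p B) = wh KY (map (m1 f) A) (m2 f p) (map (m1 f) B);
  cm_neutral : forall Γ e, neutral X (sq KX) Γ e ->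
    neutral Y (sq KY) (map (m1 f) Γ) (m2 f e) }.

(** A composite of images can be defined when the composite itself is not, so that
    preservation of partial operations is an inequality. *)
Definition ple (A : Type) (p q : option A) : Prop := forall x, p = Some x -> q = Some x.

Lemma ple_refl (A : Type) (p : option A) : ple p p.
Proof. intros x H; auto. Qed.

Arguments ple_refl {A} p _ _.

Section CalculusMap.
Variables X Y : merge_data.
Variable KX : calculus X.
Variable KY : calculus Y.
Variable f : merge_map X Y.
Hypothesis Hf : calculus_map KX KY f.

Notation f1' := (map (m1 f)).
Notation f2' := (option_map (m2 f)).

Lemma cm_vc p q p' q' : ple (f2' p) p' -> ple (f2' q) q' ->
  ple (f2' (vc KX p q)) (vc KY p' q').
Proof.
  intros Hp Hq x H. destruct (vc KX p q) as [r|] eqn:E; [|discriminate].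
  apply vc_inv in E as (p0 & q0 & -> & -> & E & ->). injection H as <-.
  rewrite (Hp _ eq_refl), (Hq _ eq_refl), vc_Some.
  - now rewrite (cm_sq Hf).
  - now rewrite (cm_inp Hf), (cm_out Hf), E.
Qed.

Arguments cm_vc {p q p' q'} _ _ _ _.

Lemma map_composable Γ : composable X Γ -> composable Y (f1' Γ).
Proof.
  intros (N & x & y & H). split; [now destruct Γ|]. exists (m0 f x), (m0 f y).
  clear N. revert x H. induction Γ; simpl; intros x H; [now subst|].
  rewrite (cm_src Hf), (cm_tgt Hf). destruct H as [<- H]. auto.
Qed.

Lemma cm_W A p B A' p' B' : ple (f2' p) p' -> f1' A = A' -> f1' B = B' ->
  ple (f2' (W KX A p B)) (W KY A' p' B').
Proof.
  intros Hp <- <- x H. destruct (W KX A p B) as [r|] eqn:E; [|discriminate].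
  apply W_inv in E as (p0 & -> & E & ->). injection H as <-.
  rewrite (Hp _ eq_refl), W_Some.
  - now rewrite (cm_wh Hf).
  - rewrite (cm_inp Hf), <- !map_app. now apply map_composable.
Qed.

Arguments cm_W {A p B A' p' B'} _ _ _ _ _.

Lemma cm_idc Γ : ple (f2' (idc KX Γ)) (idc KY (f1' Γ)).
Proof.
  intros x H. destruct (idc KX Γ) as [e|] eqn:E; [|discriminate].
  injection H as <-. apply idc_Some, (cm_neutral Hf). now apply pickP in E.
Qed.

Lemma cm_has p Γ Δ : has X p Γ Δ -> has Y (f2' p) (f1' Γ) (f1' Δ).
Proof.
  intros (p' & -> & <- & <-). exists (m2 f p').
  rewrite (cm_inp Hf), (cm_out Hf). auto.
Qed.

Lemma cm_isoc p q Γ Δ : has X p Γ Δ -> isoc KX p q Γ Δ ->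
  isoc KY (f2' p) (f2' q) (f1' Γ) (f1' Δ).
Proof.
  intros Hp I. pose proof (has_inverse Hp I) as Hq. destruct I as (_ & _ & I1 & I2).
  split; [apply has_typ, cm_has; auto|]. split; [apply has_typ, cm_has; auto|].
  destruct (idc_def KX (has_inp Hp)) as (e & E & _).
  destruct (idc_def KX (has_out Hp)) as (e' & E' & _).
  rewrite E in I1. rewrite E' in I2. split.
  - pose proof (cm_vc (ple_refl (f2' p)) (ple_refl (f2' q))) as Z. rewrite I1 in Z.
    pose proof (cm_idc Γ) as Z'. rewrite E in Z'.
    rewrite (Z _ eq_refl), (Z' _ eq_refl). auto.
  - pose proof (cm_vc (ple_refl (f2' q)) (ple_refl (f2' p))) as Z. rewrite I2 in Z.
    pose proof (cm_idc Δ) as Z'. rewrite E' in Z'.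
    rewrite (Z _ eq_refl), (Z' _ eq_refl). auto.
Qed.

Lemma cm_equi Γ Δ : equi KX Γ Δ -> equi KY (f1' Γ) (f1' Δ).
Proof.
  intros (p & q & H & I). exists (f2' p), (f2' q). split; [now apply cm_has|].
  now apply cm_isoc.
Qed.

Lemma cm_isom t : isom KX t -> isom KY (m2 f t).
Proof.
  intros [q I]. exists (f2' q). rewrite (cm_inp Hf), (cm_out Hf).
  apply (cm_isoc (has_Some X t) I).
Qed.

Lemma calculus_map_morphism : is_morphism X Y f.
Proof.
  constructor; try apply Hf.
  intros t s Δ1 Λ Δ2 Γ1 Γ2 h h'.
  assert (E : Some (m2 f (mrg h)) = Some (mrg h')); [|congruence].
  rewrite (mrg_vc KY h').
  pose proof (mrg_vc KX h) as M.
  assert (Z := cm_vc (cm_W (A := Γ1) (B := Γ2) (ple_refl (f2' (Some t))) eq_refl eq_refl)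
    (cm_W (A := Δ1) (B := Δ2) (ple_refl (f2' (Some s))) eq_refl eq_refl)).
  rewrite <- M in Z. symmetry. apply Z. auto.
Qed.

Lemma cm_unitlike : (forall x, exists i, unitlike KX i /\ src i = x /\ unitlike KY (m1 f i)) ->
  forall i, unitlike KX i -> unitlike KY (m1 f i).
Proof.
  intros HU i Ui. destruct (HU (src i)) as (j & Uj & Ej & Uj').
  apply (unitlike_equi (i := m1 f j)); auto.
  apply (cm_equi (Γ := [j]) (Δ := [i])), unitlike_unique; auto.
Qed.

Lemma cm_eqv : (forall i, unitlike KX i -> unitlike KY (m1 f i)) ->
  forall e, eqv KX e -> eqv KY (m1 f e).
Proof.
  intros HU e (u & i & j & Ui & Uj & Ei & Ej & H & H').
  exists (m1 f u), (m1 f i), (m1 f j). rewrite !(cm_src Hf), (cm_tgt Hf), Ei, Ej.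
  apply cm_equi in H, H'. auto 7.
Qed.

End CalculusMap.

Arguments cm_vc {X Y KX KY f} Hf {p q p' q'} _ _ _ _.
Arguments cm_W {X Y KX KY f} Hf {A p B A' p' B'} _ _ _ _ _.

(** Tensors, pars and universal 1-cells are described by invertible cells and units;
    invertible cells are preserved by every map of calculi, and units on a 0-cell are
    unique up to an invertible cell, so that one of them needs to be preserved. *)
Theorem calculus_map_strong X Y (KX : calculus X) (KY : calculus Y) f :
  calculus_map KX KY f -> rich KX -> rich KY ->
  (forall x, exists i, unitlike KX i /\ src i = x /\ unitlike KY (m1 f i)) ->
  is_strong X Y f.
Proof.
  intros Hf RX RY HU. pose proof (cm_unitlike Hf HU) as HU'.
  assert (T : forall a b c t, is_tensor X a b c t ->
    is_tensor Y (m1 f a) (m1 f b) (m1 f c) (m2 f t)).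
  { intros a b c t H. apply (tensor_iff KX) in H as (H1 & H2 & H3). apply (tensor_iff KY).
    rewrite (cm_inp Hf), (cm_out Hf), H1, H2. split; auto. split; auto.
    now apply (cm_isom Hf). }
  constructor; auto.
  - intros a e H. apply (neutral_unit KY), (cm_neutral Hf (Γ := [a])), (unit_neutral KX); auto.
  - intros e H. apply (tensor_universal_eqv _ RY), (cm_eqv Hf); auto.
    now apply (tensor_universal_eqv _ RX).
  - intros e H. apply (tensor_universal_eqv _ (co_rich RY)), co_eqv, (cm_eqv Hf); auto.
    now apply co_eqv, (tensor_universal_eqv _ (co_rich RX)).
  - intros a b c t H. apply (tensor_iff (co_calculus KX)) in H as (H1 & H2 & H3).
    apply (tensor_iff (co_calculus KY)). simpl in *.
    rewrite (cm_inp Hf), (cm_out Hf), H1, H2. split; auto. split; auto.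
    apply co_isom, (cm_isom Hf). now apply co_isom in H3.
Qed.

Section Strong.
Variables X Y : merge_data.
Variable KX : calculus X.
Variable KY : calculus Y.
Hypothesis RX : rich KX.
Hypothesis RY : rich KY.
Variable f : strong_morphism X Y.
Let Mf := smap_morphism f.
Let Sf := smap_strong f.
Notation f1' := (map (m1 f)).

(** A strong morphism preserves units on 1-cells by definition.  To extend this to
    sequences, an invertible cell from a sequence to a 1-cell is built by iterating
    tensors; its image is invertible too, and this forces the image of the unit on the
    sequence to be neutral. *)
Lemma strong_isom_ex Γ : composable X Γ ->
  exists T c, inp T = Γ /\ out T = [c] /\ isom KX T /\ isom KY (m2 f T).
Proof.
  induction Γ as [|a Γ IH] using rev_ind; intros C; [now destruct C|].
  destruct Γ as [|b Γ].
  - simpl. destruct (idc_def KX (composable_one a)) as (e & E & He).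
    exists e, a. pose proof He as (H1 & H2 & _). split; [|split]; auto.
    assert (I : forall Z (K : calculus Z) Θ u, neutral Z (sq K) Θ u -> isom K u).
    { intros Z K Θ u Hu. exists (Some u). pose proof Hu as (U1 & U2 & _).
      rewrite U1, U2. rewrite <- (idc_Some K Hu).
      split; [|split; [|split]]; try apply typ_idc; apply (vc_idl K (typ_idc K _)). }
    split; [eapply I; eauto|]. apply (I Y KY [m1 f a]), unit_neutral, (strong_unit Sf).
    now apply (neutral_unit KX).
  - destruct IH as (T & c & T1 & T2 & [q I] & [q' I']).
    { destruct C as (_ & x & y & C). apply chain_app in C as (z & C & _).
      split; [discriminate|]. eauto. }
    assert (Ec : composable X ([] ++ out T ++ [a])).
    { apply (composable_parallel [] T [a]). now rewrite T1. }
    rewrite T2 in Ec. simpl in Ec. pose proof Ec as E. apply composable_two in E.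
    destruct (proj2 RX c a E) as [d Hd]. destruct (equi_isom Hd) as (t & t1 & t2 & t3).
    assert (h : mergeable X T t [] [c] [] [] [a]) by (constructor; auto; discriminate).
    exists (mrg h), d. destruct (mrg_bd KX h) as [-> ->]. rewrite T1, t2.
    split; [|split]; auto.
    assert (Key : forall Z (K : calculus Z) U u c0 a0 d0 (h0 : mergeable Z U u [] [c0] [] [] [a0]),
      out U = [c0] -> inp u = [c0; a0] -> out u = [d0] -> isom K U -> isom K u -> isom K (mrg h0)).
    { clear. intros Z K U u c0 a0 d0 h0 U1 u1 u2 [q I] [q' I'].
      destruct (mrg_bd K h0) as [B1 B2]. exists (vc K q' (W K [] q [a0])).
      rewrite B1, B2, (mrg_vc K h0), W_nil. simpl. rewrite app_nil_r.
      pose proof (isoc_W [] [a0] (inp_nonempty _ U) (out_nonempty _ U) I) as I2.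
      simpl in I2. rewrite U1 in I2. rewrite u1 in I'. simpl in I2.
      eapply isoc_vc; eauto. }
    split; [eapply Key; eauto; eexists; eauto|].
    rewrite (m_mrg Mf h (mergeable_map Mf h)). eapply (Key _ _ _ _ (m1 f c) (m1 f a) (m1 f d)).
    + now rewrite (m_out Mf), T2.
    + now rewrite (m_inp Mf), t1.
    + now rewrite (m_out Mf), t2.
    + eexists; eauto.
    + assert (Ht : is_tensor X c a d t) by now apply (tensor_iff KX).
      apply (strong_tensor Sf) in Ht. now apply (tensor_iff KY) in Ht.
Qed.

Lemma mrg_full_sq Z (K : calculus Z) p q Λ (h : mergeable Z p q [] Λ [] [] []) :
  mrg h = sq K p q.
Proof. now rewrite (mrg_sq K), !wh_nil. Qed.

Lemma strong_sq p q : out p = inp q -> m2 f (sq KX p q) = sq KY (m2 f p) (m2 f q).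
Proof.
  intros E. assert (h : mergeable X p q [] (out p) [] [] []).
  { constructor; rewrite ?app_nil_r; auto. apply out_nonempty. }
  rewrite <- (mrg_full_sq KX h), (m_mrg Mf h (mergeable_map Mf h)).
  pose proof (mergeable_map Mf h) as h'. simpl in h'.
  rewrite <- (mrg_full_sq KY h'). now apply mrg_irrelevance.
Qed.

Lemma strong_neutral Γ e : neutral X (sq KX) Γ e ->
  neutral Y (sq KY) (f1' Γ) (m2 f e).
Proof.
  intros He. pose proof He as (H1 & H2 & H3 & H4).
  assert (C : composable X Γ) by (rewrite <- H1; apply composable_inp).
  destruct (strong_isom_ex C) as (T & c & T1 & T2 & _ & [q I]).
  assert (E1 : inp (m2 f e) = f1' Γ) by now rewrite (m_inp Mf), H1.
  assert (E2 : out (m2 f e) = f1' Γ) by now rewrite (m_out Mf), H2.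
  assert (E3 : inp (m2 f T) = f1' Γ) by now rewrite (m_inp Mf), T1.
  assert (Z : vc KY (Some (m2 f e)) (Some (m2 f T)) = Some (m2 f T)).
  { rewrite vc_Some by congruence. rewrite <- strong_sq by congruence. now rewrite H3. }
  assert (Z' : Some (m2 f e) = idc KY (f1' Γ)).
  { rewrite E3 in I.
    assert (Te : typ (Some (m2 f e)) (f1' Γ) (f1' Γ)).
    { rewrite <- E1 at 1. rewrite <- E2. apply typ_Some. }
    rewrite <- (isoc_cancel_r I Te), Z. apply I. }
  symmetry in Z'. now apply pickP in Z'.
Qed.

Lemma strong_calculus_map : calculus_map KX KY f.
Proof.
  constructor; try apply Mf.
  - apply strong_sq.
  - intros A p B C.
    assert (Z : forall V (K : calculus V) A p B e, composable V (A ++ inp p ++ B) ->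
      neutral V (sq K) (A ++ out p ++ B) e ->
      exists h : mergeable V p e [] (out p) [] A B, mrg h = wh K A p B).
    { clear. intros V K A p B e C He.
      assert (h : mergeable V p e [] (out p) [] A B).
      { constructor; auto; rewrite ?app_nil_r; auto; [apply He | apply out_nonempty]. }
      exists h. rewrite (mrg_sq K), wh_nil. apply He. now apply wh_out. }
    assert (C' : composable X (A ++ out p ++ B)) by now apply composable_parallel.
    destruct (idc_def KX C') as (e & _ & He).
    destruct (Z _ _ _ _ _ _ C He) as [h <-].
    apply strong_neutral in He. rewrite !map_app, <- (m_out Mf) in He.
    rewrite (m_mrg Mf h (mergeable_map Mf h)).
    destruct (Z _ KY (f1' A) (m2 f p) (f1' B) (m2 f e)) as [h' <-]; auto.
    { apply composable_parallel. destruct He as (He & _). rewrite <- He. apply composable_inp. }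
    apply mrg_irrelevance; auto. now rewrite (m_out Mf).
  - apply strong_neutral.
Qed.

Lemma strong_unitlike i : unitlike KX i -> eqv KY (m1 f i) /\ unitlike KY (m1 f i).
Proof.
  intros U. pose proof strong_calculus_map as Hf.
  assert (Q : eqv KX i).
  { pose proof U as (E & _ & _ & H). exists i, i, i. auto 7. }
  apply (tensor_universal_eqv _ RX), (strong_tensor_universal Sf),
    (tensor_universal_eqv _ RY) in Q. split; auto.
  destruct (eqv_ff Q) as [F F']. destruct U as (E & _ & _ & H).
  split; [|split; [|split]]; auto.
  - rewrite (m_src Mf), (m_tgt Mf). congruence.
  - now apply (cm_equi Hf) in H.
Qed.

End Strong.

(** * Coherent unitors *)

Section Unitors.
Variable X : merge_data.
Variable K : calculus X.
Notation vc := (vc K).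
Notation W := (W K).
Notation has := (has X).

Lemma W_congr A B A' B' C D p q : W A p B = W A' q B' ->
  W (C ++ A) p (B ++ D) = W (C ++ A') q (B' ++ D).
Proof. intros E. now rewrite <- !W_W, E. Qed.

Section Left.
Variables (i a b : cell1 X) (m l l' : option (cell2 X)).
Hypothesis F : ff K [i] [].
Hypothesis Hm : has m [i; i] [i].
Hypothesis Hl : has l [i; a] [a].
Hypothesis Hl' : has l' [i; b] [b].
Hypothesis El : W [i] l [] = W [] m [a].
Hypothesis El' : W [i] l' [] = W [] m [b].

(** After whiskering with [i], naturality is the exchange of [p] with [m]. *)
Lemma left_natural p Γ Δ : has p (a :: Γ) (b :: Δ) ->
  vc (W [i] p []) (W [] l' Δ) = vc (W [] l Γ) p.
Proof.
  intros Hp.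
  assert (C : composable X (i :: a :: Γ)).
  { apply (composable_glue [i] (B := [a]) Γ); [discriminate| |].
    - now apply has_inp in Hl.
    - now apply has_inp in Hp. }
  assert (C' : composable X (i :: b :: Δ)).
  { apply (composable_glue [i] (B := [b]) Δ); [discriminate| |].
    - now apply has_inp in Hl'.
    - now apply has_out in Hp. }
  apply (proj2 F _ _ (i :: a :: Γ) (b :: Δ)).
  - eapply has_vc.
    + pose proof (has_W K [i] [] Hp) as H. simpl in H. rewrite !app_nil_r in H. eauto.
    + apply (has_W K [] Δ Hl'). auto.
  - eapply has_vc; [|exact Hp]. apply (has_W K [] Γ Hl). auto.
  - simpl. rewrite app_nil_r. apply composable_cons. split; auto.
    apply has_inp, composable_two in Hm. auto.
  - rewrite !W_vc, !W_W. cbn [app]. rewrite !app_nil_r.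
    assert (E1 : W [i] l' Δ = W [] m (b :: Δ)).
    { rewrite <- (app_nil_l Δ), <- (app_nil_r [i]). 
      exact (W_congr [i] [] [] [b] [] Δ l' m El'). }
    assert (E2 : W [i] l Γ = W [] m (a :: Γ)).
    { exact (W_congr [i] [] [] [a] [] Γ l m El). }
    rewrite E1, E2.
    pose proof (exch K [] [] [] (has_typ Hm) (has_typ Hp)) as Z.
    simpl in Z. rewrite !app_nil_r in Z. auto.
Qed.
End Left.

Section Right.
Variables (i a b : cell1 X) (m r r' : option (cell2 X)).
Hypothesis F : ff K [] [i].
Hypothesis Hm : has m [i; i] [i].
Hypothesis Hr : has r [a; i] [a].
Hypothesis Hr' : has r' [b; i] [b].
Hypothesis Er : W [] r [i] = W [a] m [].
Hypothesis Er' : W [] r' [i] = W [b] m [].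

Lemma right_natural p Γ Δ : has p (Γ ++ [a]) (Δ ++ [b]) ->
  vc (W [] p [i]) (W Δ r' []) = vc (W Γ r []) p.
Proof.
  intros Hp.
  assert (C : composable X (Γ ++ [a; i])).
  { apply (composable_glue Γ (B := [a]) [i]); [discriminate| |].
    - now apply has_inp in Hp.
    - now apply has_inp in Hr. }
  assert (C' : composable X (Δ ++ [b; i])).
  { apply (composable_glue Δ (B := [b]) [i]); [discriminate| |].
    - now apply has_out in Hp.
    - now apply has_inp in Hr'. }
  apply (proj2 F _ _ (Γ ++ [a; i]) (Δ ++ [b])).
  - eapply has_vc.
    + pose proof (has_W K [] [i] Hp) as H. simpl in H. rewrite <- !app_assoc in H. eauto.
    + pose proof (has_W K Δ [] Hr') as H. simpl in H. auto.
  - eapply has_vc; [|exact Hp]. pose proof (has_W K Γ [] Hr) as H. simpl in H. auto.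
  - simpl. rewrite <- app_assoc.
    apply (composable_glue Γ (B := [a; i]) [i]); [discriminate|auto|].
    apply (composable_glue [a] (B := [i]) [i]); [discriminate| |].
    + now apply has_inp in Hr.
    + now apply has_inp in Hm.
  - rewrite !W_vc, !W_W. cbn [app]. rewrite ?app_nil_r.
    assert (E1 : W Δ r' [i] = W (Δ ++ [b]) m []).
    { pose proof (W_congr [] [i] [b] [] Δ [] r' m Er') as Z.
      rewrite !app_nil_r in Z. exact Z. }
    assert (E2 : W Γ r [i] = W (Γ ++ [a]) m []).
    { pose proof (W_congr [] [i] [a] [] Γ [] r m Er) as Z.
      rewrite !app_nil_r in Z. exact Z. }
    rewrite E1, E2.
    pose proof (exch K [] [] [] (has_typ Hp) (has_typ Hm)) as Z.
    simpl in Z. rewrite !app_nil_r in Z. auto.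
Qed.
End Right.

Lemma unitor_middle i a b m r l : has r [a; i] [a] -> has l [i; b] [b] ->
  (exists n, isoc K m n [i; i] [i]) ->
  W [] r [i] = W [a] m [] -> W [i] l [] = W [] m [b] ->
  W [] r [b] = W [a] l [].
Proof.
  intros Hr Hl [n I] Er El.
  assert (E1 : W [] r [i; b] = W [a] m [b]) by exact (W_congr [] [i] [a] [] [] [b] r m Er).
  assert (E2 : W [a; i] l [] = W [a] m [b]) by exact (W_congr [i] [] [] [b] [a] [] l m El).
  pose proof (exch K [] [] [] (has_typ Hr) (has_typ Hl)) as Z. cbn [app] in Z.
  rewrite E1, E2 in Z.
  assert (I' : isoc K (W [a] m [b]) (W [a] n [b]) [a; i; i; b] [a; i; b])
    by (apply (isoc_W [a] [b] (Γ := [i; i]) (Δ := [i])); auto; discriminate).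
  apply isoc_sym in I'.
  rewrite <- (isoc_cancel_l I' (typ_W K [] [b] (has_typ Hr))).
  rewrite <- (isoc_cancel_l I' (typ_W K [a] [] (has_typ Hl))).
  now rewrite Z.
Qed.

End Unitors.

Definition chosen (A : Type) (P : A -> Prop) (H : exists x, P x) : A :=
  proj1_sig (constructive_indefinite_description P H).

Arguments chosen {A P} H.

Lemma chosenP A (P : A -> Prop) (H : exists x, P x) : P (chosen H).
Proof. exact (proj2_sig (constructive_indefinite_description P H)). Qed.

Arguments chosenP {A P} H.

Section CoherentChoice.
Variable X : merge_data.
Variable K : calculus X.
Hypothesis R : rich K.

Lemma tensor_choice (a b : cell1 X) (h : tgt a = src b) :
  exists t : cell1 X * cell2 X, is_tensor X a b (fst t) (snd t).
Proof.
  destruct (proj2 R a b h) as [c Hc]. destruct (equi_isom Hc) as (t & H1 & H2 & H3).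
  exists (c, t). now apply (tensor_iff K).
Qed.

Lemma unit_choice (x : cell0 X) :
  exists u : cell1 X * cell2 X, unitlike K (fst u) /\ src (fst u) = x /\
    inp (snd u) = [fst u; fst u] /\ out (snd u) = [fst u] /\ isom K (snd u).
Proof.
  destruct (proj1 R x) as (i & U & E). pose proof U as (_ & _ & _ & H).
  destruct (equi_isom H) as (m & M1 & M2 & M3). exists (i, m). auto.
Qed.

Definition chosen_unit (x : cell0 X) := chosen (unit_choice x).

Lemma chosen_unitP x : unitlike K (fst (chosen_unit x)) /\ src (fst (chosen_unit x)) = x /\
  inp (snd (chosen_unit x)) = [fst (chosen_unit x); fst (chosen_unit x)] /\ out (snd (chosen_unit x)) = [fst (chosen_unit x)] /\
  isom K (snd (chosen_unit x)).
Proof. exact (chosenP (unit_choice x)). Qed.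

Lemma chosen_unit_has x : has X (Some (snd (chosen_unit x))) [fst (chosen_unit x); fst (chosen_unit x)] [fst (chosen_unit x)].
Proof. destruct (chosen_unitP x) as (_ & _ & <- & <- & _). apply has_Some. Qed.

Lemma left_choice (a : cell1 X) : let u := chosen_unit (src a) in
  exists l, inp l = [fst u; a] /\ out l = [a] /\ isom K l /\
    W K [fst u] (Some l) [] = W K [] (Some (snd u)) [a].
Proof.
  destruct (chosen_unitP (src a)) as (U & E & H1 & H2 & H3).
  apply (unit_left a U H1 H2 H3). destruct U. congruence.
Qed.

Lemma right_choice (a : cell1 X) : let u := chosen_unit (tgt a) in
  exists r, inp r = [a; fst u] /\ out r = [a] /\ isom K r /\
    W K [] (Some r) [fst u] = W K [a] (Some (snd u)) [].
Proof.
  destruct (chosen_unitP (tgt a)) as (U & E & H1 & H2 & H3).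
  apply (unit_right a U H1 H2 H3). congruence.
Qed.

Definition chosen_left a := chosen (left_choice a).
Definition chosen_right a := chosen (right_choice a).

Lemma chosen_leftP a : let u := chosen_unit (src a) in inp (chosen_left a) = [fst u; a] /\ out (chosen_left a) = [a] /\
  isom K (chosen_left a) /\ W K [fst u] (Some (chosen_left a)) [] = W K [] (Some (snd u)) [a].
Proof. exact (chosenP (left_choice a)). Qed.

Lemma chosen_rightP a : let u := chosen_unit (tgt a) in inp (chosen_right a) = [a; fst u] /\ out (chosen_right a) = [a] /\
  isom K (chosen_right a) /\ W K [] (Some (chosen_right a)) [fst u] = W K [a] (Some (snd u)) [].
Proof. exact (chosenP (right_choice a)). Qed.

Lemma chosen_left_has a : has X (Some (chosen_left a)) [fst (chosen_unit (src a)); a] [a].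
Proof. destruct (chosen_leftP a) as (E & E' & _). exists (chosen_left a); auto. Qed.

Lemma chosen_right_has a : has X (Some (chosen_right a)) [a; fst (chosen_unit (tgt a))] [a].
Proof. destruct (chosen_rightP a) as (E & E' & _). exists (chosen_right a); auto. Qed.

Lemma chosen_left_natural p a b Γ Δ : inp p = a :: Γ -> out p = b :: Δ ->
  vc K (W K [fst (chosen_unit (src a))] (Some p) []) (W K [] (Some (chosen_left b)) Δ)
  = vc K (W K [] (Some (chosen_left a)) Γ) (Some p).
Proof.
  intros H1 H2. pose proof (src_first X p H1 H2) as E.
  pose proof (chosen_leftP b) as Lb. pose proof (chosen_left_has b) as Hb. rewrite <- E in Lb, Hb.
  eapply (@left_natural X K _ a b).
  - apply (chosen_unitP (src a)).
  - apply chosen_unit_has.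
  - apply chosen_left_has.
  - exact Hb.
  - apply chosen_leftP.
  - apply Lb.
  - rewrite <- H1, <- H2. apply has_Some.
Qed.

Lemma chosen_right_natural p a b Γ Δ : inp p = Γ ++ [a] -> out p = Δ ++ [b] ->
  vc K (W K [] (Some p) [fst (chosen_unit (tgt a))]) (W K Δ (Some (chosen_right b)) [])
  = vc K (W K Γ (Some (chosen_right a)) []) (Some p).
Proof.
  intros H1 H2. pose proof (tgt_last X p _ _ _ _ H1 H2) as E.
  pose proof (chosen_rightP b) as Lb. pose proof (chosen_right_has b) as Hb. rewrite <- E in Lb, Hb.
  eapply (@right_natural X K _ a b).
  - apply (chosen_unitP (tgt a)).
  - apply chosen_unit_has.
  - apply chosen_right_has.
  - exact Hb.
  - apply chosen_rightP.
  - apply Lb.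
  - rewrite <- H1, <- H2. apply has_Some.
Qed.

Lemma chosen_middle a b : tgt a = src b ->
  W K [] (Some (chosen_right a)) [b] = W K [a] (Some (chosen_left b)) [].
Proof.
  intros E. pose proof (chosen_leftP b) as (L1 & L2 & L3 & L4). pose proof (chosen_left_has b) as Hb.
  rewrite <- E in *. destruct (chosen_unitP (tgt a)) as (_ & _ & H1 & H2 & [n I]).
  rewrite H1, H2 in I. eapply unitor_middle; eauto using chosen_right_has. apply chosen_rightP.
Qed.

Lemma chosen_at_unit x : Some (chosen_left (fst (chosen_unit x))) = Some (snd (chosen_unit x)) /\
  Some (chosen_right (fst (chosen_unit x))) = Some (snd (chosen_unit x)).
Proof.
  destruct (chosen_unitP x) as (U & E & H1 & H2 & H3).
  set (i := fst (chosen_unit x)) in *. set (m := snd (chosen_unit x)) in *.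
  assert (Et : tgt i = x) by (destruct U; congruence).
  pose proof (chosen_leftP i) as (_ & _ & _ & L). pose proof (chosen_rightP i) as (_ & _ & _ & R').
  pose proof (chosen_left_has i) as HL. pose proof (chosen_right_has i) as HR.
  pose proof (@chosen_middle i i) as M. cbv zeta in *.
  rewrite E in L, HL. rewrite Et in R', HR. fold i m in L, R', HL, HR.
  specialize (M (eq_trans Et (eq_sym E))).
  assert (Hm : has X (Some m) [i; i] [i]) by apply chosen_unit_has.
  assert (C : composable X [i; i; i]).
  { apply composable_cons. split; [congruence|]. now apply has_inp in Hm. }
  destruct U as (_ & F & F' & _). split.
  - apply (proj2 F _ _ [i; i] [i]); auto. now rewrite <- M, R'.
  - apply (proj2 F' _ _ [i; i] [i]); auto. now rewrite M, L.
Qed.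

(** Kock's unitors are coherent: every required equation can be checked after
    whiskering with the unit, where it becomes an instance of the exchange law. *)
Definition rich_coherent_choice : coherent_choice X.
Proof.
  refine (@CoherentChoice X
    (fun a b h => fst (chosen (tensor_choice a b h)))
    (fun a b h => snd (chosen (tensor_choice a b h))) _
    (fun x => fst (chosen_unit x)) _ chosen_left _ chosen_right _ _ _ _ _).
  - intros a b h. exact (chosenP (tensor_choice a b h)).
  - intros x. destruct (chosen_unitP x) as (U & E & _). rewrite <- E at 1.
    now apply (unitlike_tensor_unit (K := K)).
  - intros a. destruct (chosen_leftP a) as (L1 & L2 & L3 & _).
    apply (left_witness_of_ff (K := K)); auto. apply (chosen_unitP (src a)).
  - intros a. destruct (chosen_rightP a) as (L1 & L2 & L3 & _).
    apply (right_witness_of_ff (K := K)); auto. apply (chosen_unitP (tgt a)).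
  - intros p a b Γ Δ H1 H2.
    pose proof (chosen_left_natural p H1 H2) as E.
    assert (H : has X (vc K (W K [] (Some (chosen_left a)) Γ) (Some p))
      (fst (chosen_unit (src a)) :: a :: Γ) (b :: Δ)).
    { eapply has_vc; [|rewrite <- H2; apply has_Some]. rewrite H1.
      apply (has_W K [] Γ (chosen_left_has a)).
      apply (composable_glue [fst (chosen_unit (src a))] (B := [a]) Γ); [discriminate| |].
      - exact (has_inp (chosen_left_has a)).
      - simpl. rewrite <- H1. apply composable_inp. }
    destruct H as (r & Er & _). exists r.
    destruct (chosen_leftP a) as (L1 & L2 & _). destruct (chosen_leftP b) as (L1' & L2' & _). split.
    + rewrite <- (src_first X p H1 H2) in L1'. 
      apply (@cut_iff X K p (chosen_left b) r [] b Δ [fst (chosen_unit (src a))] []); auto. now rewrite E.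
    + apply (@cut_iff X K (chosen_left a) p r [] a [] [] Γ); auto. now rewrite W_nil.
  - intros p a b Γ Δ H1 H2.
    pose proof (chosen_right_natural p _ _ _ _ H1 H2) as E.
    assert (H : has X (vc K (W K Γ (Some (chosen_right a)) []) (Some p))
      (Γ ++ [a; fst (chosen_unit (tgt a))]) (Δ ++ [b])).
    { eapply has_vc; [|rewrite <- H2; apply has_Some]. rewrite H1.
      pose proof (has_W K Γ [] (chosen_right_has a)) as Z. simpl in Z. apply Z.
      apply (composable_glue Γ (B := [a]) [fst (chosen_unit (tgt a))]); [discriminate| |].
      - rewrite <- H1. apply composable_inp.
      - exact (has_inp (chosen_right_has a)). }
    destruct H as (r & Er & _). exists r.
    destruct (chosen_rightP a) as (L1 & L2 & _). destruct (chosen_rightP b) as (L1' & L2' & _). split.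
    + rewrite <- (tgt_last X p _ _ _ _ H1 H2) in L1'.
      apply (@cut_iff X K p (chosen_right b) r Δ b [] [] [fst (chosen_unit (tgt a))]); auto.
      * rewrite H2, length_app. simpl. lia.
      * now rewrite E.
    + apply (@cut_iff X K (chosen_right a) p r [] a [] Γ []); auto.
      * rewrite H1, length_app. simpl. lia.
      * now rewrite W_nil.
  - intros q a b Γ1 Γ2 j H ->.
    assert (E : tgt a = src b).
    { pose proof (composable_inp q) as C. rewrite H in C.
      apply (composable_mid Γ1 (Γ := [a; b]) Γ2) in C; [|discriminate].
      now apply composable_two in C. }
    pose proof (W_congr K [] [b] [a] [] Γ1 Γ2 _ _ (chosen_middle a b E)) as Z.
    rewrite app_nil_r in Z. cbn [app] in Z.
    assert (Hq : has X (vc K (W K Γ1 (Some (chosen_right a)) (b :: Γ2)) (Some q))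
      (Γ1 ++ [a; fst (chosen_unit (tgt a))] ++ b :: Γ2) (out q)).
    { eapply has_vc; [|apply has_Some]. rewrite H.
      apply (has_W K Γ1 (b :: Γ2) (chosen_right_has a)).
      apply (has_composable (X := X) Γ1 (b :: Γ2) (chosen_right_has a)).
      simpl. rewrite <- H. apply composable_inp. }
    destruct Hq as (r & Er & _). exists r.
    destruct (chosen_rightP a) as (L1 & L2 & _). destruct (chosen_leftP b) as (L1' & L2' & _). split.
    + apply (@cut_iff X K (chosen_right a) q r [] a [] Γ1 (b :: Γ2)); auto. now rewrite W_nil.
    + apply (@cut_iff X K (chosen_left b) q r [] b [] (Γ1 ++ [a]) Γ2); auto.
      * now rewrite <- app_assoc.
      * rewrite length_app. simpl. lia.
      * now rewrite W_nil, <- Z.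
  - intros x. destruct (chosen_at_unit x) as [H1 H2]. congruence.
Defined.

End CoherentChoice.

(** ** Comparison of units *)

Section UnitComparison.
Variable X : merge_data.
Variable K : calculus X.
Notation vc := (vc K).
Notation W := (W K).
Notation has := (has X).

(** [i] and [j] are units with coherent unitors [l], [r] and [λ], [ρ].  A
    comparison [φ] that is compatible with the left unitors at [j] is compatible
    with all of them, as one checks after whiskering with [j]. *)
Variables (i j : cell1 X) (φ lj λj : option (cell2 X)).
Hypothesis Fl : ff K [j] [].
Hypothesis Fr : ff K [] [j].
Hypothesis Hφ : has φ [i] [j].
Hypothesis Eφ : vc (W [] φ [j]) λj = lj.

Lemma unit_compare_r a ra ρa : has ra [a; i] [a] -> has ρa [a; j] [a] ->
  composable X [a; i; j] ->
  W [] ra [j] = W [a] lj [] -> W [] ρa [j] = W [a] λj [] ->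
  vc (W [a] φ []) ρa = ra.
Proof.
  intros Hr Hρ C E E'. apply (proj2 Fr _ _ [a; i] [a]); auto.
  - eapply has_vc; [|exact Hρ]. apply (has_W K [a] [] Hφ). now apply has_inp in Hr.
  - rewrite W_vc, W_W, E, E', <- Eφ, W_vc, W_W. reflexivity.
Qed.

Lemma unit_compare_l a la λa rj ρj : has la [i; a] [a] -> has λa [j; a] [a] ->
  composable X [j; i; a] ->
  W [] rj [a] = W [j] la [] -> W [] ρj [a] = W [j] λa [] ->
  vc (W [j] φ []) ρj = rj ->
  vc (W [] φ [a]) λa = la.
Proof.
  intros Hl Hλ C E E' Er. apply (proj2 Fl _ _ [i; a] [a]); auto.
  - eapply has_vc; [|exact Hλ]. apply (has_W K [] [a] Hφ). now apply has_inp in Hl.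
  - rewrite W_vc, W_W, <- E, <- E', <- Er, W_vc, W_W. reflexivity.
Qed.

Lemma unit_compare_iso l' λ' : composable X [i; j] ->
  isoc K lj l' [i; j] [j] -> isoc K λj λ' [j; j] [j] ->
  exists ψ, isoc K φ ψ [i] [j].
Proof.
  intros C I J. apply (ff_isom Fr Hφ); auto.
  assert (E : W [] φ [j] = vc lj λ').
  { rewrite <- Eφ. symmetry. eapply isoc_cancel_r; [exact J|].
    apply (typ_W K [] [j] (has_typ Hφ)). }
  rewrite E. exists (vc λj l'). eapply isoc_vc; [exact I | now apply isoc_sym].
Qed.

End UnitComparison.

(** * Bicategories presented by tensors *)

Local Open Scope bicat_scope.

(** The cells of [D] are the cells of [X] with one input and one output, and the
    operations of [D] are computed in the calculus of [X] from invertible cells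
    [prt : (a, b) -> (a ⊗ b)], [prl : (1, a) -> (a)] and [prr : (a, 1) -> (a)]. *)
Record presentation (D : bicat_data) (X : merge_data) (K : calculus X) := Presentation {
  pr1 : forall x y : bob D, bhom x y -> cell1 X;
  pr2 : forall (x y : bob D) (a b : bhom x y), bcell a b -> cell2 X;
  prt : forall (x y z : bob D) (a : bhom x y) (b : bhom y z), option (cell2 X);
  prti : forall (x y z : bob D) (a : bhom x y) (b : bhom y z), option (cell2 X);
  prl : forall (x y : bob D) (a : bhom x y), option (cell2 X);
  prr : forall (x y : bob D) (a : bhom x y), option (cell2 X);
  pr2_has : forall x y (a b : bhom x y) (p : bcell a b),
    has X (Some (pr2 _ _ _ _ p)) [pr1 _ _ a] [pr1 _ _ b];
  pr2_inj : forall x y (a b : bhom x y) (p q : bcell a b), pr2 _ _ _ _ p = pr2 _ _ _ _ q -> p = q;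
  pr2_full : forall x y (a b : bhom x y) r,
    inp r = [pr1 _ _ a] -> out r = [pr1 _ _ b] -> exists p : bcell a b, pr2 _ _ _ _ p = r;
  prt_has : forall x y z (a : bhom x y) (b : bhom y z),
    has X (prt _ _ _ a b) [pr1 _ _ a; pr1 _ _ b] [pr1 _ _ (a ⊗ b)];
  prt_iso : forall x y z (a : bhom x y) (b : bhom y z),
    isoc K (prt _ _ _ a b) (prti _ _ _ a b) [pr1 _ _ a; pr1 _ _ b] [pr1 _ _ (a ⊗ b)];
  prl_has : forall x y (a : bhom x y), has X (prl _ _ a) [pr1 _ _ (hunit x); pr1 _ _ a] [pr1 _ _ a];
  prl_iso : forall x y (a : bhom x y), exists q,
    isoc K (prl _ _ a) q [pr1 _ _ (hunit x); pr1 _ _ a] [pr1 _ _ a];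
  prr_has : forall x y (a : bhom x y), has X (prr _ _ a) [pr1 _ _ a; pr1 _ _ (hunit y)] [pr1 _ _ a];
  prr_iso : forall x y (a : bhom x y), exists q,
    isoc K (prr _ _ a) q [pr1 _ _ a; pr1 _ _ (hunit y)] [pr1 _ _ a];
  pr_unit : forall x, unitlike K (pr1 _ _ (hunit x));
  pr_middle : forall x y z (a : bhom x y) (b : bhom y z),
    W K [] (prr _ _ a) [pr1 _ _ b] = W K [pr1 _ _ a] (prl _ _ b) [];
  pr_vid : forall x y (a : bhom x y), Some (pr2 _ _ _ _ (vid a)) = idc K [pr1 _ _ a];
  pr_vcomp : forall x y (a b c : bhom x y) (p : bcell a b) (q : bcell b c),
    Some (pr2 _ _ _ _ (p ⊙ q)) = vc K (Some (pr2 _ _ _ _ p)) (Some (pr2 _ _ _ _ q));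
  pr_hcomp : forall x y z (a c : bhom x y) (b d : bhom y z)
      (p : bcell a c) (q : bcell b d),
    Some (pr2 _ _ _ _ (p ⊠ q)) = vc K (prti _ _ _ a b) (vc K (W K [] (Some (pr2 _ _ _ _ p)) [pr1 _ _ b])
      (vc K (W K [pr1 _ _ c] (Some (pr2 _ _ _ _ q)) []) (prt _ _ _ c d)));
  pr_asc : forall x y z w (a : bhom x y) (b : bhom y z) (c : bhom z w),
    Some (pr2 _ _ _ _ (asc a b c)) = vc K (prti _ _ _ (a ⊗ b) c) (vc K (W K [] (prti _ _ _ a b) [pr1 _ _ c])
      (vc K (W K [pr1 _ _ a] (prt _ _ _ b c) []) (prt _ _ _ a (b ⊗ c))));
  pr_lun : forall x y (a : bhom x y), Some (pr2 _ _ _ _ (lun a)) = vc K (prti _ _ _ (hunit x) a) (prl _ _ a);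
  pr_run : forall x y (a : bhom x y), Some (pr2 _ _ _ _ (run a)) = vc K (prti _ _ _ a (hunit y)) (prr _ _ a) }.

Arguments pr1 {D X K} P {x y} a : rename.
Arguments pr2 {D X K} P {x y a b} p : rename.
Arguments prt {D X K} P {x y z} a b : rename.
Arguments prti {D X K} P {x y z} a b : rename.
Arguments prl {D X K} P {x y} a : rename.
Arguments prr {D X K} P {x y} a : rename.
Arguments pr2_has {D X K} P {x y a b} p : rename.
Arguments pr2_inj {D X K} P {x y a b} p q _ : rename.
Arguments pr2_full {D X K} P {x y} a b r _ _ : rename.
Arguments prt_has {D X K} P {x y z} a b : rename.
Arguments prt_iso {D X K} P {x y z} a b : rename.
Arguments prl_has {D X K} P {x y} a : rename.
Arguments prl_iso {D X K} P {x y} a : rename.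
Arguments prr_has {D X K} P {x y} a : rename.
Arguments prr_iso {D X K} P {x y} a : rename.
Arguments pr_unit {D X K} P x : rename.
Arguments pr_middle {D X K} P {x y z} a b : rename.
Arguments pr_vid {D X K} P {x y} a : rename.
Arguments pr_vcomp {D X K} P {x y a b c} p q : rename.
Arguments pr_hcomp {D X K} P {x y z a c b d} p q : rename.
Arguments pr_asc {D X K} P {x y z w} a b c : rename.
Arguments pr_lun {D X K} P {x y} a : rename.
Arguments pr_run {D X K} P {x y} a : rename.

Lemma typ_conv (X : merge_data) (p : option (cell2 X)) Γ Δ Γ' Δ' :
  typ p Γ Δ -> Γ = Γ' -> Δ = Δ' -> typ p Γ' Δ'.
Proof. now intros H <- <-. Qed.

Lemma exch_vc X (K : calculus X) A V B p q Γ Δ Γ' Δ' : typ p Γ Δ -> typ q Γ' Δ' ->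
  forall x, vc K (W K A p (V ++ Γ' ++ B)) (vc K (W K (A ++ Δ ++ V) q B) x)
  = vc K (W K (A ++ Γ ++ V) q B) (vc K (W K A p (V ++ Δ' ++ B)) x).
Proof. intros H H' x. rewrite <- !vc_assoc. f_equal. now apply exch. Qed.

Arguments exch_vc {X} K A V B {p q Γ Δ Γ' Δ'} _ _.

Lemma isoc_W_cancel X (K : calculus X) A B p q Γ Δ x Θ : isoc K p q Γ Δ ->
  Γ <> [] -> Δ <> [] -> typ x (A ++ Γ ++ B) Θ ->
  vc K (W K A p B) (vc K (W K A q B) x) = x.
Proof. intros I N N' T. exact (isoc_cancel_l (isoc_W A B N N' I) T). Qed.

Lemma isoc_cancel X (K : calculus X) p q Γ Δ x Θ : isoc K p q Γ Δ -> typ x Γ Θ ->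
  vc K p (vc K q x) = x.
Proof. apply isoc_cancel_l. Qed.

Section Presented.
Variable D : bicat_data.
Variable X : merge_data.
Variable K : calculus X.
Variable P : presentation D K.
Notation vc := (vc K).
Notation W := (W K).
Notation idc := (idc K).
Notation "⌊ a ⌋" := (pr1 P a) (at level 0, format "⌊ a ⌋").
Notation "⟦ p ⟧" := (Some (pr2 P p)) (at level 0, format "⟦ p ⟧").

Lemma pr2_typ x y (a b : @bhom D x y) (p : bcell a b) : typ ⟦p⟧ [⌊a⌋] [⌊b⌋].
Proof. apply has_typ, pr2_has. Qed.

Arguments pr2_typ {x y a b} p.

Lemma prt_typ x y z (a : @bhom D x y) (b : bhom y z) :
  typ (prt P a b) [⌊a⌋; ⌊b⌋] [⌊a ⊗ b⌋].
Proof. apply has_typ, prt_has. Qed.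

Lemma prti_typ x y z (a : @bhom D x y) (b : bhom y z) :
  typ (prti P a b) [⌊a ⊗ b⌋] [⌊a⌋; ⌊b⌋].
Proof. apply (prt_iso P a b). Qed.

Lemma prl_typ x y (a : @bhom D x y) : typ (prl P a) [⌊hunit x⌋; ⌊a⌋] [⌊a⌋].
Proof. apply has_typ, prl_has. Qed.

Lemma prr_typ x y (a : @bhom D x y) : typ (prr P a) [⌊a⌋; ⌊hunit y⌋] [⌊a⌋].
Proof. apply has_typ, prr_has. Qed.

Arguments prt_typ {x y z} a b.
Arguments prti_typ {x y z} a b.
Arguments prl_typ {x y} a.
Arguments prr_typ {x y} a.

Ltac ty0 := first
  [ eapply typ_vc; [ty0 | ty0] | eapply typ_W; ty0 | apply typ_idc
  | apply pr2_typ | apply prt_typ | apply prti_typ | apply prl_typ | apply prr_typ ].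
Ltac ty := eapply typ_conv; [ty0 | cbn [app]; reflexivity | cbn [app]; reflexivity].

Ltac norm := rewrite ?W_vc, ?W_W, ?vc_assoc; cbn [app].

Ltac cancel := repeat first
  [ match goal with |- context [vc (W ?A (prt P ?a ?b) ?B) (vc (W ?A (prti P ?a ?b) ?B) ?x)] =>
      erewrite (isoc_W_cancel A B (x := x) (prt_iso P a b));
        [| discriminate | discriminate | ty] end
  | match goal with |- context [vc (W ?A (prti P ?a ?b) ?B) (vc (W ?A (prt P ?a ?b) ?B) ?x)] =>
      erewrite (isoc_W_cancel A B (x := x) (isoc_sym (prt_iso P a b)));
        [| discriminate | discriminate | ty] end
  | match goal with |- context [vc (prt P ?a ?b) (vc (prti P ?a ?b) ?x)] =>
      erewrite (isoc_cancel (x := x) (prt_iso P a b)); [| ty] end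
  | match goal with |- context [vc (prti P ?a ?b) (vc (prt P ?a ?b) ?x)] =>
      erewrite (isoc_cancel (x := x) (isoc_sym (prt_iso P a b))); [| ty] end
  | match goal with |- context [vc (idc ?Γ) ?x] =>
      erewrite (vc_idl K (p := x)); [| ty] end ].

Ltac formulas := rewrite ?(pr_hcomp P), ?(pr_vcomp P), ?(pr_asc P), ?(pr_lun P),
  ?(pr_run P), ?(pr_vid P); repeat (rewrite ?(pr_hcomp P), ?(pr_vcomp P), ?(pr_asc P), ?(pr_lun P),
  ?(pr_run P), ?(pr_vid P)); rewrite ?W_idc by discriminate; norm; cancel.

Ltac swap_step E := let Z := fresh in pose proof E as Z; cbn [app] in Z; rewrite Z; clear Z.

Ltac swap_back E := let Z := fresh in pose proof E as Z; cbn [app] in Z; rewrite <- Z; clear Z.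

Lemma prt_iso_W A B x y z (a : @bhom D x y) (b : bhom y z) :
  isoc K (W A (prt P a b) B) (W A (prti P a b) B)
    (A ++ [⌊a⌋; ⌊b⌋] ++ B) (A ++ [⌊a ⊗ b⌋] ++ B).
Proof. apply isoc_W; try discriminate. apply prt_iso. Qed.

Arguments prt_iso_W A B {x y z} a b.

Lemma pr_eq x y (a b : @bhom D x y) (p q : bcell a b) : ⟦p⟧ = ⟦q⟧ -> p = q.
Proof. intros H. apply (pr2_inj P). congruence. Qed.

Lemma pr_invertible x y (a b : @bhom D x y) (p : bcell a b) :
  (exists q, isoc K ⟦p⟧ q [⌊a⌋] [⌊b⌋]) -> invertible p.
Proof.
  intros [q I]. pose proof (has_inverse (pr2_has P p) I) as (q' & -> & H1 & H2).
  destruct (pr2_full P _ _ _ H1 H2) as [r Hr]. exists r. subst q'.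
  destruct I as (_ & _ & I1 & I2).
  split; apply pr_eq; now rewrite (pr_vcomp P), (pr_vid P).
Qed.

Lemma prl_natural x y (a b : @bhom D x y) (p : bcell a b) :
  vc (W [⌊hunit x⌋] ⟦p⟧ []) (prl P b) = vc (prl P a) ⟦p⟧.
Proof.
  assert (F : ff K [⌊hunit x⌋] []) by apply (pr_unit P).
  pose proof (@left_natural X K ⌊hunit x⌋ ⌊a⌋ ⌊b⌋ (prr P (hunit x)) (prl P a) (prl P b) F
    (prr_has P _) (prl_has P a) (prl_has P b)) as N.
  rewrite <- (W_nil K (prl P a)), <- (W_nil K (prl P b)).
  apply N.
  - symmetry. apply (pr_middle P).
  - symmetry. apply (pr_middle P).
  - apply pr2_has.
Qed.

Lemma prr_natural x y (a b : @bhom D x y) (p : bcell a b) :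
  vc (W [] ⟦p⟧ [⌊hunit y⌋]) (prr P b) = vc (prr P a) ⟦p⟧.
Proof.
  assert (F : ff K [] [⌊hunit y⌋]) by apply (pr_unit P).
  pose proof (@right_natural X K ⌊hunit y⌋ ⌊a⌋ ⌊b⌋ (prl P (hunit y)) (prr P a) (prr P b) F
    (prl_has P _) (prr_has P a) (prr_has P b)) as N.
  rewrite <- (W_nil K (prr P a)), <- (W_nil K (prr P b)).
  apply (N (pr_middle P _ _) (pr_middle P _ _) _ [] []).
  apply pr2_has.
Qed.

(** Every axiom becomes an equation in the calculus.  Once tensors have been cancelled
    against their inverses, what remains is an instance of the exchange law, and, for
    the unit axioms, of the naturality and coherence of the unitors. *)
Theorem presented_bicat : is_bicat D.
Proof.
  constructor; intros.
  - apply pr_eq. formulas. reflexivity.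
  - apply pr_eq. formulas. apply (vc_idr K (pr2_typ p)).
  - apply pr_eq. formulas. reflexivity.
  - apply pr_eq. formulas. apply (isoc_sym (prt_iso P a b)).
  - apply pr_eq. formulas.
    do 2 f_equal. swap_step (exch_vc K [] [] [] (pr2_typ q) (pr2_typ p')). reflexivity.
  - apply pr_invertible. rewrite (pr_asc P). eexists.
    exact (isoc_vc (isoc_sym (prt_iso P (a ⊗ b) c))
      (isoc_vc (isoc_sym (prt_iso_W [] [⌊c⌋] a b))
        (isoc_vc (prt_iso_W [⌊a⌋] [] b c) (prt_iso P a (b ⊗ c))))).
  - apply pr_invertible. rewrite (pr_lun P). destruct (prl_iso P a) as [q I]. eexists.
    eapply isoc_vc; [apply isoc_sym, prt_iso | exact I].
  - apply pr_invertible. rewrite (pr_run P). destruct (prr_iso P a) as [q I]. eexists.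
    eapply isoc_vc; [apply isoc_sym, prt_iso | exact I].
  - apply pr_eq. formulas.
    swap_step (exch_vc K [] [] [] (prt_typ a' b') (pr2_typ r)). cancel.
    swap_back (exch_vc K [] [] [] (pr2_typ p) (prt_typ b c)). cancel. reflexivity.
  - apply pr_eq. formulas. now rewrite prl_natural.
  - apply pr_eq. formulas. now rewrite prr_natural.
  - apply pr_eq. formulas.
    swap_step (exch_vc K [] [] [] (prti_typ a b) (prt_typ c d)). reflexivity.
  - apply pr_eq. formulas. rewrite <- !vc_assoc. do 2 f_equal.
    rewrite <- (pr_middle P). reflexivity.
Qed.

End Presented.

(** * Pseudofunctors between presented bicategories *)

Notation W_in := W.

(** A map of calculi [f] induces a pseudofunctor between the bicategories that they
    present.  Its tensor constraints are the comparisons of tensors with images of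
    tensors; for the units it is enough to prescribe one equation, at the unit
    itself. *)
Section PresentedPsf.
Variables D D' : bicat_data.
Variables X X' : merge_data.
Variable K : calculus X.
Variable K' : calculus X'.
Variable P : presentation D K.
Variable P' : presentation D' K'.
Variable f : merge_map X X'.
Hypothesis Hf : calculus_map K K' f.
Variable F : psf_data D D'.

Notation vc := (vc K').
Notation W := (W K').
Notation idc := (idc K').
Notation "⌊ a ⌋" := (pr1 P' a) (at level 0, format "⌊ a ⌋").
Notation "⟦ p ⟧" := (Some (pr2 P' p)) (at level 0, format "⟦ p ⟧").
Notation im := (option_map (m2 f)).
Notation τ a b := (im (prt P a b)).
Notation τi a b := (im (prti P a b)).

Hypothesis F1 : forall x y (a : @bhom D x y), ⌊f1 F a⌋ = m1 f (pr1 P a).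
Hypothesis F2 : forall x y (a b : @bhom D x y) (p : bcell a b),
  pr2 P' (f2 F p) = m2 f (pr2 P p).
Hypothesis Ft : forall x y z (a : @bhom D x y) (b : bhom y z),
  ⟦ften F a b⟧ = vc (prti P' (f1 F a) (f1 F b)) (τ a b).
Hypothesis Fu : forall x,
  vc (W [] ⟦funit F x⟧ [⌊f1 F (hunit x)⌋]) (im (prl P (hunit x)))
  = prl P' (f1 F (hunit x)).
Hypothesis FU : forall x, unitlike K' (⌊f1 F (hunit x)⌋).

Lemma im_τ_has x y z (a : @bhom D x y) (b : bhom y z) :
  has X' (τ a b) [⌊f1 F a⌋; ⌊f1 F b⌋] [⌊f1 F (a ⊗ b)⌋].
Proof. rewrite !F1. apply (cm_has Hf (prt_has P a b)). Qed.

Lemma im_τ_iso x y z (a : @bhom D x y) (b : bhom y z) :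
  isoc K' (τ a b) (τi a b) [⌊f1 F a⌋; ⌊f1 F b⌋] [⌊f1 F (a ⊗ b)⌋].
Proof. rewrite !F1. apply (cm_isoc Hf (prt_has P a b) (prt_iso P a b)). Qed.

Lemma im_l_has x y (a : @bhom D x y) :
  has X' (im (prl P a)) [⌊f1 F (hunit x)⌋; ⌊f1 F a⌋] [⌊f1 F a⌋].
Proof. rewrite !F1. apply (cm_has Hf (prl_has P a)). Qed.

Lemma im_r_has x y (a : @bhom D x y) :
  has X' (im (prr P a)) [⌊f1 F a⌋; ⌊f1 F (hunit y)⌋] [⌊f1 F a⌋].
Proof. rewrite !F1. apply (cm_has Hf (prr_has P a)). Qed.

Lemma im_l_iso x y (a : @bhom D x y) : exists q,
  isoc K' (im (prl P a)) q [⌊f1 F (hunit x)⌋; ⌊f1 F a⌋] [⌊f1 F a⌋].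
Proof.
  rewrite !F1. destruct (prl_iso P a) as [q I]. exists (im q).
  apply (cm_isoc Hf (prl_has P a) I).
Qed.

Arguments im_τ_has {x y z} a b.
Arguments im_τ_iso {x y z} a b.
Arguments im_l_has {x y} a.
Arguments im_r_has {x y} a.
Arguments im_l_iso {x y} a.

Lemma f2_im x y (a b : @bhom D x y) (p : bcell a b) : ⟦f2 F p⟧ = im (Some (pr2 P p)).
Proof. simpl. now rewrite F2. Qed.

Ltac img := repeat first
  [ apply (cm_vc Hf) | apply (cm_W Hf); [| simpl; rewrite ?F1; reflexivity ..]
  | apply ple_refl ].

Lemma im_eq x y (a b : @bhom D x y) (p : bcell a b) e e' :
  Some (pr2 P p) = e -> ple (im e) e' -> ⟦f2 F p⟧ = e'.
Proof. intros E H. rewrite f2_im. symmetry. apply H. now rewrite <- E. Qed.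

Lemma im_hcomp x y z (a c : @bhom D x y) (b d : bhom y z) (p : bcell a c) (q : bcell b d) :
  ⟦f2 F (p ⊠ q)⟧ = vc (τi a b) (vc (W [] ⟦f2 F p⟧ [⌊f1 F b⌋])
    (vc (W [⌊f1 F c⌋] ⟦f2 F q⟧ []) (τ c d))).
Proof. eapply im_eq; [apply (pr_hcomp P)|]. rewrite !f2_im. img. Qed.

Lemma im_asc x y z w (a : @bhom D x y) (b : bhom y z) (c : bhom z w) :
  ⟦f2 F (asc a b c)⟧ = vc (τi (a ⊗ b) c) (vc (W [] (τi a b) [⌊f1 F c⌋])
    (vc (W [⌊f1 F a⌋] (τ b c) []) (τ a (b ⊗ c)))).
Proof. eapply im_eq; [apply (pr_asc P)|]. img. Qed.

Lemma im_lun x y (a : @bhom D x y) :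
  ⟦f2 F (lun a)⟧ = vc (τi (hunit x) a) (im (prl P a)).
Proof. eapply im_eq; [apply (pr_lun P)|]. img. Qed.

Lemma im_run x y (a : @bhom D x y) :
  ⟦f2 F (run a)⟧ = vc (τi a (hunit y)) (im (prr P a)).
Proof. eapply im_eq; [apply (pr_run P)|]. img. Qed.

Lemma im_middle x y z (a : @bhom D x y) (b : bhom y z) :
  W [] (im (prr P a)) [⌊f1 F b⌋] = W [⌊f1 F a⌋] (im (prl P b)) [].
Proof.
  assert (H : has X (W_in K [] (prr P a) [pr1 P b])
    [pr1 P a; pr1 P (hunit y); pr1 P b] [pr1 P a; pr1 P b]).
  { apply (has_W K [] [pr1 P b] (prr_has P a)).
    apply (composable_glue [pr1 P a] (B := [pr1 P (hunit y)]) [pr1 P b]); [discriminate| |].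
    - exact (has_inp (prr_has P a)).
    - exact (has_inp (prl_has P b)). }
  destruct H as (r & E & _). pose proof E as E'. rewrite (pr_middle P) in E'.
  assert (G : ple (im (W_in K [] (prr P a) [pr1 P b])) (W [] (im (prr P a)) [⌊f1 F b⌋])) by img.
  assert (G' : ple (im (W_in K [pr1 P a] (prl P b) [])) (W [⌊f1 F a⌋] (im (prl P b)) [])) by img.
  rewrite E in G. rewrite E' in G'. now rewrite (G _ eq_refl), (G' _ eq_refl).
Qed.

Lemma unit_has x : has X' ⟦funit F x⟧ [⌊hunit (f0 F x)⌋] [⌊f1 F (hunit x)⌋].
Proof. apply (pr2_has P'). Qed.

Lemma unit_right_eq x y (a : @bhom D x y) :
  vc (W [⌊f1 F a⌋] ⟦funit F y⟧ []) (im (prr P a)) = prr P' (f1 F a).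
Proof.
  apply (@unit_compare_r X' K' ⌊hunit (f0 F y)⌋ ⌊f1 F (hunit y)⌋ ⟦funit F y⟧
    (prl P' (f1 F (hunit y))) (im (prl P (hunit y)))).
  - apply FU.
  - apply unit_has.
  - apply Fu.
  - apply prr_has.
  - apply im_r_has.
  - apply (composable_glue [⌊f1 F a⌋] (B := [⌊hunit (f0 F y)⌋]) [⌊f1 F (hunit y)⌋]);
      [discriminate| |].
    + exact (has_inp (prr_has P' _)).
    + exact (has_inp (prl_has P' _)).
  - apply pr_middle.
  - apply im_middle.
Qed.

Lemma unit_left_eq x y (a : @bhom D x y) :
  vc (W [] ⟦funit F x⟧ [⌊f1 F a⌋]) (im (prl P a)) = prl P' (f1 F a).
Proof.
  apply (@unit_compare_l X' K' ⌊hunit (f0 F x)⌋ ⌊f1 F (hunit x)⌋ ⟦funit F x⟧)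
    with (rj := prr P' (f1 F (hunit x))) (ρj := im (prr P (hunit x))).
  - apply FU.
  - apply unit_has.
  - apply prl_has.
  - apply im_l_has.
  - apply (composable_glue [⌊f1 F (hunit x)⌋] (B := [⌊hunit (f0 F x)⌋]) [⌊f1 F a⌋]);
      [discriminate| |].
    + exact (has_inp (prr_has P' _)).
    + exact (has_inp (prl_has P' _)).
  - apply pr_middle.
  - apply im_middle.
  - apply unit_right_eq.
Qed.

Let t_typ := @prt_typ D' X' K' P'.
Let ti_typ := @prti_typ D' X' K' P'.
Let l_typ := @prl_typ D' X' K' P'.
Let r_typ := @prr_typ D' X' K' P'.
Let c_typ := @pr2_typ D' X' K' P'.

Lemma τ_typ x y z (a : @bhom D x y) (b : bhom y z) :
  typ (τ a b) [⌊f1 F a⌋; ⌊f1 F b⌋] [⌊f1 F (a ⊗ b)⌋].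
Proof. apply has_typ, im_τ_has. Qed.

Lemma τi_typ x y z (a : @bhom D x y) (b : bhom y z) :
  typ (τi a b) [⌊f1 F (a ⊗ b)⌋] [⌊f1 F a⌋; ⌊f1 F b⌋].
Proof. apply im_τ_iso. Qed.

Lemma iml_typ x y (a : @bhom D x y) :
  typ (im (prl P a)) [⌊f1 F (hunit x)⌋; ⌊f1 F a⌋] [⌊f1 F a⌋].
Proof. apply has_typ, im_l_has. Qed.

Lemma imr_typ x y (a : @bhom D x y) :
  typ (im (prr P a)) [⌊f1 F a⌋; ⌊f1 F (hunit y)⌋] [⌊f1 F a⌋].
Proof. apply has_typ, im_r_has. Qed.

Ltac ty0 := first
  [ eapply typ_vc; [ty0 | ty0] | eapply typ_W; ty0 | apply typ_idc
  | apply c_typ | apply t_typ | apply ti_typ | apply l_typ | apply r_typ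
  | apply τ_typ | apply τi_typ | apply iml_typ | apply imr_typ ].
Ltac ty := eapply typ_conv; [ty0 | cbn [app]; reflexivity | cbn [app]; reflexivity].

Ltac norm := rewrite ?W_vc, ?W_W, ?vc_assoc; cbn [app].

Ltac cancel_with t ti iso :=
  first
  [ match goal with |- context [vc (W ?A (t ?a ?b) ?B) (vc (W ?A (ti ?a ?b) ?B) ?x)] =>
      erewrite (isoc_W_cancel A B (x := x) (iso a b)); [| discriminate | discriminate | ty] end
  | match goal with |- context [vc (W ?A (ti ?a ?b) ?B) (vc (W ?A (t ?a ?b) ?B) ?x)] =>
      erewrite (isoc_W_cancel A B (x := x) (isoc_sym (iso a b)));
        [| discriminate | discriminate | ty] end ].

Ltac cancel := repeat first
  [ match goal with |- context [vc (prt P' ?a ?b) (vc (prti P' ?a ?b) ?x)] =>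
      erewrite (isoc_cancel (x := x) (prt_iso P' a b)); [| ty] end
  | match goal with |- context [vc (prti P' ?a ?b) (vc (prt P' ?a ?b) ?x)] =>
      erewrite (isoc_cancel (x := x) (isoc_sym (prt_iso P' a b))); [| ty] end
  | match goal with |- context [vc (τ ?a ?b) (vc (τi ?a ?b) ?x)] =>
      erewrite (isoc_cancel (x := x) (im_τ_iso a b)); [| ty] end
  | match goal with |- context [vc (W ?A (prt P' ?a ?b) ?B) (vc (W ?A (prti P' ?a ?b) ?B) ?x)] =>
      erewrite (isoc_W_cancel A B (x := x) (prt_iso P' a b));
        [| discriminate | discriminate | ty] end
  | match goal with |- context [vc (W ?A (τ ?a ?b) ?B) (vc (W ?A (τi ?a ?b) ?B) ?x)] =>
      erewrite (isoc_W_cancel A B (x := x) (im_τ_iso a b));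
        [| discriminate | discriminate | ty] end
  | match goal with |- context [vc (idc ?Γ) ?x] =>
      erewrite (vc_idl K' (p := x)); [| ty] end ].

Ltac formulas := repeat progress (rewrite ?(pr_hcomp P'), ?(pr_vcomp P'), ?(pr_asc P'),
  ?(pr_lun P'), ?(pr_run P'), ?(pr_vid P'), ?Ft, ?im_hcomp, ?im_asc, ?im_lun, ?im_run);
  rewrite ?W_idc by discriminate; norm; cancel.

Theorem presented_psf : is_psf F.
Proof.
  constructor; intros.
  - apply (pr_eq P'). rewrite (pr_vid P'). eapply im_eq; [apply (pr_vid P)|].
    pose proof (cm_idc Hf [pr1 P a]) as Z. simpl in Z. rewrite <- F1 in Z. exact Z.
  - apply (pr_eq P'). rewrite (pr_vcomp P'). eapply im_eq; [apply (pr_vcomp P)|].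
    rewrite !f2_im. img.
  - apply (pr_invertible P'). rewrite Ft. eexists.
    eapply isoc_vc; [apply isoc_sym, prt_iso | apply im_τ_iso].
  - apply (pr_invertible P').
    destruct (prl_iso P' (f1 F (hunit x))) as [l' Il]. destruct (im_l_iso (hunit x)) as [λ' Iλ].
    eapply (@unit_compare_iso X' K' _ _ ⟦funit F x⟧).
    + apply FU.
    + apply unit_has.
    + apply Fu.
    + exact (has_inp (prl_has P' _)).
    + exact Il.
    + exact Iλ.
  - apply (pr_eq P'). formulas. reflexivity.
  - apply (pr_eq P'). formulas. reflexivity.
  - apply (pr_eq P'). formulas. now rewrite unit_left_eq.
  - apply (pr_eq P'). formulas. now rewrite unit_right_eq.
Qed.

End PresentedPsf.

(** * The functor from merge-bicategories to bicategories *)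

Section CancelBicat.
Variable B : bicat_data.
Hypothesis HB : is_bicat B.

Lemma invertible_epi x y (a b c : @bhom B x y) (p : bcell a b) (q q' : bcell b c) :
  invertible p -> p ⊙ q = p ⊙ q' -> q = q'.
Proof.
  intros (r & H1 & H2) E. rewrite <- (vidl HB _ _ _ _ q), <- (vidl HB _ _ _ _ q'), <- H2.
  now rewrite !(vassoc HB), E.
Qed.

Lemma invertible_mono x y (a b c : @bhom B x y) (p p' : bcell a b) (q : bcell b c) :
  invertible q -> p ⊙ q = p' ⊙ q -> p = p'.
Proof.
  intros (r & H1 & H2) E. rewrite <- (vidr HB _ _ _ _ p), <- (vidr HB _ _ _ _ p'), <- H1.
  now rewrite <- !(vassoc HB), E.
Qed.

Lemma invertible_hcomp x y z (a c : @bhom B x y) (b d : bhom y z)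
  (p : bcell a c) (q : bcell b d) : invertible p -> invertible q -> invertible (p ⊠ q).
Proof.
  intros (r & H1 & H2) (s & H3 & H4). exists (r ⊠ s).
  now rewrite <- !(interchange HB), H1, H2, H3, H4, !(hvid HB).
Qed.

End CancelBicat.

Arguments invertible_epi {B} HB {x y a b c} p q q' _ _.
Arguments invertible_mono {B} HB {x y a b c} p p' q _ _.
Arguments invertible_hcomp {B} HB {x y z a c b d} p q _ _.

(** The left unit axiom at the unit 1-cell determines [u x ⊠ vid] up to invertible
    cells, and the unit 1-cell can be cancelled.  Hence equality of pseudofunctors need
    not be checked on the unit cells. *)
Lemma psf_unit_unique (B C : bicat_data) (HB : is_bicat B) (HC : is_bicat C) g0 g1 g2 t u u' :
  is_psf (@PsfData B C g0 g1 g2 t u) -> is_psf (@PsfData B C g0 g1 g2 t u') ->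
  forall x, u x = u' x.
Proof.
  intros H H' x.
  pose proof (funit_lun H _ _ (hunit x)) as E. pose proof (funit_lun H' _ _ (hunit x)) as E'.
  simpl in E, E'. rewrite <- E' in E. clear E'.
  apply (invertible_mono HC) in E.
  2:{ apply (invertible_f2 H). apply (lun_inv HB). }
  apply (invertible_mono HC) in E; [|apply (ften_inv H)].
  apply (invertible_epi HC (run (hunit (g0 x)))); [apply (run_inv HC)|].
  rewrite <- !(run_nat HC). f_equal.
  apply (invertible_mono HC _ _ (vid (g1 _ _ (hunit x)) ⊠ u x)).
  { apply (invertible_hcomp HC); [now apply invertible_vid | apply (funit_inv H)]. }
  rewrite <- !(interchange HC), !(vidl HC), !(vidr HC).
  rewrite <- (vidl HC _ _ _ _ (u x)) at 1. rewrite <- (vidr HC _ _ _ _ (u x)) at 2.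
  rewrite <- (vidl HC _ _ _ _ (u' x)). rewrite <- (vidr HC _ _ _ _ (u x)) at 3.
  rewrite !(interchange HC). now rewrite E.
Qed.

Lemma sig_eq (A : Type) (P : A -> Prop) (a b : {x | P x}) : proj1_sig a = proj1_sig b -> a = b.
Proof. destruct a, b; simpl; intros ->. f_equal. apply proof_irrelevance. Qed.

Definition rep_calculus (X : rep_merge_bicat) : calculus X :=
  unital_calculus X (rep_unital (repP X)).

Section GPresentation.
Variable X : rep_merge_bicat.
Variable K : calculus X.
Variable c : coherent_choice X.

Lemma Gtcell_isom x y z (a : Ghom X x y) (b : Ghom X y z) : isom K (Gtcell c a b).
Proof. eapply universal_isom; [apply Gtcell_out | apply Gtcell_univ]. Qed.

Lemma Gtcell_has x y z (a : Ghom X x y) (b : Ghom X y z) :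
  has X (Some (Gtcell c a b)) [proj1_sig a; proj1_sig b] [proj1_sig (Gten c a b)].
Proof. rewrite <- (Gtcell_inp X c a b), <- Gtcell_out. apply has_Some. Qed.

Definition Gtinv x y z (a : Ghom X x y) (b : Ghom X y z) : option (cell2 X) :=
  chosen (Gtcell_isom a b).

Lemma Gtinv_iso x y z (a : Ghom X x y) (b : Ghom X y z) :
  isoc K (Some (Gtcell c a b)) (Gtinv a b) [proj1_sig a; proj1_sig b] [proj1_sig (Gten c a b)].
Proof.
  rewrite <- (Gtcell_inp X c a b), <- Gtcell_out. exact (chosenP (Gtcell_isom a b)).
Qed.

Lemma Gcell_has x y (a b : Ghom X x y) (p : Gcell a b) :
  has X (Some (proj1_sig p)) [proj1_sig a] [proj1_sig b].
Proof. destruct p as [p [H1 H2]]; simpl. rewrite <- H1, <- H2. apply has_Some. Qed.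

Lemma cut_one t s r a Γ1 Γ2 : out t = [a] -> inp s = Γ1 ++ a :: Γ2 ->
  is_cut X 1 (S (length Γ1)) t s r <-> Some r = vc K (W K Γ1 (Some t) Γ2) (Some s).
Proof.
  intros H1 H2. rewrite (@cut_iff X K t s r [] a [] Γ1 Γ2) by auto. now rewrite W_nil.
Qed.

Arguments cut_one {t} s r {a} Γ1 Γ2 _ _.

Lemma Gthe_spec x y (a b : Ghom X x y) (Q : cell2 X -> Prop) H :
  Q (proj1_sig (Gthe a b Q H)).
Proof. apply (theP _ H). Qed.

Lemma tensor_solve x y z (a : Ghom X x y) (b : Ghom X y z) (r v : cell2 X) :
  inp r = [proj1_sig (Gten c a b)] ->
  Some v = vc K (Some (Gtcell c a b)) (Some r) -> Some r = vc K (Gtinv a b) (Some v).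
Proof.
  intros Hr ->. symmetry. eapply isoc_cancel_l.
  - apply isoc_sym, Gtinv_iso.
  - rewrite <- Hr. apply typ_Some.
Qed.

(** The equations that define the operations of [GX] are solved for the unknown cell
    by composing with inverse tensors.  The coherence of the units is the middle
    coherence of the chosen unitors, merged with a unit on [(a, b)]. *)
Definition G_presentation : presentation (G_data X c) K.
Proof.
  refine (@Presentation (G_data X c) X K (fun x y a => proj1_sig a)
    (fun x y a b p => proj1_sig p)
    (fun x y z a b => Some (Gtcell c a b)) (fun x y z a b => Gtinv a b)
    (fun x y a => Some (lwit c (proj1_sig a))) (fun x y a => Some (rwit c (proj1_sig a)))
    _ _ _ _ _ _ _ _ _ _ _ _ _ _ _ _ _).
  - intros. apply Gcell_has.
  - intros x y a b p q. apply sig_eq.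
  - intros x y a b r H1 H2. exists (exist _ r (conj H1 H2)). reflexivity.
  - intros. apply Gtcell_has.
  - intros. apply Gtinv_iso.
  - intros x y a. destruct (lwitP c (proj1_sig a)) as (H1 & H2 & _).
    exists (lwit c (proj1_sig a)). rewrite H1, H2. simpl. destruct (proj2_sig a) as [-> _]. auto.
  - intros x y a. destruct (lwitP c (proj1_sig a)) as (H1 & H2 & H3 & _).
    destruct (universal_isom K H2 H3) as [q Iq]. exists q. rewrite H1, H2 in Iq.
    destruct (proj2_sig a) as [E _]. rewrite E in Iq. exact Iq.
  - intros x y a. destruct (rwitP c (proj1_sig a)) as (H1 & H2 & _).
    exists (rwit c (proj1_sig a)). rewrite H1, H2. simpl. destruct (proj2_sig a) as [_ ->]. auto.
  - intros x y a. destruct (rwitP c (proj1_sig a)) as (H1 & H2 & H3 & _).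
    destruct (universal_isom K H2 H3) as [q Iq]. exists q. rewrite H1, H2 in Iq.
    destruct (proj2_sig a) as [_ E]. rewrite E in Iq. exact Iq.
  - intros x. eapply (tensor_unit_unitlike K), (oneP c x).
  - intros x y z a b.
    assert (C : composable X [proj1_sig a; proj1_sig b])
      by now apply composable_two, Gcomposable.
    destruct (idc_def K C) as (e & E & E1 & E2 & _).
    destruct (mid_coh c e _ _ [] [] E1 eq_refl) as (r & R1 & R2).
    destruct (rwitP c (proj1_sig a)) as (H1 & H2 & _).
    destruct (lwitP c (proj1_sig b)) as (H3 & H4 & _).
    apply (cut_one _ _ [] [proj1_sig b] H2 E1) in R1.
    apply (cut_one _ _ [proj1_sig a] [] H4 E1) in R2.
    pose proof (typ_W K [] [proj1_sig b] (typ_Some (rwit c (proj1_sig a)))) as T1.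
    pose proof (typ_W K [proj1_sig a] [] (typ_Some (lwit c (proj1_sig b)))) as T2.
    rewrite H2 in T1. rewrite H4 in T2. rewrite <- E in R1, R2. cbn [app] in T1, T2.
    rewrite (vc_idr K T1) in R1. rewrite (vc_idr K T2) in R2. congruence.
  - intros x y a. symmetry. apply idc_Some, unit_neutral.
    apply (Gthe_spec a a (is_unit X [proj1_sig a]) (Gvid_ex X (proj1_sig a))).
  - intros x y a b d p q. simpl.
    pose proof (Gthe_spec a d (is_cut X 1 1 (proj1_sig p) (proj1_sig q))
      (Gvcomp_ex X _ _ (proj1 (proj2_sig p)) (proj2 (proj2_sig p))
       (proj1 (proj2_sig q)) (proj2 (proj2_sig q)))) as S.
    apply (cut_one _ _ [] [] (proj2 (proj2_sig p)) (proj1 (proj2_sig q))) in S.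
    now rewrite W_nil in S.
  - intros x y z a a' b b' p q.
    destruct (Gthe_spec _ _ _ (Ghcomp_ex X c p q)) as (u & v & S1 & S2 & S3).
    apply (cut_one _ _ [] [proj1_sig b'] (proj2 (proj2_sig p)) (Gtcell_inp X c a' b')) in S1.
    assert (Hu : inp u = [proj1_sig a; proj1_sig b']).
    { destruct (Gcell_has p) as (p' & E & P1 & P2). injection E as <-.
      pose proof (typ_vc K (typ_W K [] [proj1_sig b'] (typ_Some (proj1_sig p)))
        (typ_Some (Gtcell c a' b')) _ (eq_sym S1)) as [T _].
      now rewrite P1 in T. }
    apply (cut_one _ _ [proj1_sig a] [] (proj2 (proj2_sig q)) Hu) in S2.
    match goal with |- Some ?r = _ => 
      apply (cut_one r _ [] [] (Gtcell_out X c a b) (proj1 (proj2_sig (Ghcomp X c p q)))) in S3 end.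
    rewrite W_nil in S3. apply tensor_solve in S3; [|exact (proj1 (proj2_sig (Ghcomp X c p q)))].
    etransitivity; [exact S3|]. rewrite S2, S1. f_equal.
    rewrite <- !vc_assoc. f_equal.
    pose proof (exch K [] [] [] (has_typ (Gcell_has p)) (has_typ (Gcell_has q))) as Z.
    cbn [app] in Z. now rewrite Z.
  - intros x y z w a b d.
    destruct (Gthe_spec _ _ _ (Gasc_ex X c a b d)) as (u & v & S1 & S2 & S3).
    apply (cut_one _ _ [] [proj1_sig d] (Gtcell_out X c a b) (Gtcell_inp X c (Gten c a b) d)) in S1.
    apply (cut_one _ _ [proj1_sig a] [] (Gtcell_out X c b d) (Gtcell_inp X c a (Gten c b d))) in S2.
    assert (Hu : out u = [proj1_sig (Gten c (Gten c a b) d)]).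
    { pose proof (typ_vc K (typ_W K [] [proj1_sig d] (typ_Some (Gtcell c a b)))
        (typ_Some (Gtcell c (Gten c a b) d)) _ (eq_sym S1)) as [_ T].
      now rewrite Gtcell_out in T. }
    match goal with |- Some ?r = _ => 
      apply (cut_one r _ [] [] Hu (proj1 (proj2_sig (Gasc X c a b d)))) in S3 end.
    rewrite W_nil, S1 in S3. simpl. unfold Gasc. rewrite <- S2, S3, !vc_assoc.
    assert (I : isoc K (W K [] (Some (Gtcell c a b)) [proj1_sig d])
      (W K [] (Gtinv a b) [proj1_sig d]) [proj1_sig a; proj1_sig b; proj1_sig d]
      [proj1_sig (Gten c a b); proj1_sig d]).
    { apply (isoc_W [] [proj1_sig d] (Γ := [proj1_sig a; proj1_sig b])
        (Δ := [proj1_sig (Gten c a b)])); try discriminate. apply Gtinv_iso. }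
    apply isoc_sym in I. erewrite (isoc_cancel_l I).
    + symmetry. eapply isoc_cancel_l; [apply isoc_sym, Gtinv_iso|].
      exact (has_typ (Gcell_has (Gasc X c a b d))).
    + eapply typ_vc; [apply (has_typ (Gtcell_has (Gten c a b) d))|].
      exact (has_typ (Gcell_has (Gasc X c a b d))).
  - intros x y a. pose proof (Gthe_spec _ _ _ (Glun_ex X c a)) as S. cbv beta in S.
    match goal with |- Some ?r = _ => 
      apply (cut_one r _ [] [] (Gtcell_out X c (Gone c x) a) (proj1 (proj2_sig (Glun X c a)))) in S end.
    rewrite W_nil in S. apply tensor_solve in S; [exact S | exact (proj1 (proj2_sig (Glun X c a)))].
  - intros x y a. pose proof (Gthe_spec _ _ _ (Grun_ex X c a)) as S. cbv beta in S.
    match goal with |- Some ?r = _ => 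
      apply (cut_one r _ [] [] (Gtcell_out X c a (Gone c y)) (proj1 (proj2_sig (Grun X c a)))) in S end.
    rewrite W_nil in S. apply tensor_solve in S; [exact S | exact (proj1 (proj2_sig (Grun X c a)))].
Defined.

End GPresentation.

Arguments cut_one {X} K {t} s r {a} Γ1 Γ2 _ _.
Arguments tensor_solve {X} K c {x y z} a b r {v} _ _.

Lemma rep_rich (X : rep_merge_bicat) (K : calculus X) : rich K.
Proof. apply representable_rich, (repP X). Qed.

(** The calculus of [X] is strict: all the weakness of [GX] is due to the choice of
    tensors. *)
Lemma G_data_bicat (X : rep_merge_bicat) (c : coherent_choice X) : is_bicat (G_data X c).
Proof. exact (presented_bicat (G_presentation X (rep_calculus X) c)). Qed.

Section GMap.
Variables X Y : rep_merge_bicat.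
Variable cX : coherent_choice X.
Variable cY : coherent_choice Y.
Variable f : strong_morphism X Y.
Let KX := rep_calculus X.
Let KY := rep_calculus Y.

Lemma G_calculus_map : calculus_map KX KY f.
Proof. apply strong_calculus_map; apply rep_rich. Qed.

Lemma Gmap_ten_eq (K : calculus Y) x y z (a : Ghom X x y) (b : Ghom X y z) :
  Some (proj1_sig (Gmap_ten X Y cX cY f a b))
  = vc K (Gtinv Y K cY (Gmap1 X Y f a) (Gmap1 X Y f b)) (Some (m2 f (Gtcell cX a b))).
Proof.
  pose proof (Gthe_spec _ _ _ _ (Gmap_ten_ex X Y cX cY f a b)) as S. cbv beta in S.
  pose proof (proj2_sig (Gmap_ten X Y cX cY f a b)) as [H1 H2].
  apply (cut_one K _ _ [] [] (Gtcell_out Y cY _ _) H1) in S. rewrite W_nil in S.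
  apply tensor_solve in S; auto.
Qed.

Lemma G_map_psf : is_psf (G_map X Y cX cY f).
Proof.
  apply (presented_psf (G_presentation X KX cX) (G_presentation Y KY cY) G_calculus_map).
  - reflexivity.
  - reflexivity.
  - intros. apply Gmap_ten_eq.
  - intros x. pose proof (Gthe_spec _ _ _ _ (Gmap_unit_ex X Y cX cY f x)) as S. cbv beta in S.
    pose proof (proj2_sig (Gmap_unit X Y cX cY f x)) as [H1 H2].
    destruct (lwitP cX (one cX x)) as (L1 & _).
    destruct (oneP cX x) as (E1 & _). rewrite E1 in L1.
    assert (L : inp (m2 f (lwit cX (one cX x))) = [m1 f (one cX x); m1 f (one cX x)])
      by now rewrite (m_inp (smap_morphism f)), L1.
    apply (cut_one KY _ _ [] [m1 f (one cX x)] H2 L) in S.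
    symmetry. exact S.
  - intros x. apply (strong_unitlike (KX := KX) (rep_rich _ KX) (rep_rich _ KY)).
    apply (pr_unit (G_presentation X KX cX)).
Qed.

End GMap.

Arguments G_calculus_map {X Y} f.
Arguments Gmap_ten_eq {X Y} cX cY f K {x y z} a b.
Arguments G_map_psf {X Y} cX cY f.

(** Pseudofunctors into [GY] have untyped components, so that they can be compared
    without transport. *)
Lemma G_psf_eq (B : bicat_data) (HB : is_bicat B) (Y : rep_merge_bicat)
  (c : coherent_choice Y) (F F' : psf_data B (G_data Y c)) : is_psf F -> is_psf F' ->
  (forall x, f0 F x = f0 F' x) ->
  (forall x y (a : bhom x y), proj1_sig (f1 F a) = proj1_sig (f1 F' a)) ->
  (forall x y (a b : bhom x y) (p : bcell a b),
     proj1_sig (f2 F p) = proj1_sig (f2 F' p)) ->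
  (forall x y z (a : bhom x y) (b : bhom y z),
     proj1_sig (ften F a b) = proj1_sig (ften F' a b)) -> F = F'.
Proof.
  destruct F as [g0 g1 g2 t u], F' as [g0' g1' g2' t' u']; simpl. intros H H' E0 E1 E2 E3.
  assert (g0 = g0') by (apply functional_extensionality; auto). subst g0'.
  assert (g1 = g1').
  { do 3 (apply functional_extensionality_dep; intro). apply sig_eq, E1. }
  subst g1'.
  assert (g2 = g2').
  { do 5 (apply functional_extensionality_dep; intro). apply sig_eq, E2. }
  subst g2'.
  assert (t = t').
  { do 5 (apply functional_extensionality_dep; intro). apply sig_eq, E3. }
  subst t'. f_equal. apply functional_extensionality_dep.
  exact (psf_unit_unique HB (G_data_bicat Y c) H H').
Qed.

Lemma G_is_functorial (c : coherent_choices) : G_functorial c.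
Proof.
  assert (HB : forall X : rep_merge_bicat, is_bicat (G_data X (c X)))
    by (intros; apply G_data_bicat).
  constructor; auto.
  - intros. apply G_map_psf.
  - intros X. set (KX := rep_calculus X).
    apply (G_psf_eq (HB X)); auto.
    + apply G_map_psf.
    + apply (psf_id_is (Bicat (HB X))).
    + intros x y z a b. assert (E : forall p q : cell2 X, Some p = Some q -> p = q) by congruence.
      apply E. etransitivity; [exact (Gmap_ten_eq (c X) (c X) (strong_id X) KX a b)|].
      etransitivity; [|symmetry; exact (pr_vid (G_presentation X KX (c X)) (Gten (c X) a b))].
      assert (Ea : Gmap1 X X (strong_id X) a = a) by now apply sig_eq.
      assert (Eb : Gmap1 X X (strong_id X) b = b) by now apply sig_eq.
      rewrite Ea, Eb. apply (isoc_sym (Gtinv_iso X KX (c X) a b)).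
  - intros X Y Z f g. set (KX := rep_calculus X). set (KY := rep_calculus Y).
    set (KZ := rep_calculus Z).
    apply (G_psf_eq (HB X)); auto.
    + apply G_map_psf.
    + apply (psf_comp_is (B := Bicat (HB X)) (C := Bicat (HB Y)) (D := Bicat (HB Z))
        (Psf (Bicat (HB X)) (Bicat (HB Y)) (G_map_psf (c X) (c Y) f))
        (Psf (Bicat (HB Y)) (Bicat (HB Z)) (G_map_psf (c Y) (c Z) g))).
    + intros x y z a b. assert (E : forall p q : cell2 Z, Some p = Some q -> p = q) by congruence.
      apply E. etransitivity; [exact (Gmap_ten_eq (c X) (c Z) (strong_comp f g) KZ a b)|].
      symmetry. etransitivity; [exact (pr_vcomp (G_presentation Z KZ (c Z)) _ _)|].
      etransitivity; [refine (f_equal2 (vc KZ) _ eq_refl);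
        exact (Gmap_ten_eq (c Y) (c Z) g KZ (Gmap1 X Y f a) (Gmap1 X Y f b))|].
      assert (Eg : Some (m2 g (proj1_sig (Gmap_ten X Y (c X) (c Y) f a b)))
        = vc KZ (option_map (m2 g) (Gtinv Y KY (c Y) (Gmap1 X Y f a) (Gmap1 X Y f b)))
            (Some (m2 g (m2 f (Gtcell (c X) a b))))).
      { pose proof (Gmap_ten_eq (c X) (c Y) f KY a b) as Q.
        pose proof (cm_vc (G_calculus_map g)
          (ple_refl (option_map (m2 g) (Gtinv Y KY (c Y) (Gmap1 X Y f a) (Gmap1 X Y f b))))
          (ple_refl (option_map (m2 g) (Some (m2 f (Gtcell (c X) a b)))))) as M.
        fold KY in Q, M. rewrite <- Q in M. symmetry. apply M. reflexivity. }
      etransitivity; [exact (f_equal2 (vc KZ) eq_refl Eg)|]. rewrite vc_assoc.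
      pose proof (cm_isoc (G_calculus_map g) (Gtcell_has Y (c Y) (Gmap1 X Y f a) (Gmap1 X Y f b))
        (Gtinv_iso Y KY (c Y) (Gmap1 X Y f a) (Gmap1 X Y f b))) as I.
      rewrite (isoc_cancel_l I (Θ := [m1 g (m1 f (proj1_sig (Gten (c X) a b)))])).
      * assert (Ea : Gmap1 X Z (strong_comp f g) a = Gmap1 Y Z g (Gmap1 X Y f a)) by now apply sig_eq.
        assert (Eb : Gmap1 X Z (strong_comp f g) b = Gmap1 Y Z g (Gmap1 X Y f b)) by now apply sig_eq.
        now rewrite Ea, Eb.
      * pose proof (cm_has (G_calculus_map g) (cm_has (G_calculus_map f) (Gtcell_has X (c X) a b))) as T.
        exact (has_typ T).
Qed.

(** * The calculus of sequences in a bicategory *)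

Arguments lcomp {B x y} N.
Arguments ncat {B x y z} M N.
Arguments catl {B x y z} Γ N.
Arguments catr {B x y z} N Γ.
Arguments clist {B x y} Γ.
Arguments plist {B x y} N.
Arguments asci B {x y z w} a b c.

Lemma inverseP (B : bicat) (x y : bob B) (a b : bhom x y) (p : bcell a b)
  (H : invertible p) : p ⊙ inverse p H = vid a /\ inverse p H ⊙ p = vid b.
Proof. exact (theP _ (inverse_ex B H)). Qed.

Section SplitJoin.
Variable B : bicat.
Let HB := bicatP B.

Notation "M ⋆ N" := (ncat M N) (at level 40, left associativity).
Notation "⟪ N ⟫" := (lcomp N) (at level 0, format "⟪ N ⟫").

Lemma asc_asci x y z w (a : @bhom B x y) (b : bhom y z) (c : bhom z w) :
  asc a b c ⊙ asci B a b c = vid _ /\ asci B a b c ⊙ asc a b c = vid _.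
Proof. apply inverseP. Qed.

Arguments asc_asci {x y z w} a b c.

Lemma vid_hcomp x y z (a : @bhom B x y) (b c d : bhom y z) (p : bcell b c) (q : bcell c d) :
  vid a ⊠ (p ⊙ q) = (vid a ⊠ p) ⊙ (vid a ⊠ q).
Proof. now rewrite <- (interchange HB), (vidl HB). Qed.

Lemma hcomp_vid x y z (a : @bhom B y z) (b c d : bhom x y) (p : bcell b c) (q : bcell c d) :
  (p ⊙ q) ⊠ vid a = (p ⊠ vid a) ⊙ (q ⊠ vid a).
Proof. now rewrite <- (interchange HB), (vidl HB). Qed.

Lemma split_join x y z (M : nepath B x y) (N : nepath B y z) :
  split B M N ⊙ join B M N = vid _ /\ join B M N ⊙ split B M N = vid _.
Proof.
  induction N as [z a | z w N IH a]; simpl.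
  - now rewrite (vidl HB).
  - destruct IH as [H1 H2], (asc_asci ⟪M⟫ ⟪N⟫ a) as [H3 H4]. split.
    + rewrite (vassoc HB), <- (vassoc HB _ _ _ _ _ _ (asc _ _ _)), H3, (vidl HB).
      now rewrite <- hcomp_vid, H1, (hvid HB).
    + rewrite (vassoc HB), <- (vassoc HB _ _ _ _ _ _ (join B M N ⊠ _)).
      now rewrite <- hcomp_vid, H2, (hvid HB), (vidl HB).
Qed.

Arguments split_join {x y z} M N.

Lemma vcast_refl x y (N : nepath B x y) (E : N = N) : vcast B E = vid ⟪N⟫.
Proof. now rewrite (proof_irrelevance _ E eq_refl). Qed.

Lemma vcast_psnoc x y z (N N' : nepath B x y) (a : bhom y z) (E : N = N')
  (E' : psnoc N a = psnoc N' a) : vcast B E' = vcast B E ⊠ vid a.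
Proof. subst N'. rewrite !vcast_refl. simpl. now rewrite (hvid HB). Qed.

Lemma ncat_assoc x y z w (M : nepath B x y) (N : nepath B y z) (P : nepath B z w) :
  M ⋆ N ⋆ P = M ⋆ (N ⋆ P).
Proof. induction P; simpl; congruence. Qed.

Arguments ncat_assoc {x y z w} M N P.

(** Splitting a threefold concatenation in two ways gives the associator; the
    induction step is the pentagon.  This is all the coherence that [∫ B] needs. *)
Lemma split_assoc x y z w (M : nepath B x y) (N : nepath B y z) (P : nepath B z w)
  (E : M ⋆ N ⋆ P = M ⋆ (N ⋆ P)) :
  split B (M ⋆ N) P ⊙ (split B M N ⊠ vid ⟪P⟫) ⊙ asc ⟪M⟫ ⟪N⟫ ⟪P⟫
  = vcast B E ⊙ split B M (N ⋆ P) ⊙ (vid ⟪M⟫ ⊠ split B N P).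
Proof.
  induction P as [w a | w v P IH a]; simpl.
  - rewrite vcast_refl. simpl. now rewrite (hvid HB), (vidr HB), !(vidl HB).
  - simpl in E. rewrite (@vcast_psnoc _ _ _ _ _ a (ncat_assoc M N P) E).
    specialize (IH (ncat_assoc M N P)).
    rewrite <- (hvid HB). rewrite !(vassoc HB).
    rewrite <- (vassoc HB _ _ _ _ _ _ (asc ⟪M ⋆ N⟫ ⟪P⟫ a)).
    rewrite <- (asc_nat HB). rewrite !(vassoc HB), <- (pentagon HB), !vid_hcomp.
    rewrite <- !(vassoc HB). f_equal.
    rewrite <- !hcomp_vid. rewrite IH, !hcomp_vid, !(vassoc HB). do 2 f_equal.
    apply (asc_nat HB).
Qed.

Arguments split_assoc {x y z w} M N P E.

Lemma split_inv x y z (M : nepath B x y) (N : nepath B y z) : invertible (split B M N).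
Proof. exists (join B M N). apply split_join. Qed.

Definition wl x y z (M : nepath B x y) (N N' : nepath B y z) (p : bcell ⟪N⟫ ⟪N'⟫) :
  bcell ⟪M ⋆ N⟫ ⟪M ⋆ N'⟫ := split B M N ⊙ (vid ⟪M⟫ ⊠ p) ⊙ join B M N'.

Definition wr x y z (N N' : nepath B x y) (p : bcell ⟪N⟫ ⟪N'⟫) (M : nepath B y z) :
  bcell ⟪N ⋆ M⟫ ⟪N' ⋆ M⟫ := split B N M ⊙ (p ⊠ vid ⟪M⟫) ⊙ join B N' M.

Arguments wl {x y z} M {N N'} p.
Arguments wr {x y z N N'} p M.

Lemma wl_split x y z (M : nepath B x y) (N N' : nepath B y z) (p : bcell ⟪N⟫ ⟪N'⟫) :
  wl M p ⊙ split B M N' = split B M N ⊙ (vid ⟪M⟫ ⊠ p).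
Proof.
  unfold wl. destruct (split_join M N') as [_ H]. now rewrite (vassoc HB), H, (vidr HB).
Qed.

Lemma wr_split x y z (M : nepath B y z) (N N' : nepath B x y) (p : bcell ⟪N⟫ ⟪N'⟫) :
  wr p M ⊙ split B N' M = split B N M ⊙ (p ⊠ vid ⟪M⟫).
Proof.
  unfold wr. destruct (split_join N' M) as [_ H]. now rewrite (vassoc HB), H, (vidr HB).
Qed.

(** Associativity of concatenation does not hold by computation, so that whiskered
    cells can be equal only as untyped cells. *)
Lemma ICell_cast x y (N N' M M' : nepath B x y) (p : bcell ⟪N⟫ ⟪N'⟫)
  (q : bcell ⟪M⟫ ⟪M'⟫) (E : N = M) (E' : N' = M') :
  p ⊙ vcast B E' = vcast B E ⊙ q -> ICell N N' p = ICell M M' q.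
Proof.
  subst M M'. rewrite !vcast_refl, (vidl HB), (vidr HB). now intros ->.
Qed.

Arguments ICell_cast {x y N N' M M'} p q E E' _.

Lemma whisker_l_l x y z w (M : nepath B x y) (N : nepath B y z) (P P' : nepath B z w)
  (p : bcell ⟪P⟫ ⟪P'⟫) :
  ICell (M ⋆ (N ⋆ P)) (M ⋆ (N ⋆ P'))
    (wl M (wl N p))
  = ICell (M ⋆ N ⋆ P) (M ⋆ N ⋆ P') (wl (M ⋆ N) p).
Proof.
  set (E := ncat_assoc M N P). set (E' := ncat_assoc M N P').
  symmetry. apply (ICell_cast _ _ E E').
  apply (invertible_mono HB _ _ (split B M (N ⋆ P') ⊙ (vid ⟪M⟫ ⊠ split B N P'))).
  { apply (invertible_vcomp HB); [apply split_inv|].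
    apply (invertible_hcomp HB); [now apply invertible_vid | apply split_inv]. }
  rewrite !(vassoc HB).
  rewrite <- (vassoc HB _ _ _ _ _ _ (vcast B E')), <- split_assoc, !(vassoc HB).
  rewrite <- !(vassoc HB _ _ _ _ _ _ (wl _ _)), !wl_split.
  rewrite !(vassoc HB), <- !vid_hcomp, wl_split, !vid_hcomp.
  rewrite <- (vassoc HB _ _ _ _ _ _ (vid ⟪M ⋆ N⟫ ⊠ p)), <- (interchange HB), (vidl HB), (vidr HB).
  rewrite <- (vidr HB _ _ _ _ (split B M N)) at 1. rewrite <- (vidl HB _ _ _ _ p) at 1.
  rewrite (interchange HB), <- (hvid HB), !(vassoc HB), (asc_nat HB).
  rewrite <- !(vassoc HB). f_equal. rewrite (split_assoc _ _ _ E). now rewrite !(vassoc HB).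
Qed.

Lemma whisker_r_r x y z w (M : nepath B y z) (N : nepath B z w) (P P' : nepath B x y)
  (p : bcell ⟪P⟫ ⟪P'⟫) :
  ICell (P ⋆ M ⋆ N) (P' ⋆ M ⋆ N)
    (wr (wr p M) N)
  = ICell (P ⋆ (M ⋆ N)) (P' ⋆ (M ⋆ N)) (wr p (M ⋆ N)).
Proof.
  set (E := ncat_assoc P M N). set (E' := ncat_assoc P' M N).
  apply (ICell_cast _ _ E E').
  apply (invertible_mono HB _ _ (split B P' (M ⋆ N) ⊙ (vid ⟪P'⟫ ⊠ split B M N))).
  { apply (invertible_vcomp HB); [apply split_inv|].
    apply (invertible_hcomp HB); [now apply invertible_vid | apply split_inv]. }
  rewrite !(vassoc HB).
  rewrite <- (vassoc HB _ _ _ _ _ _ (vcast B E')), <- split_assoc, !(vassoc HB).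
  rewrite <- !(vassoc HB _ _ _ _ _ _ (wr _ _)), !wr_split.
  rewrite !(vassoc HB).
  rewrite <- (vassoc HB _ _ _ _ _ _ (wr p M ⊠ _)), <- hcomp_vid,
    wr_split, hcomp_vid, !(vassoc HB), (asc_nat HB).
  rewrite (hvid HB), <- (interchange HB), (vidl HB), (vidr HB).
  rewrite <- (vidl HB _ _ _ _ p) at 2. rewrite <- (vidr HB _ _ _ _ (split B M N)).
  rewrite (interchange HB), <- !(vassoc HB). f_equal. now rewrite (split_assoc _ _ _ E).
Qed.

Lemma whisker_l_r x y z w (M : nepath B x y) (N : nepath B z w) (P P' : nepath B y z)
  (p : bcell ⟪P⟫ ⟪P'⟫) :
  ICell (M ⋆ (P ⋆ N)) (M ⋆ (P' ⋆ N))
    (wl M (wr p N))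
  = ICell (M ⋆ P ⋆ N) (M ⋆ P' ⋆ N)
    (wr (wl M p) N).
Proof.
  set (E := ncat_assoc M P N). set (E' := ncat_assoc M P' N).
  symmetry. apply (ICell_cast _ _ E E').
  apply (invertible_mono HB _ _ (split B M (P' ⋆ N) ⊙ (vid ⟪M⟫ ⊠ split B P' N))).
  { apply (invertible_vcomp HB); [apply split_inv|].
    apply (invertible_hcomp HB); [now apply invertible_vid | apply split_inv]. }
  rewrite !(vassoc HB).
  rewrite <- (vassoc HB _ _ _ _ _ _ (vcast B E')), <- split_assoc, !(vassoc HB).
  rewrite <- (vassoc HB _ _ _ _ _ _ (wl _ _) (split B M (P' ⋆ N))), wl_split.
  rewrite <- (vassoc HB _ _ _ _ _ _ (wr _ _)), wr_split.
  rewrite !(vassoc HB), <- vid_hcomp, wr_split, vid_hcomp.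
  rewrite <- (vassoc HB _ _ _ _ _ _ (wl M p ⊠ _)), <- hcomp_vid,
    wl_split, hcomp_vid, !(vassoc HB), (asc_nat HB).
  rewrite <- !(vassoc HB). f_equal. now rewrite (split_assoc _ _ _ E).
Qed.

Lemma whisker_l_vcomp x y z (Γ : path B x y) (N N' N'' : nepath B y z)
  (p : bcell ⟪N⟫ ⟪N'⟫) (q : bcell ⟪N'⟫ ⟪N''⟫) :
  whisker_l B Γ N N'' (p ⊙ q) = whisker_l B Γ N N' p ⊙ whisker_l B Γ N' N'' q.
Proof.
  destruct Γ as [|y M]; auto. change (wl M (p ⊙ q) = wl M p ⊙ wl M q).
  apply (invertible_mono HB _ _ (split B M N'')); [apply split_inv|].
  rewrite wl_split, (vassoc HB), wl_split, <- (vassoc HB), wl_split.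
  now rewrite (vassoc HB), vid_hcomp.
Qed.

Lemma whisker_r_vcomp x y z (Γ : path B y z) (N N' N'' : nepath B x y)
  (p : bcell ⟪N⟫ ⟪N'⟫) (q : bcell ⟪N'⟫ ⟪N''⟫) :
  whisker_r B N N'' (p ⊙ q) Γ = whisker_r B N N' p Γ ⊙ whisker_r B N' N'' q Γ.
Proof.
  destruct Γ as [|z M]; auto. change (wr (p ⊙ q) M = wr p M ⊙ wr q M).
  apply (invertible_mono HB _ _ (split B N'' M)); [apply split_inv|].
  rewrite wr_split, (vassoc HB), wr_split, <- (vassoc HB), wr_split.
  now rewrite (vassoc HB), hcomp_vid.
Qed.

Lemma whisker_l_vid x y z (Γ : path B x y) (N : nepath B y z) :
  whisker_l B Γ N N (vid ⟪N⟫) = vid _.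
Proof.
  destruct Γ as [|y M]; auto. simpl. rewrite (hvid HB), (vidr HB). apply split_join.
Qed.

Lemma whisker_r_vid x y z (Γ : path B y z) (N : nepath B x y) :
  whisker_r B N N (vid ⟪N⟫) Γ = vid _.
Proof.
  destruct Γ as [|z M]; auto. simpl. rewrite (hvid HB), (vidr HB). apply split_join.
Qed.

Lemma whisker_exchange x y z (N N' : nepath B x y) (M M' : nepath B y z)
  (p : bcell ⟪N⟫ ⟪N'⟫) (q : bcell ⟪M⟫ ⟪M'⟫) :
  wr p M ⊙ wl N' q
  = wl N q ⊙ wr p M'.
Proof.
  apply (invertible_mono HB _ _ (split B N' M')); [apply split_inv|].
  rewrite !(vassoc HB), wl_split, wr_split.
  rewrite <- !(vassoc HB), wl_split, wr_split, !(vassoc HB).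
  now rewrite <- !(interchange HB), !(vidl HB), !(vidr HB).
Qed.

End SplitJoin.

Arguments wl B {x y z} M {N N'} p.
Arguments wr B {x y z N N'} p M.

Ltac inj := repeat match goal with
  | H : existT _ _ _ = existT _ _ _ |- _ => apply inj_pair2 in H
  end.

Section IntCalculus.
Variable B : bicat.
Let HB := bicatP B.
Let X := int_data B.

Notation "⟪ N ⟫" := (lcomp N) (at level 0, format "⟪ N ⟫").
Notation iw P p Q := (whisker_l B P _ _ (whisker_r B _ _ p Q)).

(** The operations are given on typed cells; [isq] and [iwh] extend them to untyped
    cells, where the boundaries match only up to a proof. *)
Inductive irel_sq : icell B -> icell B -> icell B -> Prop :=
| irel_sq_intro : forall x y (N N' N'' : nepath B x y)
    (p : bcell ⟪N⟫ ⟪N'⟫) (q : bcell ⟪N'⟫ ⟪N''⟫),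
    irel_sq (ICell N N' p) (ICell N' N'' q) (ICell N N'' (p ⊙ q)).

Inductive irel_wh : list (arrow B) -> icell B -> list (arrow B) -> icell B -> Prop :=
| irel_wh_intro : forall x y z w (P : path B x y) (N N' : nepath B y z)
    (p : bcell ⟪N⟫ ⟪N'⟫) (Q : path B z w),
    irel_wh (clist P) (ICell N N' p) (clist Q)
      (ICell (catl P (catr N Q)) (catl P (catr N' Q)) (iw P p Q)).

Definition dflt (A : Type) (d : A) (o : option A) : A :=
  match o with Some x => x | None => d end.

Definition isq (p q : icell B) : icell B := dflt p (pick (irel_sq p q)).
Definition iwh A (p : icell B) C : icell B := dflt p (pick (irel_wh A p C)).

Lemma isqE x y (N N' N'' : nepath B x y) (p : bcell ⟪N⟫ ⟪N'⟫) (q : bcell ⟪N'⟫ ⟪N''⟫) :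
  isq (ICell N N' p) (ICell N' N'' q) = ICell N N'' (p ⊙ q).
Proof.
  unfold isq. rewrite (pick_some (ICell N N'' (p ⊙ q))); [reflexivity | | constructor].
  intros r H. inversion H; subst. inj. subst. inj. now subst.
Qed.

Lemma clist_inj_l x x' y (P : path B x y) (P' : path B x' y) : clist P = clist P' ->
  existT (fun u => path B u y) x P = existT (fun u => path B u y) x' P'.
Proof.
  destruct P as [|y N]; intros E.
  - destruct P' as [|y N']; simpl in E; auto. now apply eq_sym, plist_nonempty in E.
  - destruct P' as [|y N']; simpl in E; [now apply plist_nonempty in E|].
    pose proof (plist_chain N) as C. pose proof (plist_chain N') as C'. rewrite E in C.
    destruct (chain_inj _ _ _ _ (@plist_nonempty _ _ _ N') C C') as [-> _].
    apply plist_inj in E. now subst.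
Qed.

Lemma clist_inj_r x y y' (P : path B x y) (P' : path B x y') : clist P = clist P' ->
  existT (path B x) y P = existT (path B x) y' P'.
Proof.
  destruct P as [|y N]; intros E.
  - destruct P' as [|y' N']; simpl in E; auto. now apply eq_sym, plist_nonempty in E.
  - destruct P' as [|y' N']; simpl in E; [now apply plist_nonempty in E|].
    apply plist_inj_aux in E. inversion E. inj. now subst.
Qed.

Lemma iwhE x y z w (P : path B x y) (N N' : nepath B y z)
    (p : bcell ⟪N⟫ ⟪N'⟫) (Q : path B z w) :
  iwh (clist P) (ICell N N' p) (clist Q)
  = ICell (catl P (catr N Q)) (catl P (catr N' Q)) (iw P p Q).
Proof.
  unfold iwh. rewrite (pick_some (ICell (catl P (catr N Q)) (catl P (catr N' Q)) (iw P p Q)));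
    [reflexivity | | constructor].
  intros r H. remember (clist P) as A eqn:EA. remember (clist Q) as C eqn:EC.
  remember (ICell N N' p) as i eqn:Ei. destruct H as [x0 y0 z0 w0 P0 N0 N0' p0 Q0].
  inversion Ei; subst. inj. subst. inj. subst.
  apply clist_inj_l in EA. inversion EA. inj. subst.
  apply clist_inj_r in EC. inversion EC. inj. now subst.
Qed.

Arguments iwhE {x y z w} P {N N'} p Q.

Lemma icell_match x y (N N' : nepath B x y) (p : bcell ⟪N⟫ ⟪N'⟫) (q : icell B) :
  plist N' = plist (iinp q) ->
  exists (N'' : nepath B x y) (q' : bcell ⟪N'⟫ ⟪N''⟫), q = ICell N' N'' q'.
Proof.
  destruct q as [u v M M' q]; simpl. intros E.
  pose proof (plist_chain N') as C. pose proof (plist_chain M) as C'. rewrite E in C.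
  destruct (chain_inj _ _ _ _ (@plist_nonempty _ _ _ M) C C') as [<- <-].
  apply plist_inj in E. subst M. eauto.
Qed.

Arguments icell_match {x y N N'} p q _.

Lemma context_match A C y z (N : nepath B y z) : composable X (A ++ plist N ++ C) ->
  exists x w (P : path B x y) (Q : path B z w), clist P = A /\ clist Q = C.
Proof.
  intros (_ & x & w & H). apply chain_app in H as (y' & Ha & H).
  apply chain_app in H as (z' & Hn & Hc).
  destruct (chain_inj _ _ _ _ (@plist_nonempty _ _ _ N) Hn (plist_chain N)) as [-> ->].
  apply clist_surj in Ha as [P HP]. apply clist_surj in Hc as [Q HQ]. eauto 6.
Qed.

Lemma nepath_match Γ : composable X Γ -> exists x y (N : nepath B x y), plist N = Γ.
Proof.
  intros (N & x & y & H). apply clist_surj in H as [P HP]. destruct P as [|y P].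
  - now destruct N.
  - eauto.
Qed.

Definition pcat x y z (P : path B x y) : path B y z -> path B x z :=
  match P in path _ _ y' return path B y' z -> path B x z with
  | pempty => fun Q => Q
  | pfull M => fun Q => match Q in path _ _ z' return path B x z' with
      | pempty => pfull M
      | pfull N => pfull (ncat M N)
      end
  end.

Lemma clist_pcat x y z (P : path B x y) (Q : path B y z) :
  clist (pcat P Q) = clist P ++ clist Q.
Proof.
  destruct P as [|y M]; auto. destruct Q as [|z N]; simpl.
  - now rewrite app_nil_r.
  - apply plist_ncat.
Qed.

Definition icell_l x y z (P : path B x y) (N N' : nepath B y z) (p : bcell ⟪N⟫ ⟪N'⟫) :=
  ICell (catl P N) (catl P N') (whisker_l B P N N' p).

Definition icell_r x y z (N N' : nepath B x y) (p : bcell ⟪N⟫ ⟪N'⟫) (Q : path B y z) :=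
  ICell (catr N Q) (catr N' Q) (whisker_r B N N' p Q).

Arguments icell_l {x y z} P {N N'} p.
Arguments icell_r {x y z N N'} p Q.

Lemma icell_l_congr x y z (P : path B x y) (N N' M M' : nepath B y z)
  (p : bcell ⟪N⟫ ⟪N'⟫) (q : bcell ⟪M⟫ ⟪M'⟫) :
  ICell N N' p = ICell M M' q -> icell_l P p = icell_l P q.
Proof. intros H. inversion H; subst. inj. subst. inj. subst. inj. now subst. Qed.

Lemma icell_l_l x y z w (P : path B x y) (Q : path B y z) (N N' : nepath B z w)
  (p : bcell ⟪N⟫ ⟪N'⟫) :
  icell_l P (whisker_l B Q N N' p) = icell_l (pcat P Q) p.
Proof.
  destruct P as [|y M]; auto. revert p. destruct Q as [|z M']; intros p; auto.
  exact (whisker_l_l B M M' N N' p).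
Qed.

Lemma icell_r_r x y z w (P : path B y z) (Q : path B z w) (N N' : nepath B x y)
  (p : bcell ⟪N⟫ ⟪N'⟫) :
  icell_r (whisker_r B N N' p P) Q = icell_r p (pcat P Q).
Proof.
  revert Q. destruct P as [|z M]; intros Q; auto. destruct Q as [|w M']; auto.
  exact (whisker_r_r B M M' N N' p).
Qed.

Lemma icell_l_r x y z w (P : path B x y) (Q : path B z w) (N N' : nepath B y z)
  (p : bcell ⟪N⟫ ⟪N'⟫) :
  icell_l P (whisker_r B N N' p Q) = icell_r (whisker_l B P N N' p) Q.
Proof.
  revert N N' p. destruct P as [|y M]; intros N N' p; auto. destruct Q as [|w M']; auto.
  exact (whisker_l_r B M M' N N' p).
Qed.

Lemma icell_wh_wh x y z u v w (P : path B x y) (Q : path B y z) (N N' : nepath B z u)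
  (p : bcell ⟪N⟫ ⟪N'⟫) (R : path B u v) (S : path B v w) :
  icell_l P (whisker_r B _ _ (iw Q p R) S) = icell_l (pcat P Q) (whisker_r B N N' p (pcat R S)).
Proof.
  rewrite <- icell_l_l. apply icell_l_congr.
  change (icell_r (iw Q p R) S = icell_l Q (whisker_r B N N' p (pcat R S))).
  etransitivity; [symmetry; apply icell_l_r|].
  apply icell_l_congr. exact (icell_r_r R S N N' p).
Qed.

Lemma isq_cast x y (N N' M M' : nepath B x y) (p : bcell ⟪N⟫ ⟪N'⟫) (q : bcell ⟪M⟫ ⟪M'⟫)
  (E : N' = M) : isq (ICell N N' p) (ICell M M' q) = ICell N M' (p ⊙ vcast B E ⊙ q).
Proof. subst M. rewrite isqE. simpl. now rewrite (vidr HB). Qed.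

Lemma inp_iwh A p C : composable X (A ++ inp (X := X) p ++ C) ->
  inp (X := X) (iwh A p C) = A ++ inp (X := X) p ++ C /\
  out (X := X) (iwh A p C) = A ++ out (X := X) p ++ C.
Proof.
  intros H. destruct p as [y z N N' p].
  destruct (context_match _ _ _ H) as (x & w & P & Q & <- & <-). rewrite iwhE. simpl.
  now rewrite !plist_catl, !plist_catr.
Qed.

Lemma ineutral Γ e : neutral X isq Γ e <-> exists x y (N : nepath B x y),
  plist N = Γ /\ e = ICell N N (vid ⟪N⟫).
Proof.
  assert (G : forall x y (N : nepath B x y), neutral X isq (plist N) (ICell N N (vid ⟪N⟫))).
  { intros x y N. split; auto. split; auto. split.
    - intros p Hp. destruct (icell_match (vid ⟪N⟫) p (eq_sym Hp)) as (N' & p' & ->).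
      rewrite isqE. now rewrite (vidl HB).
    - intros p Hp. destruct p as [u v M M' p]. simpl in Hp.
      destruct (icell_match p (ICell N N (vid ⟪N⟫)) Hp) as (N' & p' & E).
      rewrite E. inversion E; subst. inj. subst. inj. subst. inj. subst.
      rewrite isqE. now rewrite (vidr HB). }
  split.
  - intros H. assert (C : composable X Γ).
    { destruct H as (H & _). rewrite <- H. apply composable_inp. }
    destruct (nepath_match C) as (x & y & N & HN). exists x, y, N. split; auto.
    specialize (G _ _ N). rewrite HN in G. destruct H as (H1 & H2 & H3 & H4).
    destruct G as (G1 & G2 & G3 & G4). rewrite <- (G4 e) by auto. now apply H3.
  - intros (x & y & N & <- & ->). apply G.
Qed.

Definition int_calculus : calculus X.
Proof.
  refine (@Calculus X isq iwh _ _ _ _ _ _ _ _ _ _ _ _).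
  - intros [x y N N' p] q H. destruct (icell_match p q H) as (N'' & q' & ->).
    now rewrite isqE.
  - intros [x y N N' p] q H. destruct (icell_match p q H) as (N'' & q' & ->).
    now rewrite isqE.
  - intros. now apply inp_iwh.
  - intros. now apply inp_iwh.
  - intros [x y N N' p] q r H H'. destruct (icell_match p q H) as (N'' & q' & ->).
    destruct (icell_match q' r H') as (N3 & r' & ->).
    now rewrite !isqE, (vassoc HB).
  - intros [x y N N' p]. exact (iwhE pempty p pempty).
  - intros A A' p C' C H. destruct p as [y z N N' p].
    destruct (context_match _ _ _ H) as (x & w & P & Q & HP & HQ).
    pose proof H as (_ & x0 & w0 & Hc). rewrite <- !app_assoc in Hc.
    apply chain_app in Hc as (u & Ha & Hc). apply chain_app in Hc as (u1 & Ha' & Hc).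
    apply chain_app in Hc as (u2 & Hn & Hc). apply chain_app in Hc as (u3 & Hc' & Hc).
    destruct (chain_inj _ _ _ _ (@plist_nonempty _ _ _ N) Hn (plist_chain N)) as [-> ->].
    apply clist_surj in Ha as [P1 <-]. apply clist_surj in Ha' as [P2 <-].
    apply clist_surj in Hc' as [Q2 <-]. apply clist_surj in Hc as [Q1 <-].
    rewrite iwhE, <- !clist_pcat, !iwhE.
    exact (icell_wh_wh P1 P2 N N' p Q2 Q1).
  - intros A [y z N N' p] q C H H'. destruct (icell_match p q H) as (N'' & q' & ->).
    destruct (context_match _ _ _ H') as (x & w & P & Q & <- & <-).
    rewrite isqE, !iwhE, isqE. f_equal. now rewrite whisker_r_vcomp, whisker_l_vcomp.
  - intros [x y N N' p] [y' z M M' q] C. simpl in *.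
    assert (y = y') as <-.
    { destruct C as (_ & u & v & C). apply chain_app in C as (w & C1 & C2).
      destruct (chain_inj _ _ _ _ (@plist_nonempty _ _ _ N) C1 (plist_chain N)) as [_ ->].
      now destruct (chain_inj _ _ _ _ (@plist_nonempty _ _ _ M) C2 (plist_chain M)) as [-> _]. }
    pose proof (iwhE pempty p (pfull M)) as E1. pose proof (iwhE (pfull N') q pempty) as E2.
    pose proof (iwhE (pfull N) q pempty) as E3. pose proof (iwhE pempty p (pfull M')) as E4.
    simpl in E1, E2, E3, E4. rewrite E1, E2, E3, E4, !isqE. f_equal.
    exact (whisker_exchange B N N' M M' p q).
  - intros Γ H. destruct (nepath_match H) as (x & y & N & HN).
    exists (ICell N N (vid ⟪N⟫)). apply ineutral. eauto.
  - intros A Γ e C He H. apply ineutral in He as (y & z & N & <- & ->).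
    destruct (context_match _ _ _ H) as (x & w & P & Q & <- & <-).
    rewrite iwhE. apply ineutral. exists x, w, (catl P (catr N Q)).
    rewrite plist_catl, plist_catr. split; auto. f_equal.
    now rewrite whisker_r_vid, whisker_l_vid.
  - intros [x y N N' t] [x' y' M M' s] Δ1 Λ Δ2 Γ1 Γ2 h.
    unfold mrg. simpl. unfold int_mrg.
    destruct (epsilon (frame_ex h) (fun _ => True)) as [u v P1 P2 Q1 Q2 E1 E2 E3 E4 Em].
    simpl in *. clear h. subst Γ1 Γ2 Δ1 Δ2. rewrite !iwhE.
    symmetry. apply isq_cast.
Defined.

End IntCalculus.

Arguments iwhE B {x y z w} P {N N'} p Q.
Arguments ineutral B Γ e : clear implicits.

(** ** Representability of the calculus of sequences *)

Section IntRich.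
Variable B : bicat.
Let HB := bicatP B.
Let X := int_data B.
Let K := int_calculus B.

Notation "⟪ N ⟫" := (lcomp N) (at level 0, format "⟪ N ⟫").
Notation "⟨ a ⟩" := (psingle a) (at level 0, format "⟨ a ⟩").

Lemma int_vc x y (N N' N'' : nepath B x y) (p : bcell ⟪N⟫ ⟪N'⟫) (q : bcell ⟪N'⟫ ⟪N''⟫) :
  vc K (Some (ICell N N' p)) (Some (ICell N' N'' q)) = Some (ICell N N'' (p ⊙ q)).
Proof. rewrite vc_Some by reflexivity. simpl. now rewrite isqE. Qed.

Lemma nepath_composable x y (N : nepath B x y) : composable X (plist N).
Proof. split; [apply plist_nonempty|]. exists x, y. apply plist_chain. Qed.

Lemma int_W x y z w (P : path B x y) (N N' : nepath B y z) (p : bcell ⟪N⟫ ⟪N'⟫)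
  (Q : path B z w) :
  W K (clist P) (Some (ICell N N' p)) (clist Q)
  = Some (ICell (catl P (catr N Q)) (catl P (catr N' Q))
      (whisker_l B P _ _ (whisker_r B N N' p Q))).
Proof.
  rewrite W_Some.
  - simpl. now rewrite iwhE.
  - simpl. rewrite <- plist_catr, <- plist_catl. apply nepath_composable.
Qed.

Lemma int_idc x y (N : nepath B x y) : idc K (plist N) = Some (ICell N N (vid ⟪N⟫)).
Proof. apply idc_Some. apply ineutral. eauto. Qed.

Lemma int_isoc x y (N N' : nepath B x y) p q : p ⊙ q = vid _ -> q ⊙ p = vid _ ->
  isoc K (Some (ICell N N' p)) (Some (ICell N' N q)) (plist N) (plist N').
Proof.
  intros H1 H2. split; [|split; [|split]].
  - apply (@typ_Some X (ICell N N' p)).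
  - apply (@typ_Some X (ICell N' N q)).
  - now rewrite int_vc, H1, int_idc.
  - now rewrite int_vc, H2, int_idc.
Qed.

Lemma int_isoc_ex x y (N N' : nepath B x y) p : invertible p ->
  exists q, isoc K (Some (ICell N N' p)) q (plist N) (plist N').
Proof. intros (q & H1 & H2). exists (Some (ICell N' N q)). now apply int_isoc. Qed.

Lemma int_has x y (N N' : nepath B x y) p :
  has X (Some (ICell N N' p)) (plist N) (plist N').
Proof. apply (@has_Some X (ICell N N' p)). Qed.

Lemma icell_typed x y (N N' : nepath B x y) (q : icell B) :
  plist (iinp q) = plist N -> plist (iout q) = plist N' ->
  exists q0 : bcell ⟪N⟫ ⟪N'⟫, q = ICell N N' q0.
Proof.
  destruct q as [u v M M' q]; simpl. intros H H'.
  pose proof (plist_chain N) as C. pose proof (plist_chain M) as C'. rewrite H in C'.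
  destruct (chain_inj _ _ _ _ (@plist_nonempty _ _ _ N) C C') as [<- <-].
  apply plist_inj in H, H'. subst. eauto.
Qed.

Lemma int_has_typed x y (N N' : nepath B x y) q : has X q (plist N) (plist N') ->
  exists q0 : bcell ⟪N⟫ ⟪N'⟫, q = Some (ICell N N' q0).
Proof.
  intros (q' & -> & H1 & H2). destruct (icell_typed N N' q' H1 H2) as [q0 ->]. eauto.
Qed.

Lemma ICell_inj x y (N N' : nepath B x y) (p q : bcell ⟪N⟫ ⟪N'⟫) :
  ICell N N' p = ICell N N' q -> p = q.
Proof. intros H. inversion H. inj. auto. Qed.

Definition int_tensor x y z (a : @bhom B x y) (b : bhom y z) : icell B :=
  ICell (psnoc ⟨a⟩ b) ⟨a ⊗ b⟩ (vid (a ⊗ b)).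
Definition int_tensor_inv x y z (a : @bhom B x y) (b : bhom y z) : icell B :=
  ICell ⟨a ⊗ b⟩ (psnoc ⟨a⟩ b) (vid (a ⊗ b)).

Arguments int_tensor {x y z} a b.
Arguments int_tensor_inv {x y z} a b.

Lemma int_tensor_iso x y z (a : @bhom B x y) (b : bhom y z) :
  isoc K (Some (int_tensor a b)) (Some (int_tensor_inv a b)) [Arrow a; Arrow b] [Arrow (a ⊗ b)].
Proof. apply (int_isoc (psnoc ⟨a⟩ b) ⟨a ⊗ b⟩); apply (vidl HB). Qed.

Section Unit.
Variable x : bob B.
Let one := @hunit B x.

Definition lunc y (N : nepath B x y) : bcell ⟪ncat ⟨one⟩ N⟫ ⟪N⟫ :=
  split B ⟨one⟩ N ⊙ lun ⟪N⟫.
Definition runc y (N : nepath B y x) : bcell ⟪ncat N ⟨one⟩⟫ ⟪N⟫ :=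
  split B N ⟨one⟩ ⊙ run ⟪N⟫.

Arguments lunc {y} N.
Arguments runc {y} N.

Lemma lunc_inv y (N : nepath B x y) : invertible (lunc N).
Proof. apply (invertible_vcomp HB); [apply split_inv | apply (lun_inv HB)]. Qed.

Lemma runc_inv y (N : nepath B y x) : invertible (runc N).
Proof. apply (invertible_vcomp HB); [apply split_inv | apply (run_inv HB)]. Qed.

Lemma lunc_nat y (N N' : nepath B x y) (p : bcell ⟪N⟫ ⟪N'⟫) :
  wl B ⟨one⟩ p ⊙ lunc N' = lunc N ⊙ p.
Proof. unfold lunc. now rewrite <- (vassoc HB), wl_split, !(vassoc HB), (lun_nat HB). Qed.

Lemma runc_nat y (N N' : nepath B y x) (p : bcell ⟪N⟫ ⟪N'⟫) :
  wr B p ⟨one⟩ ⊙ runc N' = runc N ⊙ p.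
Proof. unfold runc. now rewrite <- (vassoc HB), wr_split, !(vassoc HB), (run_nat HB). Qed.

Lemma composable_from Δ : Δ <> [] -> composable X (Arrow one :: Δ) ->
  exists y (N : nepath B x y), plist N = Δ.
Proof.
  intros ND (_ & u & v & H). simpl in H. destruct H as [_ H].
  apply clist_surj in H as [P HP]. destruct P; [now destruct ND|]. eauto.
Qed.

Lemma composable_to Δ : Δ <> [] -> composable X (Δ ++ [Arrow one]) ->
  exists y (N : nepath B y x), plist N = Δ.
Proof.
  intros ND (_ & u & v & H). apply chain_app in H as (w & H & H').
  simpl in H'. destruct H' as [<- _].
  apply clist_surj in H as [P HP]. destruct P; [now destruct ND|]. eauto.
Qed.

Lemma plist_end y y' (N : nepath B x y) (N' : nepath B x y') (q : icell B) A C :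
  A ++ plist N ++ C = plist (iinp q) -> A ++ plist N' ++ C = plist (iout q) -> y = y'.
Proof.
  intros H H'. destruct (parallel (int_poly B) q) as (u & v & C1 & C2).
  simpl in C1, C2. rewrite <- H in C1. rewrite <- H' in C2.
  assert (E : forall (L : list (arrow B)) w w', chain (@asrc B) (@atgt B) w L v ->
    chain (@asrc B) (@atgt B) w' L v -> L <> [] -> w = w').
  { intros L w w' D1 D2 ND. now destruct (chain_inj _ _ _ _ ND D1 D2). }
  apply chain_app in C1 as (s & _ & C1). apply chain_app in C1 as (t & C1 & D1).
  apply chain_app in C2 as (s' & _ & C2). apply chain_app in C2 as (t' & C2 & D2).
  destruct (chain_inj _ _ _ _ (@plist_nonempty _ _ _ N) C1 (plist_chain N)) as [_ ->].
  destruct (chain_inj _ _ _ _ (@plist_nonempty _ _ _ N') C2 (plist_chain N')) as [_ ->].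
  destruct C as [|c C]; [simpl in *; congruence|].
  eapply E; eauto. discriminate.
Qed.

Lemma plist_start y y' (N : nepath B y x) (N' : nepath B y' x) (q : icell B) A C :
  A ++ plist N ++ C = plist (iinp q) -> A ++ plist N' ++ C = plist (iout q) -> y = y'.
Proof.
  intros H H'. destruct (parallel (int_poly B) q) as (u & v & C1 & C2).
  simpl in C1, C2. rewrite <- H in C1. rewrite <- H' in C2.
  apply chain_app in C1 as (s & S1 & C1). apply chain_app in C1 as (t & C1 & D1).
  apply chain_app in C2 as (s' & S2 & C2). apply chain_app in C2 as (t' & C2 & D2).
  destruct (chain_inj _ _ _ _ (@plist_nonempty _ _ _ N) C1 (plist_chain N)) as [-> _].
  destruct (chain_inj _ _ _ _ (@plist_nonempty _ _ _ N') C2 (plist_chain N')) as [-> _].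
  destruct A as [|a A]; [simpl in *; congruence|].
  assert (NA : a :: A <> []) by discriminate.
  now destruct (chain_inj _ _ _ _ NA S1 S2).
Qed.

(** Conjugation with the left unitor inverts whiskering with the unit. *)
Lemma int_ff_l : ff K [Arrow one] [].
Proof.
  assert (EW : forall y (N N' : nepath B x y) (p : bcell ⟪N⟫ ⟪N'⟫),
    W K [Arrow one] (Some (ICell N N' p)) []
    = Some (ICell (ncat ⟨one⟩ N) (ncat ⟨one⟩ N') (wl B ⟨one⟩ p))).
  { intros. exact (int_W (pfull ⟨one⟩) N N' p pempty). }
  split.
  - intros q Δ Δ' N1 N2 H. simpl in H. rewrite !app_nil_r in H.
    destruct (composable_from N1 (has_inp H)) as (y & N & <-).
    destruct (composable_from N2 (has_out H)) as (y' & N' & <-).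
    destruct H as (q' & -> & H1 & H2).
    assert (y = y') as <-.
    { eapply (plist_end N N' q' [Arrow one] []); simpl; rewrite app_nil_r; auto. }
    destruct (icell_typed (ncat ⟨one⟩ N) (ncat ⟨one⟩ N') q') as [q0 ->].
    { now rewrite plist_ncat. } { now rewrite plist_ncat. }
    destruct (lunc_inv N) as (i & I1 & I2).
    exists (Some (ICell N N' (i ⊙ q0 ⊙ lunc N'))). split; [apply int_has|].
    rewrite EW. do 2 f_equal.
    apply (invertible_mono HB _ _ (lunc N')); [apply lunc_inv|].
    now rewrite lunc_nat, <- !(vassoc HB), I1, (vidl HB).
  - intros r r' Δ Δ' H H' C E. simpl in C. rewrite app_nil_r in C.
    assert (N1 : Δ <> []) by (apply has_inp in H; apply H).
    destruct (composable_from N1 C) as (y & N & <-).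
    assert (C' : composable X (Arrow one :: Δ')).
    { pose proof (has_composable (X := X) [Arrow one] [] H) as Z. rewrite !app_nil_r in Z.
      now apply Z. }
    assert (N2 : Δ' <> []) by (apply has_out in H; apply H).
    destruct (composable_from N2 C') as (y' & N' & <-).
    assert (y = y') as <-.
    { destruct H as (r0 & -> & H1 & H2).
      eapply (plist_end N N' r0 [] []); simpl; rewrite app_nil_r; auto. }
    destruct (int_has_typed N N' H) as [p ->]. destruct (int_has_typed N N' H') as [p' ->].
    rewrite !EW in E. assert (Ew : wl B ⟨one⟩ p = wl B ⟨one⟩ p') by (apply ICell_inj; congruence).
    do 2 f_equal. apply (invertible_epi HB (lunc N)); [apply lunc_inv|].
    now rewrite <- !lunc_nat, Ew.
Qed.

Lemma int_ff_r : ff K [] [Arrow one].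
Proof.
  assert (EW : forall y (N N' : nepath B y x) (p : bcell ⟪N⟫ ⟪N'⟫),
    W K [] (Some (ICell N N' p)) [Arrow one]
    = Some (ICell (ncat N ⟨one⟩) (ncat N' ⟨one⟩) (wr B p ⟨one⟩))).
  { intros. exact (int_W pempty N N' p (pfull ⟨one⟩)). }
  split.
  - intros q Δ Δ' N1 N2 H. simpl in H.
    destruct (composable_to N1 (has_inp H)) as (y & N & <-).
    destruct (composable_to N2 (has_out H)) as (y' & N' & <-).
    destruct H as (q' & -> & H1 & H2).
    assert (y = y') as <-.
    { eapply (plist_start N N' q' [] [Arrow one]); simpl; auto. }
    destruct (icell_typed (ncat N ⟨one⟩) (ncat N' ⟨one⟩) q') as [q0 ->]; auto.
    destruct (runc_inv N) as (i & I1 & I2).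
    exists (Some (ICell N N' (i ⊙ q0 ⊙ runc N'))). split; [apply int_has|].
    rewrite EW. do 2 f_equal.
    apply (invertible_mono HB _ _ (runc N')); [apply runc_inv|].
    now rewrite runc_nat, <- !(vassoc HB), I1, (vidl HB).
  - intros r r' Δ Δ' H H' C E. simpl in C.
    assert (N1 : Δ <> []) by (apply has_inp in H; apply H).
    destruct (composable_to N1 C) as (y & N & <-).
    assert (C' : composable X (Δ' ++ [Arrow one])).
    { pose proof (has_composable (X := X) [] [Arrow one] H) as Z. now apply Z. }
    assert (N2 : Δ' <> []) by (apply has_out in H; apply H).
    destruct (composable_to N2 C') as (y' & N' & <-).
    assert (y = y') as <-.
    { destruct H as (r0 & -> & H1 & H2).
      eapply (plist_start N N' r0 [] []); simpl; rewrite app_nil_r; auto. }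
    destruct (int_has_typed N N' H) as [p ->]. destruct (int_has_typed N N' H') as [p' ->].
    rewrite !EW in E. assert (Ew : wr B p ⟨one⟩ = wr B p' ⟨one⟩) by (apply ICell_inj; congruence).
    do 2 f_equal. apply (invertible_epi HB (runc N)); [apply runc_inv|].
    now rewrite <- !runc_nat, Ew.
Qed.

Lemma int_unitlike : unitlike K (Arrow one).
Proof.
  split; [reflexivity|]. split; [apply int_ff_l|]. split; [apply int_ff_r|].
  destruct (int_isoc_ex (psnoc ⟨one⟩ one) ⟨one⟩ (lun_inv HB _ _ one)) as [q I].
  eexists _, q. split; [|exact I]. apply (int_has (psnoc ⟨one⟩ one) ⟨one⟩).
Qed.

End Unit.

Lemma int_rich : rich K.
Proof.
  split.
  - intros x. exists (Arrow (hunit x)). split; auto using int_unitlike.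
  - intros [x y a] [y' z b] E. simpl in E. subst y'. exists (Arrow (a ⊗ b)).
    exists (Some (int_tensor a b)), (Some (int_tensor_inv a b)). split; [|apply int_tensor_iso].
    apply (int_has (psnoc ⟨a⟩ b) ⟨a ⊗ b⟩).
Qed.

Ltac simplB := repeat rewrite ?(hvid HB), ?(vidl HB), ?(vidr HB).

(** [B] is presented by its own calculus of sequences; the coherence of the units is
    the triangle axiom. *)
Definition int_presentation : presentation B K.
Proof.
  refine (@Presentation B X K (fun x y a => Arrow a) (fun x y a b p => ICell ⟨a⟩ ⟨b⟩ p)
    (fun x y z a b => Some (int_tensor a b)) (fun x y z a b => Some (int_tensor_inv a b))
    (fun x y a => Some (ICell (psnoc ⟨hunit x⟩ a) ⟨a⟩ (lun a)))
    (fun x y a => Some (ICell (psnoc ⟨a⟩ (hunit y)) ⟨a⟩ (run a)))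
    _ _ _ _ _ _ _ _ _ _ _ _ _ _ _ _ _); intros.
  - apply (int_has ⟨a⟩ ⟨b⟩).
  - now apply (@ICell_inj _ _ ⟨a⟩ ⟨b⟩).
  - destruct (icell_typed ⟨a⟩ ⟨b⟩ r H H0) as [p ->]. eauto.
  - apply (int_has (psnoc ⟨a⟩ b) ⟨a ⊗ b⟩).
  - apply int_tensor_iso.
  - apply (int_has (psnoc ⟨hunit x⟩ a) ⟨a⟩).
  - apply (int_isoc_ex (psnoc ⟨hunit x⟩ a) ⟨a⟩), (lun_inv HB).
  - apply (int_has (psnoc ⟨a⟩ (hunit y)) ⟨a⟩).
  - apply (int_isoc_ex (psnoc ⟨a⟩ (hunit y)) ⟨a⟩), (run_inv HB).
  - apply int_unitlike.
  - etransitivity; [exact (int_W pempty (psnoc ⟨a⟩ (hunit y)) ⟨a⟩ (run a) (pfull ⟨b⟩))|].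
    symmetry.
    etransitivity; [exact (int_W (pfull ⟨a⟩) (psnoc ⟨hunit y⟩ b) ⟨b⟩ (lun b) pempty)|].
    simpl. do 2 f_equal. simplB. apply (triangle HB).
  - symmetry. apply (int_idc ⟨a⟩).
  - symmetry. apply (int_vc ⟨a⟩ ⟨b⟩ ⟨c⟩).
  - pose proof (int_W pempty ⟨a⟩ ⟨c⟩ p (pfull ⟨b⟩)) as E1.
    pose proof (int_W (pfull ⟨c⟩) ⟨b⟩ ⟨d⟩ q pempty) as E2.
    symmetry.
    etransitivity; [exact (f_equal2 (vc K) eq_refl (f_equal2 (vc K) E1 (f_equal2 (vc K) E2 eq_refl)))|].
    etransitivity; [refine (f_equal2 (vc K) eq_refl (f_equal2 (vc K) eq_refl _));
      exact (int_vc (psnoc ⟨c⟩ b) (psnoc ⟨c⟩ d) ⟨c ⊗ d⟩ _ _)|].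
    etransitivity; [refine (f_equal2 (vc K) eq_refl _);
      exact (int_vc (psnoc ⟨a⟩ b) (psnoc ⟨c⟩ b) ⟨c ⊗ d⟩ _ _)|].
    etransitivity; [exact (int_vc ⟨a ⊗ b⟩ (psnoc ⟨a⟩ b) ⟨c ⊗ d⟩ _ _)|].
    do 2 f_equal. simpl. simplB.
    transitivity ((p ⊙ vid c) ⊠ (vid b ⊙ q)); [symmetry; apply (interchange HB)|]. now simplB.
  - pose proof (int_W pempty ⟨a ⊗ b⟩ (psnoc ⟨a⟩ b) (vid _) (pfull ⟨c⟩)) as E1.
    pose proof (int_W (pfull ⟨a⟩) (psnoc ⟨b⟩ c) ⟨b ⊗ c⟩ (vid _) pempty) as E2.
    symmetry.
    etransitivity; [exact (f_equal2 (vc K) eq_refl (f_equal2 (vc K) E1 (f_equal2 (vc K) E2 eq_refl)))|].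
    etransitivity; [refine (f_equal2 (vc K) eq_refl (f_equal2 (vc K) eq_refl _));
      exact (int_vc (psnoc (psnoc ⟨a⟩ b) c) (psnoc ⟨a⟩ (b ⊗ c)) ⟨a ⊗ (b ⊗ c)⟩ _ _)|].
    etransitivity; [refine (f_equal2 (vc K) eq_refl _);
      exact (int_vc (psnoc ⟨a ⊗ b⟩ c) (psnoc (psnoc ⟨a⟩ b) c) ⟨a ⊗ (b ⊗ c)⟩ _ _)|].
    etransitivity; [exact (int_vc ⟨a ⊗ b ⊗ c⟩ (psnoc ⟨a ⊗ b⟩ c) ⟨a ⊗ (b ⊗ c)⟩ _ _)|].
    do 2 f_equal. simpl. now simplB.
  - symmetry. etransitivity; [exact (int_vc ⟨hunit x ⊗ a⟩ (psnoc ⟨hunit x⟩ a) ⟨a⟩ _ _)|].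
    do 2 f_equal. simpl. now simplB.
  - symmetry. etransitivity; [exact (int_vc ⟨a ⊗ hunit y⟩ (psnoc ⟨a⟩ (hunit y)) ⟨a⟩ _ _)|].
    do 2 f_equal. simpl. now simplB.
Defined.

End IntRich.

(** * The functor from bicategories to merge-bicategories *)

Arguments nmap {B C} f {x y} N.
Arguments fjoin {B C} f {x y} N.
Arguments fsplit {B C} f {x y} N.

Section IntMap.
Variables B C : bicat.
Variable f : psf B C.
Let HB := bicatP B.
Let HC := bicatP C.
Let Hf := psfP f.

Notation "⟪ N ⟫" := (lcomp N) (at level 0, format "⟪ N ⟫").
Notation "M ⋆ N" := (ncat M N) (at level 40, left associativity).

Lemma fjoin_fsplit x y (N : nepath B x y) :
  fjoin f N ⊙ fsplit f N = vid _ /\ fsplit f N ⊙ fjoin f N = vid _.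
Proof.
  induction N as [y a | y z N IH a]; simpl.
  - now rewrite (vidl HC).
  - destruct IH as [H1 H2], (inverseP C (ften_inv Hf _ _ _ ⟪N⟫ a)) as [H3 H4]. split.
    + rewrite (vassoc HC), <- (vassoc HC _ _ _ _ _ _ (ften f _ _)).
      etransitivity; [exact (f_equal2 (fun u v => u ⊙ (v ⊙ _)) eq_refl H3)|].
      rewrite (vidl HC).
      rewrite <- (interchange HC), H1, (vidl HC), (hvid HC). reflexivity.
    + rewrite (vassoc HC), <- (vassoc HC _ _ _ _ _ _ (fsplit f N ⊠ _)).
      rewrite <- (interchange HC), H2, (vidl HC), (hvid HC), (vidl HC). exact H4.
Qed.

Lemma nmap_ncat x y z (M : nepath B x y) (N : nepath B y z) :
  nmap f (M ⋆ N) = nmap f M ⋆ nmap f N.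
Proof. induction N; simpl; congruence. Qed.

(** The hexagon axiom of [f], iterated: it makes [int_map f] compatible with
    whiskering. *)
Lemma fjoin_split x y z (M : nepath B x y) (N : nepath B y z)
  (E : nmap f (M ⋆ N) = nmap f M ⋆ nmap f N) :
  fjoin f (M ⋆ N) ⊙ f2 f (split B M N)
  = vcast C E ⊙ split C (nmap f M) (nmap f N) ⊙ (fjoin f M ⊠ fjoin f N) ⊙ ften f ⟪M⟫ ⟪N⟫.
Proof.
  induction N as [z a | z w N IH a]; simpl.
  - rewrite vcast_refl. simpl. rewrite (f2_vid Hf), !(vidl HC), (vidr HC). reflexivity.
  - simpl in E. rewrite (@vcast_psnoc _ _ _ _ _ _ _ (nmap_ncat M N) E).
    specialize (IH (nmap_ncat M N)).
    rewrite (f2_vcomp Hf), !(vassoc HC).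
    rewrite <- (vassoc HC _ _ _ _ _ _ (ften f ⟪M ⋆ N⟫ a)), <- (ften_nat Hf), (f2_vid Hf).
    rewrite <- !(vassoc HC), <- (hcomp_vid C), IH, !(hcomp_vid C), !(vassoc HC).
    do 2 f_equal.
    rewrite <- (vassoc HC _ _ _ _ _ _ (ften f ⟪M⟫ ⟪N⟫ ⊠ _)), (ften_asc Hf).
    rewrite <- !(vassoc HC). f_equal. rewrite (asc_nat HC), !(vassoc HC). f_equal.
    rewrite <- (interchange HC). now rewrite (vidr HC).
Qed.

Lemma fjoin_inv x y (N : nepath B x y) : invertible (fjoin f N).
Proof. exists (fsplit f N). apply fjoin_fsplit. Qed.

Definition fbody x y (N N' : nepath B x y) (p : bcell ⟪N⟫ ⟪N'⟫) :
  bcell ⟪nmap f N⟫ ⟪nmap f N'⟫ := fjoin f N ⊙ f2 f p ⊙ fsplit f N'.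

Arguments fbody {x y N N'} p.

Lemma fbody_join x y (N N' : nepath B x y) (p : bcell ⟪N⟫ ⟪N'⟫) :
  fbody p ⊙ fjoin f N' = fjoin f N ⊙ f2 f p.
Proof.
  unfold fbody. destruct (fjoin_fsplit N') as [_ H]. now rewrite (vassoc HC), H, (vidr HC).
Qed.

Lemma fbody_wl x y z (M : nepath B x y) (N N' : nepath B y z) (p : bcell ⟪N⟫ ⟪N'⟫) :
  ICell (nmap f (M ⋆ N)) (nmap f (M ⋆ N')) (fbody (wl B M p))
  = ICell (nmap f M ⋆ nmap f N) (nmap f M ⋆ nmap f N') (wl C (nmap f M) (fbody p)).
Proof.
  set (E := nmap_ncat M N). set (E' := nmap_ncat M N').
  apply (ICell_cast C _ _ E E').
  apply (invertible_mono HC _ _ (split C (nmap f M) (nmap f N')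
    ⊙ (fjoin f M ⊠ fjoin f N') ⊙ ften f ⟪M⟫ ⟪N'⟫)).
  { apply (invertible_vcomp HC); [apply (invertible_vcomp HC)|].
    - apply split_inv.
    - apply (invertible_hcomp HC); apply fjoin_inv.
    - apply (ften_inv Hf). }
  rewrite !(vassoc HC).
  pose proof (fjoin_split M N' E') as S'. pose proof (fjoin_split M N E) as S.
  rewrite !(vassoc HC) in S, S'. rewrite <- S'.
  rewrite <- (vassoc HC _ _ _ _ _ _ (fbody _)), fbody_join, (vassoc HC), <- (f2_vcomp Hf),
    wl_split, (f2_vcomp Hf), <- (vassoc HC), S.
  rewrite !(vassoc HC). f_equal.
  rewrite <- (vassoc HC _ _ _ _ _ _ (wl C _ _)), wl_split, !(vassoc HC). f_equal.
  rewrite <- (ften_nat Hf), (f2_vid Hf), <- !(vassoc HC). f_equal.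
  rewrite <- !(interchange HC), fbody_join. now rewrite (vidl HC), (vidr HC).
Qed.

Lemma fbody_wr x y z (M : nepath B y z) (N N' : nepath B x y) (p : bcell ⟪N⟫ ⟪N'⟫) :
  ICell (nmap f (N ⋆ M)) (nmap f (N' ⋆ M)) (fbody (wr B p M))
  = ICell (nmap f N ⋆ nmap f M) (nmap f N' ⋆ nmap f M) (wr C (fbody p) (nmap f M)).
Proof.
  set (E := nmap_ncat N M). set (E' := nmap_ncat N' M).
  apply (ICell_cast C _ _ E E').
  apply (invertible_mono HC _ _ (split C (nmap f N') (nmap f M)
    ⊙ (fjoin f N' ⊠ fjoin f M) ⊙ ften f ⟪N'⟫ ⟪M⟫)).
  { apply (invertible_vcomp HC); [apply (invertible_vcomp HC)|].
    - apply split_inv.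
    - apply (invertible_hcomp HC); apply fjoin_inv.
    - apply (ften_inv Hf). }
  rewrite !(vassoc HC).
  pose proof (fjoin_split N' M E') as S'. pose proof (fjoin_split N M E) as S.
  rewrite !(vassoc HC) in S, S'. rewrite <- S'.
  rewrite <- (vassoc HC _ _ _ _ _ _ (fbody _)), fbody_join, (vassoc HC), <- (f2_vcomp Hf),
    wr_split, (f2_vcomp Hf), <- (vassoc HC), S.
  rewrite !(vassoc HC). f_equal.
  rewrite <- (vassoc HC _ _ _ _ _ _ (wr C _ _)), wr_split, !(vassoc HC). f_equal.
  rewrite <- (ften_nat Hf), (f2_vid Hf), <- !(vassoc HC). f_equal.
  rewrite <- !(interchange HC), fbody_join. now rewrite (vidl HC), (vidr HC).
Qed.

Definition pmap x y (P : path B x y) : path C (f0 f x) (f0 f y) :=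
  match P in path _ _ y' return path C (f0 f x) (f0 f y') with
  | pempty => pempty
  | pfull N => pfull (nmap f N)
  end.

Arguments pmap {x y} P.

Definition amap (a : arrow B) : arrow C := Arrow (f1 f (ahom a)).

Lemma plist_nmap x y (N : nepath B x y) : plist (nmap f N) = map amap (plist N).
Proof. induction N; simpl; auto. now rewrite map_app, IHN. Qed.

Lemma clist_pmap x y (P : path B x y) : clist (pmap P) = map amap (clist P).
Proof. destruct P; simpl; auto using plist_nmap. Qed.

Lemma fbody_l x y z (P : path B x y) (N N' : nepath B y z) (p : bcell ⟪N⟫ ⟪N'⟫) :
  ICell _ _ (fbody (whisker_l B P N N' p))
  = ICell _ _ (whisker_l C (pmap P) (nmap f N) (nmap f N') (fbody p)).
Proof. destruct P as [|y M]; [reflexivity|]. exact (fbody_wl M N N' p). Qed.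

Lemma fbody_r x y z (P : path B y z) (N N' : nepath B x y) (p : bcell ⟪N⟫ ⟪N'⟫) :
  ICell _ _ (fbody (whisker_r B N N' p P))
  = ICell _ _ (whisker_r C (nmap f N) (nmap f N') (fbody p) (pmap P)).
Proof. destruct P as [|z M]; [reflexivity|]. exact (fbody_wr M N N' p). Qed.

Lemma int_calculus_map : calculus_map (int_calculus B) (int_calculus C) (int_map f).
Proof.
  constructor; simpl.
  - reflexivity.
  - reflexivity.
  - intros p. apply plist_nmap.
  - intros p. apply plist_nmap.
  - intros [x y N N' p] q H. destruct (@icell_match B _ _ _ _ p q H) as (N'' & q' & ->).
    rewrite isqE. simpl. rewrite isqE. f_equal. rewrite (f2_vcomp Hf).
    destruct (fjoin_fsplit N') as [_ H'].
    rewrite !(vassoc HC), <- (vassoc HC _ _ _ _ _ _ (fsplit f N')), H', (vidl HC). reflexivity.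
  - intros A [y z N N' p] D H.
    destruct (@context_match B _ _ _ _ N H) as (x & w & P & Q & <- & <-).
    rewrite iwhE. simpl.
    change (map (fun a => Arrow (f1 f (ahom a)))) with (map amap).
    rewrite <- !clist_pmap. change (fjoin f N ⊙ f2 f p ⊙ fsplit f N') with (fbody p).
    rewrite iwhE.
    etransitivity; [exact (fbody_l P (catr N Q) (catr N' Q) (whisker_r B N N' p Q))|].
    exact (icell_l_congr C (pmap P) (fbody_r Q N N' p)).
  - intros Γ e H. apply ineutral in H as (x & y & N & <- & ->).
    apply ineutral. exists (f0 f x), (f0 f y), (nmap f N). split; [apply plist_nmap|].
    simpl. f_equal. rewrite (f2_vid Hf), (vidr HC). apply fjoin_fsplit.
Qed.

Lemma int_map_strong : is_strong (int_data B) (int_data C) (int_map f).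
Proof.
  apply (calculus_map_strong int_calculus_map (int_rich B) (int_rich C)).
  intros x. exists (Arrow (hunit x)). split; [apply int_unitlike|]. split; [reflexivity|].
  simpl. apply (unitlike_equi (K := int_calculus C) (i := Arrow (hunit (f0 f x))));
    [|apply int_unitlike].
  destruct (int_isoc_ex C (psingle (hunit (f0 f x))) (psingle (f1 f (hunit x))) (funit_inv Hf x))
    as [q I].
  eexists _, q. split; [|exact I]. apply (int_has C (psingle _) (psingle _)).
Qed.

End IntMap.

Section IntFunctorial.

Lemma nmap_id (B : bicat) x y (N : nepath B x y) : nmap (psf_id B) N = N.
Proof. induction N; simpl; congruence. Qed.

Lemma fjoin_id (B : bicat) x y (N : nepath B x y) (E : nmap (psf_id B) N = N) :
  fjoin (psf_id B) N = vcast B E.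
Proof.
  induction N as [y a | y z N IH a]; simpl.
  - now rewrite vcast_refl.
  - rewrite (IH (nmap_id B N)). etransitivity; [apply (vidr (bicatP B))|].
    symmetry. exact (@vcast_psnoc B _ _ _ _ _ a (nmap_id B N) E).
Qed.

Lemma int_map_id_eq (B : bicat) : int_map (psf_id B) = merge_map_id (int_data B).
Proof.
  unfold int_map, merge_map_id. simpl. f_equal.
  - apply functional_extensionality. now intros [].
  - apply functional_extensionality. intros [x y N N' p]. simpl.
    apply (ICell_cast B _ _ (nmap_id B N) (nmap_id B N')).
    rewrite <- !(fjoin_id B). apply (fbody_join (psf_id B) N N' p).
Qed.

Variables B C D : bicat.
Variable f : psf B C.
Variable g : psf C D.
Let h : psf B D := psf_comp f g.
Let HD := bicatP D.

Lemma nmap_comp x y (N : nepath B x y) : nmap h N = nmap g (nmap f N).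
Proof. induction N; simpl; congruence. Qed.

Lemma fjoin_comp x y (N : nepath B x y) (E : nmap h N = nmap g (nmap f N)) :
  fjoin h N = vcast D E ⊙ (fjoin g (nmap f N) ⊙ f2 g (fjoin f N)).
Proof.
  induction N as [y a | y z N IH a]; simpl.
  - rewrite vcast_refl. rewrite (f2_vid (psfP g)), !(vidl HD). reflexivity.
  - assert (E' : vcast D E = vcast D (nmap_comp N) ⊠ vid (f1 g (f1 f a))) by exact (@vcast_psnoc D _ _ _ _ _ _ (nmap_comp N) E).
    rewrite (IH (nmap_comp N)). etransitivity; [|exact (f_equal (fun u => u ⊙ _) (eq_sym E'))].
    rewrite !(hcomp_vid D), !(vassoc HD), (f2_vcomp (psfP g)). do 2 f_equal.
    rewrite <- !(vassoc HD). f_equal.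
    rewrite <- (f2_vid (psfP g)). apply (ften_nat (psfP g)).
Qed.

Lemma int_map_comp_eq : int_map h = merge_map_comp (int_map f) (int_map g).
Proof.
  unfold int_map, merge_map_comp. simpl. f_equal.
  apply functional_extensionality. intros [x y N N' p]. simpl.
  apply (ICell_cast D _ _ (nmap_comp N) (nmap_comp N')).
  apply (invertible_mono HD _ _ (fjoin g (nmap f N') ⊙ f2 g (fjoin f N'))).
  { apply (invertible_vcomp HD); [apply fjoin_inv|].
    apply (invertible_f2 (psfP g)), fjoin_inv. }
  rewrite (vassoc HD), <- fjoin_comp.
  etransitivity; [exact (fbody_join h N N' p)|].
  rewrite (fjoin_comp N (nmap_comp N)), !(vassoc HD). f_equal.
  f_equal.
  rewrite <- (vassoc HD _ _ _ _ _ _ (fsplit g _)).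
  rewrite (proj2 (fjoin_fsplit g (nmap f N'))), (vidl HD), <- !(f2_vcomp (psfP g)).
  symmetry. etransitivity; [exact (f_equal (f2 g) (fbody_join f N N' p))|].
  apply (f2_vcomp (psfP g)).
Qed.

End IntFunctorial.

Lemma int_is_functorial : int_functorial.
Proof.
  constructor.
  - intros B. exact (calculus_merge_bicat (int_calculus B)).
  - intros B. exact (rich_representable (int_rich B)).
  - intros B C f. exact (calculus_map_morphism (int_calculus_map f)).
  - intros B C f. exact (int_map_strong f).
  - apply int_map_id_eq.
  - apply int_map_comp_eq.
Qed.

(** * Realizing sequences in a presented bicategory *)

Lemma isoc_mono X (K : calculus X) p q Γ Δ x y Θ : isoc K p q Γ Δ ->
  typ x Θ Γ -> typ y Θ Γ -> vc K x p = vc K y p -> x = y.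
Proof.
  intros I Tx Ty E. now rewrite <- (isoc_cancel_r I Tx), E, (isoc_cancel_r I Ty).
Qed.

Section Realize.
Variable B : bicat.
Variable X : merge_data.
Variable K : calculus X.
Variable P : presentation B K.
Variable e0 : bob B -> cell0 X.
Hypothesis pr1_src : forall x y (a : @bhom B x y), src (pr1 P a) = e0 x.
Hypothesis pr1_tgt : forall x y (a : @bhom B x y), tgt (pr1 P a) = e0 y.
Let HB := bicatP B.

Notation vc := (vc K).
Notation W := (W K).
Notation idc := (idc K).
Notation "⌊ a ⌋" := (pr1 P a) (at level 0, format "⌊ a ⌋").
Notation "⟦ p ⟧" := (Some (pr2 P p)) (at level 0, format "⟦ p ⟧").
Notation "⟪ N ⟫" := (lcomp N) (at level 0, format "⟪ N ⟫").
Notation "M ⋆ N" := (ncat M N) (at level 40, left associativity).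

Definition real1 (a : arrow B) : cell1 X := ⌊ahom a⌋.

Fixpoint rlist x y (N : nepath B x y) : list (cell1 X) :=
  match N with
  | psingle a => [⌊a⌋]
  | psnoc N a => rlist N ++ [⌊a⌋]
  end.

(** [fuse N : (a1, ..., an) -> (a1 ⊗ ... ⊗ an)] iterates the tensors, and [unfuse N] is
    its inverse.  Conjugation with these cells, [real] below, turns the 2-cells of [∫ B]
    into 2-cells of [X]. *)
Fixpoint fuse x y (N : nepath B x y) : option (cell2 X) :=
  match N with
  | psingle a => idc [⌊a⌋]
  | psnoc N a => vc (W [] (fuse N) [⌊a⌋]) (prt P ⟪N⟫ a)
  end.

Fixpoint unfuse x y (N : nepath B x y) : option (cell2 X) :=
  match N with
  | psingle a => idc [⌊a⌋]
  | psnoc N a => vc (prti P ⟪N⟫ a) (W [] (unfuse N) [⌊a⌋])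
  end.

Arguments rlist {x y} N.
Arguments fuse {x y} N.
Arguments unfuse {x y} N.

Lemma rlist_plist x y (N : nepath B x y) : rlist N = map real1 (plist N).
Proof. induction N; simpl; auto. now rewrite map_app, IHN. Qed.

Lemma rlist_nonempty x y (N : nepath B x y) : rlist N <> [].
Proof. rewrite rlist_plist. intros H%map_eq_nil. now apply plist_nonempty in H. Qed.

Lemma rlist_ncat x y z (M : nepath B x y) (N : nepath B y z) :
  rlist (M ⋆ N) = rlist M ++ rlist N.
Proof. rewrite !rlist_plist, plist_ncat. apply map_app. Qed.

Lemma map_real_composable Γ : composable (int_data B) Γ -> composable X (map real1 Γ).
Proof.
  intros (N & x & y & H). split; [now destruct Γ|]. exists (e0 x), (e0 y).
  clear N. revert x H. induction Γ as [|[u v a] Γ IH]; simpl; intros x H; [now subst|].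
  destruct H as [<- H]. unfold real1 at 1 2. simpl. rewrite pr1_src, pr1_tgt. auto.
Qed.

Lemma fuse_iso x y (N : nepath B x y) : isoc K (fuse N) (unfuse N) (rlist N) [⌊⟪N⟫⌋].
Proof.
  induction N as [y a | y z N IH a]; simpl.
  - split; [|split; [|split]]; try apply typ_idc; apply (vc_idl K (typ_idc K _)).
  - eapply isoc_vc; [|apply prt_iso].
    apply (isoc_W (K := K) [] [⌊a⌋] (Γ := rlist N) (Δ := [⌊⟪N⟫⌋]));
      [apply rlist_nonempty | discriminate | exact IH].
Qed.

Lemma fuse_typ x y (N : nepath B x y) : typ (fuse N) (rlist N) [⌊⟪N⟫⌋].
Proof. apply fuse_iso. Qed.

Lemma unfuse_typ x y (N : nepath B x y) : typ (unfuse N) [⌊⟪N⟫⌋] (rlist N).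
Proof. apply fuse_iso. Qed.

Lemma fuse_has x y (N : nepath B x y) : has X (fuse N) (rlist N) [⌊⟪N⟫⌋].
Proof.
  induction N as [y a | y z N IH a]; simpl.
  - apply has_idc, composable_one.
  - eapply has_vc; [|apply prt_has]. apply (has_W K [] [⌊a⌋] IH). simpl.
    assert (C : composable X (rlist (psnoc N a))).
    { rewrite rlist_plist. apply map_real_composable. split; [apply plist_nonempty|].
      exists x, z. apply plist_chain. }
    exact C.
Qed.

Lemma unfuse_has x y (N : nepath B x y) : has X (unfuse N) [⌊⟪N⟫⌋] (rlist N).
Proof. exact (has_inverse (fuse_has N) (fuse_iso N)). Qed.

Let c_typ := @pr2_typ B X K P.
Let t_typ := @prt_typ B X K P.
Let ti_typ := @prti_typ B X K P.

Ltac ty0 := first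
  [ eapply typ_vc; [ty0 | ty0] | eapply typ_W; ty0 | apply typ_idc
  | apply c_typ | apply t_typ | apply ti_typ | apply fuse_typ | apply unfuse_typ ].
Ltac ty := eapply typ_conv; [ty0 | cbn [app]; rewrite ?app_nil_r, ?rlist_ncat; reflexivity
  | cbn [app]; rewrite ?app_nil_r, ?rlist_ncat; reflexivity].

Ltac norm := rewrite ?W_vc, ?W_W, ?vc_assoc; cbn [app]; rewrite ?app_nil_r, <- ?app_assoc; cbn [app].

Ltac cancel := repeat first
  [ match goal with |- context [vc (W ?A (prt P ?a ?b) ?B) (vc (W ?A (prti P ?a ?b) ?B) ?x)] =>
      erewrite (isoc_W_cancel A B (x := x) (prt_iso P a b));
        [| discriminate | discriminate | ty] end
  | match goal with |- context [vc (prt P ?a ?b) (vc (prti P ?a ?b) ?x)] =>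
      erewrite (isoc_cancel (x := x) (prt_iso P a b)); [| ty] end
  | match goal with |- context [vc (idc ?Γ) ?x] =>
      erewrite (vc_idl K (p := x)); [| ty] end ].

Ltac formulas := repeat progress rewrite ?(pr_hcomp P), ?(pr_vcomp P), ?(pr_asc P), ?(pr_vid P);
  rewrite ?W_idc by discriminate; norm; cancel.

(** [split] is realized as the change of bracketing that it stands for: this is where
    the definitions of the associator and of the horizontal composite of 2-cells enter. *)
Lemma fuse_split x y z (M : nepath B x y) (N : nepath B y z) :
  vc (fuse (M ⋆ N)) ⟦split B M N⟧
  = vc (W [] (fuse M) (rlist N)) (vc (W [⌊⟪M⟫⌋] (fuse N) []) (prt P ⟪M⟫ ⟪N⟫)).
Proof.
  induction N as [z a | z w N IH a]; simpl.
  - formulas. f_equal. apply (vc_idr K (t_typ _ _ _ ⟪M⟫ a)).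
  - formulas.
    transitivity (vc (W [] (vc (fuse (M ⋆ N)) ⟦split B M N⟧) [⌊a⌋])
      (vc (W [] (prti P ⟪M⟫ ⟪N⟫) [⌊a⌋])
         (vc (W [⌊⟪M⟫⌋] (prt P ⟪N⟫ a) []) (prt P ⟪M⟫ (⟪N⟫ ⊗ a))))).
    { norm. reflexivity. }
    rewrite IH. norm. cancel. reflexivity.
Qed.

Definition real x y (N N' : nepath B x y) (p : bcell ⟪N⟫ ⟪N'⟫) : option (cell2 X) :=
  vc (fuse N) (vc ⟦p⟧ (unfuse N')).

Arguments real {x y N N'} p.

Lemma real_typ x y (N N' : nepath B x y) (p : bcell ⟪N⟫ ⟪N'⟫) :
  typ (real p) (rlist N) (rlist N').
Proof. unfold real. ty. Qed.

Lemma real_has x y (N N' : nepath B x y) (p : bcell ⟪N⟫ ⟪N'⟫) :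
  has X (real p) (rlist N) (rlist N').
Proof.
  eapply has_vc; [apply fuse_has|]. eapply has_vc; [apply pr2_has | apply unfuse_has].
Qed.

Lemma real_fuse x y (N N' : nepath B x y) (p : bcell ⟪N⟫ ⟪N'⟫) :
  vc (real p) (fuse N') = vc (fuse N) ⟦p⟧.
Proof.
  unfold real. rewrite !vc_assoc.
  rewrite (proj2 (proj2 (proj2 (fuse_iso N')))). f_equal. apply (vc_idr K (c_typ _ _ _ _ p)).
Qed.

Lemma real_vcomp x y (N N' N'' : nepath B x y) (p : bcell ⟪N⟫ ⟪N'⟫) (q : bcell ⟪N'⟫ ⟪N''⟫) :
  real (p ⊙ q) = vc (real p) (real q).
Proof.
  unfold real. rewrite (pr_vcomp P), !vc_assoc.
  rewrite (isoc_cancel (isoc_sym (fuse_iso N')) (Θ := rlist N'')); [reflexivity|]. ty.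
Qed.

Lemma real_vid x y (N : nepath B x y) : real (vid ⟪N⟫) = idc (rlist N).
Proof.
  unfold real. rewrite (pr_vid P), (vc_idl K (unfuse_typ N)). apply fuse_iso.
Qed.

Lemma fuse_split_iso x y z (M : nepath B x y) (N : nepath B y z) : exists q,
  isoc K (vc (fuse (M ⋆ N)) ⟦split B M N⟧) q (rlist M ++ rlist N) [⌊⟪M⟫ ⊗ ⟪N⟫⌋].
Proof.
  destruct (split_inv B M N) as (j & J1 & J2). exists (vc ⟦j⟧ (unfuse (M ⋆ N))).
  rewrite <- rlist_ncat. eapply isoc_vc; [apply fuse_iso|].
  split; [apply c_typ|]. split; [apply c_typ|].
  rewrite <- !(pr_vcomp P), J1, J2, !(pr_vid P). auto.
Qed.

(** Both sides are compared after fusing [M] and [N'] separately, where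
    [fuse_split] applies. *)
Lemma real_wl x y z (M : nepath B x y) (N N' : nepath B y z) (p : bcell ⟪N⟫ ⟪N'⟫) :
  real (wl B M p) = W (rlist M) (real p) [].
Proof.
  destruct (fuse_split_iso M N') as [q I].
  apply (isoc_mono (Θ := rlist M ++ rlist N) I).
  - rewrite <- !rlist_ncat. apply real_typ.
  - pose proof (typ_W K (rlist M) [] (real_typ N N' p)) as T. now rewrite !app_nil_r in T.
  - rewrite <- vc_assoc, real_fuse, vc_assoc, <- (pr_vcomp P), wl_split, (pr_vcomp P),
      <- vc_assoc, fuse_split, fuse_split.
    pose proof (exch_vc K [] [] [] (fuse_typ M) (real_typ N N' p)) as E.
    cbn [app] in E. rewrite !app_nil_r in E. rewrite <- E, <- (vc_assoc K (W _ (real p) _)).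
    rewrite <- W_vc, real_fuse. formulas. reflexivity.
Qed.

Lemma real_wr x y z (M : nepath B y z) (N N' : nepath B x y) (p : bcell ⟪N⟫ ⟪N'⟫) :
  real (wr B p M) = W [] (real p) (rlist M).
Proof.
  destruct (fuse_split_iso N' M) as [q I].
  apply (isoc_mono (Θ := rlist N ++ rlist M) I).
  - rewrite <- !rlist_ncat. apply real_typ.
  - exact (typ_W K [] (rlist M) (real_typ N N' p)).
  - rewrite <- vc_assoc, real_fuse, vc_assoc, <- (pr_vcomp P), wr_split, (pr_vcomp P),
      <- vc_assoc, fuse_split, fuse_split.
    rewrite <- (vc_assoc K (W _ (real p) _)), <- W_vc, real_fuse. formulas.
    pose proof (exch_vc K [] [] [] (c_typ _ _ _ _ p) (fuse_typ M)) as E.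
    cbn [app] in E. rewrite !app_nil_r in E. rewrite <- E. reflexivity.
Qed.


Lemma real1_list x y (N : nepath B x y) : map real1 (plist N) = rlist N.
Proof. symmetry. apply rlist_plist. Qed.

Lemma real_whisker x y z w (A : path B x y) (N N' : nepath B y z) (p : bcell ⟪N⟫ ⟪N'⟫)
  (C : path B z w) :
  real (whisker_l B A _ _ (whisker_r B N N' p C))
  = W (map real1 (clist A)) (real p) (map real1 (clist C)).
Proof.
  assert (R : forall (N N' : nepath B y z) (p : bcell ⟪N⟫ ⟪N'⟫),
    real (whisker_r B N N' p C) = W [] (real p) (map real1 (clist C))).
  { destruct C as [|w M]; intros N1 N1' p1; simpl.
    - symmetry. apply W_nil.
    - rewrite real1_list. exact (real_wr M N1 N1' p1). }
  destruct A as [|y M]; simpl.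
  - apply R.
  - rewrite real1_list. etransitivity; [exact (real_wl M (catr N C) (catr N' C) _)|].
    rewrite R, W_W. cbn [app]. now rewrite !app_nil_r.
Qed.

Lemma real_ex (i : icell B) : exists r, real (ibody i) = Some r /\
  inp r = map real1 (inp (X := int_data B) i) /\ out r = map real1 (out (X := int_data B) i).
Proof.
  destruct (real_has (iinp i) (iout i) (ibody i)) as (r & E & H1 & H2).
  exists r. split; [exact E|]. simpl. rewrite !real1_list. auto.
Qed.

Definition real2 (i : icell B) : cell2 X :=
  proj1_sig (constructive_indefinite_description _ (real_ex i)).

Lemma real2E (i : icell B) : Some (real2 i) = real (ibody i).
Proof. symmetry. exact (proj1 (proj2_sig (constructive_indefinite_description _ (real_ex i)))). Qed.

Lemma real2_bd (i : icell B) : inp (real2 i) = map real1 (inp (X := int_data B) i) /\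
  out (real2 i) = map real1 (out (X := int_data B) i).
Proof. exact (proj2 (proj2_sig (constructive_indefinite_description _ (real_ex i)))). Qed.

Definition real_map : merge_map (int_data B) X := @MergeMap (int_data B) X e0 real1 real2.

Lemma real_calculus_map : calculus_map (int_calculus B) K real_map.
Proof.
  constructor; simpl.
  - intros [x y a]. apply pr1_src.
  - intros [x y a]. apply pr1_tgt.
  - intros i. apply real2_bd.
  - intros i. apply real2_bd.
  - intros [x y N N' p] q H. destruct (@icell_match B _ _ _ _ p q H) as (N'' & q' & ->).
    rewrite isqE.
    assert (E : forall u v : cell2 X, Some u = Some v -> u = v) by congruence. apply E.
    rewrite real2E. simpl. rewrite real_vcomp.
    pose proof (real2E (ICell N N' p)) as E1. pose proof (real2E (ICell N' N'' q')) as E2.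
    simpl in E1, E2. rewrite <- E1, <- E2. apply vc_Some.
    rewrite (proj2 (real2_bd (ICell N N' p))), (proj1 (real2_bd (ICell N' N'' q'))). reflexivity.
  - intros A [y z N N' p] C H.
    destruct (@context_match B _ _ _ _ N H) as (x & w & Q & R & <- & <-).
    rewrite iwhE.
    assert (E : forall u v : cell2 X, Some u = Some v -> u = v) by congruence. apply E.
    rewrite real2E. etransitivity; [exact (real_whisker Q N N' p R)|].
    pose proof (real2E (ICell N N' p)) as E1. simpl in E1. rewrite <- E1. apply W_Some.
    rewrite (proj1 (real2_bd (ICell N N' p))), <- !map_app. apply map_real_composable, H.
  - intros Γ e H. apply ineutral in H as (x & y & N & <- & ->).
    pose proof (real2E (ICell N N (vid ⟪N⟫))) as E. simpl in E.
    rewrite real_vid, <- real1_list in E. symmetry in E. now apply pickP in E.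
Qed.

(** If [pr1] is bijective then so is the realization, because conjugation with
    invertible cells is. *)
Section Bijective.
Hypothesis e0_inj : forall x y, e0 x = e0 y -> x = y.
Hypothesis real1_inj : forall a b, real1 a = real1 b -> a = b.
Hypothesis real1_surj : forall b, exists a, real1 a = b.

Lemma map_real1_inj L L' : map real1 L = map real1 L' -> L = L'.
Proof.
  revert L'. induction L; intros [|b L'] E; try discriminate; auto.
  injection E as E1 E2. f_equal; auto.
Qed.

Lemma map_real1_surj L : exists L', map real1 L' = L.
Proof.
  induction L as [|b L [L' <-]]; [now exists []|]. destruct (real1_surj b) as [a <-].
  now exists (a :: L').
Qed.

Lemma chain_real1 L x y : chain src tgt (e0 x) (map real1 L) y ->
  exists y', chain (@asrc B) (@atgt B) x L y' /\ e0 y' = y.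
Proof.
  revert x. induction L as [|[u v a] L IH]; simpl; intros x H.
  - now exists x.
  - unfold real1 in H at 1 2. simpl in H. rewrite pr1_src, pr1_tgt in H. destruct H as [E H].
    apply e0_inj in E. destruct (IH _ H) as (y' & H' & E'). exists y'. auto.
Qed.

Lemma chain_nepath L x y : L <> [] -> chain (@asrc B) (@atgt B) x L y ->
  exists N : nepath B x y, plist N = L.
Proof.
  intros NL C. apply clist_surj in C as [Q HQ]. destruct Q as [|y N]; [now destruct NL|].
  now exists N.
Qed.

Lemma real2_inj i j : real2 i = real2 j -> i = j.
Proof.
  intros E. destruct i as [x y N N' p].
  assert (Ei : inp (X := int_data B) j = plist N).
  { apply map_real1_inj. rewrite <- (proj1 (real2_bd j)), <- E. apply real2_bd. }
  assert (Eo : out (X := int_data B) j = plist N').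
  { apply map_real1_inj. rewrite <- (proj2 (real2_bd j)), <- E. apply real2_bd. }
  destruct (icell_typed B N N' j Ei Eo) as [q ->]. f_equal. apply (pr2_inj P).
  assert (Z : real p = real q).
  { pose proof (real2E (ICell N N' p)) as E1. pose proof (real2E (ICell N N' q)) as E2.
    simpl in E1, E2. congruence. }
  assert (C : vc (fuse N) ⟦p⟧ = vc (fuse N) ⟦q⟧) by now rewrite <- !real_fuse, Z.
  apply (f_equal (vc (unfuse N))) in C.
  rewrite !(isoc_cancel (isoc_sym (fuse_iso N)) (c_typ _ _ _ _ _)) in C. congruence.
Qed.

Lemma real2_surj r : exists i, real2 i = r.
Proof.
  destruct (map_real1_surj (inp r)) as [L HL], (map_real1_surj (out r)) as [L' HL'].
  assert (NL : L <> []) by (intros ->; now apply (inp_nonempty X r)).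
  assert (NL' : L' <> []) by (intros ->; now apply (out_nonempty X r)).
  destruct (parallel X r) as (x0 & y0 & C & C'). rewrite <- HL in C. rewrite <- HL' in C'.
  assert (exists x, e0 x = x0) as [x <-].
  { destruct L as [|[u v a] L]; [now destruct NL|]. destruct C as [<- _]. exists u.
    symmetry. apply pr1_src. }
  apply chain_real1 in C as (y & C & <-). apply chain_real1 in C' as (y' & C' & E).
  apply e0_inj in E. subst y'.
  apply (@chain_nepath _ _ _ NL) in C as [N <-]. apply (@chain_nepath _ _ _ NL') in C' as [N' <-].
  rewrite real1_list in HL, HL'.
  assert (T : has X (Some r) (rlist N) (rlist N')).
  { rewrite HL, HL'. apply has_Some. }
  destruct (has_vc K (unfuse_has N) (has_vc K T (fuse_has N'))) as (q & E & H1 & H2).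
  destruct (pr2_full P _ _ q H1 H2) as [p Hp]. exists (ICell N N' p).
  assert (Z : forall u v : cell2 X, Some u = Some v -> u = v) by congruence. apply Z.
  rewrite real2E. unfold real. simpl. rewrite Hp, <- E, !vc_assoc.
  rewrite (proj1 (proj2 (proj2 (fuse_iso N')))), (vc_idr K (has_typ T)).
  exact (isoc_cancel (fuse_iso N) (has_typ T)).
Qed.

End Bijective.

End Realize.

Lemma calculus_map_inverse X Y (KX : calculus X) (KY : calculus Y)
  (f : merge_map X Y) (g : merge_map Y X) : calculus_map KX KY f ->
  (forall x, m0 g (m0 f x) = x) -> (forall a, m1 g (m1 f a) = a) ->
  (forall p, m2 g (m2 f p) = p) ->
  (forall b, m1 f (m1 g b) = b) -> (forall q, m2 f (m2 g q) = q) ->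
  calculus_map KY KX g.
Proof.
  intros Hf E0 E1 E2 D1 D2.
  assert (M : forall L, map (m1 g) (map (m1 f) L) = L).
  { intros L. rewrite map_map. rewrite <- (map_id L) at 2. now apply map_ext. }
  assert (M' : forall L, map (m1 f) (map (m1 g) L) = L).
  { intros L. rewrite map_map. rewrite <- (map_id L) at 2. now apply map_ext. }
  assert (Ei : forall p, inp (m2 g p) = map (m1 g) (inp p)).
  { intros p. rewrite <- (D2 p) at 2. now rewrite (cm_inp Hf), M. }
  assert (Eo : forall p, out (m2 g p) = map (m1 g) (out p)).
  { intros p. rewrite <- (D2 p) at 2. now rewrite (cm_out Hf), M. }
  assert (Es : forall b, src (m1 g b) = m0 g (src b)).
  { intros b. rewrite <- (D1 b) at 2. now rewrite (cm_src Hf), E0. }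
  assert (Et : forall b, tgt (m1 g b) = m0 g (tgt b)).
  { intros b. rewrite <- (D1 b) at 2. now rewrite (cm_tgt Hf), E0. }
  assert (R : forall Γ, composable Y Γ -> composable X (map (m1 g) Γ)).
  { intros Γ (N & x & y & H). split; [now destruct Γ|]. exists (m0 g x), (m0 g y).
    clear N. revert x H. induction Γ; simpl; intros x H; [now subst|].
    rewrite Es, Et. destruct H as [<- H]. auto. }
  constructor; auto.
  - intros p q H. transitivity (m2 g (m2 f (sq KX (m2 g p) (m2 g q)))); [|apply E2].
    rewrite (cm_sq Hf), !D2; [reflexivity|]. now rewrite Ei, Eo, H.
  - intros A p C H.
    transitivity (m2 g (m2 f (wh KX (map (m1 g) A) (m2 g p) (map (m1 g) C)))); [|apply E2].
    rewrite (cm_wh Hf), !D2, !M'; [reflexivity|].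
    rewrite Ei, <- !map_app. apply R, H.
  - intros Γ e H. destruct (neutral_ex KX (Γ := map (m1 g) Γ)) as [e' He'].
    { apply R. destruct H as (H & _). rewrite <- H. apply composable_inp. }
    pose proof (cm_neutral Hf He') as H'. rewrite M' in H'.
    now rewrite (neutral_unique KY H H'), E2.
Qed.

(** ** Naturality of the realization *)

Section RealNatural.
Variables B B' : bicat.
Variables X X' : merge_data.
Variable K : calculus X.
Variable K' : calculus X'.
Variable P : presentation B K.
Variable P' : presentation B' K'.
Variable f : merge_map X X'.
Hypothesis Hf : calculus_map K K' f.
Variable F : psf B B'.
Let HB := bicatP B'.

Notation "⌊ a ⌋" := (pr1 P' a) (at level 0, format "⌊ a ⌋").
Notation "⟦ p ⟧" := (Some (pr2 P' p)) (at level 0, format "⟦ p ⟧").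
Notation "⟪ N ⟫" := (lcomp N) (at level 0, format "⟪ N ⟫").
Notation im := (option_map (m2 f)).

Hypothesis F1 : forall x y (a : @bhom B x y), ⌊f1 F a⌋ = m1 f (pr1 P a).
Hypothesis F2 : forall x y (a b : @bhom B x y) (p : bcell a b),
  pr2 P' (f2 F p) = m2 f (pr2 P p).
Hypothesis Ft : forall x y z (a : @bhom B x y) (b : bhom y z),
  ⟦ften F a b⟧ = vc K' (prti P' (f1 F a) (f1 F b)) (im (prt P a b)).

Variable e0 : bob B -> cell0 X.
Hypothesis Es : forall x y (a : @bhom B x y), src (pr1 P a) = e0 x.
Hypothesis Et : forall x y (a : @bhom B x y), tgt (pr1 P a) = e0 y.

Notation vc := (vc K').
Notation fuse' := (fuse B' P').
Notation fuse := (fuse B P).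

Lemma ple_has p q Γ Δ : has X p Γ Δ -> ple (im p) q -> im p = q.
Proof. intros (r & -> & _) H. symmetry. now apply H. Qed.

Lemma rlist_nmap x y (N : nepath B x y) :
  rlist B' P' (nmap F N) = map (m1 f) (rlist B P N).
Proof. induction N; simpl; rewrite ?map_app, ?F1; simpl; congruence. Qed.

(** The induction step is the hypothesis on [ften]: it compares a tensor with the image
    of a tensor. *)
Lemma fuse_natural x y (N : nepath B x y) :
  im (fuse N) = vc (fuse' (nmap F N)) ⟦fjoin F N⟧.
Proof.
  apply (ple_has (fuse_has B P e0 Es Et N)).
  induction N as [y a | y z N IH a].
  - simpl. rewrite (pr_vid P'), (vc_idl K' (typ_idc K' _)), F1. apply (cm_idc Hf [pr1 P a]).
  - assert (M : ple (im (fuse (psnoc N a))) (vc (W K' [] (vc (fuse' (nmap F N)) ⟦fjoin F N⟧)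
      [⌊f1 F a⌋]) (im (prt P ⟪N⟫ a)))).
    { apply (cm_vc Hf); [|apply ple_refl]. apply (cm_W Hf IH); simpl; now rewrite ?F1. }
    replace (vc (fuse' (nmap F (psnoc N a))) ⟦fjoin F (psnoc N a)⟧) with
      (vc (W K' [] (vc (fuse' (nmap F N)) ⟦fjoin F N⟧) [⌊f1 F a⌋]) (im (prt P ⟪N⟫ a)));
      [exact M|].
    assert (T : typ (im (prt P ⟪N⟫ a)) [⌊f1 F ⟪N⟫⌋; ⌊f1 F a⌋] [⌊f1 F (⟪N⟫ ⊗ a)⌋]).
    { pose proof (cm_has Hf (prt_has P ⟪N⟫ a)) as H. simpl in H. rewrite <- !F1 in H.
      exact (has_typ H). }
    simpl. rewrite (pr_vcomp P'), (pr_hcomp P'), Ft, (pr_vid P').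
    rewrite W_idc by discriminate. rewrite W_vc, !vc_assoc. cbn [app].
    rewrite (isoc_cancel (prt_iso P' _ _) T).
    rewrite (vc_idl K' T).
    rewrite (isoc_cancel (prt_iso P' ⟪nmap F N⟫ (f1 F a)) (Θ := [⌊f1 F (⟪N⟫ ⊗ a)⌋])); [reflexivity|].
    eapply (typ_vc K'); [|exact T]. exact (typ_W K' [] [⌊f1 F a⌋] (@pr2_typ _ _ _ P' _ _ _ _ (fjoin F N))).
Qed.

Lemma fuse_natural_iso x y (N : nepath B x y) : exists q,
  isoc K' (vc (fuse' (nmap F N)) ⟦fjoin F N⟧) q (rlist B' P' (nmap F N)) [⌊f1 F ⟪N⟫⌋].
Proof.
  exists (im (unfuse B P N)). rewrite <- fuse_natural, rlist_nmap, F1.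
  exact (cm_isoc Hf (fuse_has B P e0 Es Et N) (fuse_iso B P N)).
Qed.

Lemma real_natural x y (N N' : nepath B x y) (p : bcell ⟪N⟫ ⟪N'⟫) :
  real B' P' (nmap F N) (nmap F N') (fbody F N N' p) = im (real B P N N' p).
Proof.
  destruct (fuse_natural_iso N') as [q I].
  apply (isoc_mono (Θ := rlist B' P' (nmap F N)) I).
  - apply real_typ.
  - rewrite !rlist_nmap. apply has_typ, (cm_has Hf), (real_has B P e0 Es Et).
  - rewrite <- vc_assoc, real_fuse, vc_assoc, <- (pr_vcomp P').
    transitivity (vc (fuse' (nmap F N)) ⟦fjoin F N ⊙ f2 F p⟧).
    { do 3 f_equal. apply fbody_join. }
    rewrite (pr_vcomp P'), <- vc_assoc, <- !fuse_natural, F2.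
    pose proof (has_vc K (real_has B P e0 Es Et N N' p) (fuse_has B P e0 Es Et N')) as H.
    pose proof (cm_vc Hf (ple_refl (im (real B P N N' p))) (ple_refl (im (fuse N')))) as L.
    pose proof (cm_vc Hf (ple_refl (im (fuse N))) (ple_refl (im (Some (pr2 P p))))) as R.
    rewrite real_fuse in H, L.
    etransitivity; [symmetry; exact (ple_has H R) | exact (ple_has H L)].
Qed.

End RealNatural.

(** ** The counit [∫ G X -> X] *)

Lemma some_inj A (p q : A) : Some p = Some q -> p = q.
Proof. congruence. Qed.

Section Counit.
Variable X : rep_merge_bicat.
Variable c : coherent_choice X.
Variable HB : is_bicat (G_data X c).
Let B := Bicat HB.
Let K := rep_calculus X.
Let P : presentation B K := G_presentation X K c.

Lemma Ghom_src x y (a : @bhom B x y) : src (pr1 P a) = x.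
Proof. exact (proj1 (proj2_sig a)). Qed.

Lemma Ghom_tgt x y (a : @bhom B x y) : tgt (pr1 P a) = y.
Proof. exact (proj2 (proj2_sig a)). Qed.

Definition counit_map : merge_map (int_data B) X :=
  real_map B P (fun x => x) Ghom_src Ghom_tgt.

Lemma counit_calculus_map : calculus_map (int_calculus B) K counit_map.
Proof. apply real_calculus_map. Qed.

(** With the actual source and target as endpoints, no transport is involved. *)
Definition arrow_of (a : cell1 X) : arrow B :=
  @Arrow B (src a) (tgt a) (exist _ a (conj eq_refl eq_refl)).

Lemma arrow_of_real (a : arrow B) : arrow_of (real1 B P a) = a.
Proof.
  destruct a as [x y [a [Hs Ht]]]. unfold real1, arrow_of. simpl in *. subst x y. reflexivity.
Qed.

Lemma counit_inj : forall i j, m2 counit_map i = m2 counit_map j -> i = j.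
Proof.
  apply real2_inj. intros a b E. now rewrite <- (arrow_of_real a), E, arrow_of_real.
Qed.

Lemma counit_surj r : exists i, m2 counit_map i = r.
Proof. apply real2_surj; auto. intros b. exists (arrow_of b). reflexivity. Qed.

Definition counit_inverse_map : merge_map X (int_data B) :=
  @MergeMap X (int_data B) (fun x => x) arrow_of
    (fun r => proj1_sig (constructive_indefinite_description _ (counit_surj r))).

Lemma counit_inverse_r r : m2 counit_map (m2 counit_inverse_map r) = r.
Proof. exact (proj2_sig (constructive_indefinite_description _ (counit_surj r))). Qed.

Lemma counit_inverse_l i : m2 counit_inverse_map (m2 counit_map i) = i.
Proof. apply counit_inj, counit_inverse_r. Qed.

Lemma counit_inverse_calculus_map : calculus_map K (int_calculus B) counit_inverse_map.
Proof.
  apply (calculus_map_inverse counit_inverse_map counit_calculus_map).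
  - reflexivity.
  - apply arrow_of_real.
  - apply counit_inverse_l.
  - reflexivity.
  - apply counit_inverse_r.
Qed.

Lemma counit_strong : is_strong (int_data B) X counit_map.
Proof.
  apply (calculus_map_strong counit_calculus_map (int_rich B) (rep_rich X K)).
  intros x. exists (@Arrow B x x (@hunit B x)). split; [apply int_unitlike|]. split; auto.
  exact (pr_unit P x).
Qed.

Lemma counit_inverse_strong : is_strong X (int_data B) counit_inverse_map.
Proof.
  apply (calculus_map_strong counit_inverse_calculus_map (rep_rich X K) (int_rich B)).
  intros x. exists (pr1 P (@hunit B x)). split; [exact (pr_unit P x)|]. split; [apply Ghom_src|].
  change (unitlike (int_calculus B) (arrow_of (real1 B P (@Arrow B x x (@hunit B x))))).
  rewrite arrow_of_real. apply (int_unitlike B x).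
Qed.

End Counit.

Definition counit (X : rep_merge_bicat) (c : coherent_choice X) (HB : is_bicat (G_data X c)) :
  strong_morphism (int_data (Bicat HB)) X :=
  @StrongMorphism (int_data (Bicat HB)) X (counit_map HB)
    (calculus_map_morphism (counit_calculus_map HB)) (counit_strong HB).

Definition counit_inverse (X : rep_merge_bicat) (c : coherent_choice X)
    (HB : is_bicat (G_data X c)) : strong_morphism X (int_data (Bicat HB)) :=
  @StrongMorphism X (int_data (Bicat HB)) (counit_inverse_map HB)
    (calculus_map_morphism (counit_inverse_calculus_map HB)) (counit_inverse_strong HB).

Lemma counit_iso (c : coherent_choices) (H : G_functorial c) (I : int_functorial)
  (X : rep_merge_bicat) :
  @isomorphism MrgBiCat (int_ob I (G_ob H X)) X (counit (G_bicat H X)).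
Proof.
  exists (counit_inverse (G_bicat H X)). split; apply strong_morphism_eq.
  - simpl. unfold merge_map_comp, merge_map_id. f_equal; apply functional_extensionality.
    + apply arrow_of_real.
    + apply counit_inverse_l.
  - simpl. unfold merge_map_comp, merge_map_id. f_equal; apply functional_extensionality.
    apply counit_inverse_r.
Qed.

Lemma counit_natural (c : coherent_choices) (H : G_functorial c) (I : int_functorial)
  (X Y : rep_merge_bicat) (f : strong_morphism X Y) :
  @cmp MrgBiCat (int_ob I (G_ob H X)) (int_ob I (G_ob H Y)) Y
    (int_mor I (G_mor H X Y f)) (counit (G_bicat H Y))
  = @cmp MrgBiCat (int_ob I (G_ob H X)) X Y (counit (G_bicat H X)) f.
Proof.
  apply strong_morphism_eq. simpl. unfold merge_map_comp. f_equal.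
  apply functional_extensionality. intros i. apply some_inj.
  change (Some (m2 (counit_map (G_bicat H Y)) (m2 (int_map (G_mor H X Y f)) i))
    = option_map (m2 f) (Some (m2 (counit_map (G_bicat H X)) i))).
  simpl m2. rewrite !real2E.
  apply (real_natural (G_presentation X (rep_calculus X) (c X) : presentation (G_ob H X) _)
     (G_presentation Y (rep_calculus Y) (c Y) : presentation (G_ob H Y) _) (G_calculus_map f)
     (G_mor H X Y f)) with (e0 := fun x => x).
  - reflexivity.
  - reflexivity.
  - intros. apply Gmap_ten_eq.
  - intros. apply Ghom_src.
  - intros. apply Ghom_tgt.
Qed.

(** * Comparing two presentations over the same calculus *)

(** Two bicategories presented over one calculus, with 1-cells in correspondence, differ
    only by the choice of tensors, and the comparisons of tensors form a pseudofunctor.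
    It applies to [B] and [G ∫ B], both presented over [∫ B]. *)

Lemma identity_calculus_map X (K : calculus X) : calculus_map K K (merge_map_id X).
Proof. constructor; simpl; intros; rewrite ?map_id; auto. Qed.

Lemma option_map_id A (p : option A) : option_map (fun x => x) p = p.
Proof. now destruct p. Qed.

Section Compare.
Variables D D' : bicat_data.
Variable X : merge_data.
Variable K : calculus X.
Variable P : presentation D K.
Variable P' : presentation D' K.
Variable F0 : bob D -> bob D'.
Variable F1 : forall {x y}, @bhom D x y -> @bhom D' (F0 x) (F0 y).
Hypothesis HF : forall x y (a : @bhom D x y), pr1 P' (F1 a) = pr1 P a.

Lemma compare2_ex x y (a b : @bhom D x y) (p : bcell a b) :
  exists q : bcell (F1 a) (F1 b), pr2 P' q = pr2 P p.
Proof.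
  destruct (pr2_has P p) as (r & [= <-] & H1 & H2).
  apply (pr2_full P'); now rewrite HF.
Qed.

Lemma compare_ten_ex x y z (a : @bhom D x y) (b : bhom y z) :
  exists q : bcell (F1 a ⊗ F1 b) (F1 (a ⊗ b)),
    Some (pr2 P' q) = vc K (prti P' (F1 a) (F1 b)) (prt P a b).
Proof.
  pose proof (has_inverse (prt_has P' (F1 a) (F1 b)) (prt_iso P' (F1 a) (F1 b))) as H.
  pose proof (prt_has P a b) as H'. rewrite <- !HF in H'.
  destruct (has_vc K H H') as (r & E & H1 & H2).
  destruct (pr2_full P' _ _ r H1 H2) as [q Hq]. exists q. now rewrite Hq.
Qed.

(** The comparison of units is found by whiskering with the unit, which is bijective on
    2-cells. *)
Lemma compare_unit_ex x : exists q : bcell (hunit (F0 x)) (F1 (hunit x)),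
  vc K (W K [] (Some (pr2 P' q)) [pr1 P' (F1 (hunit x))]) (prl P (hunit x))
  = prl P' (F1 (hunit x)).
Proof.
  destruct (prl_iso P (hunit x)) as [l I]. pose proof (prl_has P (hunit x)) as L.
  pose proof (prl_has P' (F1 (hunit x))) as L'.
  pose proof (pr_unit P x) as (_ & _ & Fr & _). rewrite <- !HF in I, L. rewrite <- HF in Fr.
  pose proof (has_vc K L' (has_inverse L I)) as H.
  destruct (proj1 Fr _ [pr1 P' (hunit (F0 x))] [pr1 P' (F1 (hunit x))]
    ltac:(discriminate) ltac:(discriminate) H) as (r & (r' & -> & H1 & H2) & E).
  destruct (pr2_full P' _ _ r' H1 H2) as [q Hq]. exists q. rewrite Hq, E, vc_assoc.
  rewrite (proj2 (proj2 (proj2 I))). apply (vc_idr K (has_typ L')).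
Qed.

Definition compare : psf_data D D' :=
  @PsfData D D' F0 (@F1)
    (fun x y a b p => proj1_sig (constructive_indefinite_description _ (compare2_ex _ _ _ _ p)))
    (fun x y z a b =>
       proj1_sig (constructive_indefinite_description _ (compare_ten_ex _ _ _ a b)))
    (fun x => proj1_sig (constructive_indefinite_description _ (compare_unit_ex x))).

Lemma compare2E x y (a b : @bhom D x y) (p : bcell a b) :
  pr2 P' (f2 compare p) = pr2 P p.
Proof. exact (proj2_sig (constructive_indefinite_description _ (compare2_ex _ _ _ _ p))). Qed.

Lemma compare_tenE x y z (a : @bhom D x y) (b : bhom y z) :
  Some (pr2 P' (ften compare a b)) = vc K (prti P' (F1 a) (F1 b)) (prt P a b).
Proof. exact (proj2_sig (constructive_indefinite_description _ (compare_ten_ex _ _ _ a b))). Qed.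

Lemma compare_psf : is_psf compare.
Proof.
  apply (presented_psf P P' (identity_calculus_map K)).
  - apply HF.
  - intros. apply compare2E.
  - intros. simpl. rewrite option_map_id. apply compare_tenE.
  - intros x. simpl. rewrite option_map_id.
    exact (proj2_sig (constructive_indefinite_description _ (compare_unit_ex x))).
  - intros x. simpl. rewrite HF. apply pr_unit.
Qed.

End Compare.

Section Cancel.
Variables D D' : bicat_data.
Variable X : merge_data.
Variable K : calculus X.
Variable P : presentation D K.
Variable P' : presentation D' K.
Variable F0 : bob D -> bob D'.
Variable F1 : forall {x y}, @bhom D x y -> @bhom D' (F0 x) (F0 y).
Hypothesis HF : forall x y (a : @bhom D x y), pr1 P' (F1 a) = pr1 P a.
Variable G0 : bob D' -> bob D.
Variable G1 : forall {x y}, @bhom D' x y -> @bhom D (G0 x) (G0 y).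
Hypothesis HG : forall x y (a : @bhom D' x y), pr1 P (G1 a) = pr1 P' a.
Let F := compare P P' F0 (@F1) HF.
Let G := compare P' P G0 (@G1) HG.

Lemma compare_cancel2 x y (a b : @bhom D x y) (p : bcell a b) :
  pr2 P (f2 G (f2 F p)) = pr2 P p.
Proof. etransitivity; apply compare2E. Qed.

Lemma compare_cancel_ten x y z (a : @bhom D x y) (b : bhom y z) :
  Some (pr2 P (ften G (f1 F a) (f1 F b) ⊙ f2 G (ften F a b)))
  = vc K (prti P (G1 (F1 a)) (G1 (F1 b))) (prt P a b).
Proof.
  etransitivity; [apply (pr_vcomp P)|].
  etransitivity; [refine (f_equal2 (vc K) (compare_tenE P' P G0 (@G1) HG _ _ _ (F1 a) (F1 b)) _);
    refine (eq_trans (f_equal Some (compare2E P' P G0 (@G1) HG _ _ _ _ _)) _);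
    exact (compare_tenE P P' F0 (@F1) HF _ _ _ a b)|].
  rewrite vc_assoc. f_equal.
  apply (isoc_cancel (prt_iso P' (F1 a) (F1 b)) (Θ := [pr1 P (a ⊗ b)])).
  pose proof (prt_typ P _ _ _ a b) as T. rewrite <- (HF _ _ a), <- (HF _ _ b) in T. exact T.
Qed.

End Cancel.

Lemma presented_psf_eq (B : bicat) (D : bicat_data) (X : merge_data) (K : calculus X)
  (P : presentation D K) g0 (g1 : forall x y, @bhom B x y -> @bhom D (g0 x) (g0 y))
  g2 g2' t t' u u' :
  is_psf (@PsfData B D g0 g1 g2 t u) -> is_psf (@PsfData B D g0 g1 g2' t' u') ->
  (forall x y (a b : bhom x y) (p : bcell a b),
     pr2 P (g2 x y a b p) = pr2 P (g2' x y a b p)) ->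
  (forall x y z (a : bhom x y) (b : bhom y z),
     Some (pr2 P (t x y z a b)) = Some (pr2 P (t' x y z a b))) ->
  @PsfData B D g0 g1 g2 t u = @PsfData B D g0 g1 g2' t' u'.
Proof.
  intros H H' E2 E3.
  assert (g2 = g2').
  { do 5 (apply functional_extensionality_dep; intro). apply (pr2_inj P), E2. }
  subst g2'.
  assert (t = t').
  { do 5 (apply functional_extensionality_dep; intro). apply (pr_eq P), E3. }
  subst t'. f_equal. apply functional_extensionality_dep.
  exact (psf_unit_unique (bicatP B) (presented_bicat P) H H').
Qed.

(** ** The comparison of a bicategory with [G ∫ B] *)

Section Unit.
Variable c : coherent_choices.
Variable H : G_functorial c.
Variable I : int_functorial.
Variable B : bicat.
Let X := int_ob I B.
Let K : calculus X := int_calculus B.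
Let P : presentation B K := int_presentation B.
Let P' : presentation (G_data X (c X)) K := G_presentation X K (c X).

Definition unit1 x y (a : @bhom B x y) : Ghom X x y :=
  exist _ (Arrow a) (conj eq_refl eq_refl).

Arguments unit1 {x y} a.

Definition unit_inverse1 x y (a : Ghom X x y) : @bhom B x y.
Proof.
  destruct a as [[u v a] [Hs Ht]]. simpl in Hs, Ht. destruct Hs, Ht. exact a.
Defined.

Arguments unit_inverse1 {x y} a.

Lemma unit1E x y (a : @bhom B x y) : pr1 P' (unit1 a) = pr1 P a.
Proof. reflexivity. Qed.

Lemma unit_inverse1E x y (a : @bhom (G_data X (c X)) x y) :
  pr1 P (unit_inverse1 a) = pr1 P' a.
Proof. destruct a as [[u v a] [Hs Ht]]. simpl in Hs, Ht. destruct Hs, Ht. reflexivity. Qed.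

Lemma unit1_inverse x y (a : Ghom X x y) : unit1 (unit_inverse1 a) = a.
Proof. apply sig_eq. exact (unit_inverse1E a). Qed.

Definition unit_psf : psf B (G_ob H X) := Psf B (G_ob H X) (compare_psf P P' _ (@unit1) unit1E).
Definition unit_inverse_psf : psf (G_ob H X) B :=
  Psf (G_ob H X) B (compare_psf P' P _ (@unit_inverse1) unit_inverse1E).

Lemma unit_psf_l : psf_comp unit_psf unit_inverse_psf = psf_id B.
Proof.
  apply psf_eq.
  refine (@presented_psf_eq B B X K P _ _ _ _ _ _ _ _ (psfP (psf_comp unit_psf unit_inverse_psf)) (psf_id_is B) _ _).
  - intros. exact (compare_cancel2 P P' _ (@unit1) unit1E _ (@unit_inverse1) unit_inverse1E _ _ _ _ p).
  - intros. etransitivity;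
      [exact (compare_cancel_ten P P' _ (@unit1) unit1E _ (@unit_inverse1) unit_inverse1E _ _ _ a b)|].
    etransitivity; [|symmetry; exact (pr_vid P (a ⊗ b))]. apply (isoc_sym (prt_iso P a b)).
Qed.

Lemma unit_psf_r : psf_comp unit_inverse_psf unit_psf = psf_id (G_ob H X).
Proof.
  apply psf_eq.
  apply (G_psf_eq (bicatP (G_ob H X))).
  - apply (psfP (psf_comp unit_inverse_psf unit_psf)).
  - apply (psf_id_is (G_ob H X)).
  - reflexivity.
  - intros x y a. exact (unit_inverse1E a).
  - intros. exact (compare_cancel2 P' P _ (@unit_inverse1) unit_inverse1E _ (@unit1) unit1E _ _ _ _ p).
  - intros. apply some_inj. etransitivity;
      [exact (compare_cancel_ten P' P _ (@unit_inverse1) unit_inverse1E _ (@unit1) unit1E _ _ _ a b)|].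
    etransitivity; [|symmetry; exact (pr_vid P' (a ⊗ b))].
    rewrite !unit1_inverse. apply (isoc_sym (prt_iso P' a b)).
Qed.

End Unit.

Section UnitNatural.
Variable c : coherent_choices.
Variable H : G_functorial c.
Variable I : int_functorial.
Variables B C : bicat.
Variable F : psf B C.
Let X := int_ob I B.
Let Y := int_ob I C.
Let KX : calculus X := int_calculus B.
Let KY : calculus Y := int_calculus C.
Let HC := bicatP C.
Let f : strong_morphism X Y := int_mor I F.

Lemma int_map_cell x y (a b : @bhom B x y) (p : bcell a b) :
  m2 (int_map F) (ICell (psingle a) (psingle b) p)
  = ICell (psingle (f1 F a)) (psingle (f1 F b)) (f2 F p).
Proof. simpl. now rewrite (vidl HC), (vidr HC). Qed.

Lemma int_map_tensor x y z (a : @bhom B x y) (b : bhom y z) :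
  Some (m2 (int_map F) (int_tensor B _ _ _ a b))
  = vc KY (Some (int_tensor C _ _ _ (f1 F a) (f1 F b)))
      (Some (ICell (psingle (f1 F a ⊗ f1 F b)) (psingle (f1 F (a ⊗ b))) (ften F a b))).
Proof.
  etransitivity; [|symmetry; exact (int_vc C (psnoc (psingle (f1 F a)) (f1 F b))
    (psingle (f1 F a ⊗ f1 F b)) (psingle (f1 F (a ⊗ b))) _ _)].
  simpl. do 2 f_equal. now rewrite (f2_vid (psfP F)), !(vidr HC), !(hvid HC), !(vidl HC).
Qed.

Lemma unit_natural :
  psf_comp (unit_psf H I B) (G_mor H X Y f) = psf_comp F (unit_psf H I C).
Proof.
  apply psf_eq. apply (G_psf_eq (bicatP B)).
  - exact (psfP (psf_comp (unit_psf H I B) (G_mor H X Y f))).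
  - exact (psfP (psf_comp F (unit_psf H I C))).
  - reflexivity.
  - reflexivity.
  - intros x y a b p.
    etransitivity; [exact (f_equal (m2 f) (compare2E (int_presentation B)
      (G_presentation X KX (c X)) _ _ (unit1E c I B) _ _ _ _ p))|].
    etransitivity; [exact (int_map_cell _ _ a b p)|]. symmetry.
    exact (compare2E (int_presentation C) (G_presentation Y KY (c Y)) _ _ (unit1E c I C)
      _ _ _ _ (f2 F p)).
  - intros x y z a b. apply some_inj.
    set (P' := G_presentation Y KY (c Y)).
    etransitivity; [exact (pr_vcomp P' _ _)|].
    symmetry. etransitivity; [exact (pr_vcomp P' _ _)|].
    etransitivity; [exact (f_equal2 (vc KY) (compare_tenE (int_presentation C) P' _ _
      (unit1E c I C) _ _ _ (f1 F a) (f1 F b)) (f_equal Some (compare2E (int_presentation C) P' _ _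
      (unit1E c I C) _ _ _ _ (ften F a b))))|].
    rewrite vc_assoc. etransitivity; [exact (f_equal (vc KY _) (eq_sym (int_map_tensor _ _ _ a b)))|].
    symmetry.
    etransitivity; [exact (f_equal2 (vc KY)
      (Gmap_ten_eq (c X) (c Y) f KY (unit1 I B _ _ a) (unit1 I B _ _ b)) eq_refl)|].
    set (a' := unit1 I B _ _ a). set (b' := unit1 I B _ _ b).
    assert (E : Some (m2 f (proj1_sig (ften (unit_psf H I B) a b)))
      = vc KY (option_map (m2 f) (Gtinv X KX (c X) a' b')) (Some (m2 f (int_tensor B _ _ _ a b)))).
    { pose proof (compare_tenE (int_presentation B) (G_presentation X KX (c X)) _ _
        (unit1E c I B) _ _ _ a b) as Q.
      pose proof (cm_vc (int_calculus_map F)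
        (ple_refl (option_map (m2 f) (Gtinv X KX (c X) a' b')))
        (ple_refl (option_map (m2 f) (Some (int_tensor B _ _ _ a b))))) as M.
      symmetry. apply M. exact (f_equal (option_map (m2 f)) (eq_sym Q)). }
    etransitivity; [exact (f_equal (vc KY _) E)|]. rewrite vc_assoc.
    pose proof (cm_isoc (int_calculus_map F) (Gtcell_has X (c X) a' b')
      (Gtinv_iso X KX (c X) a' b')) as J.
    assert (Ea : Gmap1 X Y f a' = unit1 I C _ _ (f1 F a)) by now apply sig_eq.
    assert (Eb : Gmap1 X Y f b' = unit1 I C _ _ (f1 F b)) by now apply sig_eq.
    rewrite Ea, Eb. refine (f_equal (vc KY _) _). refine (isoc_cancel_l J _).
    exact (has_typ (cm_has (int_calculus_map F) (has_Some (int_data B) (int_tensor B _ _ _ a b)))).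
Qed.

End UnitNatural.

(** * The equivalence *)

Lemma square_inverse (C : category) (x x' y y' : Obj C) (k : Hom x x') (e : Hom x' x)
  (k' : Hom y y') (e' : Hom y' y) (f : Hom x y) (g : Hom x' y') :
  cmp e k = idm x' -> cmp k' e' = idm y -> cmp k g = cmp f k' -> cmp g e' = cmp e f.
Proof.
  intros E E' S. rewrite <- (cmp_idl C _ _ g), <- E, !(cmp_assoc C), <- (cmp_assoc C _ _ _ _ k).
  now rewrite S, (cmp_assoc C), E', (cmp_idr C).
Qed.

Theorem theorem5p18 :
  inhabited coherent_choices /\
  exists I : int_functorial,
    forall c : coherent_choices,
      exists H : G_functorial c,
        equivalence_pair (G_functor H) (int_functor I).
Proof.
  split; [constructor; exact (fun X => rich_coherent_choice (rep_rich X (rep_calculus X)))|].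
  exists int_is_functorial. intros c. exists (G_is_functorial c).
  set (H := G_is_functorial c). set (I := int_is_functorial). split.
  - exists (fun X : Obj MrgBiCat => counit (G_bicat H X)). split.
    + apply counit_iso.
    + intros X Y f. apply counit_natural.
  - exists (unit_inverse_psf H I). split.
    + intros B. exists (unit_psf H I B). split; [apply unit_psf_r | apply unit_psf_l].
    + intros B C F.
      exact (@square_inverse BiCat _ _ _ _ _ _ _ _ _ _ (unit_psf_r H I B) (unit_psf_l H I C)
        (unit_natural H I F)).
Qed.
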